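(* Let $(X,d,G)$ be a $G$-system and $\{F_n\}$ a tempered Følner sequence of $G$. For each $h_\mu(\epsilon)$ in $\mathcal E_1=\{\inf_{\mathrm{diam}(\alpha)\le\epsilon}h_\mu(G,\alpha),\ \inf_{\mathrm{diam}(\mathcal U)\le\epsilon}h_\mu(G,\mathcal U),\ \sup_{\mathrm{diam}(\mathcal U)\le\epsilon,\mathrm{Leb}(\mathcal U)\ge\epsilon/4}h_\mu(G,\mathcal U),\ \sup_{\mathrm{Leb}(\mathcal U)\ge\epsilon}h_\mu(G,\mathcal U)\}$, $$\overline{\mathrm{mdim}}_M(G,X,d)=\limsup_{\epsilon\to0}\frac{1}{\log\frac1\epsilon}\sup_{\mu\in E(X,G)}h_\mu(\epsilon)=\limsup_{\epsilon\to0}\frac{1}{\log\frac1\epsilon}\sup_{\mu\in M(X,G)}h_\mu(\epsilon),$$ and for each $h_\mu(\epsilon)$ in $\mathcal E_2=\{PS_\mu(\{F_n\},\epsilon),\ \underline h^K_\mu(\{F_n\},\epsilon),\ \overline h^K_\mu(\{F_n\},\epsilon)\}$, $$\overline{\mathrm{mdim}}_M(G,X,d)=\limsup_{\epsilon\to0}\frac{1}{\log\frac1\epsilon}\sup_{\mu\in E(X,G)}h_\mu(\epsilon)=\limsup_{\epsilon\to0}\frac{1}{\log\frac1\epsilon}\sup_{\mu\in M(X,G)}h_\mu(\epsilon)=\limsup_{\epsilon\to0}\frac{1}{\log\frac1\epsilon}\sup_{\mu\in M(X)}h_\mu(\epsilon).$$ All these equalities also hold for $\underline{\mathrm{mdim}}_M(G,X,d)$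 with every $\limsup_{\epsilon\to0}$ replaced by $\liminf_{\epsilon\to0}$.
   Context: $G$ is a countably infinite discrete amenable group; $(X,d,G)$ a compact metric space with continuous $G$-action by homeomorphisms. Følner: nonempty finite $F_n$ with $|gF_n\triangle F_n|/|F_n|\to0$; tempered: $|\bigcup_{j<n}F_j^{-1}F_n|\le C|F_n|$. $d_F(x,y)=\max_{g\in F}d(gx,gy)$, $B_F(x,\epsilon)=\{y:d_F(x,y)<\epsilon\}$; $s(Z,d_F,\epsilon)$ is the maximal cardinality of a subset of $Z$ with pairwise $d_F$-distances $>\epsilon$. $\overline{\mathrm{mdim}}_M(G,X,d)$ ($\underline{\mathrm{mdim}}_M(G,X,d)$) is $\limsup_{\epsilon\to0}$ (resp. $\liminf$) of $\frac{1}{\log(1/\epsilon)}\limsup_n\frac1{|F_n|}\log s(X,d_{F_n},\epsilon)$. $M(X)$: Borel probability measures; $M(X,G)$: invariant ones; $E(X,G)$: ergodic ones. For $\mu\in M(X,G)$: $h_\mu(G,\alpha)=\lim_n\frac1{|F_n|}H_\mu(\bigvee_{g\in F_n}g^{-1}\alpha)$ for a finite Borel partition $\alpha$; for a finite open cover $\mathcal U$, $h_\mu(G,\mathcal U)=\inf\{h_\mu(G,\alpha):\alpha$ finite Borel partition refining $\mathcal U\}$; $\mathrm{Leb}(\mathcal U)$ is the largest $\delta>0$ such that every open $\delta$-ball is contained in an element of $\mathcal U$. For $\mu\in M(X)$: Katok entropies $\overline h^K_\mu(\{F_n\},\epsilon)=\lim_{\delta\to0}\limsup_n\frac1{|F_n|}\log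 R_\mu(F_n,\delta)$ and $\underline h^K_\mu$ with $\liminf_n$, where $R_\mu(F,\delta)$ is the minimal number of balls $B_F(x,\epsilon)$ whose union has $\mu$-measure $\ge1-\delta$; Pfister–Sullivan entropy $PS_\mu(\{F_n\},\epsilon)=\inf_{O\ni\mu}\limsup_n\frac1{|F_n|}\log s(X_{F_n,O},d_{F_n},\epsilon)$, infimum over neighborhoods $O$ of $\mu$ in $M(X)$, with $X_{F,O}=\{x:\frac1{|F|}\sum_{g\in F}\delta_{gx}\in O\}$. *)

(* Defs.v *)
From HB Require Import structures.
From mathcomp Require Import all_boot all_order all_algebra finmap.
From mathcomp Require Import all_classical all_reals all_analysis.
Import Order.TTheory GRing.Theory Num.Theory numFieldNormedType.Exports.

Set Implicit Arguments.
Unset Strict Implicit.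
Unset Printing Implicit Defensive.

Local Open Scope classical_set_scope.
Local Open Scope ring_scope.

Section Group.
Context {R : realType} {G : countType} (mul : G -> G -> G) (one : G)
  (inv : G -> G).

Definition is_group : Prop :=
  [/\ associative mul, left_id one mul, right_id one mul,
      (forall g, mul (inv g) g = one) & (forall g, mul g (inv g) = one)].

Definition infinite_group : Prop := ~ finite_set [set: G].

Definition folner (F : nat -> {fset G}) : Prop :=
  (forall n, F n != fset0) /\
  forall g : G,
    (fun n => (#|` ([fset mul g h | h in F n] `\` F n `|`
                   (F n `\` [fset mul g h | h in F n]))%fset|%:R
               / #|` F n|%:R : R)) @ \oo --> (0 : R).

Definition tempered (F : nat -> {fset G}) : Prop :=
  exists2 C : R, 0 < C & forall n,
    (#|` (\bigcup_(j <- iota 0 n) [fset mul (inv a) b | a in F j, b in F n])%fset|%:R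
       <= C * #|` F n|%:R).
End Group.

Section Space.
Context {R : realType} {dX : measure_display} {X : measurableType dX}
  (d : X -> X -> R).

Definition is_metric : Prop :=
  [/\ (forall x y, d x y = 0 <-> x = y), (forall x y, d x y = d y x)
    & (forall x y z, d x z <= d x y + d y z)].

Definition dball (x : X) (e : R) : set X := [set y | d x y < e].

Definition dopen (A : set X) : Prop :=
  forall x, A x -> exists2 e : R, 0 < e & dball x e `<=` A.

Definition dcompact : Prop :=
  forall C : set (set X), (forall U, C U -> dopen U) ->
    \bigcup_(U in C) U = setT ->
    exists2 s : seq (set X), (forall U, U \in s -> C U) &
      \bigcup_(U in [set` s]) U = setT.

Definition borel_space : Prop :=
  forall A : set X, measurable A <-> <<s dopen >> A.

Definition dcontinuous (f : X -> X) : Prop :=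
  forall x (e : R), 0 < e ->
    exists2 del : R, 0 < del & forall y, d x y < del -> d (f x) (f y) < e.

Definition dcontinuousR (f : X -> R) : Prop :=
  forall x (e : R), 0 < e ->
    exists2 del : R, 0 < del & forall y, d x y < del -> `|f x - f y| < e.

Definition diam (A : set X) : \bar R :=
  ereal_sup [set (d x y)%:E | x in A & y in A].

Definition diam_le (al : seq (set X)) (e : R) : Prop :=
  forall A, A \in al -> (diam A <= e%:E)%E.

Definition leb (U : seq (set X)) : \bar R :=
  ereal_sup [set del%:E | del in [set del : R | 0 < del /\
     forall x, exists2 B, B \in U & dball x del `<=` B]].

Definition is_partition (al : seq (set X)) : Prop :=
  [/\ forall A, A \in al -> measurable A,
      (forall i j, (i < size al)%N -> (j < size al)%N -> i != j ->
         nth set0 al i `&` nth set0 al j = set0)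
    & \bigcup_(A in [set` al]) A = setT].

Definition is_ocover (U : seq (set X)) : Prop :=
  (forall A, A \in U -> dopen A) /\ \bigcup_(A in [set` U]) A = setT.

Definition refines (al U : seq (set X)) : Prop :=
  forall A, A \in al -> exists2 B, B \in U & A `<=` B.
End Space.

Section System.
Context {R : realType} {G : countType} (one : G)
  {dX : measure_display} {X : measurableType dX}
  (d : X -> X -> R) (act : G -> X -> X).

Definition is_action (mul : G -> G -> G) : Prop :=
  [/\ (forall x, act one x = x),
      (forall g h x, act (mul g h) x = act g (act h x))
    & (forall g, dcontinuous d (act g))].

Local Notation meas := {measure set X -> \bar R}.

Definition isprob (mu : meas) : Prop := mu setT = 1%E.

Definition invariant (mu : meas) : Prop :=
  isprob mu /\ forall g A, measurable A -> mu (act g @^-1` A) = mu A.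

Definition ergodic (mu : meas) : Prop :=
  invariant mu /\ forall A, measurable A -> (forall g, act g @^-1` A = A) ->
    mu A = 0%E \/ mu A = 1%E.

Definition phi (t : R) : R := - (t * ln t).

Definition Hmu (mu : meas) (be : seq (set X)) : R :=
  \sum_(B <- be) phi (fine (mu B)).

Definition joinF (F : {fset G}) (al : seq (set X)) : seq (set X) :=
  [seq [set x | forall i : F, nth set0 al (s i) (act (fsval i) x)]
     | s : {ffun F -> 'I_(size al)}].

Definition avg (F : {fset G}) (x : \bar R) : \bar R :=
  ((#|` F|%:R : R)^-1)%:E * x.

Definition hpart (Fs : nat -> {fset G}) (mu : meas) (al : seq (set X)) : \bar R :=
  (limn (fun n => (#|` Fs n|%:R : R)^-1 * Hmu mu (joinF (Fs n) al)))%:E.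

Definition hcover (Fs : nat -> {fset G}) (mu : meas) (U : seq (set X)) : \bar R :=
  ereal_inf [set hpart Fs mu al |
               al in [set al | is_partition al /\ refines al U]].

Definition hE1a Fs (mu : meas) (e : R) : \bar R :=
  ereal_inf [set hpart Fs mu al | al in [set al | is_partition al /\ diam_le d al e]].
Definition hE1b Fs (mu : meas) (e : R) : \bar R :=
  ereal_inf [set hcover Fs mu U | U in [set U | is_ocover d U /\ diam_le d U e]].
Definition hE1c Fs (mu : meas) (e : R) : \bar R :=
  ereal_sup [set hcover Fs mu U | U in [set U | [/\ is_ocover d U,
      diam_le d U e & ((e / 4)%:E <= leb d U)%E]]].
Definition hE1d Fs (mu : meas) (e : R) : \bar R :=
  ereal_sup [set hcover Fs mu U | U in [set U | is_ocover d U /\ (e%:E <= leb d U)%E]].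

Definition dF (F : {fset G}) (x y : X) : R :=
  \big[Num.max/0]_(g <- enum_fset F) d (act g x) (act g y).

Definition ballF (F : {fset G}) (x : X) (e : R) : set X := [set y | dF F x y < e].

Definition sep (Z : set X) (F : {fset G}) (e : R) : \bar R :=
  ereal_sup [set (size s)%:R%:E | s in [set s : seq X |
     (forall x, x \in s -> Z x) /\ pairwise (fun x y => e < dF F x y) s]].

Definition elog (x : \bar R) : \bar R :=
  match x with
  | r%:E => if 0 < r then (ln r)%:E else -oo%E
  | +oo%E => +oo%E
  | -oo%E => -oo%E
  end.

Definition LS (f : R -> \bar R) : \bar R :=
  limf_esup (fun e : R => ((ln e^-1)^-1)%:E * f e)%E (0 : R)^'+.
Definition LI (f : R -> \bar R) : \bar R :=
  limf_einf (fun e : R => ((ln e^-1)^-1)%:E * f e)%E (0 : R)^'+.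

Definition mdimM_up (Fs : nat -> {fset G}) : \bar R :=
  LS (fun e => limn_esup (fun n => avg (Fs n) (elog (sep setT (Fs n) e)))).
Definition mdimM_lo (Fs : nat -> {fset G}) : \bar R :=
  LI (fun e => limn_esup (fun n => avg (Fs n) (elog (sep setT (Fs n) e)))).

Definition Rmu (mu : meas) (F : {fset G}) (e del : R) : \bar R :=
  ereal_inf [set (size s)%:R%:E | s in [set s : seq X |
     ((1 - del)%:E <= mu (\bigcup_(x in [set` s]) ballF F x e))%E]].

Definition katok_up Fs (mu : meas) (e : R) : \bar R :=
  lim ((fun del => limn_esup (fun n => avg (Fs n) (elog (Rmu mu (Fs n) e del))))
         del @[del --> (0 : R)^'+]).
Definition katok_lo Fs (mu : meas) (e : R) : \bar R :=
  lim ((fun del => limn_einf (fun n => avg (Fs n) (elog (Rmu mu (Fs n) e del))))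
         del @[del --> (0 : R)^'+]).

Definition emp (F : {fset G}) (x : X) : meas :=
  @mscale _ _ R ((#|` F|%:R : R)^-1)%:nng
    (msum (fun i => \d_(act (nth one (enum_fset F) i) x)) #|` F|).

Definition wnbhs (mu : meas) (O : set meas) : Prop :=
  (forall nu, O nu -> isprob nu) /\
  exists (k : nat) (f : 'I_k -> X -> R) (eta : R),
    [/\ 0 < eta, (forall i, dcontinuousR d (f i))
      & forall nu, isprob nu ->
          (forall i, `| \int[nu]_x (f i x)%:E - \int[mu]_x (f i x)%:E | < eta%:E)%E ->
          O nu].

Definition XFO (F : {fset G}) (O : set meas) : set X := [set x | O (emp F x)].

Definition PS Fs (mu : meas) (e : R) : \bar R :=
  ereal_inf [set limn_esup (fun n => avg (Fs n) (elog (sep (XFO (Fs n) O) (Fs n) e)))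
              | O in wnbhs mu].

Definition supE (h : meas -> R -> \bar R) (e : R) : \bar R :=
  ereal_sup [set h mu e | mu in ergodic].
Definition supI (h : meas -> R -> \bar R) (e : R) : \bar R :=
  ereal_sup [set h mu e | mu in invariant].
Definition supM (h : meas -> R -> \bar R) (e : R) : \bar R :=
  ereal_sup [set h mu e | mu in isprob].

Definition conclE1 (Fs : nat -> {fset G}) (h : meas -> R -> \bar R) : Prop :=
  [/\ mdimM_up Fs = LS (supE h), mdimM_up Fs = LS (supI h),
      mdimM_lo Fs = LI (supE h) & mdimM_lo Fs = LI (supI h)].

Definition conclE2 (Fs : nat -> {fset G}) (h : meas -> R -> \bar R) : Prop :=
  [/\ conclE1 Fs h, mdimM_up Fs = LS (supM h) & mdimM_lo Fs = LI (supM h)].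
End System.

(* Main.v *)
(** Additive constants and rescalings of [e] disappear after division by
    [ln (1/e)], so it is enough to compare, up to these, three quantities: the
    growth rate of maximal separated sets, the infimum of the entropies of the
    partitions of diameter at most [e], and the lower Katok entropy.

    Separated sets carry invariant measures of large entropy by Misiurewicz's
    argument: uniform measures on them are averaged along the Folner sets, and a
    limit along an ultrafilter, which is only finitely additive, is made into a
    measure by outer regularity.  The measure is then made ergodic without an
    ergodic decomposition, by maximising the sum of the upper semicontinuous
    entropy relative to a cover and of a strictly convex functional.

    Conversely, let [mu] be ergodic and let balls for infinitely many Folner
    sets, few in number, have most of the measure.  A typical orbit is tiled, up
    to a small density, by translates of finitely many Folner sets, the centres
    being random unions of small cells; listing the centres and the balls to
    which they belong codes the orbit up to [2 e].  Hence a partition of diameter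
    at most [2 e] has entropy at most the lower Katok entropy plus one.
    Nontrivial stabilisers only make the count of names smaller: an orbit
    segment through points with stabiliser of order [A] costs [1/A] of the
    count, and infinite stabilisers or finite orbits force zero entropy.

    Finally the mean ergodic theorem for finitely many sets, which follows from
    the same limits, places the Pfister-Sullivan entropy of an ergodic measure
    between the Katok entropy and the separation growth. *)

Require Import Defs.
From HB Require Import structures.
From mathcomp Require Import all_boot all_order all_algebra finmap.
From mathcomp Require Import all_classical all_reals all_analysis.
From mathcomp Require Import ring lra zify.
Import Order.TTheory GRing.Theory Num.Theory numFieldNormedType.Exports.
Set Implicit Arguments.
Unset Strict Implicit.
Unset Printing Implicit Defensive.
Local Open Scope classical_set_scope.
Local Open Scope ring_scope.

(** * Entropy of finite-valued maps *)

(** Lower Katok entropy provides good Folner sets only along an unknown subsequence, so the tiling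
    is built from its last layer backwards: each new shape is chosen almost invariant for all shapes
    already present and is placed first, and the existing code serves what it leaves uncovered. This
    is why a code has to exist on every measurable [W], with a boundary penalty that vanishes on the
    whole space. Tiles may overlap, so a layer covers only [eta - eta ^+ 2] of the remaining mass;
    the cost per unit mass follows [v -> eta * (a + sg) + v * (1 - eta + eta ^+ 2)], with fixed
    point [(a + sg) / (1 - eta)], as near to [a] as desired. When stabilisers have order [A], a tile
    of shape [F] has only about [#|F| / A] points and centres need density [eta * A / #|F|]; the
    extra factor [A] is regained because positions visiting the same point need a single choice of
    name. Entropy is developed for finitely additive set functions and as an infimum over finite
    sets, since it has to be evaluated on ultrafilter limits before any measure is available. *)

Lemma sum_const_seq (R : pzRingType) (I : Type) (s : seq I) (c : R) :
  \sum_(i <- s) c = (size s)%:R * c.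
Proof. by rewrite big_const_seq count_predT iter_addr addr0 mulr_natl. Qed.

Section FProb.
Context {R : realType} {dX : measure_display} {X : measurableType dX}.
Implicit Types (pr : set X -> R) (A B : set X).

(** Only finite additivity is required, so that the class is closed under limits along an
    ultrafilter; the entropy inequalities need nothing more. *)
Definition fprob pr : Prop :=
  [/\ pr setT = 1, (forall A, measurable A -> 0 <= pr A)
    & (forall A B, measurable A -> measurable B -> A `&` B = set0 ->
         pr (A `|` B) = pr A + pr B)].

(** Finite measurable partitions are encoded as maps to a finite type: joins become pairs, and empty
    or repeated cells need no care. *)
Definition mfin (T : finType) (f : X -> T) : Prop :=
  forall t, measurable [set x | f x = t].

Lemma mfin_pred (T : finType) (f : X -> T) (Q : T -> Prop) :
  mfin f -> measurable [set x | Q (f x)].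
Proof.
move=> mf; rewrite (_ : mkset _ = \bigcup_(t in [set t | Q t]) [set x | f x = t]).
  by apply: fin_bigcup_measurable => //; exact: finite_finset.
by apply/seteqP; split => [x Qx|x [t Qt /= ->]] //; exists (f x).
Qed.

Lemma mfin_comp (T U : finType) (f : X -> T) (h : T -> U) :
  mfin f -> mfin (h \o f).
Proof. by move=> mf u; exact: (mfin_pred (fun t => h t = u)). Qed.

Lemma mfin_tt : mfin (fun _ : X => tt).
Proof. by move=> t; rewrite (_ : mkset _ = setT)//; apply/seteqP; split => // x; case: t. Qed.

Lemma mfin_pair (T U : finType) (f : X -> T) (g : X -> U) :
  mfin f -> mfin g -> mfin (fun x => (f x, g x)).
Proof.
move=> mf mg [t u]; rewrite (_ : mkset _ = [set x | f x = t] `&` [set x | g x = u]).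
  exact: measurableI.
by apply/seteqP; split => x /= [-> ->].
Qed.

Lemma mfin_set A : measurable A -> mfin (fun x => `[< A x >]).
Proof.
move=> mA [].
  by rewrite (_ : mkset _ = A)//; apply/seteqP; split=> x /= /asboolP.
rewrite (_ : mkset _ = ~` A); first exact: measurableC.
by apply/seteqP; split=> x /= => [/negbT/asboolPn//|/asboolPn/negbTE].
Qed.

Lemma mfin_ffun (I T : finType) (f : I -> X -> T) :
  (forall i, mfin (f i)) -> mfin (fun x => [ffun i => f i x]).
Proof.
move=> mf t; rewrite (_ : mkset _ = \bigcap_(i in [set: I]) [set x | f i x = t i]).
  by apply: fin_bigcap_measurable => // i _; exact: mf.
apply/seteqP; split => [x <- i _ /=|x /= h]; first by rewrite ffunE.
by apply/ffunP => i; rewrite ffunE; exact: h.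
Qed.

Section one.
Variables (pr : set X -> R) (Ppr : fprob pr).

Lemma pr_ge0 A : measurable A -> 0 <= pr A. Proof. by case: Ppr => _ h _; exact: h. Qed.
Lemma prT : pr setT = 1. Proof. by case: Ppr. Qed.
Lemma prU A B : measurable A -> measurable B -> A `&` B = set0 ->
  pr (A `|` B) = pr A + pr B.
Proof. by case: Ppr => _ _ h; exact: h. Qed.
Lemma pr0 : pr set0 = 0.
Proof.
have := prU (@measurable0 _ X) (@measurable0 _ X) (setI0 _).
rewrite setU0 => h; lra.
Qed.
Lemma prD A B : measurable A -> measurable B -> pr (A `\` B) = pr A - pr (A `&` B).
Proof.
move=> mA mB; rewrite -{2}(setUIDK A B) prU.
- by rewrite addrAC subrr add0r.
- exact: measurableI.
- exact: measurableD.
- by apply/seteqP; split => x //= [[_ ?] [_ ?]].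
Qed.
Lemma pr_le A B : measurable A -> measurable B -> A `<=` B -> pr A <= pr B.
Proof.
move=> mA mB AB; have := pr_ge0 (measurableD mB mA).
by rewrite prD// setIidr// => h; rewrite -subr_ge0.
Qed.
Lemma pr_le1 A : measurable A -> pr A <= 1.
Proof. by move=> mA; rewrite -prT; exact: pr_le. Qed.
Lemma prC A : measurable A -> pr (~` A) = 1 - pr A.
Proof. by move=> mA; rewrite -setTD prD// setTI prT. Qed.
Lemma prU_le A B : measurable A -> measurable B -> pr (A `|` B) <= pr A + pr B.
Proof.
move=> mA mB; rewrite (_ : A `|` B = A `|` (B `\` A)); last first.
  by apply/seteqP; split => x /=; have [|] := pselect (A x); tauto.
have mBA := measurableD mB mA.
rewrite prU//; last by apply/seteqP; split => x //= [? [_ ?]].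
by rewrite lerD2l pr_le.
Qed.

Definition plaw (T : finType) (f : X -> T) (t : T) : R := pr [set x | f x = t].
Definition ent (T : finType) (f : X -> T) : R := \sum_t phi (plaw f t).

Local Notation law := plaw.
Lemma law_ge0 (T : finType) (f : X -> T) t : mfin f -> 0 <= law f t.
Proof. by move=> mf; exact: pr_ge0. Qed.
Lemma law_le1 (T : finType) (f : X -> T) t : mfin f -> law f t <= 1.
Proof. by move=> mf; exact: pr_le1. Qed.

Lemma pr_law (T : finType) (f : X -> T) (Q : pred T) : mfin f ->
  pr [set x | Q (f x)] = \sum_(t | Q t) law f t.
Proof.
move=> mf; rewrite -big_filter.
have /= -> : [set x | Q (f x)] = [set x | f x \in [seq t <- index_enum T | Q t]].
  by apply/seteqP; split => x /=; rewrite mem_filter mem_index_enum andbT.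
have : uniq ([seq t <- index_enum T | Q t]) by rewrite filter_uniq// index_enum_uniq.
elim: (seq.filter _ _) => [_|t s ih /= /andP[ts us]].
  by rewrite big_nil (_ : mkset _ = set0) ?pr0//; apply/seteqP; split => x.
rewrite big_cons -ih// -prU.
- congr pr; apply/seteqP; split => x /=; rewrite in_cons.
    by case/orP => [/eqP|]; [left|right].
  by case=> [->|->]; rewrite ?eqxx ?orbT.
- exact: mf.
- exact: (mfin_pred (fun t => t \in s)).
- by apply/seteqP; split => x //= -[-> /(negP ts)].
Qed.

Lemma law_comp (T U : finType) (f : X -> T) (h : T -> U) u : mfin f ->
  law (h \o f) u = \sum_(t | h t == u) law f t.
Proof.
move=> mf; rewrite -(pr_law (fun t => h t == u))// /plaw; congr pr.
by apply/seteqP; split => x /= /eqP.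
Qed.

Lemma sum_law (T : finType) (f : X -> T) : mfin f -> \sum_t law f t = 1.
Proof.
move=> mf; rewrite -(pr_law predT)//= -[RHS]prT; congr pr.
by apply/seteqP; split.
Qed.

Lemma law_le_comp (T U : finType) (f : X -> T) (h : T -> U) t : mfin f ->
  law f t <= law (h \o f) (h t).
Proof.
move=> mf; apply: pr_le => //; last by move=> x /= ->.
exact: (mfin_comp h mf).
Qed.
End one.
End FProb.

(** * The function [-t ln t] and Gibbs' inequality *)

Section Phi.
Context {R : realType}.
Implicit Types a b t : R.

Lemma ln_leB1 t : 0 < t -> ln t <= t - 1.
Proof.
move=> t0; have := @le_ln1Dx R (t - 1); rewrite addrCA subrr addr0; apply; lra.
Qed.
Lemma phi0 : phi (0 : R) = 0. Proof. by rewrite /phi mul0r oppr0. Qed.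
Lemma phi1 : phi (1 : R) = 0. Proof. by rewrite /phi ln1 mulr0 oppr0. Qed.
Lemma phi_ge0 t : 0 <= t -> t <= 1 -> 0 <= phi t.
Proof.
rewrite le_eqVlt => /predU1P[<-|t0] t1; first by rewrite phi0.
by rewrite /phi oppr_ge0 mulr_ge0_le0 ?ln_le0// ltW.
Qed.
Lemma phiD_le a b : 0 <= a -> 0 <= b -> phi (a + b) <= phi a + phi b.
Proof.
rewrite le_eqVlt => /predU1P[<-|a0]; first by rewrite add0r phi0 add0r.
rewrite le_eqVlt => /predU1P[<-|b0]; first by rewrite addr0 phi0 addr0.
rewrite /phi -opprD lerN2 mulrDl; apply: lerD.
  by rewrite ler_pM2l// ler_ln ?posrE ?addr_gt0// lerDl ltW.
by rewrite ler_pM2l// ler_ln ?posrE ?addr_gt0// lerDr ltW.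
Qed.
(** [ln_leB1] at the inverse square root of [t]; it gives an explicit rate at 0. *)
Lemma phi_sqrt t : 0 <= t -> phi t <= 2 * Num.sqrt t.
Proof.
rewrite le_eqVlt => /predU1P[<-|t0]; first by rewrite phi0 sqrtr0 mulr0.
have s0 : 0 < Num.sqrt t by rewrite sqrtr_gt0.
have tE : t = Num.sqrt t * Num.sqrt t by rewrite -expr2 sqr_sqrtr// ltW.
set s := Num.sqrt t in s0 tE *.
rewrite /phi tE lnM ?posrE//.
have := @ln_leB1 s^-1; rewrite invr_gt0 => /(_ s0); rewrite lnV ?posrE// => h.
have : s * s * - ln s <= s * s * s^-1.
  rewrite ler_pM2l ?mulr_gt0//; lra.
rewrite mulfK ?gt_eqF// => h2; lra.
Qed.
(** Subadditivity and [phi_sqrt] bound an increase of [phi]; the tangent inequality [ln_leB1] at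
    [b / a] bounds a decrease by [b - a], which is at most its square root on the unit interval. *)
Lemma phi_dist a b : 0 <= a -> a <= 1 -> 0 <= b -> b <= 1 ->
  `|phi a - phi b| <= 2 * Num.sqrt `|a - b|.
Proof.
wlog ab : a b / a <= b.
  move=> w a0 a1 b0 b1; case/orP: (le_total a b) => h; first exact: w.
  by rewrite distrC (distrC a); exact: w.
move=> a0 a1 b0 b1.
have c0 : 0 <= b - a by rewrite subr_ge0.
rewrite (distrC a) (ger0_norm c0).
have h1 : phi b - phi a <= 2 * Num.sqrt (b - a).
  have := phiD_le a0 c0; rewrite addrC subrK => h; have := phi_sqrt c0; lra.
have h2 : phi a - phi b <= b - a.
  move: a0; rewrite le_eqVlt => /predU1P[a0|a0].
    by rewrite -a0 phi0; have := phi_ge0 b0 b1; lra.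
  have bb : 0 < b by exact: lt_le_trans ab.
  have lb : ln b <= 0 by exact: ln_le0.
  have := @ln_leB1 (b / a); rewrite divr_gt0// => /(_ isT).
  rewrite ln_div ?posrE// -(ler_pM2l a0) !mulrBr mulr1 mulrCA divff ?gt_eqF// mulr1.
  have := mulr_ge0_le0 c0 lb; rewrite /phi => *; lra.
have h3 : b - a <= Num.sqrt (b - a).
  rewrite -[leLHS](sqr_sqrtr c0) expr2 ler_piMr ?sqrtr_ge0//.
  by rewrite -sqrtr1 ler_wsqrtr; lra.
have := sqrtr_ge0 (b - a) => s0.
by rewrite ler_norml; apply/andP; split; lra.
Qed.

(** Sum of [ln u <= u - 1] at [u = q i / p i]. The weights [q] may have a smaller total than [p], as
    happens in [H_count]. *)
Lemma gibbs (I : finType) (p q : I -> R) :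
  (forall i, 0 <= p i) -> (forall i, 0 <= q i) ->
  (forall i, 0 < p i -> 0 < q i) -> \sum_i q i <= \sum_i p i ->
  \sum_i phi (p i) <= - \sum_i p i * ln (q i).
Proof.
move=> p0 q0 pq qp; rewrite -subr_ge0 -sumrN -sumrB.
apply: le_trans (_ : \sum_i (p i - q i) <= _).
  by rewrite sumrB subr_ge0.
apply: ler_sum => i _; have := p0 i; rewrite le_eqVlt => /predU1P[<-|pi0].
  by rewrite phi0 mul0r; have := q0 i; lra.
have qi0 := pq _ pi0.
have : p i * (ln (q i) - ln (p i)) <= p i * (q i / p i - 1).
  by rewrite ler_pM2l// -ln_div ?posrE// ln_leB1// divr_gt0.
rewrite mulrBr [leRHS]mulrBr mulr1 mulrCA divff ?gt_eqF// mulr1 /phi => ?; lra.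
Qed.
End Phi.

(** * Shannon's inequalities *)

Section Entropy.
Context {R : realType} {dX : measure_display} {X : measurableType dX}.
Variables (pr : set X -> R) (Ppr : fprob pr).
Local Notation H := (ent pr).
Local Notation law := (plaw pr).

Definition dpd (T U : Type) (f : X -> T) (g : X -> U) : Prop :=
  forall x y, f x = f y -> g x = g y.

Lemma fprob_inh : inhabited X.
Proof.
apply: contrapT => nX; have := prT Ppr.
rewrite (_ : setT = set0) ?(pr0 Ppr); first by move/eqP; rewrite eq_sym oner_eq0.
by apply/seteqP; split => x // _; apply: nX.
Qed.

Lemma dpd_comp (T U : Type) (f : X -> T) (g : X -> U) : dpd f g ->
  exists h : T -> U, g = h \o f.
Proof.
move=> fg; have [x0] := fprob_inh.
exists (fun t => g (xget x0 [set x | f x = t])); apply/funext => x /=.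
by apply: fg; have /= -> := @xgetPex _ x0 [set y | f y = f x] (ex_intro _ x erefl).
Qed.

Lemma H_ge0 (T : finType) (f : X -> T) : mfin f -> 0 <= H f.
Proof.
move=> mf; apply: sumr_ge0 => t _; apply: phi_ge0; first exact: law_ge0.
exact: law_le1.
Qed.

(** Expresses the entropy of a factor over the finer law, so that several entropies can be compared
    term by term over one joint law. *)
Lemma H_cross (T U : finType) (f : X -> T) (h : T -> U) : mfin f ->
  H (h \o f) = - \sum_t law f t * ln (law (h \o f) (h t)).
Proof.
move=> mf; rewrite /ent -sumrN (partition_big h predT)//=.
apply: eq_bigr => u _; rewrite /phi {1}(law_comp Ppr)// mulr_suml -sumrN.
by apply: eq_bigr => t /eqP ->.
Qed.

Lemma H_gibbs (T : finType) (f : X -> T) (q : T -> R) : mfin f ->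
  (forall t, 0 <= q t) -> (forall t, 0 < law f t -> 0 < q t) -> \sum_t q t <= 1 ->
  H f <= - \sum_t law f t * ln (q t).
Proof.
move=> mf q0 fq q1; apply: gibbs => //; first by move=> t; exact: law_ge0.
by rewrite (sum_law Ppr).
Qed.

Lemma H_comp (T U : finType) (f : X -> T) (h : T -> U) : mfin f -> H (h \o f) <= H f.
Proof.
move=> mf; rewrite H_cross// -sumrN; apply: ler_sum => t _.
have := law_ge0 Ppr t mf; rewrite le_eqVlt => /predU1P[<-|t0].
  by rewrite mul0r phi0 oppr0.
rewrite /phi lerN2 ler_pM2l// ler_ln ?posrE//.
  exact: law_le_comp.
exact: lt_le_trans (law_le_comp Ppr h t mf).
Qed.

Lemma H_dpd (T U : finType) (f : X -> T) (g : X -> U) : mfin f -> dpd f g -> H g <= H f.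
Proof. by move=> mf /dpd_comp[h ->]; exact: H_comp. Qed.

Lemma mfin_dpd (T U : finType) (f : X -> T) (g : X -> U) : mfin f -> dpd f g -> mfin g.
Proof.
move=> mf fg u.
rewrite (_ : [set x | g x = u] = [set x | (fun t => exists2 x, f x = t & g x = u) (f x)]).
  exact: (mfin_pred (fun t => exists2 x, f x = t & g x = u)).
apply/seteqP; split => x /=; first by exists x.
by move=> [y /fg yx <-].
Qed.

Lemma H_eq (T U : finType) (f : X -> T) (g : X -> U) : mfin f -> dpd f g -> dpd g f ->
  H g = H f.
Proof.
by move=> mf fg gf; apply/eqP; rewrite eq_le !H_dpd//; exact: mfin_dpd fg.
Qed.

(** Gibbs' inequality against the weights that give each admissible pair the mass [law g u / n u],
    of total at most 1: conditional entropy is at most the mean logarithm of the number of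
    admissible values. *)
Lemma H_count (T U : finType) (f : X -> T) (g : X -> U) (V : U -> {set T}) (n : U -> R) :
  mfin f -> mfin g -> (forall x, f x \in V (g x)) -> (forall u, #|V u|%:R <= n u) ->
  (forall u, 1 <= n u) ->
  H (fun x => (f x, g x)) <= H g + \sum_u law g u * ln (n u).
Proof.
move=> mf mg fV Vn n1; have n0 u : 0 < n u by exact: lt_le_trans (n1 u).
have mj := mfin_pair mf mg.
pose q (j : T * U) := (j.1 \in V j.2)%:R * (law g j.2 / n j.2).
have jg : g = snd \o (fun x => (f x, g x)) by [].
have q0 j : 0 <= q j.
  by rewrite mulr_ge0// divr_ge0// ?(law_ge0 Ppr)// ltW.
have jV j : 0 < law (fun x => (f x, g x)) j -> j.1 \in V j.2 /\ 0 < law g j.2.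
  move=> j0; split; last first.
    by apply: lt_le_trans j0 _; rewrite jg; exact: (law_le_comp Ppr snd j mj).
  apply: contrapT => jV; suff : law (fun x => (f x, g x)) j = 0 by move=> h; rewrite h ltxx in j0.
  rewrite /plaw (_ : mkset _ = set0) ?(pr0 Ppr)//.
  by apply/seteqP; split => x //= xj; apply: jV; rewrite -xj /= fV.
apply: le_trans (H_gibbs mj q0 _ _) _.
- by move=> j /jV[jV1 j0]; rewrite /q jV1 mul1r divr_gt0.
- rewrite (eq_bigr (fun j => q (j.1, j.2))); last by case.
  rewrite -(pair_bigA _ (fun t u => q (t, u)))/= exchange_big/=.
  rewrite -(sum_law Ppr mg); apply: ler_sum => u _; rewrite /q/= -mulr_suml.
  have -> : \sum_i (i \in V u)%:R = #|V u|%:R :> R.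
    by rewrite -sum1_card natr_sum [RHS]big_mkcond; apply: eq_bigr => i _; case: ifP.
  rewrite mulrCA ler_piMr ?(law_ge0 Ppr)//.
  by rewrite ler_pdivrMr// mul1r.
rewrite [in leRHS]jg (H_cross snd mj) -jg.
have -> : \sum_u law g u * ln (n u) =
    \sum_j law (fun x => (f x, g x)) j * ln (n j.2).
  rewrite [RHS](partition_big snd predT)//=; apply: eq_bigr => u _.
  rewrite {1}jg (law_comp Ppr)// mulr_suml; apply: eq_bigr => j /eqP <-//.
rewrite -!sumrN -big_split/=; apply: ler_sum => j _.
have := law_ge0 Ppr j mj; rewrite le_eqVlt => /predU1P[<-|j0].
  by rewrite !mul0r oppr0 addr0.
have [jV1 jg0] := jV _ j0.
rewrite /q jV1 mul1r ln_div ?posrE//.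
by rewrite mulrBr opprB addrC.
Qed.

(** Strong subadditivity: Gibbs' inequality against the law under which [f] and [g] are independent
    given [k]. *)
Lemma H_sub (T U W : finType) (f : X -> T) (g : X -> U) (k : X -> W) :
  mfin f -> mfin g -> mfin k ->
  H (fun x => (f x, (g x, k x))) + H k <=
  H (fun x => (f x, k x)) + H (fun x => (g x, k x)).
Proof.
move=> mf mg mk.
set j := fun x => (f x, (g x, k x)).
have mj : mfin j by apply: mfin_pair => //; exact: mfin_pair.
set fk := fun x => (f x, k x); set gk := fun x => (g x, k x).
have mfk : mfin fk by exact: mfin_pair.
have mgk : mfin gk by exact: mfin_pair.
pose h1 (t : T * (U * W)) := (t.1, t.2.2).
pose h3 (t : T * (U * W)) := t.2.2.
have -> : H fk = - \sum_t law j t * ln (law fk (h1 t)).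
  exact: (H_cross h1 mj).
have -> : H gk = - \sum_t law j t * ln (law gk t.2).
  exact: (H_cross snd mj).
have -> : H k = - \sum_t law j t * ln (law k (h3 t)).
  exact: (H_cross h3 mj).
pose q t := law fk (h1 t) * (law gk t.2 * (law k (h3 t))^-1).
have q0 t : 0 <= q t.
  by rewrite mulr_ge0 ?mulr_ge0 ?invr_ge0 ?(law_ge0 Ppr).
have l1 t : 0 < law j t -> 0 < law fk (h1 t).
  by move/lt_le_trans; apply; exact: (law_le_comp Ppr h1 t mj).
have l2 t : 0 < law j t -> 0 < law gk t.2.
  by move/lt_le_trans; apply; exact: (law_le_comp Ppr snd t mj).
have l3 t : 0 < law j t -> 0 < law k (h3 t).
  by move/lt_le_trans; apply; exact: (law_le_comp Ppr h3 t mj).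
have q1 t : 0 < law j t -> 0 < q t.
  by move=> t0; rewrite /q !mulr_gt0 ?invr_gt0 ?l1 ?l2 ?l3.
have sq : \sum_t q t <= 1.
  rewrite (eq_bigr (fun t => q (t.1, t.2))); last by case.
  rewrite -(pair_bigA _ (fun t s => q (t, s)))/= exchange_big/=.
  rewrite -(sum_law Ppr mgk); apply: ler_sum => -[s u] _.
  rewrite (eq_bigr (fun t => law fk (t, u) * (law gk (s, u) / law k u)))//.
  rewrite -mulr_suml.
  have -> : \sum_(t : T) law fk (t, u) = law k u.
    have -> : law k u = law (snd \o fk) u by [].
    rewrite (law_comp Ppr)// [RHS](eq_bigl (fun i => (true && (i.2 == u))))//.
    rewrite (eq_bigr (fun i => law fk (i.1, i.2))); last by case.
    rewrite -(pair_big xpredT (fun v => v == u) (fun t v => law fk (t, v)))/=.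
    by apply: eq_bigr => t _; rewrite big_pred1_eq.
  have := law_ge0 Ppr u mk; rewrite le_eqVlt => /predU1P[<-|u0].
    by rewrite mul0r (law_ge0 Ppr).
  by rewrite mulrCA divff ?gt_eqF// mulr1.
have := H_gibbs mj q0 q1 sq.
have -> : \sum_t law j t * ln (q t) = \sum_t law j t * ln (law fk (h1 t)) +
   \sum_t law j t * ln (law gk t.2) - \sum_t law j t * ln (law k (h3 t)).
  rewrite -big_split -sumrB/=; apply: eq_bigr => t _.
  have := law_ge0 Ppr t mj; rewrite le_eqVlt => /predU1P[<-|t0].
    by rewrite !mul0r addr0 subr0.
  rewrite /q !lnM ?posrE ?mulr_gt0 ?invr_gt0 ?l1 ?l2 ?l3// lnV ?posrE ?l3//.
  ring.
move=> ?; lra.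
Qed.

(** [H_sub] with [k := b]: since [b'] determines [b], the joint maps collapse, and what remains says
    that finer conditioning lowers conditional entropy. *)
Lemma H_condmono (T U W : finType) (a : X -> T) (b' : X -> U) (b : X -> W) :
  mfin a -> mfin b' -> dpd b' b ->
  H (fun x => (a x, b' x)) - H b' <= H (fun x => (a x, b x)) - H b.
Proof.
move=> ma mb' bb; have mb := mfin_dpd mb' bb.
have := H_sub ma mb' mb.
have -> : H (fun x => (a x, (b' x, b x))) = H (fun x => (a x, b' x)).
  by apply: H_eq => [|x y []|x y [] -> ->]; [exact: mfin_pair|move=> -> e; rewrite e (bb _ _ e)|].
have -> : H (fun x => (b' x, b x)) = H b'.
  by apply: H_eq => // [x y e|x y []//]; rewrite e (bb _ _ e).
move=> ?; lra.
Qed.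

Lemma H_le_ln (T : finType) (f : X -> T) (n : R) : mfin f -> 1 <= n -> #|T|%:R <= n -> H f <= ln n.
Proof.
move=> mf n1 Tn; have mg : mfin (fun _ : X => tt) by exact: mfin_tt.
have := H_count (V := fun=> [set: T]%SET) (n := fun=> n) mf mg.
have -> : H (fun x => (f x, tt)) = H f by apply: H_eq => // x y; [move=> ->|case].
move=> h; apply: (le_trans (h _ _ _)) => //; first by move=> _; rewrite cardsT.
rewrite -mulr_suml (sum_law Ppr)// mul1r {1}/ent (_ : \sum_(t : unit) _ = 0) ?add0r//.
rewrite (big_pred1 tt); last by case.
rewrite /plaw (_ : mkset _ = setT) ?(prT Ppr) ?phi1//.
by apply/seteqP; split => // x; case: (tt).
Qed.

Lemma H_pair (T U : finType) (f : X -> T) (g : X -> U) : mfin f -> mfin g ->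
  H (fun x => (f x, g x)) <= H f + H g.
Proof.
move=> mf mg; have mt : mfin (fun _ : X => tt) by exact: mfin_tt.
have := @H_condmono _ _ _ f g (fun=> tt) mf mg (fun _ _ _ => erefl).
have -> : H (fun x => (f x, tt)) = H f by apply: H_eq => // x y; [move=> ->|case].
have := H_ge0 mt; lra.
Qed.
End Entropy.

(** * Names of finite orbit segments *)

Section Names.
Context {R : realType} {dX : measure_display} {X : measurableType dX}
  {G : countType} (act : G -> X -> X).
Hypothesis mact : forall g A, measurable A -> measurable (act g @^-1` A).

(** Names are indexed by a list and not by a set, so that windows can be concatenated and
    repetitions are harmless. *)
Definition nm (T : Type) (f : X -> T) (s : seq G) (x : X) : {ffun 'I_(size s) -> T} :=
  [ffun i => f (act (tnth (in_tuple s) i) x)].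

Lemma nmP (T : Type) (f : X -> T) (s : seq G) (x y : X) :
  nm f s x = nm f s y <-> forall g, g \in s -> f (act g x) = f (act g y).
Proof.
split=> [h g gs|h].
  have gs' : g \in in_tuple s by [].
  have /tnthP[i ->] := gs'.
  by move/ffunP : h => /(_ i); rewrite !ffunE.
by apply/ffunP => i; rewrite !ffunE; apply: h; exact: (mem_tnth i (in_tuple s)).
Qed.

Lemma dpd_nm (T U : Type) (f : X -> T) (s : seq G) (h : X -> U) :
  (forall x y, (forall g, g \in s -> f (act g x) = f (act g y)) -> h x = h y) ->
  dpd (nm f s) h.
Proof. by move=> H x y /nmP; exact: H. Qed.

Lemma mfin_act (T : finType) (f : X -> T) g : mfin f -> mfin (f \o act g).
Proof. by move=> mf t; exact: (mact g (mf t)). Qed.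

Lemma mfin_nm (T : finType) (f : X -> T) (s : seq G) : mfin f -> mfin (nm f s).
Proof. by move=> mf; apply: mfin_ffun => i; exact: mfin_act. Qed.

Section pr.
Variables (pr : set X -> R) (Ppr : fprob pr).
Local Notation H := (ent pr).

Lemma H_nm_sub (T : finType) (f : X -> T) (s t : seq G) : mfin f ->
  {subset s <= t} -> H (nm f s) <= H (nm f t).
Proof.
move=> mf st; apply: (H_dpd Ppr (mfin_nm mf)); apply: dpd_nm => x y h.
by apply/nmP => g gs; apply: h; exact: st.
Qed.

Lemma H_nm_cons (T : finType) (f : X -> T) g (s : seq G) : mfin f ->
  H (nm f (g :: s)) = H (fun x => (f (act g x), nm f s x)).
Proof.
move=> mf; apply: (H_eq Ppr).
- by apply: mfin_pair; [exact: mfin_act|exact: mfin_nm].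
- move=> x y [gxy /nmP h]; apply/nmP => k; rewrite inE => /predU1P[->//|]; exact: h.
- by apply: dpd_nm => x y h; rewrite h ?mem_head//; congr pair; apply/nmP => k ks;
    apply: h; rewrite inE ks orbT.
Qed.

Lemma H_nm_cat (T : finType) (f : X -> T) (s t : seq G) : mfin f ->
  H (nm f (s ++ t)) <= H (nm f s) + H (nm f t).
Proof.
move=> mf; apply: le_trans (H_pair Ppr (mfin_nm mf) (mfin_nm mf)).
apply: (H_dpd Ppr); first by apply: mfin_pair; exact: mfin_nm.
move=> x y [/nmP hs /nmP ht]; apply/nmP => g; rewrite mem_cat => /orP[]; [exact: hs|exact: ht].
Qed.

Lemma H_nm_condmono (T U : finType) (f : X -> T) (a : X -> U) (s t : seq G) :
  mfin f -> mfin a -> {subset s <= t} ->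
  H (fun x => (a x, nm f t x)) - H (nm f t) <= H (fun x => (a x, nm f s x)) - H (nm f s).
Proof.
move=> mf ma st; apply: (H_condmono Ppr) => //; first exact: mfin_nm.
by apply: dpd_nm => x y h; apply/nmP => g gs; apply: h; exact: st.
Qed.

(** The increment [de] due to a new [g], conditioned on all of [F], is at most the increment
    conditioned on the part of [F] in [S c]; at least [k] indices [c] contain [g], so the right side
    grows by [k * de] or more. *)
Lemma shearer (T : finType) (f : X -> T) (I : Type) (cs : seq I) (S : I -> seq G)
  (F : seq G) (k : nat) : mfin f ->
  (forall g, g \in F -> (k <= count (fun c => g \in S c) cs)%N) ->
  k%:R * H (nm f F) <= \sum_(c <- cs) H (nm f [seq g <- F | g \in S c]).
Proof.
move=> mf; elim: F => [|g F ih] kF.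
  rewrite [X in _ * X](_ : _ = 0); last first.
    apply/eqP; rewrite eq_le (H_ge0 Ppr) ?andbT; last exact: mfin_nm.
    rewrite -[leRHS](@ln1 R); apply: (H_le_ln Ppr) => //; first exact: mfin_nm.
    by rewrite card_ffun card_ord expn0.
  by rewrite mulr0; apply: sumr_ge0 => c _; apply: (H_ge0 Ppr); exact: mfin_nm.
have {}ih := ih (fun h hF => kF h (@mem_behead _ (g :: F) h hF)).
pose de := H (nm f (g :: F)) - H (nm f F).
have de0 : 0 <= de by rewrite subr_ge0 H_nm_sub// => h hF; rewrite inE hF orbT.
apply: le_trans (_ : \sum_(c <- cs) (H (nm f [seq h <- F | h \in S c]) +
  (g \in S c)%:R * de) <= _); last first.
  apply: ler_sum => c _ /=; case: ifP => gS; last by rewrite mul0r addr0.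
  rewrite mul1r -lerBrDl /de !H_nm_cons//.
  apply: H_nm_condmono => //; first exact: mfin_act.
  by move=> h; rewrite mem_filter => /andP[].
rewrite big_split/= -mulr_suml -natr_sum.
have -> : k%:R * H (nm f (g :: F)) = k%:R * H (nm f F) + k%:R * de by rewrite /de; ring.
apply: lerD => //; apply: ler_wpM2r => //; rewrite ler_nat.
have := kF g (mem_head _ _); rewrite -sum1_count => /leq_trans; apply.
by rewrite big_mkcond/=; apply: leq_sum => c _; case: (g \in S c).
Qed.

Lemma H_nm_le (T : finType) (f : X -> T) (s : seq G) (n : R) : mfin f ->
  1 <= n -> #|T|%:R <= n -> H (nm f s) <= (size s)%:R * ln n.
Proof.
move=> mf n1 Tn; elim: s => [|g s ih].
  rewrite mul0r -(@ln1 R); apply: (H_le_ln Ppr) => //; first exact: mfin_nm.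
  by rewrite card_ffun card_ord expn0.
rewrite H_nm_cons//; apply: le_trans (H_pair Ppr _ _) _.
- exact: mfin_act.
- exact: mfin_nm.
rewrite /= -natr1 mulrDl mul1r [leRHS]addrC; apply: lerD => //.
by apply: (H_le_ln Ppr) => //; exact: mfin_act.
Qed.

(** Chain rule along [K]: the name over [L] contains the window [s k], so that conditioning on it
    makes the value of [a] at [k] cost at most [e]. *)
Lemma H_nm_cond (T U : finType) (f : X -> T) (a : X -> U) (s K L : seq G)
  (mul : G -> G -> G) (e : R) :
  mfin f -> mfin a ->
  (forall g k x, act (mul g k) x = act g (act k x)) ->
  (forall k, k \in K -> {subset [seq mul g k | g <- s] <= L}) ->
  (forall k, k \in K -> H (fun x => (a (act k x), nm f s (act k x))) -
       H (nm f s \o act k) <= e) ->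
  H (fun x => (nm a K x, nm f L x)) <= H (nm f L) + (size K)%:R * e.
Proof.
move=> mf ma actM; elim: K => [|k K ih] sL he.
  rewrite mul0r addr0; apply: (H_dpd Ppr); first exact: mfin_nm.
  by move=> x y ->; congr pair; apply/nmP.
have {}ih := ih (fun h hF => sL h (@mem_behead _ (k :: K) h hF))
   (fun h hF => he h (@mem_behead _ (k :: K) h hF)).
have maL : mfin (fun x => (nm a K x, nm f L x)) by apply: mfin_pair; exact: mfin_nm.
have mak : mfin (a \o act k) by exact: mfin_act.
have mfk : mfin (nm f s \o act k) by apply: mfin_act; exact: mfin_nm.
have d1 : dpd (fun x => (nm a K x, nm f L x)) (nm f s \o act k).
  move=> x y [_ /nmP h] /=; apply/nmP => g gs; rewrite -!actM.
  by apply: h; apply: (sL k (mem_head _ _)); exact: map_f.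
have := H_condmono Ppr mak maL d1.
have -> : H (fun x => ((a \o act k) x, (nm a K x, nm f L x))) =
   H (fun x => (nm a (k :: K) x, nm f L x)).
  apply: (H_eq Ppr).
  - by apply: mfin_pair; exact: mfin_nm.
  - move=> x y [/nmP h ->]; congr (_, (_, _)); first by apply: h; exact: mem_head.
    by apply/nmP => g gK; apply: h; rewrite inE gK orbT.
  - move=> x y [/= ak /nmP aK ->]; congr (_, _); apply/(nmP a (k :: K)) => g.
    by rewrite inE => /predU1P[->//|]; exact: aK.
have := he k (mem_head _ _).
rewrite /= -natr1 mulrDl mul1r => *; lra.
Qed.

Definition inv_pr : Prop := forall g A, measurable A -> pr (act g @^-1` A) = pr A.

Lemma H_act (T : finType) (f : X -> T) g : inv_pr -> mfin f -> H (f \o act g) = H f.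
Proof. by move=> ip mf; apply: eq_bigr => t _; congr phi; exact: (ip g _ (mf t)). Qed.

End pr.
End Names.

(** * Folner sequences and dynamical entropy *)

Section Group.
Context {R : realType} {G : countType} (mul : G -> G -> G) (one : G) (inv : G -> G).
Hypothesis hG : is_group mul one inv.

Lemma mulA : associative mul. Proof. by case: hG. Qed.
Lemma mul1 g : mul one g = g. Proof. by case: hG. Qed.
Lemma mulg1 g : mul g one = g. Proof. by case: hG. Qed.
Lemma mulVg g : mul (inv g) g = one. Proof. by case: hG. Qed.
Lemma mulgV g : mul g (inv g) = one. Proof. by case: hG. Qed.
Lemma mulKg g h : mul (inv g) (mul g h) = h. Proof. by rewrite mulA mulVg mul1. Qed.
Lemma mulVKg g h : mul g (mul (inv g) h) = h. Proof. by rewrite mulA mulgV mul1. Qed.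
Lemma mulgK g h : mul (mul h g) (inv g) = h. Proof. by rewrite -mulA mulgV mulg1. Qed.
Lemma mulgVK g h : mul (mul h (inv g)) g = h. Proof. by rewrite -mulA mulVg mulg1. Qed.
Lemma mul_injl g : injective (mul g).
Proof. by move=> x y h; rewrite -(mulKg g x) h mulKg. Qed.
Lemma mul_injr g : injective (mul^~ g).
Proof. by move=> x y h; rewrite -(mulgK g x) /= h mulgK. Qed.
Lemma invK g : inv (inv g) = g.
Proof. by rewrite -[LHS](mulgVK g) mulVg mul1. Qed.

Lemma bigfcup_card (I : choiceType) (r : seq I) (A : I -> {fset G}) :
  (#|` (\bigcup_(i <- r) A i)%fset| <= \sum_(i <- r) #|` A i|)%N.
Proof.
elim: r => [|i r ih]; first by rewrite !big_nil cardfs0.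
rewrite !big_cons; apply: leq_trans (_ : #|` A i| + #|` (\bigcup_(j <- r) A j)%fset| <= _)%N.
  by rewrite cardfsU leq_subr.
by rewrite leq_add2l.
Qed.

Variable Fs : nat -> {fset G}.
Hypothesis hF : folner (R := R) mul Fs.

Lemma Fs_neq0 n : Fs n != fset0. Proof. by case: hF => h _; exact: h. Qed.
Lemma Fs_gt0 n : (0 < #|` Fs n|)%N.
Proof. by rewrite cardfs_gt0 Fs_neq0. Qed.
Lemma Fs_gt0R n : 0 < #|` Fs n|%:R :> R. Proof. by rewrite ltr0n Fs_gt0. Qed.

Lemma folner1 g (e : R) : 0 < e -> \forall n \near \oo,
  #|` ([fset mul g h | h in Fs n] `\` Fs n)%fset|%:R <= e * #|` Fs n|%:R.
Proof.
move=> e0; have [_ /(_ g)] := hF.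
move/cvgrPdist_le => /(_ e e0); apply: filterS => n.
rewrite sub0r normrN ger0_norm ?divr_ge0// ler_pdivrMr ?Fs_gt0R//.
apply: le_trans; rewrite ler_nat; apply: fsubset_leq_card; exact: fsubsetUl.
Qed.

Definition bdl (T : seq G) (F : {fset G}) : {fset G} :=
  (\bigcup_(t <- T) ([fset mul t h | h in F] `\` F))%fset.

Lemma bdlP T (F : {fset G}) t h : t \in T -> h \in F -> mul t h \notin F -> mul t h \in bdl T F.
Proof.
move=> tT hF' n; apply/bigfcupP; exists t; first by rewrite tT.
by rewrite inE n in_imfset.
Qed.

Lemma folner_bdl (T : seq G) (e : R) : 0 < e -> \forall n \near \oo,
  #|` bdl T (Fs n)|%:R <= e * #|` Fs n|%:R.
Proof.
move=> e0.
have h m : \forall n \near \oo, forall t, t \in T ->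
    #|` ([fset mul t h | h in Fs n] `\` Fs n)%fset|%:R <= (e / m.+1%:R) * #|` Fs n|%:R.
  elim: T => [|t T ih]; first by near=> n.
  have h1 := @folner1 t (e / m.+1%:R) (divr_gt0 e0 (ltr0Sn _ _)).
  near=> n => u; rewrite inE => /predU1P[->|uT].
    by near: n.
  by move: u uT; near: n.
apply: filterS (h (size T)) => n {}h; rewrite /bdl.
apply: le_trans (_ : (\sum_(t <- T) #|` ([fset mul t h | h in Fs n] `\` Fs n)%fset|)%:R <= _).
  by rewrite ler_nat; exact: bigfcup_card.
rewrite natr_sum big_seq; apply: le_trans (ler_sum _ h) _.
rewrite -big_seq sum_const_seq mulrA.
apply: ler_wpM2r => //; rewrite mulrCA; apply: ler_piMr; first exact: ltW.
by rewrite ler_pdivrMr ?ltr0Sn// mul1r ler_nat.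
Unshelve. all: by end_near. Qed.

End Group.

(** Only the measurable side of the dynamics. [sys_fix] makes stabilisers measurable, so that they
    can be counted and coded. *)
Record sys {R : realType} {G : countType} (mul : G -> G -> G) (one : G) (inv : G -> G)
    (Fs : nat -> {fset G}) {dX : measure_display} {X : measurableType dX}
    (act : G -> X -> X) : Prop := Sys {
  sysG : is_group mul one inv;
  sysF : folner (R := R) mul Fs;
  sys_mact : forall g A, measurable A -> measurable (act g @^-1` A);
  sysM : forall g h x, act (mul g h) x = act g (act h x);
  sys1 : forall x, act one x = x;
  sys_fix : forall g, measurable [set x | act g x = x] }.

Section SysEnt.
Context {R : realType} {G : countType} (mul : G -> G -> G) (one : G) (inv : G -> G)
  (Fs : nat -> {fset G}) {dX : measure_display} {X : measurableType dX} (act : G -> X -> X).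
Hypothesis Sy : sys (R := R) mul one inv Fs act.
Let hG := sysG Sy. Let hF := sysF Sy. Let mact := sys_mact Sy. Let actM := sysM Sy.
Let act1 := sys1 Sy.
Let mulVKg := mulVKg hG. Let invK := invK hG. Let mul_injr := mul_injr hG.
Let folner_bdl := folner_bdl hF. Let Fs_gt0R := Fs_gt0R hF. Let Fs_neq0 := Fs_neq0 hF.
Variable pr : set X -> R.
Local Notation bdl := (bdl mul).

Lemma actK g : cancel (act g) (act (inv g)).
Proof. by move=> x; rewrite -actM (mulVg hG) act1. Qed.
Lemma actVK g : cancel (act (inv g)) (act g).
Proof. by move=> x; rewrite -actM (mulgV hG) act1. Qed.

Definition iprob : Prop := fprob pr /\ inv_pr act pr.
Local Notation H := (ent pr).
Local Notation nm := (nm act).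

Lemma H_nm_shift (Ppr : fprob pr) (T : finType) (f : X -> T) (K : seq G) c : mfin f ->
  H (nm f [seq mul k c | k <- K]) = H (nm f K \o act c).
Proof.
move=> mf; apply: (H_eq Ppr).
- by apply: mfin_act => //; exact: mfin_nm.
- move=> x y /= /nmP h; apply/nmP => g /mapP[k kK ->].
  by rewrite !actM; exact: h.
- apply: dpd_nm => x y h /=; apply/nmP => g gK; rewrite -!actM; apply: h.
  exact: map_f.
Qed.

(** Shearer's inequality for the translates [K c]. A point [g] of [F] lies in those centred at
    [k^-1 g]; centres falling outside [F] are collected in [B], where the trivial bound [#|K| ln n]
    is paid. *)
Lemma H_cover (Ppr : fprob pr) (T : finType) (f : X -> T) (n : R) (K : {fset G}) (F : {fset G}) :
  mfin f -> 1 <= n -> #|T|%:R <= n ->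
  #|` K|%:R * H (nm f F) <= \sum_(c <- F) H (nm f K \o act c) +
    #|` bdl [seq inv k | k <- K] F|%:R * (#|` K|%:R * ln n).
Proof.
move=> mf n1 Tn.
pose B := bdl [seq inv k | k <- K] F.
pose S c := [seq mul k c | k <- K].
have cnt g : g \in (F : seq G) -> (size K <= count (fun c => g \in S c) (F ++ B))%N.
  move=> gF.
  have -> : size K = size [seq mul (inv k) g | k <- K] by rewrite size_map.
  have sub : {subset [seq mul (inv k) g | k <- K] <= [seq c <- F ++ B | g \in S c]}.
    move=> c /mapP[k kK ->]; rewrite mem_filter; apply/andP; split.
      by apply/mapP; exists k => //; rewrite mulVKg.
    rewrite mem_cat; case: (boolP (mul (inv k) g \in (F : seq G))) => //= n0.
    by apply: bdlP => //; exact: map_f.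
  rewrite -size_filter; apply: uniq_leq_size sub.
  rewrite map_inj_uniq ?fset_uniq// => k k' h.
  by rewrite -(invK k) -(invK k'); congr inv; exact: (mul_injr h).
have := shearer mact Ppr mf cnt; move/le_trans; apply.
apply: le_trans (_ : \sum_(c <- F ++ B) H (nm f (S c)) <= _).
  apply: ler_sum => c _; apply: H_nm_sub => // g.
  by rewrite mem_filter => /andP[].
rewrite big_cat/=; apply: lerD.
  by apply: ler_sum => c _; rewrite H_nm_shift.
apply: le_trans (_ : \sum_(c <- B) (#|` K|%:R * ln n) <= _).
  apply: ler_sum => c _; apply: le_trans (H_nm_le mact Ppr _ mf n1 Tn) _.
  by rewrite size_map.
by rewrite sum_const_seq.
Qed.

Hypothesis Ip : iprob.
Let Ppr := proj1 Ip. Let ip := proj2 Ip.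

(** An infimum over all finite sets rather than a limit along [Fs]: each finite set gives an upper
    bound at once, and lower bounds pass to limits of measures. [hent_cvg] identifies it with the
    limit. *)
Definition hent (T : finType) (f : X -> T) : R :=
  inf [set H (nm f K) / #|` K|%:R | K in [set K : {fset G} | K != fset0]].

Lemma hent_lb (T : finType) (f : X -> T) : mfin f ->
  has_inf [set H (nm f K) / #|` K|%:R | K in [set K : {fset G} | K != fset0]].
Proof.
move=> mf; split; first by exists (H (nm f (Fs 0)) / #|` Fs 0|%:R); exists (Fs 0) => //; exact: Fs_neq0.
exists 0 => _ [K _ <-]; apply: divr_ge0 => //; apply: (H_ge0 Ppr); exact: mfin_nm.
Qed.

Lemma hent_ge0 (T : finType) (f : X -> T) : mfin f -> 0 <= hent f.
Proof.
move=> mf; apply: lb_le_inf; first by case: (hent_lb mf).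
move=> _ [K _ <-]; apply: divr_ge0 => //; apply: (H_ge0 Ppr); exact: mfin_nm.
Qed.

Lemma hent_le (T : finType) (f : X -> T) (K : {fset G}) : mfin f -> K != fset0 ->
  hent f * #|` K|%:R <= H (nm f K).
Proof.
move=> mf K0; rewrite -ler_pdivlMr ?ltr0n ?cardfs_gt0//.
by apply: inf_lbound; [case: (hent_lb mf)|exists K].
Qed.

Lemma hent_leP (T : finType) (f : X -> T) (b : R) (K : {fset G}) : mfin f -> K != fset0 ->
  H (nm f K) <= b * #|` K|%:R -> hent f <= b.
Proof.
move=> mf K0 h; have := le_trans (hent_le mf K0) h.
by rewrite ler_pM2r// ltr0n cardfs_gt0.
Qed.

(** Take [K] almost attaining the infimum. By invariance all terms of [H_cover] over [Fs m] are
    equal, and the boundary term is negligible for large [m]. *)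
Lemma hent_near (T : finType) (f : X -> T) (e : R) : mfin f -> 0 < e ->
  \forall n \near \oo, H (nm f (Fs n)) <= (hent f + e) * #|` Fs n|%:R.
Proof.
move=> mf e0.
have [_ [K /= K0 <-]] := inf_adherent (divr_gt0 e0 (ltr0Sn _ 1)) (hent_lb mf).
rewrite -/(hent f) => hK.
have Kp : 0 < #|` K|%:R :> R by rewrite ltr0n cardfs_gt0.
pose n := Num.max 1 #|T|%:R : R.
have n1 : 1 <= n by rewrite le_max lexx.
have Tn : #|T|%:R <= n by rewrite le_max lexx orbT.
pose l := ln n + 1; have l0 : 0 < l by have := ln_ge0 n1; rewrite /l; lra.
have := @folner_bdl [seq inv k | k <- K] (e / 2 / l).
rewrite !divr_gt0//; move=> /(_ isT); apply: filterS => m hm.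
have := H_cover Ppr K (Fs m) mf n1 Tn.
have -> : \sum_(c <- Fs m) H (nm f K \o act c) = \sum_(c <- Fs m) H (nm f K).
  by apply: eq_bigr => c _; apply: H_act => //; exact: mfin_nm.
have Fp := Fs_gt0R m.
rewrite sum_const_seq => hc.
have {}hm : #|` bdl [seq inv k | k <- K] (Fs m)|%:R * ln n <= e / 2 * #|` Fs m|%:R.
  have := ler_wpM2r (ltW l0) hm; rewrite mulrAC divfK ?gt_eqF// => h.
  by apply: le_trans h; apply: ler_wpM2l => //; rewrite /l lerDl.
rewrite -(ler_pM2l Kp); apply: le_trans hc _.
have h1 : H (nm f K) <= (hent f + e / 2) * #|` K|%:R by rewrite -ler_pdivrMr// ltW.
have h2 := ler_wpM2l (ltW Fp) h1.
have h3 := ler_wpM2l (ltW Kp) hm.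
move: h2 h3; rewrite -[size _]/(#|` Fs m|); nra.
Qed.

Lemma hent_cvg (T : finType) (f : X -> T) : mfin f ->
  (#|` Fs n|%:R^-1 * H (nm f (Fs n))) @[n --> \oo] --> hent f.
Proof.
move=> mf; apply/cvgrPdist_le => e e0.
apply: filterS (hent_near mf e0) => n h.
have Fp := Fs_gt0R n; have F0 := Fs_neq0 n.
have := hent_le mf F0; rewrite -ler_pdivlMr// => h1.
move: h; rewrite -ler_pdivrMr// => h; rewrite mulrC ler_norml; apply/andP; split; lra.
Qed.

Lemma hent_limP (T : finType) (f : X -> T) (b : R) : mfin f ->
  (forall e : R, 0 < e -> \forall n \near \oo, H (nm f (Fs n)) <= (b + e) * #|` Fs n|%:R) ->
  hent f <= b.
Proof.
move=> mf h; apply/ler_addgt0Pr => e e0.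
have [n _ /(_ n (leqnn n)) /= hn] := h _ e0.
by apply: hent_leP (Fs_neq0 n) hn.
Qed.

Lemma hent_le_H (T : finType) (f : X -> T) : mfin f ->
  hent f <= H f.
Proof.
move=> mf; apply: (@hent_leP _ _ _ [fset one]%fset) => //.
  by apply/eqP => /fsetP /(_ one); rewrite !inE eqxx.
rewrite [leRHS](_ : _ = H f); last by rewrite cardfs1 mulr1.
apply: (H_dpd Ppr) => //; move=> x y h.
by apply/nmP => g /fset1P ->; rewrite !act1.
Qed.

(** When [g] is a function of [f] seen through the window [s], its name over [Fs m] is read from
    that of [f] over [Fs m] and its [s]-boundary, whose density tends to 0. *)
Lemma hent_dpd (T U : finType) (f : X -> T) (g : X -> U) (s : seq G) : mfin f ->
  dpd (nm f s) g -> hent g <= hent f.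
Proof.
move=> mf fg; have mg : mfin g := mfin_dpd (mfin_nm mact mf) fg.
apply: hent_limP => // e e0.
pose n := Num.max 1 #|T|%:R : R.
have n1 : 1 <= n by rewrite le_max lexx.
have Tn : #|T|%:R <= n by rewrite le_max lexx orbT.
pose l := ln n + 1; have l0 : 0 < l by have := ln_ge0 n1; rewrite /l; lra.
have h1 := @folner_bdl s (e / 2 / l); rewrite !divr_gt0// in h1; have {}h1 := h1 isT.
have h2 := hent_near mf (divr_gt0 e0 (ltr0Sn _ 1)).
apply: filterS2 h1 h2 => m hm h2.
apply: le_trans (_ : H (nm f (Fs m ++ bdl s (Fs m))) <= _).
  apply: (H_dpd Ppr); first exact: mfin_nm.
  apply: dpd_nm => x y h; apply/nmP => k kF; apply: fg; apply/nmP => a sa.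
  rewrite -!actM; apply: h; rewrite mem_cat.
  by case: (boolP (mul a k \in (Fs m : seq G))) => //= n0; apply: bdlP.
apply: le_trans (H_nm_cat mact Ppr _ _ mf) _.
have h3 := H_nm_le mact Ppr (bdl s (Fs m)) mf n1 Tn.
have Fp := Fs_gt0R m.
have h4 : #|` bdl s (Fs m)|%:R * ln n <= e / 2 * #|` Fs m|%:R.
  have := ler_wpM2r (ltW l0) hm; rewrite mulrAC divfK ?gt_eqF// => h.
  by apply: le_trans h; apply: ler_wpM2l => //; rewrite /l lerDl.
nra.
Qed.

Lemma hent_pair (T U : finType) (f : X -> T) (g : X -> U) : mfin f -> mfin g ->
  hent (fun x => (f x, g x)) <= hent f + hent g.
Proof.
move=> mf mg; apply: hent_limP => [|e e0]; first exact: mfin_pair.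
have h1 := hent_near mf (divr_gt0 e0 (ltr0Sn _ 1)).
have h2 := hent_near mg (divr_gt0 e0 (ltr0Sn _ 1)).
apply: filterS2 h1 h2 => m h1 h2.
apply: le_trans (_ : H (fun x => (nm f (Fs m) x, nm g (Fs m) x)) <= _).
  apply: (H_dpd Ppr); first by apply: mfin_pair; exact: mfin_nm.
  by move=> x y [/nmP hf /nmP hg]; apply/nmP => k kF; rewrite hf// hg.
apply: le_trans (H_pair Ppr _ _) _; [exact: mfin_nm|exact: mfin_nm|].
nra.
Qed.

(** [H_nm_cond] along [Fs m]: each position pays the entropy of [a] given the window [s] of [f], and
    these windows leave [Fs m] only through its boundary. *)
Lemma hent_cond (T U : finType) (f : X -> T) (a : X -> U) (s : seq G) : mfin f -> mfin a ->
  hent a <= hent f + (H (fun x => (a x, nm f s x)) - H (nm f s)).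
Proof.
move=> mf ma; apply: hent_limP => // e e0.
pose n := Num.max 1 #|T|%:R : R.
have n1 : 1 <= n by rewrite le_max lexx.
have Tn : #|T|%:R <= n by rewrite le_max lexx orbT.
pose l := ln n + 1; have l0 : 0 < l by have := ln_ge0 n1; rewrite /l; lra.
have h1 := @folner_bdl s (e / 2 / l); rewrite !divr_gt0// in h1; have {}h1 := h1 isT.
have h2 := hent_near mf (divr_gt0 e0 (ltr0Sn _ 1)).
apply: filterS2 h1 h2 => m hm h2.
have mfs : mfin (nm f s) by exact: mfin_nm.
have hc := @H_nm_cond _ _ _ _ act mact pr Ppr _ _ f a s (Fs m) (Fs m ++ bdl s (Fs m)) mul
  (H (fun x => (a x, nm f s x)) - H (nm f s)) mf ma actM.
have {hc} : H (fun x => (nm a (Fs m) x, nm f (Fs m ++ bdl s (Fs m)) x)) <=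
    H (nm f (Fs m ++ bdl s (Fs m))) +
    #|` Fs m|%:R * (H (fun x => (a x, nm f s x)) - H (nm f s)).
  apply: hc => k kF.
    move=> _ /mapP[b sb ->]; rewrite mem_cat.
    by case: (boolP (mul b k \in (Fs m : seq G))) => //= n0; apply: bdlP.
  apply: lerB; last by rewrite (H_act _ ip).
  by have := @H_act _ _ _ _ _ _ _ (fun x => (a x, nm f s x)) k ip (mfin_pair ma mfs) => <-.
have h3 := H_nm_le mact Ppr (bdl s (Fs m)) mf n1 Tn.
have h5 := H_nm_cat mact Ppr (Fs m) (bdl s (Fs m)) mf.
have Fp := Fs_gt0R m.
have h4 : #|` bdl s (Fs m)|%:R * ln n <= e / 2 * #|` Fs m|%:R.
  have := ler_wpM2r (ltW l0) hm; rewrite mulrAC divfK ?gt_eqF// => h.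
  by apply: le_trans h; apply: ler_wpM2l => //; rewrite /l lerDl.
have h6 : H (nm a (Fs m)) <= H (fun x => (nm a (Fs m) x, nm f (Fs m ++ bdl s (Fs m)) x)).
  apply: (H_dpd Ppr); first by apply: mfin_pair; exact: mfin_nm.
  by move=> x y [].
nra.
Qed.
End SysEnt.

(** * Counting names *)

Section Count.
Context {R : realType}.

(** An admissible function is fixed by one value on each connected component. A component of size
    [c] costs one [ln N], that is [ln (N i) / c] summed over its elements, and [D i] lies in the
    component of [i]. *)
Lemma count_const_edges (I T : finType) (e : rel I) (V : I -> {set T}) (N : I -> R)
  (D : I -> {set I}) :
  (forall i, 1 <= N i) -> (forall i, #|V i|%:R <= N i) ->
  (forall i j, e i j -> N i = N j) ->
  (forall i, i \in D i) -> (forall i j, j \in D i -> i = j \/ e i j) ->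
  #|[set f : {ffun I -> T} | [forall i, f i \in V i] &&
      [forall i, forall j, e i j ==> (f i == f j)]]%SET|%:R <=
  expR (\sum_i ln (N i) / #|D i|%:R).
Proof.
move=> N1 VN Ne Di De.
pose e' i j := e i j || e j i.
have sy : connect_sym e' by apply: sym_connect_sym => i j; rewrite /e' orbC.
have cN (A : Type) (q : I -> A) : (forall i j, e i j -> q i = q j) ->
    forall i j, connect e' i j -> q i = q j.
  move=> qe i j /connectP[p]; elim: p i => [i _ -> //|k p ih i /= /andP[ik kp] l].
  by rewrite -(ih k kp l); case/orP : ik => /qe.
pose rt := fingraph.root e'.
pose isr i := rt i == i.
set Fam := (X in #|X|%:R <= _).
apply: le_trans (_ : (\prod_(i | isr i) #|V i|)%:R <= _).
  rewrite ler_nat.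
  (* Only the values at component roots are kept; all other positions receive the dummy [None]. *)
  pose W i : {set option T} := (if isr i then [set Some t | t in V i] else [set None])%SET.
  pose psi (f : {ffun I -> T}) := [ffun i => if isr i then Some (f i) else None].
  have inj : {in Fam &, injective psi}.
    move=> f g; rewrite !inE => /andP[_ /forallP fe] /andP[_ /forallP ge] /ffunP fg.
    apply/ffunP => i.
    have fr (h : {ffun I -> T}) : (forall i, [forall j, e i j ==> (h i == h j)]) ->
        h i = h (rt i).
      move=> he; apply: cN (connect_root e' i) => a b ab.
      by have /forallP/(_ b)/implyP/(_ ab)/eqP := he a.
    rewrite (fr f)// (fr g)//; move: (fg (rt i)); rewrite !ffunE /isr /rt root_root// eqxx.
    by case.
  rewrite -(card_in_imset inj).
  apply: leq_trans (_ : #|family W| <= _)%N.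
    apply: subset_leq_card; apply/fintype.subsetP => _ /imsetP[f + ->].
    rewrite inE => /andP[/forallP fV _]; apply/familyP => i; rewrite ffunE /W.
    by case: ifP => _; [apply/imsetP; exists (f i)|rewrite inE].
  rewrite card_family foldrE big_map big_enum/= [leqRHS]big_mkcond.
  apply: leq_prod => i _; rewrite /W; case: ifP => _; last by rewrite cards1.
  by rewrite leq_imset_card.
rewrite natr_prod; apply: le_trans (_ : \prod_(i | isr i) expR (ln (N i)) <= _).
  apply: ler_prod => i _; rewrite ler0n lnK ?VN// posrE.
  exact: lt_le_trans (N1 i).
rewrite -expR_sum ler_expR.
rewrite [leRHS](partition_big rt isr)/=; last first.
  by move=> i _; rewrite /isr /rt root_root.
apply: ler_sum => r /eqP rr.
have lN0 i : 0 <= ln (N i) by exact: ln_ge0.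
pose C := [set i | rt i == r]%SET.
have C0 : (0 < #|C|)%N by rewrite card_gt0; apply/set0Pn; exists r; rewrite inE rr.
apply: le_trans (_ : \sum_(i in C) ln (N r) / #|C|%:R <= _).
  rewrite sumr_const -[leRHS]mulr_natr divfK// pnatr_eq0 -lt0n//.
rewrite [leLHS](eq_bigl (fun i => rt i == r)); last by move=> i; rewrite inE.
apply: ler_sum => i /eqP ir.
have -> : N r = N i by apply: cN => //; rewrite sy -ir connect_root.
apply: ler_wpM2l => //.
have D0 : (0 < #|D i|)%N by rewrite card_gt0; apply/set0Pn; exists i.
rewrite lef_pV2 ?posrE ?ltr0n// ler_nat; apply: subset_leq_card.
apply/fintype.subsetP => j /De[<-|ij]; rewrite inE ?ir//.
rewrite -ir eq_sym; apply/eqP/(fingraph.rootP sy); apply: connect1; by rewrite /e' ij.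
Qed.
End Count.

Section NameCount.
Context {R : realType} {G : countType} (mul : G -> G -> G) (one : G) (inv : G -> G)
  (Fs : nat -> {fset G}) {dX : measure_display} {X : measurableType dX} (act : G -> X -> X).
Hypothesis Sy : sys (R := R) mul one inv Fs act.
Let hG := sysG Sy. Let hF := sysF Sy. Let mact := sys_mact Sy. Let actM := sysM Sy.
Let act1 := sys1 Sy. Let mfix := sys_fix Sy.
Variables (pr : set X -> R) (Ip : iprob act pr).
Let Ppr := proj1 Ip. Let ip := proj2 Ip.
Local Notation H := (ent pr).
Local Notation nm := (nm act).
Local Notation hent := (hent act pr).

Definition stab (S : seq G) (x : X) : {ffun 'I_(size S) -> bool} :=
  [ffun i => `[< act (tnth (in_tuple S) i) x = x >]].

Lemma mfin_stab S : mfin (stab S).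
Proof. by apply: mfin_ffun => i; apply: mfin_set; exact: mfix. Qed.

Lemma sum_law_act (T : finType) (f : X -> T) (psi : T -> R) (U : finType) (q : X -> U)
   (h : U -> T) g : mfin f -> mfin q -> (forall x, f (act g x) = h (q x)) ->
  \sum_u plaw pr q u * psi (h u) = \sum_t plaw pr f t * psi t.
Proof.
move=> mf mq fq; rewrite (partition_big h predT)//=; apply: eq_bigr => t _.
have -> : plaw pr f t = \sum_(u | h u == t) plaw pr q u.
  rewrite -(law_comp Ppr)// /plaw -(ip g (mf t)); congr pr.
  by apply/seteqP; split => x /=; rewrite fq.
by rewrite mulr_suml; apply: eq_bigr => u /eqP ->.
Qed.

(** If [s] fixes the point at position [c], then the positions [c] and [s c] carry the same value of
    [xi]. Names are thus constant along edges known from [stab], and each position pays [ln N]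
    divided by the number of elements of [S] that fix its point. *)
Lemma hent_count (T T0 : finType) (xi : X -> T) (ka : X -> T0) (V : T0 -> {set T})
  (N : T0 -> R) (S : seq G) :
  mfin xi -> mfin ka -> (forall x, xi x \in V (ka x)) -> (forall k, 1 <= N k) ->
  (forall k, #|V k|%:R <= N k) -> uniq S -> one \in S ->
  hent xi <= hent (fun x => (stab S x, ka x)) +
    \sum_u plaw pr (fun x => (stab S x, ka x)) u * (ln (N u.2) / #|[set i | u.1 i]%SET|%:R).
Proof.
move=> mxi mka xV N1 VN uS oneS.
set f := fun x => (stab S x, ka x).
have mf : mfin f by apply: mfin_pair => //; exact: mfin_stab.
pose M := \big[Num.max/1]_k N k.
have M1 : 1 <= M by exact: bigmax_ge_id.
have NM k : N k <= M by exact: le_bigmax.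
have lM0 : 0 <= ln M by exact: ln_ge0.
apply: (hent_limP Sy Ip) => // e e0.
(* Budget for the positions some [S]-translate of which leaves [K]: at most [size S * #|bdl|] of
   them, each paying at most [ln M]. *)
pose l := (size S)%:R * ln M + 1.
have l0 : 0 < l by have := mulr_ge0 (ler0n R (size S)) lM0; rewrite /l; lra.
have h1 := folner_bdl hF S (e := e / 2 / l).
rewrite !divr_gt0// in h1; have {}h1 := h1 isT.
have h2 := hent_near Sy Ip mf (divr_gt0 e0 (ltr0Sn _ 1)).
apply: filterS2 h1 h2 => m hm h2.
set K := Fs m in hm h2 *.
pose kk (c : 'I_(size K)) := tnth (in_tuple K) c.
pose ss (i : 'I_(size S)) := tnth (in_tuple S) i.
pose eu (u : {ffun 'I_(size K) -> {ffun 'I_(size S) -> bool} * T0}) (c c' : 'I_(size K)) :=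
  [exists i, (u c).1 i && (kk c' == mul (ss i) (kk c))].
pose D u c : {set 'I_(size K)} := (c |: [set c' | eu u c c'])%SET.
pose n (u : {ffun 'I_(size K) -> {ffun 'I_(size S) -> bool} * T0}) := expR (\sum_c ln (N (u c).2) / #|D u c|%:R) : R.
pose VV (u : {ffun 'I_(size K) -> {ffun 'I_(size S) -> bool} * T0}) :
    {set {ffun 'I_(size K) -> T}} :=
  [set h | `[< exists2 x, nm f K x = u & nm xi K x = h >]]%SET.
have eux x c c' : eu (nm f K x) c c' -> act (kk c') x = act (kk c) x.
  move=> /existsP[i /andP[]]; rewrite !ffunE/= => /asboolP fx /eqP ->.
  by rewrite actM.
have cnt : H (fun x => (nm xi K x, nm f K x)) <=
    H (nm f K) + \sum_u plaw pr (nm f K) u * ln (n u).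
  apply: (H_count Ppr (V := VV)); [exact: mfin_nm|exact: mfin_nm| | |].
  - by move=> x; rewrite inE; apply/asboolP; exists x.
  - move=> u; have [[x0 x0u]|nu] := pselect (exists x, nm f K x = u); last first.
      rewrite (_ : VV u = finset.set0) ?cards0 ?expR_ge0//; apply/setP => h.
      by rewrite !inE; apply/asboolP => -[x xu _]; apply: nu; exists x.
    apply: le_trans (count_const_edges (e := eu u) (V := fun c => V (u c).2)
       (N := fun c => N (u c).2) (D := D u) _ _ _ _ _) => //.
    + rewrite ler_nat; apply: subset_leq_card; apply/fintype.subsetP => h.
      rewrite !finset.in_set => hx; have [x xu xh] := asboolW hx; apply/andP; split.
        by apply/forallP => c; rewrite -xu -xh !ffunE/=; exact: xV.
      apply/forallP => c; apply/forallP => c'; apply/implyP; rewrite -xu => /eux ec.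
      by rewrite -xh !ffunE/= -/(kk c) -/(kk c') ec.
    + by move=> c c'; rewrite -x0u => /eux ec; rewrite !ffunE/= -/(kk c) -/(kk c') ec.
    + by move=> c; rewrite !inE eqxx.
    + by move=> c c'; rewrite !inE => /orP[/eqP ->|]; [left|right].
  - move=> u; rewrite -expR0 ler_expR; apply: sumr_ge0 => c _.
    by rewrite divr_ge0// ln_ge0.
have mnf : mfin (nm f K) by exact: mfin_nm.
apply: le_trans (_ : H (fun x => (nm xi K x, nm f K x)) <= _).
  by apply: (H_dpd Ppr); [apply: mfin_pair; exact: mfin_nm|move=> x y []].
apply: le_trans cnt _.
under eq_bigr do rewrite expRK mulr_sumr.
rewrite exchange_big/=.
set E := (X in (_ + X + _) * _).
have E0 : 0 <= E.
  apply: sumr_ge0 => u _; rewrite mulr_ge0 ?(law_ge0 Ppr)// divr_ge0// ln_ge0//.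
pose bad c := ~~ all (fun s => mul s (kk c) \in (K : seq G)) S.
(* At a good position the stabilising elements inject into [D u c], and invariance brings the
   average at [c] back to the average [E] at the identity. *)
have good c : ~~ bad c -> \sum_u plaw pr (nm f K) u * (ln (N (u c).2) / #|D u c|%:R) <= E.
  rewrite negbK => /allP gc.
  rewrite /E -(@sum_law_act _ f (fun u => ln (N u.2) / #|[set i | u.1 i]%SET|%:R) _ (nm f K)
     (fun u => u c) (kk c) mf mnf); last by move=> x; rewrite ffunE.
  apply: ler_sum => u _; have := law_ge0 Ppr u mnf.
  rewrite le_eqVlt => /predU1P[<-|u0]; first by rewrite !mul0r.
  rewrite ler_pM2l//; apply: ler_wpM2l; first exact: ln_ge0.
  have [x0 x0u] : exists x, nm f K x = u.
    apply: contrapT => nx; move: u0; rewrite /plaw (_ : mkset _ = set0) ?(pr0 Ppr) ?ltxx//.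
    by apply/seteqP; split => // x xu; apply: nx; exists x.
  have [i1 i1E] : exists i, ss i = one by have /tnthP[i ->] : one \in in_tuple S by []; exists i.
  rewrite lef_pV2 ?posrE ?ltr0n ?card_gt0; last 2 first.
  - by apply/set0Pn; exists c; rewrite !inE eqxx.
  - apply/set0Pn; exists i1; rewrite inE -x0u !ffunE /=; apply/asboolP.
    by rewrite -/(ss i1) i1E act1.
  rewrite ler_nat.
  have ex i : {c' | kk c' = mul (ss i) (kk c)}.
    apply: cid; have /gc : ss i \in S by exact: mem_tnth.
    by move=> h; have /tnthP[c' ->] : mul (ss i) (kk c) \in in_tuple K by []; exists c'.
  pose ph i := projT1 (ex i).
  have phE i : kk (ph i) = mul (ss i) (kk c) by exact: (projT2 (ex i)).
  have phi_inj : injective ph.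
    move=> i j ij; have := phE i; rewrite ij phE => /(mul_injr hG) /= sij.
    have : injective ss by apply/tuple_uniqP.
    by apply.
  rewrite -(card_imset _ phi_inj); apply: subset_leq_card.
  apply/fintype.subsetP => c' /imsetP[i]; rewrite inE => ui ->.
  by rewrite !inE; apply/orP; right; apply/existsP; exists i; rewrite ui phE eqxx.
have nogood c : \sum_u plaw pr (nm f K) u * (ln (N (u c).2) / #|D u c|%:R) <= ln M.
  apply: le_trans (_ : \sum_u plaw pr (nm f K) u * ln M <= _); last first.
    by rewrite -mulr_suml (sum_law Ppr)// mul1r.
  apply: ler_sum => u _; apply: ler_wpM2l; first exact: (law_ge0 Ppr).
  have D1 : (0 < #|D u c|)%N by rewrite card_gt0; apply/set0Pn; exists c; rewrite !inE eqxx.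
  rewrite ler_pdivrMr ?ltr0n//; apply: le_trans (_ : ln M <= _).
    by rewrite ler_ln ?posrE//; [exact: lt_le_trans (N1 _)|exact: lt_le_trans M1].
  by rewrite ler_peMr// ler1n.
(* A bad position is sent to some [s] together with the boundary element [s c], from which [c] is
   recovered by cancellation. *)
have cbad : (#|[set c | bad c]%SET| <= size S * #|` bdl mul S K|)%N.
  have ex c : bad c -> exists i, mul (ss i) (kk c) \in bdl mul S K.
    move=> /allPn[s sS sn]; have /tnthP[i si] : s \in in_tuple S by [].
    exists i; rewrite /ss -si; apply: bdlP => //; exact: mem_tnth.
  pose ph c := if pselect (bad c) is left bc then
     let i := projT1 (cid (ex c bc)) in (tnth (in_tuple S) i, mul (ss i) (kk c)) else (one, one).
  rewrite cardE -[X in (_ <= X)%N](size_allpairs pair S (bdl mul S K)).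
  rewrite -(size_map ph); apply: uniq_leq_size.
    rewrite map_inj_in_uniq ?enum_uniq// => c c'; rewrite !mem_enum !inE /ph => bc bc'.
    case: pselect => // bc1; case: pselect => // bc2.
    move: (projT1 _) (projT1 _) => i j /=; rewrite -/(ss i) -/(ss j) => -[-> /(mul_injl hG)].
    have : injective kk by apply/tuple_uniqP; exact: fset_uniq.
    by move=> h /h.
  move=> p /mapP[c]; rewrite mem_enum inE /ph => bc ->.
  case: pselect => // bc1; case: cid => i /= hi.
  by apply/allpairsP; eexists (_, _); split; [exact: (mem_tnth i (in_tuple S))|exact: hi|].
have sumE : \sum_c \sum_u plaw pr (nm f K) u * (ln (N (u c).2) / #|D u c|%:R) <=
    #|` K|%:R * E + (size S)%:R * #|` bdl mul S K|%:R * ln M.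
  apply: le_trans (_ : \sum_c (E + (bad c)%:R * ln M) <= _).
    apply: ler_sum => c _; case: (boolP (bad c)) => bc.
      by rewrite mul1r; apply: le_trans (nogood c) _; rewrite lerDr.
    by rewrite mul0r addr0; exact: good.
  rewrite big_split/= sumr_const card_ord -mulr_suml; apply: lerD; first by rewrite mulr_natl.
  apply: ler_wpM2r => //; rewrite -natrM.
  have -> : \sum_c (bad c)%:R = #|[set c | bad c]%SET|%:R :> R.
    rewrite -sum1_card natr_sum [RHS]big_mkcond/=; apply: eq_bigr => c _.
    by rewrite inE; case: (bad c).
  by rewrite ler_nat.
have Kp := Fs_gt0R hF m; rewrite -/K in Kp.
have h4 : (size S)%:R * #|` bdl mul S K|%:R * ln M <= e / 2 * #|` K|%:R.
  have := ler_wpM2r (ltW l0) hm; rewrite mulrAC divfK ?gt_eqF// => h.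
  apply: le_trans h; rewrite mulrAC mulrC; apply: ler_wpM2l => //.
  by rewrite /l lerDl.
nra.
Qed.
End NameCount.

(** * Random cells and quasi-tilings *)

Section Bernoulli.
Context {R : realType} (I : finType) (p : R).
Hypotheses (p0 : 0 <= p) (p1 : p <= 1).

Definition bwt (o : {ffun I -> bool}) : R := \prod_i (if o i then p else 1 - p).

Lemma bwt_ge0 o : 0 <= bwt o.
Proof. by apply: prodr_ge0 => i _; case: ifP => _ //; rewrite subr_ge0. Qed.

Lemma bern_prod (f : I -> bool -> R) :
  \sum_o bwt o * \prod_i f i (o i) = \prod_i (p * f i true + (1 - p) * f i false).
Proof.
rewrite (eq_bigr (fun i => \sum_(b : bool) (if b then p else 1 - p) * f i b)); last first.
  by move=> i _; rewrite big_bool.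
rewrite bigA_distr_bigA/=; apply: eq_bigr => o _.
by rewrite /bwt -big_split.
Qed.

Lemma bern1 : \sum_o bwt o = 1.
Proof.
transitivity (\sum_o bwt o * \prod_(i : I) (fun _ _ => 1 : R) i (o i)).
  by apply: eq_bigr => o _; rewrite big1 ?mulr1.
by rewrite (bern_prod (fun _ _ => 1)) big1// => i _; rewrite !mulr1 addrC subrK.
Qed.

Lemma bern_exists (Q : {ffun I -> bool} -> R) c : \sum_o bwt o * Q o <= c ->
  exists o, Q o <= c.
Proof.
move=> h; apply: contrapT => /forallNP n.
have {}n o : c < Q o by rewrite ltNge; apply/negP; exact: n.
have : \sum_o bwt o * (Q o - c) <= 0.
  under eq_bigr do rewrite mulrBr.
  by rewrite sumrB -mulr_suml bern1 mul1r subr_le0.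
have h0 o : true -> 0 <= bwt o * (Q o - c) by move=> _; rewrite mulr_ge0 ?bwt_ge0// subr_ge0 ltW.
have s0 : 0 <= \sum_o bwt o * (Q o - c) by exact: sumr_ge0.
move=> sle; have : \sum_o bwt o * (Q o - c) == 0 by rewrite eq_le sle s0.
rewrite psumr_eq0// => /allP hz.
have : \sum_o bwt o = 0.
  apply: big1 => o _; have /= := hz o (mem_index_enum _).
  rewrite mulf_eq0 => /orP[/eqP//|]; have := n o; rewrite -subr_gt0 => /gt_eqF ->.
  by [].
by rewrite bern1 => /eqP; rewrite oner_eq0.
Qed.

Definition bnone (J : {set I}) (o : {ffun I -> bool}) : bool := [forall i in J, ~~ o i].

Lemma bnoneE J o : (bnone J o)%:R = \prod_i (if i \in J then (~~ o i)%:R else 1) :> R.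
Proof.
rewrite /bnone; case: (boolP [forall i in J, ~~ o i]) => [/forall_inP h|].
  by rewrite big1// => i _; case: ifP => // /h ->.
rewrite negb_forall => /existsP[i]; rewrite negb_imply negbK => /andP[iJ oi].
by rewrite (bigD1 i)//= iJ oi mul0r.
Qed.

Lemma bern_none J : \sum_o bwt o * (bnone J o)%:R = (1 - p) ^+ #|J|.
Proof.
under eq_bigr do rewrite bnoneE.
rewrite (bern_prod (fun i b => if i \in J then (~~ b)%:R else 1)).
rewrite (eq_bigr (fun i => if i \in J then 1 - p else 1)).
  by rewrite -big_mkcond/= prodr_const.
by move=> i _ /=; case: ifP => _; rewrite /= ?mulr0 ?mulr1 ?add0r// addrC subrK.
Qed.

Lemma bern_in i : \sum_o bwt o * (o i)%:R = p.
Proof.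
have := bern_none [set i]%SET; rewrite cards1 expr1 => h.
transitivity (\sum_o bwt o - \sum_o bwt o * (bnone [set i]%SET o)%:R); last first.
  by rewrite h bern1 opprB addrC subrK.
rewrite -sumrB; apply: eq_bigr => o _.
have -> : bnone [set i]%SET o = ~~ o i.
  apply/forall_inP/idP => [h'|oi j]; first by apply: h'; rewrite finset.in_set1.
  by rewrite finset.in_set1 => /eqP ->.
by case: (o i) => /=; rewrite ?mulr0 ?mulr1 ?subr0 ?subrr.
Qed.

Lemma bern_none2 (J : {set I}) i j : i != j -> i \notin J -> j \notin J ->
  \sum_o bwt o * (bnone J o && (o i && o j))%:R = (1 - p) ^+ #|J| * p ^+ 2.
Proof.
move=> ij iJ jJ.
pose f k (b : bool) : R := if k \in J then (~~ b)%:R else if (k == i) || (k == j) then b%:R else 1.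
rewrite (eq_bigr (fun o => bwt o * \prod_k f k (o k))); last first.
  move=> o _; congr (_ * _); rewrite andbC; case: (boolP (o i)) => oi /=; last first.
    by rewrite (bigD1 i)//= /f (negbTE iJ) eqxx (negbTE oi) mul0r.
  case: (boolP (o j)) => oj /=; last first.
    by rewrite (bigD1 j)//= /f (negbTE jJ) eqxx orbT (negbTE oj) mul0r.
  rewrite bnoneE; apply: eq_bigr => k _; rewrite /f; case: ifP => // _.
  by case: ifP => // /orP[/eqP ->|/eqP ->]; rewrite ?oi ?oj.
rewrite bern_prod (bigID (fun k => k \in J))/=; congr (_ * _).
  rewrite (eq_bigr (fun=> 1 - p)) ?prodr_const// => k kJ.
  by rewrite /f kJ /= mulr0 add0r mulr1.
rewrite (bigD1 i)//= (bigD1 j)/=; last by rewrite jJ eq_sym.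
rewrite /f (negbTE iJ) (negbTE jJ) !eqxx orbT /= !mulr0 !addr0 !mulr1 big1 ?mulr1 ?expr2//.
move=> k /andP[/andP[kJ ki] kj]; rewrite (negbTE kJ) (negbTE ki) (negbTE kj) /=; lra.
Qed.

(** Either no index of [vs] is selected, or the first selected one must have a selected partner,
    which has probability at most [p]. The induction carries the set [J] of indices already known to
    be unselected. *)
Lemma bern_match (vs : seq I) (w : I -> I) : uniq vs -> (forall i, i \in vs -> w i != i) ->
  \sum_o bwt o * (all (fun i => o i ==> o (w i)) vs)%:R <= (1 - p) ^+ size vs + p.
Proof.
move=> uvs wvs.
suff : forall J : {set I}, (forall i, i \in vs -> i \notin J) ->
  \sum_o bwt o * (bnone J o && all (fun i => o i ==> o (w i)) vs)%:R <=
     (1 - p) ^+ #|J| * ((1 - p) ^+ size vs + p).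
  move=> /(_ finset.set0); rewrite cards0 expr0 mul1r.
  move=> h; apply: le_trans (h _); last by move=> i _; rewrite finset.in_set0.
  apply: ler_sum => o _; rewrite ler_wpM2l ?bwt_ge0//.
  suff -> : bnone finset.set0 o by [].
  by apply/forall_inP => i; rewrite finset.in_set0.
have q0 n : 0 <= (1 - p) ^+ n by rewrite exprn_ge0// subr_ge0.
elim: vs uvs wvs => [_ _|v vs ih /= /andP[vvs uvs] wvs] J vJ.
  under eq_bigr do rewrite andbT.
  by rewrite bern_none expr0 ler_peMr// lerDl.
have vnJ : v \notin J by apply: vJ; exact: mem_head.
(* If [v] is not selected it joins [J]; if it is, its partner must be selected too, at the price
   [p ^+ 2]. The two bounds add up exactly to the claimed one. *)
apply: le_trans (_ : \sum_o (bwt o * (bnone (v |: J)%SET o && all (fun i => o i ==> o (w i)) vs)%:R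
   + bwt o * (bnone J o && (o v && o (w v)))%:R) <= _).
  apply: ler_sum => o _; rewrite -mulrDr; apply: ler_wpM2l; first exact: bwt_ge0.
  have -> : bnone (v |: J)%SET o = ~~ o v && bnone J o.
    apply/forall_inP/andP => [h|[ov /forall_inP h] i].
      by split; [|apply/forall_inP => i iJ]; apply: h; rewrite !finset.inE ?eqxx ?iJ ?orbT.
    by rewrite !finset.inE => /predU1P[->//|]; exact: h.
  by case: (bnone J o); case: (o v); case: (o (w v)); case: all; rewrite /= ?addr0 ?add0r.
rewrite big_split/=.
have h1 : \sum_o bwt o * (bnone (v |: J)%SET o && all (fun i => o i ==> o (w i)) vs)%:R <=
    (1 - p) ^+ #|J|.+1 * ((1 - p) ^+ size vs + p).
  have <- : #|(v |: J)%SET| = #|J|.+1 by rewrite cardsU1 vnJ.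
  apply: ih => // [i ivs|i ivs]; first by apply: wvs; rewrite inE ivs orbT.
  rewrite !finset.inE negb_or; apply/andP; split; last by apply: vJ; rewrite inE ivs orbT.
  by apply: contraNneq vvs => <-.
have h2 : \sum_o bwt o * (bnone J o && (o v && o (w v)))%:R <= (1 - p) ^+ #|J| * p ^+ 2.
  case: (boolP (w v \in J)) => wJ.
    rewrite big1 ?mulr_ge0// ?sqr_ge0// => o _.
    case: (boolP (bnone J o)) => [/forall_inP/(_ _ wJ)/negbTE ->|]; last by rewrite mulr0.
    by rewrite andbF mulr0.
  by rewrite bern_none2// eq_sym; apply: wvs; exact: mem_head.
have := q0 #|J|; have := q0 (size vs).
move: h1 h2; rewrite !exprS; set a := (1 - p) ^+ size vs; set b := (1 - p) ^+ #|J|.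
rewrite expr0 mulr1.
nra.
Qed.
End Bernoulli.

Section FProb2.
Context {R : realType} {dX : measure_display} {X : measurableType dX}.
Variables (pr : set X -> R) (Ppr : fprob pr).

Lemma pr_lawE (T : finType) (f : X -> T) (Q : pred T) : mfin f ->
  pr [set x | Q (f x)] = \sum_t plaw pr f t * (Q t)%:R.
Proof.
move=> mf; rewrite (pr_law Ppr)// big_mkcond/=; apply: eq_bigr => t _.
by case: ifP => _; rewrite ?mulr1 ?mulr0.
Qed.

Lemma plaw_gt0 (T : finType) (f : X -> T) t : 0 < plaw pr f t -> exists x, f x = t.
Proof.
move=> u0; apply: contrapT => nx; move: u0; rewrite /plaw (_ : mkset _ = set0) ?(pr0 Ppr) ?ltxx//.
by apply/seteqP; split => // x xu; apply: nx; exists x.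
Qed.

Lemma bern_pr (I : finType) (p : R) (T : finType) (f : X -> T)
   (Q : {ffun I -> bool} -> pred T) (b : T -> R) : 0 <= p -> p <= 1 -> mfin f ->
  (forall x, \sum_o bwt p o * (Q o (f x))%:R <= b (f x)) ->
  \sum_o bwt p o * pr [set x | Q o (f x)] <= \sum_t plaw pr f t * b t.
Proof.
move=> p0 p1 mf h.
under eq_bigr do rewrite (pr_lawE _ mf) mulr_sumr.
rewrite exchange_big/=; apply: ler_sum => t _.
have := law_ge0 Ppr t mf; rewrite le_eqVlt => /predU1P[<-|t0].
  by rewrite mul0r big1// => o _; rewrite mul0r mulr0.
have [x xt] := plaw_gt0 t0.
under eq_bigr do rewrite mulrCA.
by rewrite -mulr_sumr ler_pM2l// -xt.
Qed.

Lemma sum_law_le (T : finType) (f : X -> T) (b c : T -> R) : mfin f ->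
  (forall x, b (f x) <= c (f x)) ->
  \sum_t plaw pr f t * b t <= \sum_t plaw pr f t * c t.
Proof.
move=> mf h; apply: ler_sum => t _.
have := law_ge0 Ppr t mf; rewrite le_eqVlt => /predU1P[<-|t0]; first by rewrite !mul0r.
by have [x <-] := plaw_gt0 t0; rewrite ler_wpM2l// (law_ge0 Ppr).
Qed.

Lemma H_set (A : set X) : measurable A ->
  ent pr (fun x => `[< A x >]) <= 4 * Num.sqrt (pr A).
Proof.
move=> mA; rewrite /ent big_bool /=.
have e1 : plaw pr (fun x => `[< A x >]) true = pr A.
  by rewrite /plaw; congr pr; apply/seteqP; split => x /= /asboolP.
have e2 : plaw pr (fun x => `[< A x >]) false = 1 - pr A.
  rewrite -(prC Ppr)// /plaw; congr pr; apply/seteqP; split => x /=.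
    by move/negbT/asboolPn.
  by move=> nA; apply/negbTE/asboolPn.
rewrite e1 e2; have a0 := pr_ge0 Ppr mA; have a1 := pr_le1 Ppr mA.
have := phi_sqrt a0.
have : `|phi (1 - pr A) - phi 1| <= 2 * Num.sqrt `|1 - pr A - 1| by apply: phi_dist; lra.
rewrite phi1 subr0 (_ : 1 - pr A - 1 = - pr A); last by lra.
rewrite [X in Num.sqrt X]normrN (ger0_norm a0).
by rewrite ler_norml => /andP[_]; lra.
Qed.
End FProb2.

(** * Stabilisers, and one random layer of tiles *)

Section Stage.
Context {R : realType} {G : countType} (mul : G -> G -> G) (one : G) (inv : G -> G)
  (Fs : nat -> {fset G}) {dX : measure_display} {X : measurableType dX} (act : G -> X -> X).
Hypothesis Sy : sys (R := R) mul one inv Fs act.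
Let mact := sys_mact Sy. Let actM := sysM Sy.
Let mfix := sys_fix Sy.
Variables (pr : set X -> R) (Ip : iprob act pr).
Let Ppr := proj1 Ip. Let ip := proj2 Ip.
Local Notation H := (ent pr).
Local Notation nm := (nm act).
Local Notation hent := (hent act pr).

(** Replaces freeness: off a small set, one finite family of cells tells apart all distinct points
    of a finite orbit segment, so that random choices of cells are independent there. *)
Definition separating : Prop := forall (T : seq G) (e : R), 0 < e ->
  exists (I : finType) (cell : X -> I) (Bad : set X),
  [/\ mfin cell, measurable Bad, pr Bad <= e & forall x, ~ Bad x ->
    forall g h, g \in T -> h \in T -> act g x <> act h x ->
      cell (act g x) != cell (act h x)].

(** Infinite orbits in a form suited to finite windows: one list [T] serves all points off [Bad]. *)
Definition infinite_orbits : Prop := forall (n : nat) (e : R), 0 < e ->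
  exists (T : seq G) (Bad : set X), [/\ measurable Bad, pr Bad <= e &
    forall x, ~ Bad x -> exists t : seq G, [/\ size t = n, {subset t <= T} &
      {in t &, injective (act^~ x)} /\ uniq t]].

(** Mark each cell with a small probability [p]; the marking has small entropy. If [s] fixes [x],
    the marks at [g x] and [g s x] agree for all [g]; otherwise [n] distinct points [g x] very
    likely show a mismatch, by [bern_match]. So a window of a map of small entropy nearly determines
    whether [s] fixes [x]. *)
Lemma stab1_hent0 (s : G) : separating -> infinite_orbits ->
  hent (fun x => `[< act s x = x >]) <= 0.
Proof.
move=> sepH infH; set D := fun x => _.
have mD : mfin D by apply: mfin_set; exact: mfix.
apply/ler_addgt0Pr => e e0; rewrite add0r.
(* Two entropies, each at most [4 * Num.sqrt q], make up the final bound [e]. *)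
pose q := Num.min 1 ((e / 8) ^+ 2).
have q0 : 0 < q by rewrite lt_min ltr01 exprn_gt0// divr_gt0.
have q8 : 8 * Num.sqrt q <= e.
  have : Num.sqrt q <= Num.sqrt ((e / 8) ^+ 2).
    by apply: ler_wsqrtr; rewrite ge_min lexx orbT.
  by rewrite sqrtr_sqr gtr0_norm ?divr_gt0//; lra.
have q1 : q <= 1 by rewrite ge_min lexx.
pose p := q / 8.
have p0 : 0 < p by rewrite divr_gt0.
have p1 : p <= 1 by rewrite /p; lra.
have [n hn] : exists n, (1 - p) ^+ n <= q / 8.
  have /cvgrPdist_le /(_ (q / 8)) : (1 - p) ^+ n @[n --> \oo] --> (0 : R).
    by apply: cvg_expr; rewrite ger0_norm; lra.
  rewrite divr_gt0// => /(_ isT)[n _ /(_ n (leqnn n)) /=].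
  rewrite sub0r normrN ger0_norm; first by exists n.
  by rewrite exprn_ge0// subr_ge0.
have [T [Bad1 [mB1 B1 hT]]] := infH n (q / 8) (divr_gt0 q0 (ltr0Sn _ 7)).
pose TT := T ++ [seq mul g s | g <- T].
have [I [cell [Bad2 [mc mB2 B2 hc]]]] := sepH TT (q / 8) (divr_gt0 q0 (ltr0Sn _ 7)).
pose good x := `[< (~` Bad1 `&` (~` Bad2 `&` ~` [set x | act s x = x])) x >].
have mgood : mfin good.
  by apply: mfin_set; apply: measurableI; [exact: measurableC|apply: measurableI; exact: measurableC].
pose tt (i : 'I_(size T)) := tnth (in_tuple T) i.
pose pat x : {ffun 'I_(size T) -> I * I} :=
  [ffun i => (cell (act (tt i) x), cell (act (tt i) (act s x)))].
have mpat : mfin pat.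
  apply: mfin_ffun => i; apply: mfin_pair; first exact: (mfin_act mact).
  exact: (mfin_act mact s (mfin_act mact (tt i) mc)).
pose f x := (pat x, good x).
have mf : mfin f by exact: mfin_pair.
pose Q (o : {ffun I -> bool}) (u : {ffun 'I_(size T) -> I * I} * bool) :=
  u.2 && [forall i, o (u.1 i).1 ==> o (u.1 i).2].
pose La (o : {ffun I -> bool}) := [set x | o (cell x)].
have h1 : \sum_o bwt p o * pr (La o) <= \sum_i plaw pr cell i * p.
  apply: (bern_pr Ppr (Q := fun o i => o i)) => //; first exact: ltW.
  by move=> x; rewrite bern_in// ltW.
rewrite -mulr_suml (sum_law Ppr)// mul1r in h1.
have h2 : \sum_o bwt p o * pr [set x | Q o (f x)] <= \sum_t plaw pr f t * (q / 8 + p).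
  apply: (bern_pr Ppr) => //; first exact: ltW.
  move=> x; case: (boolP (good x)) => gx; last first.
    rewrite big1 ?addr_ge0 ?divr_ge0 ?ltW// => o _.
    by rewrite /Q /f /= (negbTE gx) mulr0.
  have /asboolP[nB1 [nB2 sx]] := gx.
  have [t [st tT [it ut]]] := hT x nB1.
  pose vs := [seq cell (act g x) | g <- t].
  have cinj g h : g \in TT -> h \in TT -> cell (act g x) = cell (act h x) -> act g x = act h x.
    move=> gT hT' e1; apply: contrapT => ne; have := hc x nB2 g h gT hT' ne.
    by rewrite e1 eqxx.
  have tTT g : g \in t -> g \in TT by move=> /tT gT; rewrite mem_cat gT.
  have uvs : uniq vs.
    rewrite map_inj_in_uniq// => g h gt ht /(cinj _ _ (tTT _ gt) (tTT _ ht)).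
    exact: it.
  (* The partner of the cell of [g x] is the cell of [g s x]; this is well defined because [cell]
     separates the points in play. *)
  pose w (i : I) := if pselect (exists2 g, g \in t & cell (act g x) = i) is left ex
    then cell (act (projT1 (cid2 ex)) (act s x)) else i.
  have wE g : g \in t -> w (cell (act g x)) = cell (act g (act s x)).
    move=> gt; rewrite /w; case: pselect => [ex|[]]; last by exists g.
    case: cid2 => h /= ht /(cinj _ _ (tTT _ ht) (tTT _ gt)) hg.
    by rewrite (it h g ht gt hg).
  apply: le_trans (_ : (1 - p) ^+ size vs + p <= _); last first.
    by rewrite size_map st lerD2r.
  apply: le_trans (bern_match (w := w) (ltW p0) p1 uvs _).
    apply: ler_sum => o _; apply: ler_wpM2l; first exact: (bwt_ge0 (ltW p0) p1).
    rewrite ler_nat /Q /f /= gx /=; case: (boolP [forall i, _]) => // /forallP h.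
    rewrite lt0b; apply/allP => _ /mapP[g gt ->]; rewrite wE//.
    have /tnthP[i gi] : g \in in_tuple T by exact: tT.
    by have := h i; rewrite /pat ffunE /tt -gi.
  move=> _ /mapP[g gt ->]; rewrite wE// -actM; apply: hc => //.
  - by rewrite mem_cat map_f ?orbT//; exact: tT.
  - exact: tTT.
  - rewrite actM => e1; apply: sx.
    exact: (can_inj (actK Sy g)) e1.
rewrite -mulr_suml (sum_law Ppr)// mul1r in h2.
have [om ho] : exists o, pr (La o) + pr [set x | Q o (f x)] <= p + (q / 8 + p).
  apply: (bern_exists (ltW p0) p1); under eq_bigr do rewrite mulrDr.
  by rewrite big_split/=; exact: lerD.
pose la x := om (cell x).
have mla : mfin la by exact: (mfin_comp om mc).
have mLa : measurable (La om) by exact: (mfin_pred (fun i => om i)).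
have mQ : measurable [set x | Q om (f x)] by exact: (mfin_pred (fun i => Q om i)).
have laE : la = fun x => `[< La om x >] by apply/funext => x; rewrite /la /La /= asboolb.
(* The guess that [s] moves [x]. A fixed point never shows a mismatch, so the guess can fail only at
   moved points that show none. *)
pose gu x := ~~ [forall i : 'I_(size T), la (act (tt i) x) ==> la (act (tt i) (act s x))].
have dgu : dpd (nm la TT) gu.
  apply: dpd_nm => x y h; rewrite /gu; congr (~~ _); apply: eq_forallb => i.
  have iT : tt i \in T by exact: mem_tnth.
  by rewrite h ?mem_cat ?iT// -!actM h// mem_cat map_f// orbT.
have mnl : mfin (nm la TT) by exact: mfin_nm.
have mgu : mfin gu by exact: (mfin_dpd mnl dgu).
pose Err := Bad1 `|` Bad2 `|` [set x | Q om (f x)].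
have mErr : measurable Err by do 2?apply: measurableU.
have mErr' : mfin (fun x => `[< Err x >]) by exact: mfin_set.
have prErr : pr Err <= q / 8 + q / 8 + pr [set x | Q om (f x)].
  apply: le_trans (prU_le Ppr (measurableU _ _ mB1 mB2) mQ) _; rewrite lerD2r.
  by apply: le_trans (prU_le Ppr mB1 mB2) _; exact: lerD.
have b1 : H la <= 4 * Num.sqrt q.
  rewrite laE; apply: le_trans (H_set Ppr mLa) _.
  rewrite ler_pM2l//; apply: ler_wsqrtr.
  by have := pr_ge0 Ppr mQ; move: ho; rewrite /p => *; lra.
have b2 : H (fun x => (D x, nm la TT x)) - H (nm la TT) <= 4 * Num.sqrt q.
  apply: le_trans (H_condmono Ppr mD mnl dgu) _.
  pose W := [set x | D x != ~~ gu x].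
  have mW : measurable W by exact: (mfin_pred (fun u => u.1 != ~~ u.2) (mfin_pair mD mgu)).
  have WE : W `<=` Err.
    move=> x; rewrite /W /=; case gx : (gu x) => /=.
      rewrite eqbF_neg negbK => /asboolP sx; move/negP: gx; case.
      by apply/forallP => i; rewrite sx implybb.
    rewrite eqb_id => /asboolP sx.
    have [?|nB1] := pselect (Bad1 x); first by left; left.
    have [?|nB2] := pselect (Bad2 x); first by left; right.
    right; rewrite /= /Q /f /=; apply/andP; split; first exact/asboolP.
    by apply/forallP => i; rewrite /pat ffunE; move/negbFE/forallP : gx => /(_ i).
  have mW' : mfin (fun x => `[< W x >]) by exact: mfin_set.
  apply: le_trans (_ : H (fun x => `[< W x >]) <= _); last first.
    apply: le_trans (H_set Ppr mW) _.
    rewrite ler_pM2l//; apply: ler_wsqrtr.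
    by have := pr_le Ppr mW mErr WE; have := pr_ge0 Ppr mLa; move: ho prErr; rewrite /p => *; lra.
  have := H_pair Ppr mW' mgu.
  suff : H (fun x => (D x, gu x)) <= H (fun x => (`[< W x >], gu x)) by lra.
  apply: (H_dpd Ppr); first exact: mfin_pair.
  move=> x y [+ gxy]; rewrite gxy => /eqP; rewrite !asboolb => /eqP.
  by rewrite /= gxy; case: (gu y); case: (D x); case: (D y).
have := hent_cond Sy Ip TT mla mD.
have := hent_le_H Sy Ip mla.
lra.
Qed.

(** At a point [x] of [W] outside this set, every [f^-1 x] with [f] in [F] is a possible centre: its
    whole tile lies in [W]. *)
Definition boundary (F : seq G) (W : set X) : set X :=
  [set x | W x /\ exists f f', [/\ f \in F, f' \in F & ~ W (act (mul f' (inv f)) x)]].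

Definition orbit_of (F : seq G) (D : set X) : set X :=
  [set x | exists2 f, f \in F & D (act (inv f) x)].

Lemma measurable_seq_ex (F : seq G) (A : G -> set X) : (forall g, g \in F -> measurable (A g)) ->
  measurable [set x | exists2 f, f \in F & A f x].
Proof.
elim: F => [|g F ih] mA.
  by rewrite (_ : mkset _ = set0)//; apply/seteqP; split => x // [].
rewrite (_ : mkset _ = A g `|` [set x | exists2 f, f \in F & A f x]).
  apply: measurableU; first by apply: mA; exact: mem_head.
  by apply: ih => h hF'; apply: mA; rewrite inE hF' orbT.
apply/seteqP; split => x /=.
  by move=> [f]; rewrite inE => /predU1P[->|fF] ?; [left|right; exists f].
by move=> [?|[f fF ?]]; [exists g; rewrite ?mem_head|exists f; rewrite // inE fF orbT].
Qed.

Lemma measurable_orbit_of F D : measurable D -> measurable (orbit_of F D).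
Proof. by move=> mD; apply: measurable_seq_ex => g _; exact: mact. Qed.

Lemma measurable_boundary F W : measurable W -> measurable (boundary F W).
Proof.
move=> mW; rewrite (_ : boundary F W = W `&`
   [set x | exists2 f, f \in F & exists2 f', f' \in F & (~` (act (mul f' (inv f)) @^-1` W)) x]).
  apply: measurableI => //; apply: measurable_seq_ex => f _.
  by apply: measurable_seq_ex => f' _; apply: measurableC; exact: mact.
apply/seteqP; split => x /= [Wx].
  by move=> [f [f' [fF fF' ?]]]; split => //; exists f => //; exists f'.
by move=> [f fF [f' fF' ?]]; split => //; exists f, f'.
Qed.

Lemma expRN_quad (a : R) : 0 <= a -> expR (- a) <= 1 - a + a ^+ 2.
Proof.
move=> a0; rewrite expRN -div1r ler_pdivrMr ?expR_gt0//.
have h := expR_ge1Dx a.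
have : (1 - a + a ^+ 2) * (1 + a) <= (1 - a + a ^+ 2) * expR a.
  by apply: ler_wpM2l => //; nra.
apply: le_trans; have : 0 <= a ^+ 3 by rewrite exprn_ge0.
by rewrite !exprS expr0; lra.
Qed.

(** One layer of a quasi-tiling: the centres are a random union of small cells,
    kept only where the whole translate of [F] fits inside [W]. *)
Lemma stage (W Y N0 : set X) (F : seq G) (A : nat) (eta p w v tau : R) :
  separating -> measurable W -> measurable Y -> measurable N0 -> pr N0 = 0 ->
  uniq F -> F != [::] -> (0 < A)%N ->
  (forall x, ~ N0 x -> forall z, (count (fun f => `[< act (inv f) x = z >]) F <= A)%N) ->
  0 <= eta -> eta <= 1 -> p = eta * A%:R / (size F)%:R -> p <= 1 ->
  0 <= w -> 0 <= v -> 0 < tau ->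
  exists D, [/\ measurable D, D `<=` Y, (forall f, f \in F -> D `<=` act f @^-1` W) &
    w * pr D + v * pr (W `\` orbit_of F D) <= w * (p * pr W) +
      v * ((1 - eta + eta ^+ 2) * pr W + pr (boundary F W) + eta * pr (~` Y)) + tau].
Proof.
move=> sepH mW mY mN N00 uF F0 A0 hA eta0 eta1 pE p1 w0 v0 tau0.
have sF : 0 < (size F)%:R :> R by rewrite ltr0n lt0n size_eq0.
have A0' : 0 < A%:R :> R by rewrite ltr0n.
have p0 : 0 <= p by rewrite pE divr_ge0 ?mulr_ge0// ltW.
have t'0 : 0 < tau / (v + 1) by rewrite divr_gt0//; lra.
have [I [cell [Bad [mc mBad prBad hc]]]] := sepH [seq inv f | f <- F] _ t'0.
pose ff (i : 'I_(size F)) := tnth (in_tuple F) i.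
have ffF i : ff i \in F by exact: mem_tnth.
have ffinj : injective ff by apply/tuple_uniqP.
(* Admissible centres: the tile fits in [W] and the centre lies in the prescribed set [Y]. *)
pose Good := [set z | forall f, f \in F -> W (act f z)] `&` Y.
have mGood : measurable Good.
  apply: measurableI => //; rewrite (_ : mkset _ =
      ~` [set x | exists2 f, f \in F & (~` (act f @^-1` W)) x]).
    by apply: measurableC; apply: measurable_seq_ex => f _; apply: measurableC; exact: mact.
  apply/seteqP; split => x /= h; first by move=> [f fF]; apply; exact: h.
  by move=> f fF; apply: contrapT => nW; apply: h; exists f.
have prGood : pr Good <= pr W.
  have [f fF] : exists f, f \in F.
    by case: (F) F0 => // f F' _; exists f; exact: mem_head.
  rewrite -(ip f mW); apply: (pr_le Ppr) => //; first exact: mact.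
  by move=> x [+ _]; apply.
pose Dd (o : {ffun I -> bool}) := Good `&` [set z | o (cell z)].
have mDd o : measurable (Dd o).
  by apply: measurableI => //; exact: (mfin_pred (fun i => o i)).
have h1 : \sum_o bwt p o * pr (Dd o) <= p * pr W.
  have mg : mfin (fun x => (cell x, `[< Good x >])) by apply: mfin_pair => //; exact: mfin_set.
  have := bern_pr Ppr (Q := fun o u => u.2 && o u.1) (b := fun u => u.2%:R * p) p0 p1 mg.
  have -> : \sum_t plaw pr (fun x => (cell x, `[< Good x >])) t * (t.2%:R * p) = pr Good * p.
    under eq_bigr do rewrite mulrA.
    rewrite -mulr_suml; congr (_ * _).
    rewrite -(pr_lawE Ppr (fun u : I * bool => u.2) mg); congr pr.
    by apply/seteqP; split => x /= /asboolP.
  move=> h; apply: le_trans (_ : pr Good * p <= _); last first.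
    by rewrite mulrC ler_wpM2l.
  apply: le_trans (h _).
    apply: ler_sum => o _; apply: ler_wpM2l; first exact: bwt_ge0.
    rewrite le_eqVlt; apply/orP; left; apply/eqP; congr pr.
    by apply/seteqP; split => x /=; [move=> [/asboolP -> ->]|move=> /andP[/asboolP]].
  move=> x /=; case: asboolP => _ /=; last by rewrite mul0r big1// => o _; rewrite mulr0.
  by rewrite mul1r bern_in.
pose Core := W `\` (boundary F W `|` Bad `|` N0).
have mB := measurable_boundary F mW.
have mCore : measurable Core by apply: measurableD => //; do 2?apply: measurableU.
(* The cells that cover [x] when marked. At points of [Core] distinct candidate centres lie in
   distinct cells, and every candidate in [Y] is admissible. *)
pose J x : {set I} := [set cell (act (inv (ff i)) x) | i in [set i | `[< Y (act (inv (ff i)) x) >]]]%SET.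
pose y x : {ffun 'I_(size F) -> bool} := [ffun i => `[< Y (act (inv (ff i)) x) >]].
pose cc x : {ffun 'I_(size F) -> I} := [ffun i => cell (act (inv (ff i)) x)].
have mcc : mfin cc by apply: mfin_ffun => i; exact: (mfin_act mact).
have my : mfin y by apply: mfin_ffun => i; apply: mfin_set; exact: mact.
pose f x := (cc x, (y x, `[< Core x >])).
have mf : mfin f by apply: mfin_pair => //; apply: mfin_pair => //; exact: mfin_set.
pose Q (o : {ffun I -> bool}) (u : {ffun 'I_(size F) -> I} * ({ffun 'I_(size F) -> bool} * bool)) :=
  u.2.2 && [forall i, u.2.1 i ==> ~~ o (u.1 i)].
pose n0 (u : {ffun 'I_(size F) -> bool}) : R := \sum_i (u i)%:R.
have QJ x o : Q o (f x) = `[< Core x >] && bnone (J x) o.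
  rewrite /Q /f /=; congr (_ && _); apply/forallP/forall_inP => h.
    move=> j /imsetP[i]; rewrite finset.in_set => yi ->.
    by have := h i; rewrite !ffunE yi.
  move=> i; apply/implyP; rewrite !ffunE => yi; apply: h.
  by apply/imsetP; exists i; rewrite ?finset.in_set.
have n0_ge0 u : 0 <= n0 u by apply: sumr_ge0.
have n0_le u : n0 u <= (size F)%:R.
  apply: le_trans (_ : \sum_(i < size F) 1 <= _); last by rewrite sumr_const card_ord.
  by apply: ler_sum => i _; rewrite lern1 leq_b1.
have n0J x : Core x -> n0 (y x) <= A%:R * #|J x|%:R.
  move=> [Wx]; rewrite !not_orP => -[[_ nBad] nN].
  rewrite /n0 (eq_bigr (fun i => (i \in [set i | `[< Y (act (inv (ff i)) x) >]]%SET)%:R)); last first.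
    by move=> i _; rewrite ffunE finset.in_set.
  rewrite -natr_sum -natrM ler_nat -big_mkcond /=.
  set S := [set i | _]%SET; rewrite (partition_big (fun i => cell (act (inv (ff i)) x)) (mem (J x)))/=; last first.
    by move=> i iS; apply: imset_f.
  apply: leq_trans (_ : \sum_(j in J x) A <= _)%N; last by rewrite sum_nat_const mulnC.
  apply: leq_sum => j /imsetP[i0 i0S ->].
  apply: leq_trans (hA x nN (act (inv (ff i0)) x)).
  have FE : F = [seq ff i | i <- enum 'I_(size F)] := esym (map_tnth_enum (in_tuple F)).
  rewrite [X in count _ X]FE count_map -size_filter sum1dep_card cardE.
  apply: uniq_leq_size; first exact: enum_uniq.
  move=> i; rewrite mem_enum finset.in_set mem_filter mem_enum /= andbT => /andP[iS /eqP ec].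
  apply/asboolP; apply: contrapT => ne.
  by have := hc x nBad (inv (ff i)) (inv (ff i0)) (map_f _ (ffF i)) (map_f _ (ffF i0)) ne; rewrite ec eqxx.
(* The probability [(1 - p) ^+ m] of staying uncovered is at most [expR (- a)] with [a <= eta], and
   then at most an expression affine in [n0], which can be integrated. *)
have bJ x : \sum_o bwt p o * (Q o (f x))%:R <=
   (f x).2.2%:R * (1 + eta ^+ 2 - eta / (size F)%:R * n0 (f x).2.1).
  case: (boolP (f x).2.2) => /= Cx; last first.
    by rewrite mul0r big1// => o _; rewrite QJ (negbTE Cx) mulr0.
  rewrite mul1r; under eq_bigr do rewrite QJ Cx /=.
  rewrite bern_none; set m := #|J x|.
  have e1 : (1 - p) ^+ m <= expR (- (p * m%:R)).
    rewrite -mulNr expRM_natr lerXn2r ?nnegrE ?subr_ge0 ?expR_ge0//.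
    exact: expR_ge1Dx.
  apply: le_trans e1 _.
  set a := eta / (size F)%:R * n0 (y x).
  have a0 : 0 <= a by rewrite mulr_ge0 ?divr_ge0 ?(ltW sF).
  have ap : a <= p * m%:R.
    have -> : p * m%:R = eta / (size F)%:R * (A%:R * m%:R).
      by rewrite pE -!mulrA; congr (_ * _); rewrite mulrCA.
    by apply: ler_wpM2l; [rewrite divr_ge0// ltW|apply: n0J; exact/asboolP].
  apply: le_trans (_ : expR (- a) <= _); first by rewrite ler_expR lerN2.
  apply: le_trans (expRN_quad a0) _.
  have ae : a <= eta.
    by rewrite /a mulrAC ler_pdivrMr// ler_wpM2l.
  have : a ^+ 2 <= eta ^+ 2 by rewrite lerXn2r ?nnegrE.
  by rewrite /=; lra.
have h2 := bern_pr Ppr (Q := Q)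
  (b := fun u => u.2.2%:R * (1 + eta ^+ 2 - eta / (size F)%:R * n0 u.2.1)) p0 p1 mf bJ.
have mYC : measurable (~` Y) by exact: measurableC.
have h3 : \sum_t plaw pr f t * (t.2.2%:R * (1 + eta ^+ 2 - eta / (size F)%:R * n0 t.2.1)) <=
   (1 - eta + eta ^+ 2) * pr W + eta * pr (~` Y).
  have pC : \sum_t plaw pr f t * (t.2.2)%:R = pr Core.
    rewrite -(pr_lawE Ppr (fun u => u.2.2) mf); congr pr.
    by apply/seteqP; split => x /asboolP.
  have e1 : \sum_t plaw pr f t * (t.2.2%:R * n0 t.2.1) =
      \sum_(i < size F) pr (Core `&` act (inv (ff i)) @^-1` Y).
    rewrite [RHS](eq_bigr (fun i => \sum_t plaw pr f t * (t.2.2 && t.2.1 i)%:R)); last first.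
      move=> i _; rewrite -(pr_lawE Ppr (fun u : {ffun 'I_(size F) -> I} * ({ffun 'I_(size F) -> bool} * bool) => u.2.2 && u.2.1 i) mf); congr pr.
      apply/seteqP; split => x /=; rewrite /y ?ffunE.
        by move=> [? ?]; apply/andP; split; exact/asboolP.
      by move=> /andP[/asboolP ? /asboolP].
    rewrite exchange_big/=; apply: eq_bigr => t _; rewrite mulr_sumr mulr_sumr.
    by apply: eq_bigr => i _; congr (_ * _); rewrite -natrM mulnb.
  (* By invariance, each [f^-1 x] falls outside [Y] with exactly the probability of the complement
     of [Y]. *)
  have e2 : (size F)%:R * (pr Core - pr (~` Y)) <=
      \sum_(i < size F) pr (Core `&` act (inv (ff i)) @^-1` Y).
    have -> : (size F)%:R * (pr Core - pr (~` Y)) = \sum_(i < size F) (pr Core - pr (~` Y)).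
      by rewrite sumr_const card_ord mulr_natl.
    apply: ler_sum => i _; have mYi := mact (inv (ff i)) mY.
    rewrite -(ip (inv (ff i)) mYC) -preimage_setC.
    have := prD Ppr mCore mYi.
    have : pr (Core `\` act (inv (ff i)) @^-1` Y) <= pr (~` (act (inv (ff i)) @^-1` Y)).
      by apply: (pr_le Ppr); [exact: measurableD|exact: measurableC|move=> x []].
    by lra.
  have prCW : pr Core <= pr W by apply: (pr_le Ppr) => // x [].
  have -> : \sum_t plaw pr f t * (t.2.2%:R * (1 + eta ^+ 2 - eta / (size F)%:R * n0 t.2.1)) =
     (1 + eta ^+ 2) * pr Core - eta / (size F)%:R *
        \sum_(i < size F) pr (Core `&` act (inv (ff i)) @^-1` Y).
    rewrite -pC -e1 !mulr_sumr -sumrB; apply: eq_bigr => t _; ring.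
  have := ler_wpM2l (divr_ge0 eta0 (ltW sF)) e2; rewrite mulrA divfK ?gt_eqF//.
  have : (1 - eta + eta ^+ 2) * pr Core <= (1 - eta + eta ^+ 2) * pr W.
    by apply: ler_wpM2l => //; nra.
  by lra.
(* Both expectations enter with nonnegative weights [w] and [v], so a single marking [om] controls
   the mass of the centres and the uncovered mass together. *)
have [om ho] : exists o, w * pr (Dd o) + v * pr [set x | Q o (f x)] <=
    w * (p * pr W) + v * ((1 - eta + eta ^+ 2) * pr W + eta * pr (~` Y)).
  apply: (bern_exists p0 p1); under eq_bigr do rewrite mulrDr mulrCA (mulrCA _ v).
  rewrite big_split/= -!mulr_sumr; apply: lerD; apply: ler_wpM2l => //.
  exact: le_trans h2 h3.
exists (Dd om); split => //; first by move=> x [[]].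
  by move=> g gF x [[h _] _]; exact: h.
have mQ : measurable [set x | Q om (f x)] by exact: (mfin_pred (fun i => Q om i)).
have mO := measurable_orbit_of F (mDd om).
have : pr (W `\` orbit_of F (Dd om)) <= pr (boundary F W `|` Bad `|` N0 `|` [set x | Q om (f x)]).
  apply: (pr_le Ppr); [exact: measurableD|by do 3?apply: measurableU|].
  move=> x [Wx nO].
  have [?|nB] := pselect (boundary F W x); first by left; left; left.
  have [?|nBad] := pselect (Bad x); first by left; left; right.
  have [?|nN] := pselect (N0 x); first by left; right.
  right; rewrite /= QJ; apply/andP; split.
    by apply/asboolP; split => // -[[]|].
  apply/forall_inP => j /imsetP[i]; rewrite finset.in_set => /asboolP Yi ->.
  apply/negP => oi; apply: nO; exists (ff i) => //; split => //; split => // g gF.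
  apply: contrapT => nW; apply: nB; split => //; exists (ff i), g; split => //.
  by rewrite actM.
have mU1 : measurable (boundary F W `|` Bad) by exact: measurableU.
have mU2 : measurable (boundary F W `|` Bad `|` N0) by exact: measurableU.
have := prU_le Ppr mU2 mQ; have := prU_le Ppr mU1 mN; have := prU_le Ppr mB mBad.
rewrite N00 => u1 u2 u3 u4.
have vb : v * pr Bad <= tau.
  have : v * pr Bad <= v * (tau / (v + 1)) by exact: ler_wpM2l.
  move/le_trans; apply; rewrite mulrCA ler_piMr ?(ltW tau0)//.
  by rewrite ler_pdivrMr; lra.
have : v * pr (W `\` orbit_of F (Dd om)) <= v * (pr (boundary F W) + pr Bad + pr [set x | Q om (f x)]).
  by apply: ler_wpM2l => //; lra.
lra.
Qed.
End Stage.
(** The bookkeeping of one step of [code_iter], with masses and costs replaced by letters so that it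
    becomes linear in its products. *)
Lemma code_arith (K : realFieldType) (sg v eta a p k m0 m1 m2 m3 r0 r1 r2 r3 e b b0 : K) :
  0 < sg ->
  m0 - m3 + m1 + v * r0 <=
    m2 + v * ((1 - eta + eta ^+ 2) * r1 + r3 + eta * r2) + sg / 4 ->
  m2 <= eta * (a + sg) * r1 -> v * (eta * r2) <= sg / 4 -> b0 <= b + m1 ->
  e <= - m3 + 2 * p -> p <= sg / 8 ->
  v * r0 + b0 + sg * k + e + m0 <=
  (eta * (a + sg) + v * (1 - eta + eta ^+ 2)) * r1 + (v * r3 + b) + sg * (k + 1).
Proof. by move=> *; lra. Qed.

(** * Codes built from successive layers of tiles *)

Section Coding.
Context {R : realType} {G : countType} (mul : G -> G -> G) (one : G) (inv : G -> G)
  (Fs : nat -> {fset G}) {dX : measure_display} {X : measurableType dX} (act : G -> X -> X).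
Hypothesis Sy : sys (R := R) mul one inv Fs act.
Let mact := sys_mact Sy. Let actM := sysM Sy.
Let act1 := sys1 Sy. Let mfix := sys_fix Sy.
Variables (pr : set X -> R) (Ip : iprob act pr).
Let Ppr := proj1 Ip. Let ip := proj2 Ip.
Local Notation H := (ent pr).
Local Notation nm := (nm act).
Local Notation hent := (hent act pr).
Local Notation boundary := (boundary mul inv act).
Local Notation orbit_of := (orbit_of inv act).

(** Subadditivity reduces this to one element at a time, which is [stab1_hent0]. *)
Lemma stab_hent0 (S : seq G) : separating act pr -> infinite_orbits act pr ->
  hent (stab act S) <= 0.
Proof.
move=> sepH infH.
have h (T : seq G) : exists2 f : X -> {ffun 'I_(size T) -> bool}, mfin f /\
    (forall i x, f x i = `[< act (tnth (in_tuple T) i) x = x >]) & hent f <= 0.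
  elim: T => [|s T [f [mf fE] hf]].
    exists (stab act [::]); first by split; [exact: (mfin_stab Sy)|case].
    have h0 := hent_le_H Sy Ip (mfin_stab Sy (S := [::])); apply: le_trans h0 _.
    rewrite -(@ln1 R); apply: (H_le_ln Ppr) => //; first exact: (mfin_stab Sy).
    by rewrite card_ffun card_ord expn0.
  exists (stab act (s :: T)); first by split; [exact: (mfin_stab Sy)|move=> i x; rewrite ffunE].
  have mD : mfin (fun x => `[< act s x = x >]) by apply: mfin_set; exact: mfix.
  apply: le_trans (_ : hent (fun x => (`[< act s x = x >], f x)) <= _).
    apply: (hent_dpd Sy Ip (s := [:: one])); first exact: mfin_pair.
    apply: dpd_nm => x y /(_ one (mem_head _ _)); rewrite !act1 => -[e1 e2].
    apply/ffunP => i; rewrite !ffunE.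
    case: (unliftP ord0 i) => [j ->|->] //.
    have : f x j = f y j by rewrite e2.
    by rewrite !fE !(tnth_nth one).
  apply: le_trans (hent_pair Sy Ip mD mf) _.
  have := stab1_hent0 Sy Ip s sepH infH; rewrite -/(hent _) => ?; lra.
have [f [mf fE] hf] := h S.
by have -> : stab act S = f by apply/funext => x; apply/ffunP => i; rewrite ffunE fE.
Qed.

Variables (near : X -> X -> Prop) (A : nat).
Hypothesis A0 : (0 < A)%N.

(* On [W] the points are coded at cost [c]: [de] records the centres of the
   tiles, which determine the list [ka x] of the at most [N (ka x)] possible ball
   names [xi x], and finitely many translates of [xi] determine [al x]. *)
Definition code (W : set X) (c : R) : Prop :=
  exists (T1 T0 T U : finType) (de : X -> T1) (ka : X -> T0) (xi : X -> T) (al : X -> U)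
    (V : T0 -> {set T}) (N : T0 -> R) (s : seq G),
  [/\ [/\ mfin de, mfin ka, mfin xi & mfin al],
      dpd (nm (fun x => (`[< W x >], de x)) s) ka,
      [/\ forall x, xi x \in V (ka x), forall k, 1 <= N k & forall k, #|V k|%:R <= N k],
      dpd (nm xi s) al /\ (forall x y, W x -> W y -> al x = al y -> near x y) &
      hent de + A%:R^-1 * (\sum_k plaw pr ka k * ln (N k)) <= c].

(** The code without tiles: on [W] every value of [rho] is allowed, elsewhere only [None]. *)
Lemma code_base (TR : finType) (rho : X -> TR) (W : set X) : measurable W -> mfin rho ->
  (forall x y, rho x = rho y -> near x y) ->
  code W (ln (Num.max 1 #|TR|%:R) * pr W).
Proof.
move=> mW mrho nr; set n := Num.max _ _.
have n1 : 1 <= n by rewrite le_max lexx.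
pose xi x : option TR := if `[< W x >] then Some (rho x) else None.
have mWb : mfin (fun x => `[< W x >]) by exact: mfin_set.
have mxi : mfin xi.
  apply: (mfin_dpd (mfin_pair mWb mrho)) => x y [e1 e2].
  by rewrite /xi e1 e2.
exists unit, bool, (option TR), (option TR), (fun=> tt), (fun x => `[< W x >]), xi, xi,
  (fun b => if b then [set Some t | t in [set: TR]]%SET else [set None]%SET),
  (fun b => if b then n else 1), [:: one]; split.
- by split => //; exact: mfin_tt.
- by apply: dpd_nm => x y /(_ one (mem_head _ _)); rewrite !act1 => -[].
- split=> [x|[]//|[]].
  + by rewrite /xi; case: asboolP => _; [apply/imsetP; exists (rho x)|rewrite finset.in_set1].
  + rewrite card_imset; last by move=> ? ? [].
    by rewrite cardsT le_max lexx orbT.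
  + by rewrite cards1.
- split; first by apply: dpd_nm => x y /(_ one (mem_head _ _)); rewrite !act1.
  move=> x y Wx Wy; rewrite /xi; do 2 case: asboolP => // _.
  by move=> [/nr].
have -> : \sum_k plaw pr (fun x => `[< W x >]) k * ln (if k then n else 1) = pr W * ln n.
  rewrite big_bool /= ln1 mulr0 addr0; congr (_ * _); rewrite /plaw; congr pr.
  by apply/seteqP; split => x /= /asboolP.
have := hent_le_H Sy Ip (@mfin_tt _ X).
have : H (fun _ : X => tt) <= ln 1.
  by apply: (H_le_ln Ppr) => //; [exact: mfin_tt|rewrite card_unit].
rewrite ln1 => h1 h2.
have : A%:R^-1 * (pr W * ln n) <= pr W * ln n.
  rewrite ler_piMl//; first by rewrite mulr_ge0 ?ln_ge0 ?(pr_ge0 Ppr).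
  by rewrite invf_le1 ?ler1n ?ltr0n.
by rewrite (mulrC (ln n)); lra.
Qed.

(** A covered point is coded by the ball index [j] of the centre of its tile, an uncovered one by
    the old code. The indicator of [D] is recorded at its own entropy, while [j] enters the list of
    possible names, where the factor [A^-1] applies. *)
Lemma code_step (W Y D : set X) (F : seq G) (M : nat) (j : X -> 'I_M) (c : R) :
  measurable W -> measurable D -> D `<=` Y -> (forall f, f \in F -> D `<=` act f @^-1` W) ->
  mfin j -> (0 < M)%N ->
  (forall x y, Y x -> Y y -> j x = j y -> forall f, f \in F -> near (act f x) (act f y)) ->
  code (W `\` orbit_of F D) c ->
  code W (c + H (fun x => `[< D x >]) + pr D * (ln M%:R / A%:R)).
Proof.
move=> mW mD DY FD mj M0 nj.
move=> [T1 [T0 [T [U [de [ka [xi [al [V [N [s [[mde mka mxi mal]]]]]]]]]]]]].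
move=> dka [xiV N1 VN] [dal nal] hc.
pose bD x := `[< D x >].
have mbD : mfin bD by exact: mfin_set.
have mWb : mfin (fun x => `[< W x >]) by exact: mfin_set.
pose jD x : option 'I_M := if bD x then Some (j x) else None.
have mjD : mfin jD.
  by apply: (mfin_dpd (mfin_pair mbD mj)) => x y [e1 e2]; rewrite /jD e1 e2.
(* A tile position that covers the point, read from translates of the recorded set [D]. *)
pose fo x : option ('I_(size F)) := [pick i | bD (act (inv (tnth (in_tuple F) i)) x)].
have foP x : if fo x is Some i then D (act (inv (tnth (in_tuple F) i)) x) else ~ orbit_of F D x.
  rewrite /fo; case: pickP => [i /asboolP//|h [f fF Df]].
  have /tnthP[i fi] : f \in in_tuple F by [].
  by have := h i; rewrite -fi => /asboolP.
pose al' x : option ('I_(size F) * 'I_M) * U :=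
  if fo x is Some i then (Some (i, j (act (inv (tnth (in_tuple F) i)) x)), al x) else (None, al x).
(* The identity reads [D], the elements of [s] serve the old code, [f^-1] finds a covering centre,
   and [f^-1 g] decides whether [g x] is still uncovered. *)
pose s' := one :: s ++ [seq inv f | f <- F] ++ [seq mul (inv f) g | f <- F, g <- s].
have s'one : one \in s' by exact: mem_head.
have s's : {subset s <= s'} by move=> g gs; rewrite inE mem_cat gs !orbT.
have s'F f : f \in F -> inv f \in s'.
  by move=> fF; rewrite inE !mem_cat map_f ?orbT.
have s'Fs f g : f \in F -> g \in s -> mul (inv f) g \in s'.
  by move=> fF gs; rewrite inE !mem_cat; apply/orP; right; apply/orP; right; apply/orP; right;
    apply/allpairsP; exists (f, g).
have mal' : dpd (nm (fun x => (jD x, xi x)) s') al'.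
  apply: dpd_nm => x y h.
  have eal : al x = al y by apply: dal; apply/nmP => g gs; have [] := h g (s's _ gs).
  have ejD f : f \in F -> jD (act (inv f) x) = jD (act (inv f) y).
    by move=> fF; have [] := h _ (s'F f fF).
  have eb f : f \in F -> bD (act (inv f) x) = bD (act (inv f) y).
    by move=> /ejD; rewrite /jD; case: ifP; case: ifP.
  have efo : fo x = fo y by apply: eq_pick => i; apply: eb; exact: mem_tnth.
  rewrite /al' eal efo; have := foP x; have := foP y; rewrite efo.
  case: (fo y) => // i Dy Dx; have := ejD _ (mem_tnth i (in_tuple F)).
  by rewrite /jD /bD !asboolT// => -[->].
exists (bool * T1)%type, (bool * T0)%type, (option 'I_M * T)%type, _,
  (fun x => (bD x, de x)), (fun x => (bD x, ka x)), (fun x => (jD x, xi x)), al',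
  (fun u => finset.setX (if u.1 then [set Some t | t in [set: 'I_M]]%SET else [set None]%SET) (V u.2)),
  (fun u => (if u.1 then M%:R else 1) * N u.2), s'; split.
- split; [exact: mfin_pair|exact: mfin_pair|exact: mfin_pair|].
  by apply: (mfin_dpd _ mal'); apply: (mfin_nm mact); exact: mfin_pair.
- apply: dpd_nm => x y h.
  have e1 : bD x = bD y by have := h one s'one; rewrite !act1 => -[].
  congr pair => //; apply: dka; apply/nmP => g gs.
  have [eW _ ede] := h g (s's _ gs); congr pair => //.
  have eO : orbit_of F D (act g x) <-> orbit_of F D (act g y).
    have ef f : f \in F -> D (act (inv f) (act g x)) <-> D (act (inv f) (act g y)).
      move=> fF; have [_ + _] := h _ (s'Fs f g fF gs); rewrite !actM /bD => e2.
      by split => h'; apply/asboolP; [rewrite -e2|rewrite e2]; apply/asboolP.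
    by split => -[f fF Df]; exists f => //; apply/ef.
  have eW' : W (act g x) <-> W (act g y).
    by split => h'; apply/asboolP; [rewrite -eW|rewrite eW]; apply/asboolP.
  by apply/asboolP/asboolP => -[h1 h2]; split; [exact/eW'|move/eO|exact/eW'|move/eO].
- split=> [x|[b k] /=|[b k] /=].
  + rewrite finset.in_setX xiV andbT /jD /=; case: ifP => _.
      by apply: imset_f; rewrite finset.in_setT.
    by rewrite finset.in_set1.
  + by case: b; rewrite ?mul1r// mulr_ege1 ?ler1n.
  + rewrite cardsX natrM; apply: ler_pM => //; case: b; last by rewrite cards1.
    by rewrite card_imset ?cardsT ?card_ord// => ? ? [].
- split=> // x y Wx Wy; rewrite /al'; have := foP x; have := foP y.
  case: (fo x) => [i|]; case: (fo y) => [i'|] //.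
    move=> Dy Dx [ii jj _]; rewrite -ii in Dy jj *.
    have := nj _ _ (DY _ Dx) (DY _ Dy) jj _ (mem_tnth i (in_tuple F)).
    by rewrite !(actVK Sy).
  by move=> nOy nOx [/nal]; apply.
have h1 := hent_pair Sy Ip mbD mde.
have h2 := hent_le_H Sy Ip mbD.
have mk : mfin (fun x => (bD x, ka x)) by exact: mfin_pair.
have M1 : 1 <= M%:R :> R by rewrite ler1n.
have -> : \sum_k plaw pr (fun x => (bD x, ka x)) k * ln ((if k.1 then M%:R else 1) * N k.2) =
   pr D * ln M%:R + \sum_k plaw pr ka k * ln (N k).
  have -> : \sum_k plaw pr ka k * ln (N k) =
     \sum_k plaw pr (fun x => (bD x, ka x)) k * ln (N k.2).
    symmetry; apply: (sum_law_act Ip (fun k => ln (N k)) (f := ka) (h := snd) (g := one) mka mk).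
    by move=> x /=; rewrite act1.
  have -> : pr D * ln M%:R = \sum_k plaw pr (fun x => (bD x, ka x)) k * (k.1%:R * ln M%:R).
    under eq_bigr do rewrite mulrA; rewrite -mulr_suml; congr (_ * _).
    rewrite -(pr_lawE Ppr (fun u : bool * T0 => u.1) mk); congr pr.
    by apply/seteqP; split => x /asboolP.
  rewrite -big_split/=; apply: eq_bigr => -[b k] _ /=; rewrite -mulrDr; congr (_ * _).
  have Nk : 0 < N k by exact: lt_le_trans (N1 k).
  case: b; last by rewrite mul1r mul0r add0r.
  by rewrite mul1r lnM ?posrE// (lt_le_trans _ M1).
rewrite mulrDr mulrCA (mulrC _ (ln _)) -/bD.
move: h1 h2 hc; rewrite /bD; lra.
Qed.

Lemma code_mono (W : set X) (c c' : R) : c <= c' -> code W c -> code W c'.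
Proof.
move=> cc [T1 [T0 [T [U [de [ka [xi [al [V [N [s [h1 h2 h3 h4 h5]]]]]]]]]]]].
by exists T1, T0, T, U, de, ka, xi, al, V, N, s; split => //; exact: le_trans cc.
Qed.

(** Gibbs' inequality against the Bernoulli law of parameter [p]. Unlike [H_set], the bound is
    affine in [pr D], so the cost of recording [D] can be charged to its mass. *)
Lemma H_set_lin (D : set X) (p : R) : measurable D -> 0 < p -> p <= 2^-1 ->
  H (fun x => `[< D x >]) <= - (pr D * ln p) + 2 * p.
Proof.
move=> mD p0 p1; have mb : mfin (fun x => `[< D x >]) by exact: mfin_set.
have := H_gibbs Ppr (q := fun b : bool => if b then p else 1 - p) mb.
rewrite !big_bool /= => h.
have e1 : plaw pr (fun x => `[< D x >]) true = pr D.
  by rewrite /plaw; congr pr; apply/seteqP; split => x /= /asboolP.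
have l0 := law_ge0 Ppr false mb; have l1 := law_le1 Ppr false mb.
apply: le_trans (h _ _ _) _; [by case; lra|by case => _; lra|lra|].
rewrite e1 opprD lerD2l.
have h2 : ln (1 - p)^-1 <= 2 * p.
  apply: le_trans (ln_leB1 _) _; first by rewrite invr_gt0; lra.
  rewrite lerBlDr -div1r ler_pdivrMr; last by lra.
  have : 0 <= p * (1 - 2 * p) by rewrite mulr_ge0//; lra.
  by rewrite mulrBr; lra.
rewrite lnV ?posrE in h2; last by lra.
have l3 : ln (1 - p) <= 0 by apply: ln_le0; lra.
have : plaw pr (fun x => `[< D x >]) false * - ln (1 - p) <= 1 * - ln (1 - p).
  by apply: ler_wpM2r => //; lra.
lra.
Qed.

Lemma pr_seq_ex (s : seq G) (B : G -> set X) : (forall g, measurable (B g)) ->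
  pr [set x | exists2 g, g \in s & B g x] <= \sum_(g <- s) pr (B g).
Proof.
move=> mB; elim: s => [|g s ih].
  rewrite big_nil (_ : mkset _ = set0) ?(pr0 Ppr)//.
  by apply/seteqP; split => x // [].
rewrite big_cons (_ : mkset _ = B g `|` [set x | exists2 f, f \in s & B f x]).
  apply: le_trans (prU_le Ppr _ _) _ => //; first exact: measurable_seq_ex.
  by rewrite lerD2l.
apply/seteqP; split => x /=.
  by move=> [f]; rewrite inE => /predU1P[->|fF] ?; [left|right; exists f].
by move=> [?|[f fF ?]]; [exists g; rewrite ?mem_head|exists f; rewrite // inE fF orbT].
Qed.

(** A new boundary point is uncovered but is carried by some [f' f^-1] into a tile. It therefore
    lies in a translate of [D] by an element of the outer boundary of [F], and there are [#|bdl|] of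
    these. *)
Lemma boundary_step (F' F : {fset G}) (T : seq G) (W D : set X) : measurable W -> measurable D ->
  (forall f f', f \in F' -> f' \in F' -> inv (mul f' (inv f)) \in T) ->
  pr (boundary F' (W `\` orbit_of F D)) <= pr (boundary F' W) + #|` bdl mul T F|%:R * pr D.
Proof.
move=> mW mD FT.
have mO := measurable_orbit_of Sy F mD.
pose E := [set x | exists2 g, g \in bdl mul T F & (act (inv g) @^-1` D) x].
have mg g : measurable (act (inv g) @^-1` D) by exact: mact.
have mE : measurable E by apply: measurable_seq_ex => g _.
have mB1 := measurable_boundary Sy F' mW.
apply: le_trans (_ : pr (boundary F' W `|` E) <= _).
  apply: (pr_le Ppr); [exact: (measurable_boundary Sy _ (measurableD mW mO))|exact: measurableU|].
  move=> x [[Wx nOx] [f [f' [fF fF' nW]]]].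
  have [Wtx|nWtx] := pselect (W (act (mul f' (inv f)) x)); last first.
    by left; split => //; exists f, f'.
  right; have {nW} [h Fh Dh] : orbit_of F D (act (mul f' (inv f)) x).
    by apply: contrapT => nO; apply: nW.
  set t := mul f' (inv f) in Dh *.
  exists (mul (inv t) h).
    apply: bdlP => //; first exact: FT.
    apply/negP => inF; apply: nOx; exists (mul (inv t) h) => //.
    suff -> : act (inv (mul (inv t) h)) x = act (inv h) (act t x) by [].
    by apply: (can_inj (actK Sy (mul (inv t) h))); rewrite (actVK Sy) actM (actVK Sy) (actK Sy).
  rewrite /=; suff -> : act (inv (mul (inv t) h)) x = act (inv h) (act t x) by [].
  by apply: (can_inj (actK Sy (mul (inv t) h))); rewrite (actVK Sy) actM (actVK Sy) (actK Sy).
apply: le_trans (prU_le Ppr mB1 mE) _; rewrite lerD2l.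
apply: le_trans (pr_seq_ex _ mg) _.
rewrite (eq_bigr (fun=> pr D)); last by move=> g _; exact: ip.
by rewrite sum_const_seq.
Qed.

(* [Y] is a union of [M] Bowen balls over [F], and [j] selects one of them. *)
Definition shapes (a : R) : Prop := forall (T : seq G) (ka de : R) (m : nat), 0 < ka -> 0 < de ->
  exists (F : {fset G}) (Y : set X) (M : nat) (j : X -> 'I_M),
  [/\ (m <= #|` F|)%N /\ #|` bdl mul T F|%:R <= ka * #|` F|%:R,
      [/\ measurable Y, mfin j & (0 < M)%N], pr (~` Y) <= de,
      ln M%:R <= a * #|` F|%:R &
      forall x y, Y x -> Y y -> j x = j y -> forall f, f \in F -> near (act f x) (act f y)].

Hypothesis sepH : separating act pr.
Variable N0 : set X.
Hypotheses (mN0 : measurable N0) (prN0 : pr N0 = 0).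
Hypothesis multA : forall x, ~ N0 x -> forall (F : seq G), uniq F -> forall z,
   (count (fun f => `[< act (inv f) x = z >]) F <= A)%N.

(** A layer covers about the share [eta] of [W] at cost [a + sg] per unit mass and leaves the share
    [1 - eta + eta ^+ 2] at the old cost [v]. The list [B] keeps the price of the boundaries of [W]
    for the shapes in use; stating the bound for every [W] lets it be applied to the uncovered
    part. *)
Lemma code_iter (TR : finType) (rho : X -> TR) (a sg eta : R) : mfin rho ->
  (forall x y, rho x = rho y -> near x y) -> shapes a -> 0 <= a -> 0 < sg -> sg <= 1 ->
  0 < eta -> eta <= 2^-1 ->
  forall k, exists (v : R) (B : seq ({fset G} * R)),
  [/\ 0 <= v, v <= (a + sg) / (1 - eta) + (1 - eta + eta ^+ 2) ^+ k * ln (Num.max 1 #|TR|%:R),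
     (forall b, b \in B -> 0 <= b.2) &
     forall W, measurable W ->
       code W (v * pr W + \sum_(b <- B) b.2 * pr (boundary b.1 W) + sg * k%:R)].
Proof.
move=> mrho nrho sh a0 sg0 sg1 eta0 eta1.
have A0' : 0 < A%:R :> R by rewrite ltr0n.
have fx0 : 0 <= (a + sg) / (1 - eta) by rewrite divr_ge0; lra.
elim=> [|k [v [B [v0 vle B0 ih]]]].
  exists (ln (Num.max 1 #|TR|%:R)), [::]; split => //.
  - by rewrite ln_ge0// le_max lexx.
  - by rewrite expr0 mul1r lerDr.
  - by move=> W mW; rewrite big_nil addr0 mulr0 addr0; exact: (code_base mW mrho).
(* The new [F] must be almost invariant under these elements, so that cutting out its tiles adds
   little boundary for the older shapes. *)
pose T := flatten [seq [seq inv (mul f' (inv f)) | f <- enum_fset b.1, f' <- enum_fset b.1] | b <- B].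
pose Cb := \sum_(b <- B) b.2.
have Cb0 : 0 <= Cb by rewrite /Cb big_seq; apply: sumr_ge0 => b /B0.
(* The three terms secure the hypothesis of [H_set_lin], a small [phi p], and a small remainder
   [2 * p]. *)
pose p0 := Num.min 2^-1 (Num.min ((eta * sg / 4) ^+ 2) (sg / 8)).
have es0 : 0 < eta * sg by exact: mulr_gt0.
have p00 : 0 < p0 by rewrite !lt_min invr_gt0 ltr0n /= exprn_gt0 ?divr_gt0.
have C1 : 0 < Cb + 1 by lra.
pose ka := sg / (2 * (Cb + 1) * A%:R).
have ka0 : 0 < ka by rewrite divr_gt0// !mulr_gt0.
pose de := sg / (4 * (v + 1)).
have de0 : 0 < de by rewrite divr_gt0// mulr_gt0//; lra.
(* Makes [F] so large that the density [eta * A / #|F|] of centres is at most [p0]. *)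
pose m := (Num.truncn (eta * A%:R / p0)).+1.
have [F [Y [M [j [[mF bF] [mY mj M0] dY lM nj]]]]] := sh T ka de m ka0 de0.
have Fm : eta * A%:R / p0 <= #|` F|%:R.
  by apply: le_trans (_ : m%:R <= _); [exact/ltW/truncnS_gt|rewrite ler_nat].
have F0 : 0 < #|` F|%:R :> R by apply: lt_le_trans Fm; rewrite divr_gt0// mulr_gt0.
pose p := eta * A%:R / #|` F|%:R.
have pp0 : 0 < p by rewrite divr_gt0// mulr_gt0.
have pp : p <= p0.
  by move: Fm; rewrite ler_pdivrMr// => Fm; rewrite /p ler_pdivrMr// [leRHS]mulrC.
have p2 : p <= 2^-1 by apply: le_trans pp _; rewrite ge_min lexx.
have p3 : p <= sg / 8 by apply: le_trans pp _; rewrite !ge_min lexx !orbT.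
have p4 : phi p <= eta * sg / 2.
  apply: le_trans (phi_sqrt (ltW pp0)) _.
  have : Num.sqrt p <= Num.sqrt ((eta * sg / 4) ^+ 2).
    by apply: ler_wsqrtr; apply: le_trans pp _; rewrite !ge_min lexx !orbT.
  by rewrite sqrtr_sqr gtr0_norm ?divr_gt0//; lra.
pose nb := #|` bdl mul T F|%:R : R.
(* Total price per unit mass of centres: the ball index, the recording of [D], and the added
   boundary. *)
pose w := ln M%:R / A%:R - ln p + Cb * nb.
have lp0 : ln p <= 0 by apply: ln_le0; lra.
have lM0 : 0 <= ln M%:R :> R by rewrite ln_ge0// ler1n.
have w0 : 0 <= w.
  have := divr_ge0 lM0 (ltW A0').
  have : 0 <= Cb * nb by rewrite mulr_ge0.
  by rewrite /w; lra.
have wp : w * p <= eta * (a + sg).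
  rewrite /w !mulrDl mulNr.
  have t1 : ln M%:R / A%:R * p <= eta * a.
    have -> : ln M%:R / A%:R * p = eta * (ln M%:R / #|` F|%:R).
      by rewrite /p; field; rewrite !gt_eqF.
    by rewrite ler_pM2l// ler_pdivrMr.
  have t2 : - (ln p * p) <= eta * sg / 2 by move: p4; rewrite /phi mulrC.
  have t3 : Cb * nb * p <= eta * sg / 2.
    apply: le_trans (_ : Cb * (ka * #|` F|%:R) * p <= _).
      by apply: ler_wpM2r; [exact: ltW|exact: ler_wpM2l].
    rewrite /p /ka.
    have -> : Cb * (sg / (2 * (Cb + 1) * A%:R) * #|` F|%:R) * (eta * A%:R / #|` F|%:R) =
        (Cb / (Cb + 1)) * (eta * sg / 2).
      by field; rewrite !gt_eqF.
    apply: ler_piMl; first by lra.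
    by rewrite ler_pdivrMr//; lra.
  lra.
have r0 : 0 <= 1 - eta + eta ^+ 2 by have := sqr_ge0 eta; lra.
exists (eta * (a + sg) + v * (1 - eta + eta ^+ 2)), ((F, v) :: B); split.
- by rewrite addr_ge0// mulr_ge0//; lra.
- move: vle r0 fx0; set q := 1 - eta + eta ^+ 2; set L := ln _.
  move=> vle r0 fx0; rewrite [q ^+ _]exprS.
  have := ler_wpM2r r0 vle; rewrite mulrDl.
  set fx := (a + sg) / (1 - eta) in vle fx0 *.
  have -> : a + sg = fx * (1 - eta) by rewrite divfK// gt_eqF//; lra.
  have -> : eta * (fx * (1 - eta)) = fx * (1 - q) by rewrite /q; ring.
  have -> : q * q ^+ k * L = q ^+ k * L * q by ring.
  lra.
- by move=> b; rewrite inE => /predU1P[->//|/B0].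
move=> W mW.
have pF : p = eta * A%:R / (size F)%:R by [].
have eta1' : eta <= 1 by lra.
have p1 : p <= 1 by lra.
have nF : (F : seq G) != [::] by rewrite -size_eq0 -lt0n -(ltr0n R).
have tau0 : 0 < sg / 4 by lra.
have [D [mD DY DF hD]] := stage Sy Ip sepH mW mY mN0 prN0 (fset_uniq F) nF A0
   (fun x nx z => multA nx (fset_uniq F) z) (ltW eta0) eta1' pF p1 w0 v0 tau0.
have mW' : measurable (W `\` orbit_of F D).
  by apply: measurableD => //; exact: (measurable_orbit_of Sy F mD).
have := code_step mW mD DY DF mj M0 nj (ih _ mW').
apply: code_mono; rewrite big_cons /=.
have hH := H_set_lin mD pp0 p2.
have hB : \sum_(b <- B) b.2 * pr (boundary b.1 (W `\` orbit_of F D)) <=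
   \sum_(b <- B) b.2 * pr (boundary b.1 W) + Cb * nb * pr D.
  rewrite /Cb mulr_suml mulr_suml -big_split/= big_seq [leRHS]big_seq.
  apply: ler_sum => b bB; rewrite -mulrA -mulrDr; apply: ler_wpM2l; first exact: B0.
  apply: boundary_step => // f f' fF fF'; apply/flattenP.
  exists [seq inv (mul f1 (inv f0)) | f0 <- b.1, f1 <- b.1].
    exact: (@map_f _ _ (fun b0 : {fset G} * R => [seq inv (mul f1 (inv f0)) | f0 <- b0.1, f1 <- b0.1]) B b bB).
  by apply/allpairsP; exists (f, f').
have prW := pr_ge0 Ppr mW.
have h1 : w * (p * pr W) <= eta * (a + sg) * pr W by rewrite mulrA ler_wpM2r.
have h2 : v * (eta * pr (~` Y)) <= sg / 4.
  have : v * (eta * pr (~` Y)) <= v * de.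
    apply: ler_wpM2l => //; apply: le_trans dY; rewrite ler_piMl//.
    by apply: (pr_ge0 Ppr); exact: measurableC.
  move/le_trans; apply; rewrite /de mulrA ler_pdivrMr ?mulr_gt0//; last by lra.
  have := ltW sg0; nra.
have hw : w * pr D = pr D * (ln M%:R / A%:R) - pr D * ln p + Cb * nb * pr D.
  by rewrite /w; ring.
rewrite -[k.+1%:R]natr1; move: hD h1 h2 hB hH p3; rewrite hw.
exact: code_arith sg0.
Qed.

(** [code_iter] on the whole space, where boundaries are empty, with enough layers to make the
    residue of the crude code small. [hent_count] then divides the cost of the names by [A], and the
    knowledge of [stab] that it requires is free by [stab_hent0]. *)
Lemma coding (TR : finType) (rho : X -> TR) (a : R) : mfin rho ->
  (forall x y, rho x = rho y -> near x y) -> shapes a -> 0 <= a ->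
  infinite_orbits act pr ->
  (forall de : R, 0 < de -> exists (S : seq G) (Bad : set X),
    [/\ uniq S, one \in S, measurable Bad, pr Bad <= de &
        forall x, ~ Bad x -> (A <= #|[set i | stab act S x i]%SET|)%N]) ->
  exists (U : finType) (al : X -> U), [/\ mfin al, (forall x y, al x = al y -> near x y) &
    hent al <= a + 1].
Proof.
move=> mrho nrho sh a0 infH stabA.
have A0' : 0 < A%:R :> R by rewrite ltr0n.
(* With this [eta] and [sg <= 8^-1], the fixed point [(a + sg) / (1 - eta)] is at most
   [a + 4^-1]. *)
pose eta := (8 * (a + 1))^-1.
have eta0 : 0 < eta by rewrite invr_gt0; lra.
have etaE : eta * (8 * (a + 1)) = 1 by rewrite mulVf// gt_eqF//; lra.
have eta1 : eta <= 2^-1 by rewrite lef_pV2 ?posrE; lra.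
set L := ln (Num.max 1 #|TR|%:R : R).
have L0 : 0 <= L by rewrite ln_ge0// le_max lexx.
pose q := 1 - eta + eta ^+ 2.
have q0 : 0 <= q by rewrite /q; have := sqr_ge0 eta; lra.
have q1 : q < 1 by rewrite /q; nra.
have [k hk] : exists k, q ^+ k * L <= 8^-1.
  have L1 : 0 < L + 1 by lra.
  have /cvgrPdist_le /(_ (8 * (L + 1))^-1) : q ^+ n @[n --> \oo] --> (0 : R).
    by apply: cvg_expr; rewrite ger0_norm.
  rewrite invr_gt0 mulr_gt0// => /(_ isT)[n _ /(_ n (leqnn n)) /=].
  rewrite sub0r normrN ger0_norm ?exprn_ge0// => h; exists n.
  apply: le_trans (_ : (8 * (L + 1))^-1 * (L + 1) <= _).
    apply: ler_pM => //; [exact: exprn_ge0|lra].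
  by rewrite invfM -mulrA mulVf ?mulr1// gt_eqF.
(* The errors [sg] of the [k] layers add up to at most [8^-1]. *)
pose sg : R := (8 * k.+1%:R)^-1.
have k1 : 1 <= k.+1%:R :> R by rewrite ler1n.
have sg0 : 0 < sg by rewrite invr_gt0; lra.
have sgE : sg * (8 * k.+1%:R) = 1 by rewrite mulVf// gt_eqF//; lra.
have sg8 : sg <= 8^-1 by rewrite lef_pV2 ?posrE; lra.
have sgk : sg * k%:R <= 8^-1 by move: sgE; rewrite -[k.+1%:R]natr1; lra.
have sg1 : sg <= 1 by lra.
have [v [B [v0 vle B0 /(_ setT measurableT)]]] :=
  code_iter mrho nrho sh a0 sg0 sg1 eta0 eta1 k.
rewrite (prT Ppr) mulr1 big1_seq; last first.
  move=> b /andP[_ bB]; rewrite (_ : boundary b.1 setT = set0) ?(pr0 Ppr) ?mulr0//.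
  by apply/seteqP; split => // x [_ [f [f' [_ _]]]]; apply.
have vb : v + 0 + sg * k%:R <= a + 2^-1.
  have : (a + sg) / (1 - eta) <= a + 4^-1.
    by rewrite ler_pdivrMr; [nra|lra].
  by move: vle; rewrite -/q -/L; lra.
move/(code_mono vb) => [T1 [T0 [T [U [de [ka [xi [al [V [N [s [[mde mka mxi mal]]]]]]]]]]]]].
move=> dka [xiV N1 VN] [dal nal] hc.
exists U, al; split => //; first by move=> x y; apply: nal.
have h1 := hent_dpd Sy Ip mxi dal.
pose Mx := \big[Num.max/1]_k N k.
have M1 : 1 <= Mx by exact: bigmax_ge_id.
have NM k' : N k' <= Mx by exact: le_bigmax.
have lM0 : 0 <= ln Mx by exact: ln_ge0.
(* On the exceptional set the division by [A] may fail and the cost is only bounded by [ln Mx]; this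
   mass keeps that loss below [2^-1]. *)
have d0 : 0 < (2 * (ln Mx + 1))^-1 by rewrite invr_gt0; lra.
have [S [Bad [uS oneS mBad pBad hS]]] := stabA _ d0.
have h2 := hent_count Sy Ip mxi mka xiV N1 VN uS oneS.
have mst := mfin_stab Sy (S := S).
have h3 := hent_pair Sy Ip mst mka.
have h4 := stab_hent0 S sepH infH.
have h5 : hent ka <= hent de.
  have mTd : mfin (fun x => (`[< [set: X] x >], de x)).
    by apply: mfin_pair => //; exact: mfin_set.
  apply: le_trans (hent_dpd Sy Ip mTd dka) _.
  apply: (hent_dpd Sy Ip (s := [:: one])) => //.
  apply: dpd_nm => x y /(_ one (mem_head _ _)); rewrite !act1 => ->.
  by congr pair; apply/asboolP/asboolP.
have h6 : \sum_u plaw pr (fun x => (stab act S x, ka x)) u * (ln (N u.2) / #|[set i | u.1 i]%SET|%:R)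
   <= A%:R^-1 * (\sum_k plaw pr ka k * ln (N k)) + 2^-1.
  pose g x := ((stab act S x, ka x), `[< Bad x >]).
  have mf : mfin (fun x => (stab act S x, ka x)) by exact: mfin_pair.
  have mg : mfin g by apply: mfin_pair => //; exact: mfin_set.
  rewrite -(sum_law_act Ip (fun u : {ffun 'I_(size S) -> bool} * T0 => ln (N u.2) / #|[set i | u.1 i]%SET|%:R) (q := g)
    (h := fst) (g := one) mf mg); last by move=> x; rewrite act1.
  rewrite -(sum_law_act Ip (fun k => ln (N k)) (q := g) (h := fun u => u.1.2) (g := one) mka mg);
    last by move=> x; rewrite act1.
  have e1 : \sum_u plaw pr g u * (u.2%:R * ln Mx) <= 2^-1.
    under eq_bigr do rewrite mulrA; rewrite -mulr_suml.
    rewrite -(pr_lawE Ppr (fun u : ({ffun 'I_(size S) -> bool} * T0) * bool => u.2) mg).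
    have -> : [set x | (g x).2] = Bad by apply/seteqP; split => x /= /asboolP.
    apply: le_trans (_ : (2 * (ln Mx + 1))^-1 * (ln Mx + 1) <= _).
      apply: ler_pM => //; [exact: (pr_ge0 Ppr)|lra].
    by rewrite invfM -mulrA mulVf ?mulr1// gt_eqF//; lra.
  apply: le_trans (_ : A%:R^-1 * (\sum_u plaw pr g u * ln (N u.1.2)) +
      \sum_u plaw pr g u * (u.2%:R * ln Mx) <= _); last by rewrite lerD2l.
  rewrite mulr_sumr -big_split/=.
  rewrite [leRHS](eq_bigr (fun u => plaw pr g u * (A%:R^-1 * ln (N u.1.2) + u.2%:R * ln Mx))); last first.
    by move=> u _; rewrite mulrDr mulrCA.
  apply: (sum_law_le Ppr (f := g) (b := fun u : ({ffun 'I_(size S) -> bool} * T0) * bool => ln (N u.1.2) / #|[set i | u.1.1 i]%SET|%:R)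
    (c := fun u => A%:R^-1 * ln (N u.1.2) + u.2%:R * ln Mx)) => // x /=.
  have lN0 : 0 <= ln (N (ka x)) by exact: ln_ge0.
  case: asboolP => Bx.
    rewrite mul1r; apply: le_trans (_ : ln Mx <= _); last by rewrite lerDr mulr_ge0// invr_ge0 ltW.
    apply: le_trans (_ : ln (N (ka x)) <= _).
      (* A zero count makes the quotient zero, by the convention for division. *)
      have [->|c0] := eqVneq (#|[set i | stab act S x i]%SET|) 0%N; first by rewrite invr0 mulr0.
      by rewrite ler_piMr// invf_le1 ?ler1n ?ltr0n lt0n.
    have Np : 0 < N (ka x) := lt_le_trans ltr01 (N1 _).
    by rewrite ler_ln ?posrE ?NM// (lt_le_trans Np).
  rewrite mul0r addr0 mulrC; apply: ler_wpM2r => //.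
  have hA := hS x Bx.
  by rewrite lef_pV2 ?posrE ?ltr0n ?ler_nat// (leq_trans A0 hA).
lra.
Qed.
End Coding.

(** * Infinite stabilisers *)

Section CodingInf.
Context {R : realType} {G : countType} (mul : G -> G -> G) (one : G) (inv : G -> G)
  (Fs : nat -> {fset G}) {dX : measure_display} {X : measurableType dX} (act : G -> X -> X).
Hypothesis Sy : sys (R := R) mul one inv Fs act.
Variables (pr : set X -> R) (Ip : iprob act pr).
Let Ppr := proj1 Ip.

(** [hent_count] with a trivial key and unrestricted values: each position pays [ln Mx] divided by
    the number of known stabilising elements, which can be taken beyond [2 * ln Mx]. *)
Lemma hent_inf_stab (TR : finType) (rho : X -> TR) : mfin rho ->
  separating act pr -> infinite_orbits act pr ->
  (forall (n : nat) (de : R), 0 < de -> exists (S : seq G) (Bad : set X),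
    [/\ uniq S, one \in S, measurable Bad, pr Bad <= de &
        forall x, ~ Bad x -> (n <= #|[set i | stab act S x i]%SET|)%N]) ->
  hent act pr rho <= 1.
Proof.
move=> mrho sepH infH hS.
pose Mx := Num.max 1 #|TR|%:R : R.
have M1 : 1 <= Mx by rewrite le_max lexx.
have lM0 : 0 <= ln Mx by exact: ln_ge0.
have d0 : 0 < (2 * (ln Mx + 1))^-1 by rewrite invr_gt0; lra.
pose n := (Num.truncn (2 * ln Mx)).+1.
have hn : 2 * ln Mx <= n%:R by exact/ltW/truncnS_gt.
have n0 : 0 < n%:R :> R by rewrite ltr0n.
have [S [Bad [uS oneS mBad pBad {}hS]]] := hS n _ d0.
have mtt := @mfin_tt _ X.
have := hent_count Sy Ip (V := fun=> [set: TR]%SET) (N := fun=> Mx) mrho mtt _ _ _ uS oneS.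
move=> /(_ (fun x => finset.in_setT _) (fun=> M1)).
have cT : #|[set: TR]%SET|%:R <= Mx by rewrite cardsT le_max lexx orbT.
move=> /(_ (fun=> cT)) h2.
have mst := mfin_stab Sy (S := S).
have h3 := hent_pair Sy Ip mst mtt.
have h4 := stab_hent0 Sy Ip S sepH infH.
have h5 : hent act pr (fun _ : X => tt) <= 0.
  apply: le_trans (hent_le_H Sy Ip mtt) _; rewrite -(@ln1 R).
  by apply: (H_le_ln Ppr) => //; rewrite card_unit.
suff : \sum_u plaw pr (fun x => (stab act S x, tt)) u * (ln Mx / #|[set i | u.1 i]%SET|%:R) <= 1.
  by move: h2 h3 h4 h5 => /=; lra.
pose g x := ((stab act S x, tt), `[< Bad x >]).
have mf : mfin (fun x => (stab act S x, tt)) by exact: mfin_pair.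
have mg : mfin g by apply: mfin_pair => //; exact: mfin_set.
rewrite -(sum_law_act Ip (fun u : {ffun 'I_(size S) -> bool} * unit => ln Mx / #|[set i | u.1 i]%SET|%:R) (q := g)
    (h := fst) (g := one) mf mg); last by move=> x; rewrite (sys1 Sy).
have e1 : \sum_u plaw pr g u * (u.2%:R * ln Mx) <= 2^-1.
  under eq_bigr do rewrite mulrA; rewrite -mulr_suml.
  rewrite -(pr_lawE Ppr (fun u : ({ffun 'I_(size S) -> bool} * unit) * bool => u.2) mg).
  have -> : [set x | (g x).2] = Bad by apply/seteqP; split => x /= /asboolP.
  apply: le_trans (_ : (2 * (ln Mx + 1))^-1 * (ln Mx + 1) <= _).
    apply: ler_pM => //; [exact: (pr_ge0 Ppr)|lra].
  by rewrite invfM -mulrA mulVf ?mulr1// gt_eqF//; lra.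
apply: le_trans (_ : \sum_u plaw pr g u * 2^-1 + \sum_u plaw pr g u * (u.2%:R * ln Mx) <= _); last first.
  by rewrite -mulr_suml (sum_law Ppr)//; lra.
rewrite -big_split/= [leRHS](eq_bigr (fun u => plaw pr g u * (2^-1 + u.2%:R * ln Mx))); last first.
  by move=> u _; rewrite mulrDr.
apply: (sum_law_le Ppr (f := g) (b := fun u : ({ffun 'I_(size S) -> bool} * unit) * bool => ln Mx / #|[set i | u.1.1 i]%SET|%:R)
    (c := fun u => 2^-1 + u.2%:R * ln Mx)) => // x /=.
case: asboolP => Bx.
  rewrite mul1r; apply: le_trans (_ : ln Mx <= _); last by lra.
  have [->|c0] := eqVneq (#|[set i | stab act S x i]%SET|) 0%N; first by rewrite invr0 mulr0.
  by rewrite ler_piMr// invf_le1 ?ler1n ?ltr0n lt0n.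
have hA := hS x Bx.
have hA' : n%:R <= #|[set i | stab act S x i]%SET|%:R :> R by rewrite ler_nat.
rewrite mul0r addr0 ler_pdivrMr; last exact: lt_le_trans hA'.
lra.
Qed.
End CodingInf.

(** * Compact metric spaces and regular measures *)

Section Topology.
Context {R : realType} {dX : measure_display} {X : measurableType dX} (d : X -> X -> R).
Hypotheses (hd : is_metric d) (cpt : dcompact d) (bor : borel_space d).
Local Notation dball := (dball d).
Local Notation dopen := (dopen d).

Lemma dxx x : d x x = 0. Proof. by case: hd => h _ _; apply/h. Qed.
Lemma dC x y : d x y = d y x. Proof. by case: hd. Qed.
Lemma dT y x z : d x z <= d x y + d y z. Proof. by case: hd. Qed.
Lemma d0_eq x y : d x y = 0 -> x = y. Proof. by case: hd => h _ _ /h. Qed.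
Lemma d_ge0 x y : 0 <= d x y.
Proof. have := dT y x x; rewrite dxx (dC y x); lra. Qed.
Lemma d_gt0 x y : x <> y -> 0 < d x y.
Proof. by move=> h; rewrite lt_neqAle d_ge0 andbT eq_sym; apply/eqP => /d0_eq. Qed.

Lemma dopen_ball x r : dopen (dball x r).
Proof.
move=> y; rewrite /Defs.dball /= => xy; exists (r - d x y); first by lra.
by move=> z; rewrite /Defs.dball /= => yz; have := dT y x z; lra.
Qed.

Lemma dball_center x r : 0 < r -> dball x r x.
Proof. by rewrite /Defs.dball /= dxx. Qed.

Lemma dopenT : dopen setT. Proof. by move=> x _; exists 1. Qed.
Lemma dopen0 : dopen set0. Proof. by []. Qed.

Lemma dopenI A B : dopen A -> dopen B -> dopen (A `&` B).
Proof.
move=> oA oB x [Ax Bx]; have [e e0 eA] := oA x Ax; have [f f0 fB] := oB x Bx.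
exists (Num.min e f); first by rewrite lt_min e0.
by move=> y; rewrite /Defs.dball /= lt_min => /andP[h1 h2]; split; [exact: eA|exact: fB].
Qed.

Lemma dopen_bigcup (I : Type) (P : set I) (A : I -> set X) : (forall i, P i -> dopen (A i)) ->
  dopen (\bigcup_(i in P) A i).
Proof.
move=> oA x [i Pi Aix]; have [e e0 h] := oA i Pi x Aix.
by exists e => // y /h ?; exists i.
Qed.

Lemma dopenU A B : dopen A -> dopen B -> dopen (A `|` B).
Proof.
move=> oA oB x [/oA|/oB] [e e0 h]; exists e => // y /h ?; [by left|by right].
Qed.

Lemma dopen_forall (I : finType) (A : I -> set X) : (forall i, dopen (A i)) ->
  dopen [set x | forall i, A i x].
Proof.
move=> oA; suff h (s : seq I) : dopen [set x | forall i, i \in s -> A i x].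
  have -> : [set x | forall i, A i x] = [set x | forall i, i \in enum I -> A i x].
    by apply/seteqP; split => x /= h' i; [move=> _|]; apply: h'; rewrite ?mem_enum.
  exact: h.
elim: s => [|i s ih].
  have -> : [set x | forall i, i \in [::] -> A i x] = setT by apply/seteqP; split.
  exact: dopenT.
have -> : [set x | forall j, j \in i :: s -> A j x] = A i `&` [set x | forall j, j \in s -> A j x].
  apply/seteqP; split => x /=.
    by move=> h; split => [|j js]; apply: h; rewrite in_cons ?eqxx// js orbT.
  by move=> [h1 h2] j; rewrite in_cons => /predU1P[->|/h2].
exact: dopenI.
Qed.

Definition dclosed (A : set X) : Prop := dopen (~` A).

Lemma dclosedI A B : dclosed A -> dclosed B -> dclosed (A `&` B).
Proof. by rewrite /dclosed setCI; exact: dopenU. Qed.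
Lemma dclosedU A B : dclosed A -> dclosed B -> dclosed (A `|` B).
Proof. by rewrite /dclosed setCU; exact: dopenI. Qed.
Lemma dclosedT : dclosed setT. Proof. by rewrite /dclosed setCT. Qed.
Lemma dclosed0 : dclosed set0. Proof. by rewrite /dclosed setC0; exact: dopenT. Qed.

Lemma mopen A : dopen A -> measurable A.
Proof. by move=> oA; apply/bor; apply: sub_gen_smallest. Qed.
Lemma mclosed A : dclosed A -> measurable A.
Proof. by move=> /mopen /measurableC; rewrite setCK. Qed.

Definition thick (C : set X) (r : R) : set X := [set x | exists2 c, C c & d c x < r].

Lemma dopen_thick C r : dopen (thick C r).
Proof.
move=> y [c Cc cy]; exists (r - d c y); first by lra.
by move=> z; rewrite /Defs.dball /= => yz; exists c => //; have := dT y c z; lra.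
Qed.

Lemma sub_thick C r : 0 < r -> C `<=` thick C r.
Proof. by move=> r0 x Cx; exists x; rewrite ?dxx. Qed.

Lemma thick_le C r r' : r <= r' -> thick C r `<=` thick C r'.
Proof. by move=> rr x [c Cc h]; exists c => //; exact: lt_le_trans rr. Qed.

Lemma thick_cap C : dclosed C -> forall x, (forall n : nat, thick C n.+1%:R^-1 x) -> C x.
Proof.
move=> cC x h; apply: contrapT => nC; have [e e0 he] := cC x nC.
have [n hn] : exists n : nat, n.+1%:R^-1 < e :> R.
  have [n _ /(_ n (leqnn n))] := near_infty_natSinv_lt (PosNum e0).
  by move=> /= ?; exists n.
have [c Cc cx] := h n; apply: (he c) => //.
by rewrite /Defs.dball /= dC; exact: lt_trans hn.
Qed.

Lemma natSinv_lt (e : R) : 0 < e -> exists n : nat, n.+1%:R^-1 < e.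
Proof.
move=> e0; have [n _ /(_ n (leqnn n))] := near_infty_natSinv_lt (PosNum e0).
by move=> /= ?; exists n.
Qed.

(** Cantor's intersection theorem: the complements form an increasing open cover. *)
Lemma compact_seq (K : nat -> set X) : (forall n, dclosed (K n)) ->
  (forall n, K n.+1 `<=` K n) -> (forall x, exists n, ~ K n x) -> exists n, K n = set0.
Proof.
move=> cK dK eK.
have dK' : forall m n, (m <= n)%N -> K n `<=` K m.
  move=> m n; elim: n => [|n ih]; first by rewrite leqn0 => /eqP->.
  by rewrite leq_eqVlt => /predU1P[->//|]; rewrite ltnS => /ih h; apply: subset_trans h.
have [||s sC sT] := cpt (C := [set V | exists n, V = ~` K n]).
- by move=> U [n ->]; exact: cK.
- apply/seteqP; split=> // x _; have [n nx] := eK x.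
  by exists (~` K n) => //; exists n.
suff [N hN] : exists N, forall U, U \in s -> U `<=` ~` K N.
  exists N; apply/seteqP; split=> // x Kx.
  have : [set: X] x by [].
  by rewrite -sT => -[U /= Us Ux]; exact: hN Us x Ux Kx.
elim: s sC {sT} => [|U s ih] sC; first by exists 0.
have [|N hN] := ih; first by move=> V Vs; apply: sC; rewrite in_cons Vs orbT.
have [n ->] := sC U (mem_head _ _).
exists (maxn n N) => V; rewrite in_cons => /predU1P[->|/hN h].
  by apply: subsetC; apply: dK'; exact: leq_maxl.
by apply: subset_trans h _; apply: subsetC; apply: dK'; exact: leq_maxr.
Qed.

Lemma lebesgue_number (C : set (set X)) : (forall U, C U -> dopen U) ->
  \bigcup_(U in C) U = setT ->
  exists2 r : R, 0 < r & forall x, exists2 B, C B & dball x r `<=` B.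
Proof.
move=> oC CT.
(* Balls of half the admissible radius, so that around each point of such a ball a ball of the same
   radius still lies in [B]. *)
have [||s sC sT] := cpt (C := [set V | exists x r, [/\ 0 < r, V = dball x r &
    exists2 B, C B & dball x (r + r) `<=` B]]).
- by move=> U [x [r [_ -> _]]]; exact: dopen_ball.
- apply/seteqP; split=> // x _.
  have : [set: X] x by [].
  rewrite -CT => -[B CB Bx]; have [e e0 eB] := oC B CB x Bx.
  exists (dball x (e / 2)); last by apply: dball_center; lra.
  exists x, (e / 2); split=> //; first by lra.
  by exists B => //; have -> : e / 2 + e / 2 = e by lra.
suff [r r0 hr] : exists2 r0 : R, 0 < r0 & forall V, V \in s -> exists x r,
    [/\ r0 <= r, V = dball x r & exists2 B, C B & dball x (r + r) `<=` B].
  exists r => // x; have : [set: X] x by [].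
  rewrite -sT => -[V /= Vs Vx]; have [y [r' [rr' VE [B CB hB]]]] := hr V Vs.
  exists B => // z xz; apply: hB; move: xz Vx; rewrite VE /Defs.dball /= => h1 h2.
  by have := dT x y z; lra.
elim: s sC {sT} => [|V s ih] sC; first by exists 1.
have [|r r0 hr] := ih; first by move=> U Us; apply: sC; rewrite in_cons Us orbT.
have [x [r' [r'0 VE hB]]] := sC V (mem_head _ _).
exists (Num.min r r'); first by rewrite lt_min r0.
move=> U; rewrite in_cons => /predU1P[->|/hr [y [t [rt UE h]]]].
  by exists x, r'; split=> //; rewrite ge_min lexx orbT.
by exists y, t; split=> //; rewrite ge_min rt.
Qed.

Lemma closed_in_open C O : dclosed C -> dopen O -> C `<=` O ->
  exists2 r : R, 0 < r & thick C r `<=` O.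
Proof.
move=> cC oO CO; have [||r r0 hr] := lebesgue_number (C := [set V | V = O \/ V = ~` C]).
- by move=> U [->|->].
- apply/seteqP; split=> // x _; have [Cx|nC] := pselect (C x).
    by exists O; [left|exact: CO].
  by exists (~` C); [right|].
exists r => // x [c Cc cx]; have [B [->|->] h] := hr c; first exact: h.
by have := h c (dball_center c r0).
Qed.

Lemma closed_disj C D : dclosed C -> dclosed D -> C `&` D = set0 ->
  exists2 r : R, 0 < r & thick C r `&` thick D r = set0.
Proof.
move=> cC cD CD; have [|r r0 h] := closed_in_open cC cD.
  by move=> x Cx Dx; have : (C `&` D) x by []; rewrite CD.
exists (r / 2); first by lra.
apply/seteqP; split=> // y [[c Cc cy] [e De ey]].
by apply: (h e) => //; exists c => //; have := dT y c e; rewrite (dC y e); lra.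
Qed.

Lemma net r : 0 < r -> exists s : seq X, forall x, exists2 y, y \in s & d y x < r.
Proof.
move=> r0; have [||s sC sT] := cpt (C := [set V | exists x, V = dball x r]).
- by move=> U [x ->]; exact: dopen_ball.
- by apply/seteqP; split=> // x _; exists (dball x r); [exists x|exact: dball_center].
suff [t ht] : exists t : seq X, forall V, V \in s -> exists2 y, y \in t & V = dball y r.
  exists t => x; have : [set: X] x by [].
  by rewrite -sT => -[V /= /ht [y yt ->]] h; exists y.
elim: s sC {sT} => [|V s ih] sC; first by exists [::].
have [|t ht] := ih; first by move=> U Us; apply: sC; rewrite in_cons Us orbT.
have [x VE] := sC V (mem_head _ _); exists (x :: t) => U.
rewrite in_cons => /predU1P[->|/ht[y yt ->]]; first by exists x; rewrite ?mem_head.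
by exists y; rewrite // in_cons yt orbT.
Qed.

Lemma fin_small (I : finType) (P : I -> R -> Prop) :
  (forall i r r', r' <= r -> P i r -> P i r') -> (forall i, exists2 r, 0 < r & P i r) ->
  exists2 r, 0 < r & forall i, P i r.
Proof.
move=> mP hP; suff [r r0 h] : exists2 r, 0 < r & forall i, i \in enum I -> P i r.
  by exists r => // i; apply: h; rewrite mem_enum.
elim: (enum I) => [|i s [r r0 h]]; first by exists 1.
have [r' r'0 h'] := hP i; exists (Num.min r r'); first by rewrite lt_min r0.
move=> j; rewrite in_cons => /predU1P[->|/h hj].
  by apply: mP h'; rewrite ge_min lexx orbT.
by apply: mP hj; rewrite ge_min lexx.
Qed.

(** Quantifying over points and not over values leaves empty fibres unconstrained. *)
Definition sub_cover (J T : Type) (U : J -> set X) (f : X -> T) : Prop :=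
  forall x, exists j, forall y, f y = f x -> U j y.

Lemma sub_cover_ex (J : finType) (U : J -> set X) : (forall j, measurable (U j)) ->
  (forall x, exists j, U j x) -> exists (T : finType) (f : X -> T), mfin f /\ sub_cover U f.
Proof.
move=> oU cU; pose f x := [pick j | `[<U j x>]].
exists (option J), f; split; last first.
  move=> x; case fx : (f x) => [j|]; last first.
    have [j Ujx] := cU x; move: fx; rewrite /f; case: pickP => // /(_ j).
    by case: asboolP.
  by exists j => y; rewrite /f; case: pickP => // k /asboolP Uky [<-].
apply: (@mfin_dpd _ _ _ _ (fun x => [ffun j => `[<U j x>]])).
  apply: mfin_ffun => j; exact: mfin_set.
move=> x y /ffunP h; rewrite /f; apply: eq_pick => j; have := h j.
by rewrite !ffunE.
Qed.

Lemma fine_map (r : R) : 0 < r -> exists (T : finType) (f : X -> T), mfin f /\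
  forall x y, f x = f y -> d x y < r.
Proof.
move=> r0; have r2 : 0 < r / 2 by lra.
have [s hs] := net r2.
pose U (i : 'I_(size s)) := dball (tnth (in_tuple s) i) (r / 2).
have [|x|T [f [mf sf]]] := @sub_cover_ex 'I_(size s) U.
- by move=> j; apply: mopen; exact: dopen_ball.
- have [y ys yx] := hs x; have /tnthP[i yi] : y \in in_tuple s by [].
  by exists i; rewrite /U -yi.
exists T, f; split=> // x y fxy; have [j hj] := sf x.
have := hj x erefl; have := hj y (esym fxy); rewrite /U /Defs.dball /= => h1 h2.
set c := tnth _ _ in h1 h2; have := dT c x y; rewrite (dC x c); lra.
Qed.

End Topology.

(** * Countably additive probabilities and regularity *)

Section SProb.
Context {R : realType} {dX : measure_display} {X : measurableType dX}.

(** Countable additivity as continuity at the empty set, the form that compactness and domination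
    arguments deliver directly. *)
Definition sprob (pr : set X -> R) : Prop := fprob pr /\
  forall D : nat -> set X, (forall n, measurable (D n)) -> (forall n, D n.+1 `<=` D n) ->
    (forall x, exists n, ~ D n x) -> forall e : R, 0 < e -> exists n, pr (D n) <= e.

Lemma meas_fin (mu : {measure set X -> \bar R}) A : isprob mu -> measurable A ->
  mu A \is a fin_num.
Proof.
move=> mu1 mA; rewrite ge0_fin_numE//; apply: le_lt_trans (_ : mu setT < +oo)%E.
  by apply: le_measure; rewrite ?inE.
by rewrite mu1 ltry.
Qed.

Lemma decr_le (D : nat -> set X) : (forall n, D n.+1 `<=` D n) ->
  forall m n, (m <= n)%N -> D n `<=` D m.
Proof.
move=> dD m n; elim: n => [|n ih]; first by rewrite leqn0 => /eqP->.
by rewrite leq_eqVlt => /predU1P[->//|]; rewrite ltnS => /ih h; apply: subset_trans h.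
Qed.

Lemma sprob_meas (mu : {measure set X -> \bar R}) : isprob mu -> sprob (fun A => fine (mu A)).
Proof.
move=> mu1; split; first split.
- by rewrite mu1.
- by move=> A mA; rewrite fine_ge0.
- by move=> A B mA mB AB; rewrite measureU// fineD//; exact: meas_fin.
move=> D mD dD eD e e0.
have capD : \bigcap_n D n = set0.
  by apply/seteqP; split=> // x h; have [n []] := eD x; exact: h.
have hc : mu (D n) @[n --> \oo] --> mu (\bigcap_n D n).
  apply: nonincreasing_cvg_mu => //.
  - by rewrite -ge0_fin_numE//; exact: meas_fin.
  - by rewrite capD.
  - by move=> m n mn; apply/subsetPset; exact: decr_le.
rewrite capD measure0 in hc.
have := fine_cvg hc.
move=> /(_ _) /cvgrPdist_le /(_ e e0) [n _ /(_ n (leqnn n))] /= h.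
by exists n; move: h; rewrite sub0r normrN ger0_norm// fine_ge0.
Qed.

Variables (pr : set X -> R) (Spr : sprob pr).
Let Ppr := proj1 Spr.

Lemma meas_sprob : exists mu : {measure set X -> \bar R}, forall A, measurable A ->
  mu A = (pr A)%:E.
Proof.
(* Nothing is known of [pr] on other sets, so 0 is taken there to keep the measure nonnegative. *)
pose m (A : set X) : \bar R := if pselect (measurable A) then (pr A)%:E else 0%E.
have mE A : measurable A -> m A = (pr A)%:E by rewrite /m; case: pselect.
have m0 : m set0 = 0%E by rewrite mE// (pr0 Ppr).
have mge0 A : (0 <= m A)%E by rewrite /m; case: pselect => // mA; rewrite lee_fin pr_ge0.
have msig : semi_sigma_additive m.
  move=> F mF tF mUF.
  have mfU n : measurable (\big[setU/set0]_(i < n) F i) by exact: bigsetU_measurable.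
  have sumE n : (\sum_(0 <= i < n) m (F i))%E = (pr (\big[setU/set0]_(i < n) F i))%:E.
    elim: n => [|n ih]; first by rewrite big_nil big_ord0 (pr0 Ppr).
    rewrite big_nat_recr//= ih mE// big_ord_recr/= (prU Ppr)//.
      exact: mfU.
    apply/seteqP; split=> // x []; rewrite -bigcup_mkord => -[i /= ilt Fi] Fn.
    have/trivIsetP/(_ i n I I) := tF; rewrite (ltn_eqF ilt) => /(_ isT).
    by move=> h; have : (F i `&` F n) x by []; rewrite h.
  rewrite mE//; under eq_cvg => n do rewrite sumE.
  apply: cvg_EFin; first by near=> n.
  apply/cvgrPdist_le => e e0.
  pose D n := \bigcup_n F n `\` \big[setU/set0]_(i < n) F i.
  have mD n : measurable (D n) by exact: measurableD.
  have dD n : D n.+1 `<=` D n.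
    by move=> x [Ux nx]; split => // h; apply: nx; rewrite big_ord_recr/=; left.
  have [|n hn] := (proj2 Spr) D mD dD _ e e0.
    move=> x; have [[i _ Fi]|nx] := pselect ((\bigcup_n F n) x); last by exists 0 => -[].
    by exists i.+1 => -[_]; apply; rewrite big_ord_recr/=; right.
  exists n => // k /= nk; have sub : \big[setU/set0]_(i < k) F i `<=` \bigcup_n F n.
    by rewrite -bigcup_mkord => x [i _ Fi]; exists i.
  have mk := mfU k; rewrite /comp/= -(setIidr sub) -(prD Ppr mUF mk) ger0_norm; last by apply: (pr_ge0 Ppr); exact: mD.
  by apply: le_trans hn; apply: (pr_le Ppr (mD k) (mD n)); exact: (decr_le dD nk).
pose M := HB.pack_for {measure set X -> \bar R} m (isMeasure.Build _ _ _ m m0 mge0 msig).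
by exists M => A /mE.
Unshelve. all: by end_near. Qed.

Lemma sprob_bigcup (E : nat -> set X) c : (forall n, measurable (E n)) ->
  (forall n, \sum_(i < n) pr (E i) <= c) -> pr (\bigcup_n E n) <= c.
Proof.
move=> mE hc; apply/ler_addgt0Pr => e e0.
have mfU n : measurable (\big[setU/set0]_(i < n) E i) by exact: bigsetU_measurable.
have mU : measurable (\bigcup_n E n) by exact: bigcupT_measurable.
have hfin n : pr (\big[setU/set0]_(i < n) E i) <= c.
  apply: le_trans (hc n); elim: n => [|n ih]; first by rewrite !big_ord0 (pr0 Ppr).
  rewrite !big_ord_recr/=; apply: le_trans (prU_le Ppr (mfU n) (mE n)) _.
  exact: lerD.
pose D n := \bigcup_n E n `\` \big[setU/set0]_(i < n) E i.
have [|||n hn] := (proj2 Spr) D _ _ _ e e0.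
- by move=> n; exact: measurableD.
- by move=> n x [Ux nx]; split => // h; apply: nx; rewrite big_ord_recr/=; left.
- move=> x; have [[i _ Fi]|nx] := pselect ((\bigcup_n E n) x); last by exists 0 => -[].
  by exists i.+1 => -[_]; apply; rewrite big_ord_recr/=; right.
apply: le_trans (lerD (hfin n) hn).
apply: le_trans (prU_le Ppr _ _) => //; last by exact: measurableD.
apply: (pr_le Ppr) => //; first by apply: measurableU => //; exact: measurableD.
by move=> x Ux; have [?|?] := pselect ((\big[setU/set0]_(i < n) E i) x); [left|right].
Qed.

Lemma sprob_incr (E : nat -> set X) (A : set X) (e : R) : (forall n, measurable (E n)) ->
  measurable A -> (forall n, E n `<=` E n.+1) -> (forall n, E n `<=` A) ->
  (forall x, A x -> exists n, E n x) -> 0 < e -> exists n, pr A - e <= pr (E n).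
Proof.
move=> mE mA iE EA AE e0.
have [|||n hn] := (proj2 Spr) (fun n => A `\` E n) _ _ _ e e0.
- by move=> n; exact: measurableD.
- by move=> n x [Ax nx]; split => // /iE.
- move=> x; have [/AE [n Ex]|nA] := pselect (A x); last by exists 0 => -[].
  by exists n => -[].
exists n; move: hn; rewrite (prD Ppr)// setIidr; last exact: EA.
lra.
Qed.

Lemma sprob_decr (E : nat -> set X) (A : set X) (e : R) : (forall n, measurable (E n)) ->
  measurable A -> (forall n, E n.+1 `<=` E n) -> (forall n, A `<=` E n) ->
  (forall x, (forall n, E n x) -> A x) -> 0 < e -> exists n, pr (E n) <= pr A + e.
Proof.
move=> mE mA dE AE EA e0.
have [|||n hn] := (proj2 Spr) (fun n => E n `\` A) _ _ _ e e0.
- by move=> n; exact: measurableD.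
- by move=> n x [/dE Ex nx].
- move=> x; apply: contrapT => h; have Ax : A x.
    by apply: EA => n; apply: contrapT => nE; apply: h; exists n => -[].
  by apply: h; exists 0 => -[].
exists n; move: hn; rewrite (prD Ppr)// setIidr; last exact: AE.
lra.
Qed.

End SProb.

Section Regular.
Context {R : realType} {dX : measure_display} {X : measurableType dX} (d : X -> X -> R).
Hypotheses (hd : is_metric d) (bor : borel_space d).
Variables (pr : set X -> R) (Spr : sprob pr).
Let Ppr := proj1 Spr.
Local Notation dopen := (dopen d).
Local Notation dclosed := (dclosed d).

Lemma geo_sum_le (e : R) n : 0 <= e -> \sum_(i < n) e / 2 ^+ i.+1 <= e.
Proof.
move=> e0; suff -> : \sum_(i < n) e / 2 ^+ i.+1 = e - e / 2 ^+ n.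
  by rewrite lerBlDr lerDl divr_ge0// exprn_ge0.
elim: n => [|n ih]; first by rewrite big_ord0 expr0 divr1 subrr.
rewrite big_ord_recr/= ih exprS; field.
by rewrite expf_neq0.
Qed.

(** The sets with this property form a sigma-algebra: complements exchange the two approximants, and
    in a countable union finitely many closed sets suffice up to a small mass. Open sets belong to
    it through complements of thickenings. *)
Lemma regular A e : measurable A -> 0 < e -> exists C O, [/\ dclosed C, dopen O,
  C `<=` A, A `<=` O & pr (O `\` C) <= e].
Proof.
move=> mA; move: A mA e; suff h : measurable `<=` [set A | measurable A /\
    forall e, 0 < e -> exists C O, [/\ dclosed C, dopen O,
  C `<=` A, A `<=` O & pr (O `\` C) <= e]] by move=> A /h[].
have mo := mopen bor; have mc := mclosed bor.
move=> A /bor; apply; split; last first.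
  move=> O oO; split; first exact: mo.
  move=> e e0; pose C n := ~` thick d (~` O) n.+1%:R^-1.
  have cC n : dclosed (C n) by rewrite /dclosed setCK; exact: dopen_thick.
  have [|||||n hn] := sprob_incr Spr (E := C) (A := O) (e := e) _ _ _ _ _ e0.
  - by move=> n; exact: mc.
  - exact: mo.
  - move=> n; apply: subsetC; apply: thick_le.
    by rewrite lef_pV2 ?posrE// ler_nat.
  - by move=> n x nx; apply: contrapT => Ox; apply: nx; apply: (sub_thick hd).
  - move=> x Ox; apply: contrapT => h.
    have /(thick_cap hd) : forall n : nat, thick d (~` O) n.+1%:R^-1 x.
      by move=> n; apply: contrapT => nx; apply: h; exists n.
    by move=> /(_ _); rewrite /dclosed setCK => /(_ oO).
  have CO : C n `<=` O.
    by move=> x nx; apply: contrapT => Ox; apply: nx; apply: (sub_thick hd).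
  exists (C n), O; split=> //; rewrite (prD Ppr) ?setIidr//; [lra|exact: mo|exact: mc].
split.
- split=> // e e0; exists set0, set0; split=> //; first exact: dclosed0.
  by rewrite setD0 (pr0 Ppr) ltW.
- move=> B [mB h]; split; first exact: measurableD.
  move=> e e0; have [C [Op [cC oO CB BO hCO]]] := h e e0.
  exists (~` Op), (~` C); split.
  + by rewrite /dclosed setCK.
  + exact: cC.
  + by rewrite setTD; exact: subsetC.
  + by rewrite setTD; exact: subsetC.
  + by rewrite setDE setCK setIC -setDE.
move=> B hB; have mB n : measurable (B n) by case: (hB n).
split; first exact: bigcupT_measurable.
move=> e e0; have e20 : 0 < e / 2 by lra.
have /choice [C] : forall n, exists C, exists O, [/\ dclosed C, dopen O,
    C `<=` B n, B n `<=` O & pr (O `\` C) <= e / 2 / 2 ^+ n.+1].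
  by move=> n; apply: (hB n).2; rewrite divr_gt0// exprn_gt0.
move=> /choice [Op hCO].
have oUO : dopen (\bigcup_n Op n) by apply: dopen_bigcup => n _; case: (hCO n).
have cUC n : dclosed (\big[setU/set0]_(i < n) C i).
  elim: n => [|n ih]; first by rewrite big_ord0; exact: dclosed0.
  by rewrite big_ord_recr/=; apply: dclosedU => //; case: (hCO n).
have mC n : measurable (C n) by apply: mc; case: (hCO n).
have mO n : measurable (Op n) by apply: mo; case: (hCO n).
have mUC : measurable (\bigcup_n C n) by exact: bigcupT_measurable.
have [|||||n hn] := sprob_incr Spr (E := fun n => \big[setU/set0]_(i < n) C i)
   (A := \bigcup_n C n) (e := e / 2) _ _ _ _ _ e20.
- by move=> n; exact: mc.
- exact: mUC.
- by move=> n x h; rewrite big_ord_recr/=; left.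
- by move=> n; rewrite -bigcup_mkord => x [i _ ?]; exists i.
- by move=> x [i _ Cx]; exists i.+1; rewrite big_ord_recr/=; right.
have mfC := mc _ (cUC n).
exists (\big[setU/set0]_(i < n) C i), (\bigcup_n Op n); split=> //.
- by rewrite -bigcup_mkord => x [i _ ?]; exists i => //; case: (hCO i) => _ _ h _ _; apply: h.
- by move=> x [i _ ?]; exists i => //; case: (hCO i) => _ _ _ h _; apply: h.
have mE : measurable (\bigcup_n (Op n `\` C n)).
  by apply: bigcupT_measurable => k; exact: measurableD.
apply: le_trans (_ : pr (\bigcup_n (Op n `\` C n) `|`
   (\bigcup_n C n `\` \big[setU/set0]_(i < n) C i)) <= _).
  apply: (pr_le Ppr); [apply: measurableD => //; exact: mo|apply: measurableU => //;
    exact: measurableD|].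
  move=> x [[i _ Oi] nC]; have [Ci|nCi] := pselect (C i x); last by left; exists i.
  by right; split=> //; exists i.
apply: le_trans (prU_le Ppr _ _) _ => //; first exact: measurableD.
have -> : e = e / 2 + e / 2 by lra.
apply: lerD.
  apply: (sprob_bigcup Spr) => [k|k]; first exact: measurableD.
  apply: le_trans (geo_sum_le k (ltW e20)); apply: ler_sum => i _.
  by case: (hCO i).
rewrite (prD Ppr)// setIidr; first by lra.
by rewrite -bigcup_mkord => x [i _ ?]; exists i.
Qed.

End Regular.

(** * The entropies of a system *)

Section Dyn.
Context {R : realType} {G : countType} (mul : G -> G -> G) (one : G) (inv : G -> G)
  (Fs : nat -> {fset G}) {dX : measure_display} {X : measurableType dX}
  (d : X -> X -> R) (act : G -> X -> X).
Hypotheses (hG : is_group mul one inv) (hF : folner (R := R) mul Fs)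
  (hd : is_metric d) (cpt : dcompact d) (bor : borel_space d) (hact : is_action one d act mul).
Local Notation dball := (dball d).
Local Notation dopen := (dopen d).
Local Notation dclosed := (dclosed d).
Local Notation dF := (dF d act).

Lemma act_open g A : dopen A -> dopen (act g @^-1` A).
Proof.
move=> oA x /oA [e e0 he]; have [_ _ /(_ g x e e0) [r r0 hr]] := hact.
by exists r => // y xy; apply: he; apply: hr.
Qed.

Lemma act_meas g A : measurable A -> measurable (act g @^-1` A).
Proof.
move: A; suff h : measurable `<=` [set A | measurable (act g @^-1` A)] by [].
move=> A /bor; apply; split; last by move=> O oO; apply: (mopen bor); exact: act_open.
split => /=; first by rewrite preimage_set0.
- by move=> B mB; rewrite setTD preimage_setC; exact: measurableC.
- by move=> B mB; rewrite preimage_bigcup; exact: bigcupT_measurable.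
Qed.

Lemma dclosed_eq g h : dclosed [set x | act g x = act h x].
Proof.
move=> x /= /(d_gt0 hd); set e := d _ _ => e0; have e2 : 0 < e / 2 by lra.
have [_ _ ac] := hact; have [r r0 hr] := ac g x _ e2; have [r' r'0 hr'] := ac h x _ e2.
exists (Num.min r r'); first by rewrite lt_min r0.
move=> y; rewrite /Defs.dball /= lt_min => /andP[/hr h1 /hr' h2] yy.
have := dT hd (act g y) (act g x) (act h x); rewrite -/e yy (dC hd (act h y)).
by move: h1 h2; rewrite yy; lra.
Qed.

Lemma dsys : sys (R := R) mul one inv Fs act.
Proof.
have [a1 aM _] := hact; split=> //; first exact: act_meas.
move=> g; rewrite (_ : mkset _ = [set x | act g x = act one x]).
  exact: (mclosed bor (@dclosed_eq g one)).
by apply/seteqP; split => x /=; rewrite a1.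
Qed.

Lemma dF_le (F : {fset G}) x y e : 0 <= e ->
  (forall g, g \in F -> d (act g x) (act g y) <= e) -> dF F x y <= e.
Proof.
move=> e0 h; rewrite /Defs.dF big_seq; elim/big_rec: _ => // g m gF me.
by rewrite ge_max me andbT; exact: h.
Qed.

Lemma dF_lt (F : {fset G}) x y e : 0 < e ->
  (forall g, g \in F -> d (act g x) (act g y) < e) -> dF F x y < e.
Proof.
move=> e0 h; rewrite /Defs.dF big_seq; elim/big_rec: _ => // g m gF me.
by rewrite gt_max me andbT; exact: h.
Qed.

Lemma dF_ge (F : {fset G}) x y g : g \in F -> d (act g x) (act g y) <= dF F x y.
Proof.
move=> gF; have {gF} : g \in enum_fset F by [].
rewrite /Defs.dF; elim: (enum_fset F) => // h s ih; rewrite in_cons big_cons le_max.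
by move=> /predU1P[->|/ih ->]; rewrite ?lexx// orbT.
Qed.

Lemma dF_ge0 (F : {fset G}) x y : 0 <= dF F x y.
Proof.
by rewrite /Defs.dF; elim/big_rec: _ => // g m _ m0; rewrite le_max m0 orbT.
Qed.

Lemma dFC (F : {fset G}) x y : dF F x y = dF F y x.
Proof. by rewrite /Defs.dF; apply: eq_bigr => g _; rewrite (dC hd). Qed.

Lemma open_ballF (F : {fset G}) x e : dopen (ballF d act F x e).
Proof.
have [e0|e0] := ltP 0 e; last first.
  by move=> y; rewrite /ballF /= => h; have := dF_ge0 F x y; lra.
have -> : ballF d act F x e = [set y | forall g : F, (act (fsval g) @^-1` dball (act (fsval g) x) e) y].
  apply/seteqP; split => y; rewrite /ballF /Defs.dball /= => h.
    by move=> g; apply: le_lt_trans h; apply: dF_ge; exact: fsvalP.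
  by apply: dF_lt => // g gF; exact: (h [` gF]%fset).
by apply: dopen_forall => g; apply: act_open; apply: dopen_ball.
Qed.

(** Points having two distinct images closer than [1 / (n + 1)] form sets that decrease to the empty
    set, since each point has finitely many images under [T]. *)
Lemma thick_act_small (T : seq G) (pr : set X -> R) (e : R) : sprob pr -> 0 < e ->
  exists2 r : R, 0 < r & exists Bad, [/\ measurable Bad, pr Bad <= e & forall x, ~ Bad x ->
    forall g h, g \in T -> h \in T -> act g x <> act h x -> r <= d (act g x) (act h x)].
Proof.
move=> Spr e0; have Ppr := proj1 Spr.
pose I := 'I_(size T); pose t (i : I) := tnth (in_tuple T) i.
pose D n := [set x | exists2 ij : I * I, act (t ij.1) x <> act (t ij.2) x &
  d (act (t ij.1) x) (act (t ij.2) x) < n.+1%:R^-1].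
have mD n : measurable (D n).
  rewrite (_ : D n = \bigcup_(ij in [set: I * I])
     ((~` [set x | act (t ij.1) x = act (t ij.2) x]) `&`
      [set x | d (act (t ij.1) x) (act (t ij.2) x) < n.+1%:R^-1])).
    apply: fin_bigcup_measurable => [|ij _]; first exact: finite_finset.
    apply: measurableI; first by apply: measurableC; exact: (mclosed bor (@dclosed_eq _ _)).
    apply: (mopen bor).
    move=> x /=; set g := t _; set h := t _; set a := d _ _; set b := n.+1%:R^-1 => ab.
    have c0 : 0 < (b - a) / 2 by lra.
    have [_ _ ac] := hact; have [r r0 hr] := ac g x _ c0; have [r' r'0 hr'] := ac h x _ c0.
    exists (Num.min r r'); first by rewrite lt_min r0.
    move=> y; rewrite /Defs.dball /= lt_min => /andP[/hr h1 /hr' h2].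
    have := dT hd (act g x) (act g y) (act h y); have := dT hd (act h x) (act g x) (act h y).
    by rewrite -/a (dC hd (act g y) (act g x)); lra.
  apply/seteqP; split => x.
    by move=> [ij h1 h2]; exists ij.
  by move=> [ij _ [h1 h2]]; exists ij.
have [||n hn] := (proj2 Spr) D mD _ _ e e0.
- move=> n x [ij h1 h2]; exists ij => //; apply: lt_le_trans h2 _.
  by rewrite lef_pV2 ?posrE// ler_nat.
- move=> x; suff [n hn] : exists n : nat, forall ij : I * I, act (t ij.1) x <> act (t ij.2) x ->
      n.+1%:R^-1 <= d (act (t ij.1) x) (act (t ij.2) x).
    by exists n => -[ij /hn h1]; rewrite ltNge h1.
  have [||r r0 hr] := @fin_small R (I * I)%type (fun ij r => act (t ij.1) x <> act (t ij.2) x ->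
      r <= d (act (t ij.1) x) (act (t ij.2) x)).
  + by move=> ij r r' rr h /h; exact: le_trans.
  + move=> ij; have [->|ne] := pselect (act (t ij.1) x = act (t ij.2) x); first by exists 1.
    by exists (d (act (t ij.1) x) (act (t ij.2) x)) => //; exact: (d_gt0 hd).
  by have [n hn] := natSinv_lt r0; exists n => ij /hr; apply: le_trans; exact: ltW.
exists n.+1%:R^-1; first by rewrite invr_gt0.
exists (D n); split=> // x nD g h gT hT.
have /tnthP[i ->] : g \in in_tuple T by [].
have /tnthP[j ->] : h \in in_tuple T by [].
move=> ne.
by rewrite leNgt; apply/negP => lt; apply: nD; exists (i, j).
Qed.

Lemma dseparating (pr : set X -> R) : sprob pr -> separating act pr.
Proof.
move=> Spr T e e0; have [r r0 [Bad [mB hB h]]] := thick_act_small T Spr e0.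
have [I [f [mf hf]]] := fine_map hd cpt bor r0.
exists I, f, Bad; split=> // x nB g g' gT g'T ne; apply/eqP => /hf.
by have := h x nB g g' gT g'T ne; lra.
Qed.

Lemma hent_eq (pr : set X -> R) (T U : finType) (f : X -> T) (g : X -> U) : iprob act pr ->
  mfin f -> dpd f g -> dpd g f -> hent act pr f = hent act pr g.
Proof.
move=> Ip mf fg gf; have Ppr := proj1 Ip; have [a1 _ _] := hact.
have mg : mfin g := mfin_dpd mf fg.
have one_dpd (V W : finType) (p : X -> V) (q : X -> W) : dpd p q -> dpd (nm act p [:: one]) q.
  by move=> pq; apply: dpd_nm => x y /(_ _ (mem_head _ _)); rewrite !a1; exact: pq.
apply/eqP; rewrite eq_le; apply/andP; split.
  exact: (hent_dpd dsys Ip mg (one_dpd _ _ _ _ gf)).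
exact: (hent_dpd dsys Ip mf (one_dpd _ _ _ _ fg)).
Qed.

Local Notation mpr mu := (fun A => fine (mu A)).

Lemma invariant_iprob (mu : {measure set X -> \bar R}) : Defs.invariant act mu -> iprob act (mpr mu).
Proof.
move=> [mu1 imu]; split; first exact: (proj1 (sprob_meas mu1)).
by move=> g A mA; rewrite imu.
Qed.

Lemma part_map (al : seq (set X)) : is_partition al ->
  exists p : X -> 'I_(size al), mfin p /\ forall x (i : 'I_(size al)), nth set0 al i x <-> p x = i.
Proof.
move=> [mal dis cov].
have /choice [p hp] : forall x, exists i : 'I_(size al), nth set0 al i x.
  move=> x; have : [set: X] x by [].
  rewrite -cov => -[A /= Aal Ax]; have ilt : (index A al < size al)%N by rewrite index_mem.
  by exists (Ordinal ilt); rewrite /= nth_index.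
have hpi x (i : 'I_(size al)) : nth set0 al i x <-> p x = i.
  split=> [h|<-//]; apply/val_inj/eqP/negPn/negP => ne.
  have := dis _ _ (ltn_ord (p x)) (ltn_ord i) ne.
  by move/seteqP => -[/(_ x (conj (hp x) h))].
exists p; split=> // i; rewrite (_ : mkset _ = nth set0 al i).
  by apply: mal; exact: mem_nth.
by apply/seteqP; split => x /= /hpi.
Qed.

Lemma Hmu_joinF (mu : {measure set X -> \bar R}) (al : seq (set X)) (F : {fset G})
    (p : X -> 'I_(size al)) : isprob mu -> mfin p -> (forall x (i : 'I_(size al)), nth set0 al i x <-> p x = i) ->
  Hmu mu (joinF act F al) = ent (mpr mu) (nm act p F).
Proof.
move=> mu1 mp hp; have Ppr := proj1 (sprob_meas mu1).
pose q (x : X) : {ffun F -> 'I_(size al)} := [ffun i => p (act (fsval i) x)].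
have mq : mfin q by apply: mfin_ffun => i; apply: (mfin_act act_meas).
have -> : Hmu mu (joinF act F al) = ent (mpr mu) q.
  rewrite /Hmu /joinF /ent big_map big_enum/=; apply: eq_bigr => s _.
  congr (phi (fine (mu _))); apply/seteqP; split => x /= h.
    by apply/ffunP => i; rewrite ffunE; apply/hp; exact: h.
  by move=> i; apply/hp; rewrite -h ffunE.
apply: (H_eq Ppr) => //.
- exact: (mfin_nm act_meas).
- move=> x y /nmP h; apply/ffunP => i; rewrite !ffunE; apply: h; exact: fsvalP.
- move=> x y /ffunP h; apply/nmP => g gF.
  by have := h [` gF]%fset; rewrite !ffunE.
Qed.

(** [hent_cvg] shows that the [limn] in [hpart] is a genuine limit. *)
Lemma hpartE (mu : {measure set X -> \bar R}) (al : seq (set X)) (p : X -> 'I_(size al)) :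
  Defs.invariant act mu -> mfin p -> (forall x (i : 'I_(size al)), nth set0 al i x <-> p x = i) ->
  hpart act Fs mu al = (hent act (mpr mu) p)%:E.
Proof.
move=> imu mp hp; rewrite /hpart; congr (_%:E).
have := hent_cvg dsys (invariant_iprob imu) mp => /cvg_lim <-//.
by congr (limn _); apply/funext => n; rewrite (Hmu_joinF (Fs n) (proj1 imu) mp hp).
Qed.

Lemma part_of_map (T : finType) (f : X -> T) : mfin f ->
  is_partition [seq [set x | f x = t] | t <- enum T].
Proof.
move=> mf; split.
- by move=> A /mapP[t _ ->]; exact: mf.
- move=> i j; rewrite size_map => il jl ij; apply/seteqP; split => // x [].
  have [t0 _] : exists t0, t0 \in enum T.
    by case: (enum T) il => // t s _; exists t; rewrite mem_head.
  rewrite (nth_map t0 _ _ il) (nth_map t0 _ _ jl) /= => -> /eqP; rewrite nth_uniq ?enum_uniq// => /eqP ij'.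
  by rewrite ij' eqxx in ij.
- apply/seteqP; split => // x _; exists [set y | f y = f x] => //=.
  by apply/mapP; exists (f x); rewrite ?mem_enum.
Qed.

Lemma hpart_of_map (mu : {measure set X -> \bar R}) (T : finType) (f : X -> T) :
  Defs.invariant act mu -> mfin f ->
  hpart act Fs mu [seq [set x | f x = t] | t <- enum T] = (hent act (mpr mu) f)%:E.
Proof.
move=> imu mf; have [p [mp hp]] := part_map (part_of_map mf).
rewrite (hpartE imu mp hp); congr (_%:E); have Ip := invariant_iprob imu.
have pf x y : nth set0 [seq [set x | f x = t] | t <- enum T] (p y) x <-> f x = f y.
  have := (hp y (p y)).2 erefl; have il := ltn_ord (p y); rewrite [X in (_ < X)%N]size_map in il.
  by rewrite (nth_map (f x) _ _ il) /= => ->.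
apply: hent_eq => // x y.
  by move=> pxy; apply/pf; apply/hp.
by move=> fxy; apply/hp; apply/pf.
Qed.

Definition near_le (e : R) (T : Type) (f : X -> T) : Prop := forall x y, f x = f y -> d x y <= e.

Lemma diam_leP (A : set X) (e : R) : (diam d A <= e%:E)%E <->
  forall x y, A x -> A y -> d x y <= e.
Proof.
split=> [h x y Ax Ay|h].
  rewrite -lee_fin; apply: le_trans h; apply: ereal_sup_ubound.
  by exists x => //; exists y.
by apply: ge_ereal_sup => _ [x Ax [y Ay <-]]; rewrite lee_fin; exact: h.
Qed.

Lemma hE1a_le (mu : {measure set X -> \bar R}) e (T : finType) (f : X -> T) :
  Defs.invariant act mu -> mfin f -> near_le e f ->
  (hE1a d act Fs mu e <= (hent act (mpr mu) f)%:E)%E.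
Proof.
move=> imu mf nf; rewrite -(hpart_of_map imu mf); apply: ereal_inf_lbound.
exists [seq [set x | f x = t] | t <- enum T] => //; split; first exact: part_of_map.
by move=> A /mapP[t _ ->]; apply/diam_leP => x y /= <- /esym; exact: nf.
Qed.

Lemma hE1a_ge (mu : {measure set X -> \bar R}) e b : Defs.invariant act mu ->
  (forall (T : finType) (f : X -> T), mfin f -> near_le e f -> b <= hent act (mpr mu) f) ->
  (b%:E <= hE1a d act Fs mu e)%E.
Proof.
move=> imu h; apply: le_ereal_inf_tmp => _ [al [pal dal] <-].
have [p [mp hp]] := part_map pal; rewrite (hpartE imu mp hp) lee_fin; apply: h => // x y pxy.
have /diam_leP := dal _ (mem_nth set0 (ltn_ord (p x))); apply; apply/hp => //.
Qed.

Definition idx_cover (U : seq (set X)) (i : 'I_(size U)) : set X := nth set0 U i.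

Lemma E1a_le_E1b mu e : Defs.invariant act mu -> (hE1a d act Fs mu e <= hE1b d act Fs mu e)%E.
Proof.
move=> imu; apply: le_ereal_inf_tmp => _ [U [oU dU] <-].
apply: le_ereal_inf => _ [al [pal ral] <-]; exists al => //; split => // A /ral [B BU AB].
by apply/diam_leP => x y Ax Ay; have /diam_leP := dU B BU; apply; exact: AB.
Qed.

(** Balls of radius [e / 2] around an [e / 4]-net; this realises the pair of diameter [e] and
    Lebesgue number [e / 4] in [hE1c]. *)
Lemma ball_cover (e : R) : 0 < e -> exists U, [/\ is_ocover d U, diam_le d U e &
  forall x, exists2 B, B \in U & dball x (e / 4) `<=` B].
Proof.
move=> e0; have e4 : 0 < e / 4 by lra.
have [s hs] := net hd cpt e4; exists [seq dball x (e / 2) | x <- s].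
have lb x : exists2 B, B \in [seq dball x (e / 2) | x <- s] & dball x (e / 4) `<=` B.
  have [y ys yx] := hs x; exists (dball y (e / 2)); first by apply/mapP; exists y.
  by move=> z; rewrite /Defs.dball /= => xz; have := dT hd x y z; lra.
split=> //.
  split; first by move=> A /mapP[x _ ->]; exact: dopen_ball.
  by apply/seteqP; split => // x _; have [B BU hB] := lb x; exists B => //; apply/hB/dball_center.
move=> A /mapP[x _ ->]; apply/diam_leP => y z; rewrite /Defs.dball /= => h1 h2.
by have := dT hd x y z; rewrite (dC hd y x); lra.
Qed.

Lemma E1b_le_E1c mu e : 0 < e -> (hE1b d act Fs mu e <= hE1c d act Fs mu e)%E.
Proof.
move=> e0; have [U [oU dU lU]] := ball_cover e0.
apply: (@le_trans _ _ (hcover act Fs mu U)); first by apply: ereal_inf_lbound; exists U.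
apply: ereal_sup_ubound; exists U => //; split => //.
by apply: ereal_sup_ubound; exists (e / 4) => //; split => //; lra.
Qed.

Lemma E1c_le_E1d mu e : (hE1c d act Fs mu e <= hE1d d act Fs mu (e / 4))%E.
Proof. by apply: le_ereal_sup => _ [U [oU _ lU] <-]; exists U. Qed.

(** A cell of diameter below [del] lies in the [del]-ball around any of its points; an empty cell
    fits in any element of [U]. *)
Lemma hcover_le_E1a mu U del e : Defs.invariant act mu -> e < del ->
  (forall x, exists2 B, B \in U & dball x del `<=` B) ->
  (hcover act Fs mu U <= hE1a d act Fs mu e)%E.
Proof.
move=> imu ed lU; apply: le_ereal_inf => _ [al [pal dal] <-]; exists al => //; split=> // A Aal.
have [x0] := fprob_inh (proj1 (invariant_iprob imu)).
have [[x Ax]|ne] := pselect (exists x, A x); last first.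
  by have [B BU _] := lU x0; exists B => // y Ay; case: ne; exists y.
have [B BU hB] := lU x; exists B => // y Ay; apply: hB.
by rewrite /Defs.dball /=; have /diam_leP/(_ x y Ax Ay) := dal A Aal; lra.
Qed.

(** The scale is halved because the supremum [leb] need not be attained. *)
Lemma E1d_le_E1a mu e : Defs.invariant act mu -> 0 < e ->
  (hE1d d act Fs mu e <= hE1a d act Fs mu (e / 2))%E.
Proof.
move=> imu e0; apply: ge_ereal_sup => _ [U [_ lU] <-].
have : ((e / 2)%:E < leb d U)%E by apply: lt_le_trans lU; rewrite lte_fin; lra.
move=> /ereal_sup_gt [_ [del [del0 hdel] <-]]; rewrite lte_fin => h.
exact: hcover_le_E1a hdel.
Qed.

End Dyn.

(** * Limits of measures along ultrafilters *)

Section Ultra.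
Context {R : realType} (U : set_system nat) (UU : UltraFilter U) (oU : \oo `<=` U).
Implicit Types (u v : nat -> R) (l : R).

Definition ulim u : R := lim (u n @[n --> U]).

(** By compactness the image filter has a cluster point, and an ultrafilter converges to its cluster
    points. *)
Lemma ulim_cvg u (M : R) : (forall n, `|u n| <= M) -> u n @[n --> U] --> ulim u.
Proof.
move=> hu; have [|l [_ hl]] := @segment_compact R (- M) M (u n @[n --> U]) _.
  suff : U [set n | `[- M, M]%classic (u n)] by [].
  by apply: filterE => n; rewrite /= in_itv/= -ler_norml.
suff ul : u n @[n --> U] --> l by rewrite /ulim (cvg_lim _ ul).
move=> V lV; have [//|nV] := in_ultra_setVsetC (u @^-1` V) UU.
by have [x [Vx nVx]] := hl (~` V) V nV lV.
Qed.

Lemma ulim_of_cvg u l : u n @[n --> U] --> l -> ulim u = l.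
Proof. by move=> ul; rewrite /ulim (cvg_lim _ ul). Qed.

Lemma cvg_U_le u l c : u n @[n --> U] --> l -> U [set n | u n <= c] -> l <= c.
Proof. by move=> hu h; exact: (cvgr_to_le hu h). Qed.

Lemma cvg_U_ge u l c : u n @[n --> U] --> l -> U [set n | c <= u n] -> c <= l.
Proof. by move=> hu h; exact: (cvgr_to_ge hu h). Qed.

Context {dX : measure_display} {X : measurableType dX}.
Variables (m : nat -> set X -> R) (Pm : forall n, fprob (m n)).

Definition ulim_pr (A : set X) : R := ulim (fun n => m n A).

Lemma ulim_pr_cvg A : measurable A -> m n A @[n --> U] --> ulim_pr A.
Proof.
move=> mA; apply: (@ulim_cvg _ 1) => n.
by rewrite ger0_norm ?(pr_ge0 (Pm n))// (pr_le1 (Pm n)).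
Qed.

Lemma ulim_fprob : fprob ulim_pr.
Proof.
split.
- apply: ulim_of_cvg; under eq_cvg => n do rewrite (prT (Pm n)).
  exact: cvg_cst.
- move=> A mA; apply: cvg_U_ge (ulim_pr_cvg mA) _.
  by apply: filterE => n; exact: (pr_ge0 (Pm n)).
- move=> A B mA mB AB; apply: ulim_of_cvg.
  under eq_cvg => n do rewrite (prU (Pm n) mA mB AB).
  by apply: cvgD; exact: ulim_pr_cvg.
Qed.

Lemma phi_cvg_U u l : (forall n, 0 <= u n <= 1) -> u n @[n --> U] --> l ->
  phi (u n) @[n --> U] --> phi l.
Proof.
move=> hu ul; have l0 : 0 <= l.
  by apply: cvg_U_ge ul _; apply: filterE => n; case/andP: (hu n).
have l1 : l <= 1.
  by apply: cvg_U_le ul _; apply: filterE => n; case/andP: (hu n).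
apply/cvgrPdist_le => e e0.
have e2 : 0 < (e / 2) ^+ 2 by rewrite exprn_gt0//; lra.
move/cvgrPdist_le : ul => /(_ _ e2); apply: filterS => n /= h.
have /andP[u0 u1] := hu n; apply: le_trans (phi_dist l0 l1 u0 u1) _.
have -> : e = 2 * (e / 2) by lra.
rewrite ler_pM2l//; have -> : e / 2 = Num.sqrt ((e / 2) ^+ 2).
  by rewrite sqrtr_sqr ger0_norm//; lra.
exact: ler_wsqrtr.
Qed.

Lemma ent_cvg_U (T : finType) (f : X -> T) : mfin f ->
  ent (m n) f @[n --> U] --> ent ulim_pr f.
Proof.
move=> mf; rewrite /ent; elim: (index_enum T) => [|t s ih].
  by rewrite big_nil; under eq_cvg => n do rewrite big_nil; exact: cvg_cst.
rewrite big_cons; under eq_cvg => n do rewrite big_cons.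
apply: cvgD => //; apply: phi_cvg_U.
  by move=> n; rewrite (law_ge0 (Pm n))// (law_le1 (Pm n)).
exact: ulim_pr_cvg.
Qed.

End Ultra.

(** * Measures from finitely additive limits *)

Section WeakLimit.
Context {R : realType} {dX : measure_display} {X : measurableType dX} (d : X -> X -> R).
Hypotheses (hd : is_metric d) (cpt : dcompact d) (bor : borel_space d).
Local Notation dopen := (dopen d).
Local Notation dclosed := (dclosed d).
Variables (m : set X -> R) (Pm : fprob m).
Let mo := mopen bor. Let mc := mclosed bor.

(** The value that the new measure will have on open sets. Closed sets inside are compact, which is
    what reduces countable unions to finite ones. *)
Definition itau (A : set X) : R := sup [set m C | C in [set C | dclosed C /\ C `<=` A]].

Let itau_has_sup A : has_sup [set m C | C in [set C | dclosed C /\ C `<=` A]].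
Proof.
split; first by exists (m set0), set0 => //; split => //; exact: dclosed0.
by exists 1 => _ [C [cC _] <-]; apply: (pr_le1 Pm); exact: mc.
Qed.

Lemma itau_ge A C : dclosed C -> C `<=` A -> m C <= itau A.
Proof. by move=> cC CA; apply: ub_le_sup; [exact: (itau_has_sup A).2|exists C]. Qed.

Lemma itau_le A c : (forall C, dclosed C -> C `<=` A -> m C <= c) -> itau A <= c.
Proof.
move=> h; apply: ge_sup; first exact: (itau_has_sup A).1.
by move=> _ [C [cC CA] <-]; exact: h.
Qed.

Lemma itau_near A e : 0 < e -> exists C, [/\ dclosed C, C `<=` A & itau A - e <= m C].
Proof.
move=> e0; have [_ [C [cC CA] <-] h] := sup_adherent e0 (itau_has_sup A).
by exists C; split=> //; exact: ltW.
Qed.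

Lemma itau_mono A B : A `<=` B -> itau A <= itau B.
Proof. by move=> AB; apply: itau_le => C cC CA; apply: itau_ge => //; exact: subset_trans AB. Qed.

Lemma itau_ge0 A : 0 <= itau A.
Proof. by rewrite -(pr0 Pm); apply: itau_ge => //; exact: dclosed0. Qed.

Lemma itau_le_m A : dopen A -> itau A <= m A.
Proof. by move=> oA; apply: itau_le => C cC CA; apply: (pr_le Pm); [exact: mc|exact: mo|]. Qed.

Lemma itauT : itau setT = 1.
Proof.
apply/eqP; rewrite eq_le; apply/andP; split.
  by rewrite -(prT Pm); apply: itau_le_m; exact: dopenT.
by rewrite -(prT Pm); apply: itau_ge => //; exact: dclosedT.
Qed.

(** A Lebesgue number of the cover by [A], [B] and the complement of [C] splits a closed [C] into
    closed pieces inside [A] and inside [B]. *)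
Lemma itauU A B : dopen A -> dopen B -> itau (A `|` B) <= itau A + itau B.
Proof.
move=> oA oB; apply: itau_le => C cC CAB.
have [||r r0 hr] := lebesgue_number hd cpt (C := [set V | [\/ V = A, V = B | V = ~` C]]).
- by move=> V [->|->|->].
- apply/seteqP; split=> // x _; have [/CAB [Ax|Bx]|nC] := pselect (C x).
  + by exists A => //; apply: Or31.
  + by exists B => //; apply: Or32.
  + by exists (~` C) => //; apply: Or33.
pose K (V : set X) := C `&` ~` thick d (~` V) r.
have cK V : dclosed (K V) by apply: dclosedI => //; rewrite /dclosed setCK; exact: dopen_thick.
have KV V : K V `<=` V.
  by move=> x [Cx nx]; apply: contrapT => Vx; apply: nx; exact: (sub_thick hd).
have key x V : dball d x r `<=` V -> ~ thick d (~` V) r x.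
  by move=> h [c nc cx]; apply: nc; apply: h; rewrite /dball /= (dC hd).
have CK : C `<=` K A `|` K B.
  move=> x Cx; have [V [->|->|->] h] := hr x.
  - by left; split => //; exact: key.
  - by right; split => //; exact: key.
  - by have := h x (dball_center hd x r0).
apply: le_trans (_ : m (K A `|` K B) <= _).
  by apply: (pr_le Pm) => //; apply: mc => //; exact: dclosedU.
apply: le_trans (prU_le Pm _ _) _; [exact: mc|exact: mc|].
by apply: lerD; apply: itau_ge.
Qed.

Lemma itau_bigU (A : nat -> set X) n : (forall i, dopen (A i)) ->
  itau (\big[setU/set0]_(i < n) A i) <= \sum_(i < n) itau (A i).
Proof.
move=> oA; suff : dopen (\big[setU/set0]_(i < n) A i) /\
    itau (\big[setU/set0]_(i < n) A i) <= \sum_(i < n) itau (A i) by case.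
elim: n => [|n [ih1 ih2]].
  rewrite !big_ord0; split; first exact: dopen0.
  by rewrite -(pr0 Pm); apply: itau_le_m; exact: dopen0.
rewrite !big_ord_recr/=; split; first exact: dopenU.
by apply: le_trans (itauU ih1 (oA n)) _; exact: lerD.
Qed.

Lemma itauD A K : dclosed K -> K `<=` A -> itau (A `\` K) <= itau A - m K.
Proof.
move=> cK KA; apply: itau_le => C cC CAK; rewrite lerBrDr.
rewrite -(prU Pm); [|exact: mc|exact: mc|].
  by apply: itau_ge; [exact: dclosedU|move=> x [/CAK[]|/KA]].
by apply/seteqP; split => // x [/CAK[_ h] /h].
Qed.

Lemma itau_disj A B : A `&` B = set0 -> itau A + itau B <= itau (A `|` B).
Proof.
move=> AB; apply/ler_addgt0Pr => e e0; have e2 : 0 < e / 2 by lra.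
have [C [cC CA hC]] := itau_near A e2; have [D [cD DB hD]] := itau_near B e2.
have : m (C `|` D) <= itau (A `|` B) by apply: itau_ge; [exact: dclosedU|exact: setUSS].
rewrite (prU Pm); [lra|exact: mc|exact: mc|].
by apply/seteqP; split => // x [/CA Ax /DB Bx]; rewrite -AB.
Qed.

(** Outer regularisation of [itau]. It lies below [m] on open sets and above [m] on closed sets, the
    two inequalities of a weak limit. *)
Definition wlim (A : set X) : R := inf [set itau V | V in [set V | dopen V /\ A `<=` V]].

Let wlim_has_inf A : has_inf [set itau V | V in [set V | dopen V /\ A `<=` V]].
Proof.
split; first by exists (itau setT), setT => //; split => //; exact: dopenT.
by exists 0 => _ [C _ <-]; exact: itau_ge0.
Qed.

Lemma wlim_le A V : dopen V -> A `<=` V -> wlim A <= itau V.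
Proof. by move=> oV AV; apply: ge_inf; [exact: (wlim_has_inf A).2|exists V]. Qed.

Lemma wlim_ge A c : (forall V, dopen V -> A `<=` V -> c <= itau V) -> c <= wlim A.
Proof.
move=> h; apply: lb_le_inf; first exact: (wlim_has_inf A).1.
by move=> _ [V [oV AV] <-]; exact: h.
Qed.

Lemma wlim_near A e : 0 < e -> exists V, [/\ dopen V, A `<=` V & itau V <= wlim A + e].
Proof.
move=> e0; have [_ [V [oV AV] <-] h] := inf_adherent e0 (wlim_has_inf A).
by exists V; split=> //; exact: ltW.
Qed.

Lemma wlim_open A : dopen A -> wlim A = itau A.
Proof.
move=> oA; apply/eqP; rewrite eq_le wlim_le//=.
by apply: wlim_ge => V _ ; exact: itau_mono.
Qed.

Lemma wlim_ge0 A : 0 <= wlim A.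
Proof. by apply: wlim_ge => V _ _; exact: itau_ge0. Qed.

(** The sigma-algebra argument of [regular], carried out before [wlim] is known to be additive: for
    countable unions, compactness of [K] takes the place of continuity from below. *)
Lemma wlim_reg A e : measurable A -> 0 < e -> exists C V, [/\ dclosed C, dopen V,
  C `<=` A, A `<=` V & itau (V `\` C) <= e].
Proof.
move=> mA; move: e; suff h : measurable `<=` [set A | forall e, 0 < e -> exists C V,
    [/\ dclosed C, dopen V, C `<=` A, A `<=` V & itau (V `\` C) <= e]] by exact: h.
move=> {mA}A /bor; apply; split; last first.
  move=> V oV e e0; have [C [cC CV hC]] := itau_near V e0.
  by exists C, V; split=> //; have := itauD cC CV; lra.
split.
- move=> e e0; exists set0, set0; split=> //; first exact: dclosed0.
  rewrite setD0; apply: le_trans (ltW e0); rewrite -(pr0 Pm); apply: itau_le_m; exact: dopen0.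
- move=> B h e e0; have [C [V [cC oV CB BV hCV]]] := h e e0.
  exists (~` V), (~` C); split.
  + by rewrite /dclosed setCK.
  + exact: cC.
  + by rewrite setTD; exact: subsetC.
  + by rewrite setTD; exact: subsetC.
  + by rewrite setDE setCK setIC -setDE.
move=> B hB e e0; have e20 : 0 < e / 2 by lra.
have /choice [C] : forall n, exists C, exists V, [/\ dclosed C, dopen V,
    C `<=` B n, B n `<=` V & itau (V `\` C) <= e / 2 / 2 ^+ n.+1].
  by move=> n; apply: hB; rewrite divr_gt0// exprn_gt0.
move=> /choice [V hCV].
have cC n : dclosed (C n) by case: (hCV n).
have oV n : dopen (V n) by case: (hCV n).
have oUV : dopen (\bigcup_n V n) by apply: dopen_bigcup.
have [K [cK KV hK]] := itau_near (\bigcup_n V n) e20.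
have [|||n hn] := @compact_seq _ _ _ _ cpt (fun n => K `\` \big[setU/set0]_(i < n) V i).
- move=> n; rewrite setDE; apply: dclosedI => //; rewrite /dclosed setCK -bigcup_mkord.
  exact: dopen_bigcup.
- by move=> n x [Kx nx]; split => // h; apply: nx; rewrite big_ord_recr/=; left.
- move=> x; have [/KV [i _ Vi]|nK] := pselect (K x); last by exists 0 => -[].
  by exists i.+1 => -[_]; apply; rewrite big_ord_recr/=; right.
have Kn : K `<=` \big[setU/set0]_(i < n) V i.
  by move=> x Kx; apply: contrapT => nx; have : set0 x by rewrite -hn.
have cUC k : dclosed (\big[setU/set0]_(i < k) C i).
  elim: k => [|k ih]; first by rewrite big_ord0; exact: dclosed0.
  by rewrite big_ord_recr/=; apply: dclosedU.
have oVC i : dopen (V i `\` C i) by rewrite setDE; apply: dopenI => //; exact: cC.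
exists (\big[setU/set0]_(i < n) C i), (\bigcup_n V n); split=> //.
- by rewrite -bigcup_mkord => x [i _ ?]; exists i => //; case: (hCV i) => _ _ h _ _; apply: h.
- by move=> x [i _ ?]; exists i => //; case: (hCV i) => _ _ _ h _; apply: h.
apply: le_trans (_ : itau ((\bigcup_n V n `\` K) `|` \big[setU/set0]_(i < n) (V i `\` C i)) <= _).
  apply: itau_mono => x [Vx nC]; have [Kx|?] := pselect (K x); last by left.
  right; move: (Kn x Kx) nC; rewrite -!bigcup_mkord -(bigcup_mkord n (fun i => V i `\` C i)).
  move=> -[i /= il Vi] nC; exists i => //.
  by split=> // Ci; apply: nC; exists i.
apply: le_trans (itauU _ _) _.
- by rewrite setDE; apply: dopenI.
- by rewrite -(bigcup_mkord n (fun i => V i `\` C i)); exact: dopen_bigcup.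
have -> : e = e / 2 + e / 2 by lra.
apply: lerD; first by have := itauD cK KV; lra.
apply: le_trans (itau_bigU n oVC) _.
apply: le_trans (geo_sum_le n (ltW e20)); apply: ler_sum => i _.
by case: (hCV i).
Qed.

(** Additivity: closed cores of disjoint sets are disjoint and compact, hence have disjoint
    thickenings. Continuity at the empty set: finitely many closed cores already have empty
    intersection, so [D n] lies in the union of the approximation errors. *)
Lemma wlim_sprob : sprob wlim.
Proof.
split; first split.
- by rewrite wlim_open ?itauT//; exact: dopenT.
- by move=> A _; exact: wlim_ge0.
- move=> A B mA mB AB; apply/eqP; rewrite eq_le; apply/andP; split.
    apply/ler_addgt0Pr => e e0; have e2 : 0 < e / 2 by lra.
    have [V [oV AV hV]] := wlim_near A e2; have [W [oW BW hW]] := wlim_near B e2.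
    apply: le_trans (wlim_le (dopenU oV oW) (setUSS AV BW)) _.
    by have := itauU oV oW; lra.
  apply: wlim_ge => W oW ABW; apply/ler_addgt0Pr => e e0; have e2 : 0 < e / 2 by lra.
  have [C [V [cC oV CA AV hV]]] := wlim_reg mA e2.
  have [C' [V' [cC' oV' CB BV' hV']]] := wlim_reg mB e2.
  have CC : C `&` C' = set0.
    by apply/seteqP; split => // x [/CA Ax /CB Bx]; rewrite -AB.
  have [r r0 hr] := closed_disj hd cpt cC cC' CC.
  have h1 : wlim A <= itau (W `&` thick d C r) + e / 2.
    apply: le_trans (wlim_le (V := (W `&` thick d C r) `|` (V `\` C)) _ _) _.
    - apply: dopenU; first by apply: dopenI => //; exact: dopen_thick.
      by rewrite setDE; apply: dopenI.
    - move=> x Ax; have [Cx|nC] := pselect (C x); last by right; split => //; exact: AV.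
      by left; split; [apply: ABW; left|exact: (sub_thick hd)].
    apply: le_trans (itauU _ _) _; last exact: lerD.
      by apply: dopenI => //; exact: dopen_thick.
    by rewrite setDE; apply: dopenI.
  have h2 : wlim B <= itau (W `&` thick d C' r) + e / 2.
    apply: le_trans (wlim_le (V := (W `&` thick d C' r) `|` (V' `\` C')) _ _) _.
    - apply: dopenU; first by apply: dopenI => //; exact: dopen_thick.
      by rewrite setDE; apply: dopenI.
    - move=> x Ax; have [Cx|nC] := pselect (C' x); last by right; split => //; exact: BV'.
      by left; split; [apply: ABW; right|exact: (sub_thick hd)].
    apply: le_trans (itauU _ _) _; last exact: lerD.
      by apply: dopenI => //; exact: dopen_thick.
    by rewrite setDE; apply: dopenI.
  have : itau (W `&` thick d C r) + itau (W `&` thick d C' r) <= itau W.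
    apply: le_trans (itau_disj _) _.
      apply/seteqP; split => // x [[_ h] [_ h']].
      by have : (thick d C r `&` thick d C' r) x by []; rewrite hr.
    by apply: itau_mono => x [[]|[]].
  lra.
move=> D mD dD eD e e0.
have /choice [C] : forall n, exists C, exists V, [/\ dclosed C, dopen V,
    C `<=` D n, D n `<=` V & itau (V `\` C) <= e / 2 ^+ n.+1].
  by move=> n; apply: wlim_reg => //; rewrite divr_gt0// exprn_gt0.
move=> /choice [V hCV].
have cC n : dclosed (C n) by case: (hCV n).
have oV n : dopen (V n) by case: (hCV n).
have CD n : C n `<=` D n by case: (hCV n).
have oVC i : dopen (V i `\` C i) by rewrite setDE; apply: dopenI => //; exact: cC.
have [|||n hn] := @compact_seq _ _ _ _ cpt (fun n => ~` \big[setU/set0]_(i < n.+1) (~` C i)).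
- by move=> n; rewrite /dclosed setCK -(bigcup_mkord n.+1 (fun i => ~` C i)); apply: dopen_bigcup => i _; exact: cC.
- by move=> n; apply: subsetC => x h; rewrite big_ord_recr/=; left.
- move=> x; have [i nD] := eD x; exists i; apply; rewrite big_ord_recr/=; right.
  by move=> /CD.
exists n; apply: le_trans (geo_sum_le n.+1 (ltW e0)).
apply: le_trans (_ : itau (\big[setU/set0]_(i < n.+1) (V i `\` C i)) <= _).
  apply: wlim_le; first by rewrite -(bigcup_mkord n.+1 (fun i => V i `\` C i)); exact: dopen_bigcup.
  move=> x Dx; rewrite -(bigcup_mkord n.+1 (fun i => V i `\` C i)).
  have : (\big[setU/set0]_(i < n.+1) (~` C i)) x.
    by apply: contrapT => h; have : set0 x by rewrite -hn.
  rewrite -(bigcup_mkord n.+1 (fun i => ~` C i)) => -[i /= il nC]; exists i => //; split => //.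
  case: (hCV i) => _ _ _ h _; apply: h; apply: (decr_le dD) Dx.
  by rewrite -ltnS.
apply: le_trans (itau_bigU n.+1 oVC) _; apply: ler_sum => i _.
by case: (hCV i).
Qed.

Lemma wlim_le_open A : dopen A -> wlim A <= m A.
Proof. by move=> oA; rewrite wlim_open//; exact: itau_le_m. Qed.

Lemma wlim_ge_closed A : dclosed A -> m A <= wlim A.
Proof.
move=> cA; have := wlim_le_open cA; rewrite (prC Pm (mc cA)) (prC (proj1 wlim_sprob) (mc cA)).
lra.
Qed.

Lemma wlim_inv_le (h k : X -> X) A : cancel k h ->
  (forall V, dopen V -> dopen (h @^-1` V)) -> (forall V, dopen V -> dopen (k @^-1` V)) ->
  (forall B, measurable B -> m (k @^-1` B) = m B) -> wlim (h @^-1` A) <= wlim A.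
Proof.
move=> kh oh ok mk; apply: wlim_ge => V oV AV.
apply: le_trans (wlim_le (oh _ oV) _) _; first by move=> x /AV.
apply: itau_le => C cC CV; rewrite -mk; last exact: mc.
apply: itau_ge; first exact: (ok _ cC).
by move=> x /CV; rewrite /preimage /= kh.
Qed.

End WeakLimit.
Lemma eq_ler {disp : Order.disp_t} {T : porderType disp} (x y : T) : x = y -> (x <= y)%O.
Proof. by move=> ->. Qed.

(** * Semicontinuity of entropy relative to a cover *)

Section LawClose.
Context {R : realType}.

(** [p] nearly dominates [a] along [io]; as both have total mass 1, [p] is close to [a] there and
    almost zero elsewhere, and [phi_dist] applies to each term. *)
Lemma law_close (I I' : finType) (io : I -> I') (a : I -> R) (p : I' -> R) (del : R) :
  injective io -> (forall i, 0 <= a i) -> (forall i, 0 <= p i) ->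
  \sum_i a i = 1 -> \sum_i p i = 1 -> 0 <= del -> (forall i, a i - del <= p (io i)) ->
  \sum_i phi (p i) <= \sum_i phi (a i) + #|I'|%:R * (2 * Num.sqrt (#|I|%:R * del)).
Proof.
move=> io_inj a0 p0 a1 p1 d0 h.
have sub_inj (P : pred I) : \sum_(i | P i) p (io i) <= \sum_(i' in [set io i | i in P]%SET) p i'.
  rewrite big_imset//=; last by move=> x y _ _; exact: io_inj.
have le1 (i : I') (P : pred I) : (forall j, P j -> io j != i) -> p i + \sum_(j | P j) p (io j) <= 1.
  move=> hP; rewrite -p1 (bigD1 i)//= lerD2l; apply: le_trans (sub_inj P) _.
  rewrite [leRHS]big_mkcond [leLHS]big_mkcond; apply: ler_sum => k _.
  case: ifPn => [/imsetP[j Pj ->]|_]; first by rewrite hP.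
  by case: ifP.
have sumd (P : pred I) : \sum_(j | P j) a j - #|I|%:R * del <= \sum_(j | P j) p (io j).
  apply: le_trans (_ : \sum_(j | P j) (a j - del) <= _); last exact: ler_sum.
  rewrite sumrB lerD2l lerN2 big_mkcond.
  apply: le_trans (_ : \sum_(j : I) del <= _); first by apply: ler_sum => j _; case: ifP.
  by rewrite sumr_const mulr_natl.
have pi_le1 i : p i <= 1 by have := le1 i pred0 (fun _ => ltac:(done)); rewrite big_pred0// addr0.
have ai_le1 i : a i <= 1 by rewrite -a1 (bigD1 i)//= lerDl sumr_ge0.
rewrite [\sum_i phi (a i)](partition_big io xpredT)//=.
rewrite mulr_natl -sumr_const -big_split/=; apply: ler_sum => i' _.
have D0 : 0 <= #|I|%:R * del by rewrite mulr_ge0.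
have key x : 0 <= x -> x <= 1 -> `|p i' - x| <= #|I|%:R * del ->
    phi (p i') <= phi x + 2 * Num.sqrt (#|I|%:R * del).
  move=> x0 x1 hx; have := phi_dist (p0 i') (pi_le1 i') x0 x1.
  rewrite ler_norml => /andP[_ h1]; have := ler_wsqrtr hx; lra.
have [[i ii]|ne] := pselect (exists i, io i = i').
  rewrite (big_pred1 i); last first.
    by move=> j /=; rewrite -ii; apply/eqP/eqP => [/io_inj|->].
  apply: key => //; rewrite -ii.
  have h1 := le1 (io i) (predC1 i) (fun j ji => ltac:(by rewrite (inj_eq io_inj))).
  have h2 := sumd (predC1 i); move: a1; rewrite (bigD1 i)//= => a1.
  rewrite ler_norml; apply/andP; split; last by lra.
  have := h i; suff : del <= #|I|%:R * del by lra.
  by rewrite ler_peMl// ler1n; apply/card_gt0P; exists i.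
rewrite big_pred0; last by move=> j /=; apply/negP => /eqP ji; apply: ne; exists j.
rewrite -phi0; apply: key => //; rewrite subr0 ger0_norm//.
have := le1 i' xpredT; have := sumd xpredT; rewrite a1 => h2 h1.
have /h1 : forall j : I, true -> io j != i' by move=> j _; apply/eqP => ji; apply: ne; exists j.
lra.
Qed.

End LawClose.

Section Usc.
Context {R : realType} {G : countType} {dX : measure_display} {X : measurableType dX}
  (d : X -> X -> R) (act : G -> X -> X).
Hypotheses (hd : is_metric d) (cpt : dcompact d) (bor : borel_space d)
  (ao : forall g A, dopen d A -> dopen d (act g @^-1` A))
  (mact : forall g A, measurable A -> measurable (act g @^-1` A)).
Local Notation dopen := (dopen d).
Local Notation dclosed := (dclosed d).
Variables (m mu : set X -> R) (Pm : fprob m) (Smu : sprob mu) (imu : inv_pr act mu)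
  (mum : forall A, dopen A -> mu A <= m A).
Variables (J : finType) (U : J -> set X) (oU : forall j, dopen (U j)) (cU : forall x, exists j, U j x).
Let Pmu := proj1 Smu.

(** Each cell is shrunk to a closed set, then thickened to an open one, still disjoint from the
    others and inside one element of [U]. Masses of open sets compare in the direction [mum]; points
    outside all the [V t] are labelled by the cover. *)
Lemma ent_usc (T : finType) (f : X -> T) (K : seq G) (e : R) : mfin f -> sub_cover U f -> 0 < e ->
  exists (T' : finType) (f' : X -> T'), [/\ mfin f', sub_cover U f' &
    ent m (nm act f' K) <= ent mu (nm act f K) + e].
Proof.
move=> mf sf e0; have mo := mopen bor; have mc := mclosed bor.
have [x0] := fprob_inh Pmu.
have /choice [sig hsig] : forall t, exists j, forall y, f y = t -> U j y.
  move=> t; have [[x fx]|ne] := pselect (exists x, f x = t).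
    by have [j hj] := sf x; exists j => y fy; apply: hj; rewrite fy.
  by have [j _] := cU x0; exists j => y fy; case: ne; exists y.
pose T' : finType := (T + option J)%type.
pose I := {ffun 'I_(size K) -> T}; pose I' := {ffun 'I_(size K) -> T'}.
(* The error of [law_close] will be at most [N * (2 * c)], which is [e]. *)
pose N : R := #|I'|%:R + 1; have N0 : 0 < N by rewrite /N; have := ler0n R #|I'|; lra.
pose c := e / (2 * N); have c0 : 0 < c by rewrite divr_gt0// mulr_gt0.
pose L : R := #|I|%:R * (size K)%:R + 1.
have L0 : 0 < L by rewrite /L; have := @mulr_ge0 R _ _ (ler0n R #|I|) (ler0n R (size K)); lra.
pose tau := c ^+ 2 / L; have tau0 : 0 < tau by rewrite divr_gt0// exprn_gt0.
have /choice [C hC] : forall t, exists C, [/\ dclosed C, C `<=` [set x | f x = t] &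
    mu ([set x | f x = t] `\` C) <= tau].
  move=> t; have [C [V [cC oV CA AV h]]] := regular hd bor Smu (mf t) tau0.
  exists C; split=> //; apply: le_trans h; apply: (pr_le Pmu).
  - by apply: measurableD; [exact: mf|exact: mc].
  - by apply: measurableD; [exact: mo|exact: mc].
  - exact: setSD.
have cC t : dclosed (C t) by case: (hC t).
have CA t : C t `<=` [set x | f x = t] by case: (hC t).
have [||r r0 hr] := @fin_small R (T * T)%type (fun st r => st.1 != st.2 ->
   thick d (C st.1) r `&` thick d (C st.2) r = set0).
- move=> [s t] r r' /= rr h /h hst; apply/seteqP; split => // x [h1 h2]; rewrite -hst.
  by split; [exact: thick_le h1|exact: thick_le h2].
- move=> [s t] /=; have [->|st] := eqVneq s t; first by exists 1.
  have [|r r0 h] := closed_disj hd cpt (cC s) (cC t); last by exists r.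
  apply/seteqP; split => // x [/CA /= fs /CA /= ft]; by rewrite -fs -ft eqxx in st.
pose V t := thick d (C t) r `&` U (sig t).
have oV t : dopen (V t) by apply: dopenI => //; exact: dopen_thick.
have CV t : C t `<=` V t.
  by move=> x Cx; split; [exact: (sub_thick hd)|apply: hsig; exact: CA].
have dV s t x : V s x -> V t x -> s = t.
  move=> [hs _] [ht _]; apply/eqP/negPn/negP => st.
  by have : set0 x by rewrite -(hr (s, t) st).
pose p x := [pick t | `[<V t x>]]; pose q x := [pick j | `[<U j x>]].
pose f' x : T' := if p x is Some t then inl t else inr (q x).
have pV t x : V t x -> p x = Some t.
  rewrite /p => Vt; case: pickP => [s /asboolP Vs|/(_ t)]; first by rewrite (dV s t x).
  by case: asboolP.
have mf' : mfin f'.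
  apply: (@mfin_dpd _ _ _ _ (fun x => ([ffun t => `[<V t x>]], [ffun j => `[<U j x>]]))).
    by apply: mfin_pair; apply: mfin_ffun => j; apply: mfin_set; exact: mo.
  move=> x y [/ffunP h1 /ffunP h2]; rewrite /f'.
  have -> : p x = p y by apply: eq_pick => t; have := h1 t; rewrite !ffunE.
  by have -> : q x = q y by apply: eq_pick => t; have := h2 t; rewrite !ffunE.
have sf' : sub_cover U f'.
  move=> x; case px : (p x) => [t|].
    exists (sig t) => y; rewrite /f' px; rewrite /p; case: pickP => // s /asboolP [_ Us] [<-] //.
  have [j Uj] := cU x; case qx : (q x) => [k|]; last first.
    by move: qx; rewrite /q; case: pickP => // /(_ j); case: asboolP.
  exists k => y; rewrite /f' px qx; case: (p y) => // -[].
  by rewrite /q; case: pickP => // i /asboolP Ui [<-].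
exists T', f'; split=> //.
have mnf := mfin_nm mact (s := K) mf; have mnf' := mfin_nm mact (s := K) mf'.
pose io (et : I) : I' := [ffun i => inl (et i)].
have io_inj : injective io.
  by move=> x y /ffunP h; apply/ffunP => i; have := h i; rewrite !ffunE => -[].
have del0 : 0 <= (size K)%:R * tau by rewrite mulr_ge0// ltW.
have close (et : I) : plaw mu (nm act f K) et - (size K)%:R * tau <= plaw m (nm act f' K) (io et).
  pose k i := tnth (in_tuple K) i.
  pose Oe := [set x | forall i, (act (k i) @^-1` V (et i)) x].
  have oO : dopen Oe by apply: dopen_forall => i; apply: ao.
  apply: le_trans (_ : m Oe <= _); last first.
    apply: (pr_le Pm); [exact: mo|exact: mnf'|].
    by move=> x h; apply/ffunP => i; rewrite !ffunE /f' (pV (et i))//; exact: h.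
  apply: le_trans (mum oO).
  (* A point with name [et] outside [Oe] has some position in a cell minus its closed core. *)
  pose Bi i := act (k i) @^-1` ([set x | f x = et i] `\` C (et i)).
  have mBi i : measurable (Bi i).
    by apply: mact; apply: measurableD; [exact: mf|exact: mc].
  have hB (r' : seq 'I_(size K)) : mu (\big[setU/set0]_(i <- r') Bi i) <= (size r')%:R * tau /\
      measurable (\big[setU/set0]_(i <- r') Bi i).
    elim: r' => [|i s [ih1 ih2]]; first by rewrite big_nil (pr0 Pmu) mul0r.
    rewrite big_cons; split; last exact: measurableU.
    apply: le_trans (prU_le Pmu (mBi i) ih2) _; rewrite /= -[(size s).+1%:R]natr1.
    rewrite mulrDl mul1r addrC; apply: lerD => //.
    rewrite imu; last by apply: measurableD; [exact: mf|exact: mc].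
    by case: (hC (et i)).
  have [] := hB (enum 'I_(size K)); rewrite size_enum_ord => hB1 hB2; rewrite lerBlDr.
  apply: le_trans (_ : mu (Oe `|` \big[setU/set0]_(i <- enum 'I_(size K)) Bi i) <= _); last first.
    apply: le_trans (prU_le Pmu (mo _ oO) hB2) _; exact: lerD.
  apply: (pr_le Pmu); [exact: mnf|by apply: measurableU => //; exact: mo|].
  move=> x /ffunP hx; have [?|nO] := pselect (Oe x); [by left|right].
  have [i nV] : exists i, ~ V (et i) (act (k i) x).
    by apply: contrapT => h; apply: nO => i; apply: contrapT => nV; apply: h; exists i.
  have Bx : Bi i x.
    split => /=; first by have := hx i; rewrite ffunE.
    by move=> /CV.
  have : i \in enum 'I_(size K) by rewrite mem_enum.
  elim: (enum _) => // j s ih; rewrite in_cons big_cons => /predU1P[<-|/ih]; by [left|right].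
have := law_close io_inj (fun et => law_ge0 Pmu et mnf) (fun et => law_ge0 Pm et mnf')
  (sum_law Pmu mnf) (sum_law Pm mnf') del0 close.
move/le_trans; apply; rewrite lerD2l.
have hs : Num.sqrt (#|I|%:R * ((size K)%:R * tau)) <= c.
  rewrite -[leRHS](ger0_norm (ltW c0)) -sqrtr_sqr; apply: ler_wsqrtr.
  rewrite mulrA /tau mulrA ler_pdivrMr// [leRHS]mulrC; apply: ler_wpM2r.
    exact: exprn_ge0 (ltW c0).
  by rewrite /L lerDl.
have hN : #|I'|%:R <= N by rewrite /N lerDl.
apply: le_trans (_ : N * (2 * c) <= _).
  by apply: ler_pM => //; rewrite ler_pM2l.
rewrite /c; apply: eq_ler; field; lra.
Qed.

Lemma hent_ge (pr : set X -> R) (g0 : G) (T : finType) (f : X -> T) b :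
  (forall K : {fset G}, K != fset0 -> b * #|` K|%:R <= ent pr (nm act f K)) ->
  b <= hent act pr f.
Proof.
move=> hb; apply: lb_le_inf.
  have n0 : [fset g0]%fset != fset0 by apply/fset0Pn; exists g0; rewrite inE.
  by eexists; exists [fset g0]%fset.
move=> _ [K K0 <-]; rewrite ler_pdivlMr ?ltr0n ?cardfs_gt0//; exact: hb.
Qed.

(** The hypothesis concerns all maps subordinate to [U], because the map [f'] of [ent_usc] varies
    with [K] and [e]. *)
Lemma hent_usc (g0 : G) b : (forall (T : finType) (f : X -> T) (K : {fset G}), mfin f -> sub_cover U f ->
    K != fset0 -> b * #|` K|%:R <= ent m (nm act f K)) ->
  forall (T : finType) (f : X -> T), mfin f -> sub_cover U f -> b <= hent act mu f.
Proof.
move=> hb T f mf sf; apply: (hent_ge g0) => K K0.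
apply/ler_addgt0Pr => e e0; have [T' [f' [mf' sf' h]]] := ent_usc K mf sf e0.
exact: le_trans (hb _ _ _ mf' sf' K0) h.
Qed.

End Usc.

(** * Averages of probabilities *)

Section Averages.
Context {R : realType} {dX : measure_display} {X : measurableType dX}.

Definition avgpr (I : Type) (s : seq I) (p : I -> set X -> R) (A : set X) : R :=
  (size s)%:R^-1 * \sum_(i <- s) p i A.

Section avgpr.
Variables (I : eqType) (s : seq I) (p : I -> set X -> R).
Hypotheses (s0 : s != [::]) (Pp : forall i, i \in s -> fprob (p i)).

Let sz : 0 < (size s)%:R :> R. Proof. by rewrite ltr0n lt0n size_eq0. Qed.

Lemma avgpr_fprob : fprob (avgpr s p).
Proof.
split.
- rewrite /avgpr big_seq (eq_bigr (fun=> 1)) -?big_seq; last by move=> i /Pp /prT.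
  by rewrite sum_const_seq mulr1 mulVf// gt_eqF.
- move=> A mA; rewrite mulr_ge0 ?invr_ge0// big_seq sumr_ge0// => i /Pp Pi.
  exact: (pr_ge0 Pi).
- move=> A B mA mB AB; rewrite /avgpr -mulrDr -big_split/=; congr (_ * _).
  by rewrite big_seq [RHS]big_seq; apply: eq_bigr => i /Pp Pi; exact: (prU Pi).
Qed.

Lemma avgpr_le A c : (forall i, i \in s -> p i A <= c) -> avgpr s p A <= c.
Proof.
move=> h; rewrite /avgpr mulrC ler_pdivrMr//.
rewrite big_seq; apply: le_trans (_ : \sum_(i <- s | i \in s) c <= _); first exact: ler_sum.
by rewrite -big_seq sum_const_seq mulrC.
Qed.

(** Gibbs' inequality for each [p i] against the averaged law. *)
Lemma ent_concave (T : finType) (f : X -> T) : mfin f ->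
  \sum_(i <- s) ent (p i) f <= (size s)%:R * ent (avgpr s p) f.
Proof.
move=> mf; have Pa := avgpr_fprob.
pose q t := plaw (avgpr s p) f t.
have hq i t : i \in s -> 0 < plaw (p i) f t -> 0 < q t.
  move=> is_ h; rewrite /q /plaw /avgpr mulr_gt0 ?invr_gt0//.
  rewrite (big_rem i is_)/=; apply: ltr_wpDr => //.
  rewrite big_seq sumr_ge0// => j /mem_rem /Pp Pj; exact: (pr_ge0 Pj).
apply: le_trans (_ : \sum_(i <- s) - \sum_t plaw (p i) f t * ln (q t) <= _).
  rewrite big_seq [leRHS]big_seq; apply: ler_sum => i is_; apply: (H_gibbs (Pp is_)) => //.
  - by move=> t; exact: (law_ge0 Pa).
  - by move=> t; exact: hq.
  - by rewrite (sum_law Pa).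
apply: eq_ler; rewrite sumrN exchange_big/= /ent mulr_sumr -sumrN; apply: eq_bigr => t _.
rewrite -mulr_suml /phi mulrN; congr (- _); rewrite mulrA; congr (_ * _).
by rewrite /q /plaw /avgpr mulrA divff ?mul1r// gt_eqF.
Qed.

End avgpr.

Definition pdirac (x : X) (A : set X) : R := (`[<A x>])%:R.

Lemma pdirac_fprob x : fprob (pdirac x).
Proof.
split; rewrite /pdirac.
- by have -> : `[<[set: X] x>] = true by apply/asboolP.
- by move=> A _; rewrite ler0n.
- move=> A B _ _ AB; case: (asboolP (A x)) => Ax; case: (asboolP (B x)) => Bx.
  + by have : set0 x by rewrite -AB.
  + by rewrite addr0; case: asboolP => // -[]; left.
  + by rewrite add0r; case: asboolP => // -[]; right.
  + by rewrite addr0; case: asboolP => // -[].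
Qed.

(** Injectivity on [s] bounds every value of the law by the inverse of [size s]. *)
Lemma ent_uniform (s : seq X) (T : finType) (f : X -> T) : s != [::] -> uniq s -> mfin f ->
  {in s &, injective f} -> ln (size s)%:R <= ent (avgpr s pdirac) f.
Proof.
move=> s0 us mf injf.
have Pa := avgpr_fprob s0 (fun i _ => pdirac_fprob i).
have sz : 0 < (size s)%:R :> R by rewrite ltr0n lt0n size_eq0.
rewrite -[leLHS]mul1r -[X in X * _](sum_law Pa mf) mulr_suml /ent; apply: ler_sum => t _.
have q0 := law_ge0 Pa t mf; have q1 : plaw (avgpr s pdirac) f t <= (size s)%:R^-1.
  rewrite /plaw /avgpr ler_piMr ?invr_ge0// /pdirac -natr_sum lern1.
  rewrite -big_mkcond/= sum1_count -size_filter.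
  case E : [seq x <- s | `[<[set x0 | f x0 = t] x>]] => [//|x [//|y r]].
  have ux : uniq [:: x, y & r] by rewrite -E filter_uniq.
  have : x \in [:: x, y & r] by rewrite mem_head.
  have : y \in [:: x, y & r] by rewrite !in_cons eqxx orbT.
  rewrite -E !mem_filter => /andP[/asboolP /= fy ys] /andP[/asboolP /= fx xs].
  by move: ux; rewrite (injf x y) ?fx ?fy//= in_cons eqxx.
move: q0; rewrite le_eqVlt => /predU1P[<-|q0]; first by rewrite mul0r phi0.
rewrite /phi -mulrN; apply: ler_wpM2l; first exact: ltW.
by rewrite -lnV ?posrE// ler_ln ?posrE ?invr_gt0// -[leLHS]invrK lef_pV2 ?posrE ?invr_gt0.
Qed.

End Averages.

Section AvgAct.
Context {R : realType} {G : countType} (mul : G -> G -> G) (one : G) (inv : G -> G)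
  (Fs : nat -> {fset G}) {dX : measure_display} {X : measurableType dX} (act : G -> X -> X).
Hypothesis Sy : sys (R := R) mul one inv Fs act.
Let hG := sysG Sy. Let hF := sysF Sy. Let mact := sys_mact Sy. Let actM := sysM Sy.

Definition avgact (F : {fset G}) (pr : set X -> R) : set X -> R :=
  avgpr F (fun k A => pr (act k @^-1` A)).

Lemma push_fprob (pr : set X -> R) g : fprob pr -> fprob (fun A => pr (act g @^-1` A)).
Proof.
move=> Ppr; split.
- by rewrite preimage_setT (prT Ppr).
- by move=> A mA; apply: (pr_ge0 Ppr); exact: mact.
- move=> A B mA mB AB; rewrite preimage_setU (prU Ppr)//; [exact: mact|exact: mact|].
  by rewrite -preimage_setI AB preimage_set0.
Qed.

Lemma avgact_fprob (F : {fset G}) (pr : set X -> R) : fprob pr -> F != fset0 -> fprob (avgact F pr).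
Proof.
move=> Ppr F0; apply: avgpr_fprob; last by move=> g _; exact: push_fprob.
by rewrite -size_eq0; rewrite -cardfs_eq0 in F0.
Qed.

Lemma avgact_shift (F : {fset G}) (pr : set X -> R) g A : fprob pr -> measurable A ->
  \sum_(k <- F) pr (act k @^-1` (act g @^-1` A)) <=
  \sum_(k <- F) pr (act k @^-1` A) + #|` bdl mul [:: g] F|%:R.
Proof.
move=> Ppr mA.
have E k : act k @^-1` (act g @^-1` A) = act (mul g k) @^-1` A.
  by apply/seteqP; split => x /=; rewrite actM.
under eq_bigr => k _ do rewrite E.
pose u h := pr (act h @^-1` A).
have u0 h : 0 <= u h by apply: (pr_ge0 Ppr); exact: mact.
have u1 h : u h <= 1 by apply: (pr_le1 Ppr); exact: mact.
rewrite -/(u _) (eq_bigr (fun k => u (mul g k))) // [X in _ <= X + _](eq_bigr u)//.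
rewrite (bigID (fun k => mul g k \in F))/=; apply: lerD.
  rewrite -big_filter -(big_map (mul g) xpredT u).
  have us : uniq [seq mul g k | k <- [seq i <- F | mul g i \in F]].
    by rewrite map_inj_uniq ?filter_uniq ?fset_uniq//; exact: mul_injl hG g.
  have sub : {subset [seq mul g k | k <- [seq i <- F | mul g i \in F]] <= enum_fset F}.
    by move=> h /mapP[k]; rewrite mem_filter => /andP[gk _] ->.
  rewrite [leRHS](bigID (mem [seq mul g k | k <- [seq i <- F | mul g i \in F]]))/=.
  rewrite -[leLHS]addr0 lerD// ?sumr_ge0// -[leRHS]big_filter; apply: eq_ler; apply: perm_big.
  apply: uniq_perm => //; first by rewrite filter_uniq// fset_uniq.
  move=> h; rewrite mem_filter; apply/idP/andP => [hh|[]//]; split => //; exact: sub.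
apply: le_trans (_ : \sum_(k <- F | mul g k \notin F) (1 : R) <= _); first exact: ler_sum.
rewrite -big_filter sum_const_seq mulr1 ler_nat.
rewrite -[leqLHS](size_map (mul g)); apply: uniq_leq_size.
  by rewrite map_inj_uniq ?filter_uniq ?fset_uniq//; exact: mul_injl hG g.
move=> h /mapP[k]; rewrite mem_filter => /andP[ngk kF] ->.
by apply: bdlP => //; rewrite mem_head.
Qed.

Lemma avgact_asym (F : {fset G}) (pr : set X -> R) g A e : fprob pr -> measurable A ->
  F != fset0 -> #|` bdl mul [:: g] F|%:R <= e * #|` F|%:R ->
  avgact F pr (act g @^-1` A) <= avgact F pr A + e.
Proof.
move=> Ppr mA F0 he; have Fp : 0 < #|` F|%:R :> R by rewrite ltr0n cardfs_gt0.
rewrite /avgact /avgpr mulrC ler_pdivrMr// mulrDl mulrAC mulVf ?gt_eqF// mul1r.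
have h := @avgact_shift F pr g A Ppr mA.
by apply: le_trans h _; rewrite lerD2l.
Qed.

(** The averages are invariant up to the density of the [g]-boundary. One inequality suffices, since
    applying it to the inverse of [g] gives the other. *)
Lemma ulim_invariant (U : set_system nat) (UU : UltraFilter U) (oU : \oo `<=` U)
    (ph : nat -> nat) (sg : nat -> set X -> R) : (forall n, (n <= ph n)%N) ->
  (forall n, fprob (sg n)) ->
  inv_pr act (ulim_pr U (fun n => avgact (Fs (ph n)) (sg n))).
Proof.
move=> hph Psg; set m := fun n => _; have Pm n : fprob (m n).
  by apply: avgact_fprob => //; exact: (Fs_neq0 hF).
have le1 g A : measurable A -> ulim_pr U m (act g @^-1` A) <= ulim_pr U m A.
  move=> mA; apply/ler_addgt0Pr => e e0; have mgA : measurable (act g @^-1` A) by exact: mact.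
  have h1 := ulim_pr_cvg UU Pm mgA; have h2 := ulim_pr_cvg UU Pm mA.
  have h3 : (m n (act g @^-1` A) - m n A) @[n --> U] --> ulim_pr U m (act g @^-1` A) - ulim_pr U m A.
    exact: cvgB.
  have : ulim_pr U m (act g @^-1` A) - ulim_pr U m A <= e; last by lra.
  apply: (cvg_U_le UU h3); apply: oU.
  have [N _ hN] := folner_bdl hF [:: g] e0; exists N => // n /= Nn.
  have := avgact_asym (Psg n) mA (Fs_neq0 hF (ph n)) (hN (ph n) (leq_trans Nn (hph n))).
  by rewrite -/(m n); lra.
move=> g A mA; apply/eqP; rewrite eq_le le1//=.
have := le1 (inv g) (act g @^-1` A) (mact g mA).
suff -> : act (inv g) @^-1` (act g @^-1` A) = A by [].
by apply/seteqP; split => x /=; rewrite (actVK Sy).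
Qed.

End AvgAct.

(** * The maximum principle *)

Section Cond.
Context {R : realType} {G : countType} {dX : measure_display} {X : measurableType dX}
  (act : G -> X -> X).
Hypothesis mact : forall g A, measurable A -> measurable (act g @^-1` A).

Definition pcond (pr : set X -> R) (A B : set X) : R := pr (A `&` B) / pr A.

Lemma pcond_fprob (pr : set X -> R) A : fprob pr -> measurable A -> 0 < pr A -> fprob (pcond pr A).
Proof.
move=> Ppr mA A0; rewrite /pcond; split.
- by rewrite setIT divff// gt_eqF.
- by move=> B mB; rewrite divr_ge0 ?(ltW A0)//; apply: (pr_ge0 Ppr); exact: measurableI.
- move=> B C mB mC BC; rewrite -mulrDl setIUr (prU Ppr)//; [exact: measurableI|exact: measurableI|].
  by rewrite setIACA setIid BC setI0.
Qed.

Lemma pcond_sprob (pr : set X -> R) A : sprob pr -> measurable A -> 0 < pr A -> sprob (pcond pr A).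
Proof.
move=> [Ppr Spr] mA A0; split; first exact: pcond_fprob.
move=> D mD dD eD e e0.
have [|n h] := Spr D mD dD eD (e * pr A); first by rewrite mulr_gt0.
exists n; rewrite /pcond ler_pdivrMr//; apply: le_trans h; apply: (pr_le Ppr) => //.
exact: measurableI.
Qed.

Lemma pcond_inv (pr : set X -> R) A : inv_pr act pr -> measurable A ->
  (forall g, act g @^-1` A = A) -> inv_pr act (pcond pr A).
Proof.
move=> ip mA iA g B mB; rewrite /pcond; congr (_ / _).
by rewrite -{1}(iA g) -preimage_setI ip//; exact: measurableI.
Qed.

(** The map [k], constant on [A], has zero entropy and supplies the values of [b] off [A]. *)
Lemma H_ae (pr : set X -> R) (A : set X) (T U : finType) (a : X -> T) (b : X -> U) :
  fprob pr -> measurable A -> pr A = 1 -> mfin a -> mfin b ->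
  (forall x y, A x -> A y -> a x = a y -> b x = b y) -> ent pr b <= ent pr a.
Proof.
move=> Ppr mA A1 ma mb h.
pose k x : option U := if `[<A x>] then None else Some (b x).
have mk : mfin k.
  apply: (@mfin_dpd _ _ _ _ (fun x => (`[<A x>], b x))).
    by apply: mfin_pair => //; exact: mfin_set.
  by move=> x y [h1 h2]; rewrite /k h1 h2.
have Hk : ent pr k = 0.
  apply: big1 => u _; rewrite /plaw; case: u => [u|].
    suff -> : pr [set x | k x = Some u] = 0 by rewrite phi0.
    apply/eqP; rewrite eq_le; apply/andP; split; last exact: (pr_ge0 Ppr (mk _)).
    apply: le_trans (_ : pr (~` A) <= 0); last by rewrite (prC Ppr mA) A1 subrr.
    apply: (pr_le Ppr) => //; first exact: measurableC.
    by move=> x; rewrite /k /=; case: asboolP.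
  suff -> : pr [set x | k x = None] = 1 by rewrite phi1.
  by rewrite -A1; congr (pr _); apply/seteqP; split => x; rewrite /k /=; case: asboolP.
apply: le_trans (_ : ent pr (fun x => (a x, k x)) <= _).
  apply: (H_dpd Ppr); first exact: mfin_pair.
  move=> x y [axy]; rewrite /k; case: asboolP => Ax; case: asboolP => Ay //; last by case.
  by move=> _; exact: h.
by apply: le_trans (H_pair Ppr ma mk) _; rewrite Hk addr0.
Qed.

(** The excess [phi t + phi (1 - t)] is independent of [f], so it vanishes when entropies of long
    names are divided by their length. *)
Lemma ent_mix (pr p1 p2 : set X -> R) (t : R) (T : finType) (f : X -> T) :
  fprob p1 -> fprob p2 -> 0 <= t -> t <= 1 -> mfin f ->
  (forall B, measurable B -> pr B = t * p1 B + (1 - t) * p2 B) ->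
  ent pr f <= t * ent p1 f + (1 - t) * ent p2 f + (phi t + phi (1 - t)).
Proof.
move=> P1 P2 t0 t1 mf hp.
have phiM (a b : R) : 0 <= a -> 0 <= b -> phi (a * b) = a * phi b + phi a * b.
  move=> a0 b0; have [->|a1] := eqVneq a 0; first by rewrite !mul0r phi0 mul0r add0r.
  have [->|b1] := eqVneq b 0; first by rewrite mulr0 phi0 !mulr0 add0r.
  by rewrite /phi lnM ?posrE ?lt_neqAle ?a0 ?b0 ?andbT 1?eq_sym//; ring.
have -> : phi t + phi (1 - t) = \sum_u (phi t * plaw p1 f u + phi (1 - t) * plaw p2 f u).
  by rewrite big_split/= -!mulr_sumr !sum_law// !mulr1.
rewrite /ent !mulr_sumr -!big_split/=; apply: ler_sum => u _.
have t1' : 0 <= 1 - t by rewrite subr_ge0.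
have h1 := law_ge0 P1 u mf; have h2 := law_ge0 P2 u mf.
have -> : plaw pr f u = t * plaw p1 f u + (1 - t) * plaw p2 f u by rewrite /plaw hp//; exact: mf.
apply: le_trans (phiD_le _ _) _; [by rewrite mulr_ge0|by rewrite mulr_ge0|].
by rewrite !phiM//; lra.
Qed.

End Cond.

Lemma glue_arith (K : realFieldType) (t z1 z2 z3 z4 z5 z6 z7 c e e' : K) :
  t * z4 <= t * (z6 * z7) -> (1 - t) * z3 <= (1 - t) * (z5 * z7) ->
  t * (z6 * z7) <= t * ((z2 + e * 2 / 3) * z7) ->
  (1 - t) * (z5 * z7) <= (1 - t) * ((z1 + e * 2 / 3) * z7) ->
  c <= e / 3 * z7 -> 0 <= e' * z7 ->
  t * z4 + (1 - t) * z3 + c <= (t * z2 + (1 - t) * z1 + e + e') * z7.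
Proof. by move=> *; lra. Qed.

Section MaxPrinciple.
Context {R : realType} {G : countType} (mul : G -> G -> G) (one : G) (inv : G -> G)
  (Fs : nat -> {fset G}) {dX : measure_display} {X : measurableType dX}
  (d : X -> X -> R) (act : G -> X -> X).
Hypotheses (hG : is_group mul one inv) (iG : infinite_group (G := G))
  (hF : folner (R := R) mul Fs)
  (hd : is_metric d) (cpt : dcompact d) (bor : borel_space d) (hact : is_action one d act mul).
Local Notation dopen := (dopen d).
Local Notation dclosed := (dclosed d).
Let Sy := dsys hG hF hd bor hact.
Let mact := sys_mact Sy.
Let mo := mopen bor.
Let mc := mclosed bor.

Definition isprob_inv (pr : set X -> R) : Prop := sprob pr /\ inv_pr act pr.

Definition perg (pr : set X -> R) : Prop := isprob_inv pr /\
  forall A, measurable A -> (forall g, act g @^-1` A = A) -> pr A = 0 \/ pr A = 1.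

Lemma isprob_iprob pr : isprob_inv pr -> iprob act pr.
Proof. by move=> [[]]. Qed.

(** A set [Fs n] of fewer than [M] elements, invariant under a finite [T] up to the share
    [1 / (M + 1)], is exactly invariant and so contains a translate of [T], which is larger. *)
Lemma Fs_large (M : nat) : \forall n \near \oo, (M <= #|` Fs n|)%N.
Proof.
have /(infinite_set_fset M.+1) [T _ hT] : infinite_set [set: G] := iG.
have e0 : 0 < (M.+1%:R : R)^-1 by rewrite invr_gt0.
have [N _ hN] := folner_bdl hF T e0; exists N => // n /= Nn.
have := hN n Nn; rewrite mulrC ler_pdivlMr// -natrM ler_nat => h.
rewrite leqNgt; apply/negP => small.
have [h0 h0F] : exists h, h \in Fs n by apply/fset0Pn; exact: (Fs_neq0 hF).
have : #|` bdl mul T (Fs n)| = 0%N.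
  by apply/eqP; rewrite -leqn0 -ltnS -(ltn_pmul2r (ltn0Sn M)) mul1n; apply: leq_ltn_trans h (ltnW _).
move=> /eqP; rewrite cardfs_eq0 => /eqP b0.
have : (size [seq mul t h0 | t <- T] <= size (Fs n))%N.
  apply: uniq_leq_size.
    by rewrite map_inj_uniq ?fset_uniq//; exact: mul_injr hG h0.
  move=> g /mapP[t tT ->]; apply: contraT => nF.
  have tT' : t \in enum_fset T by [].
  by have := bdlP tT' h0F nF; rewrite b0 inE.
by rewrite size_map => h2; have := leq_trans hT (leq_trans h2 (ltnW small)); rewrite ltnn.
Qed.

Lemma lim_meas (m : set X -> R) : fprob m -> inv_pr act m ->
  exists mu, [/\ isprob_inv mu, (forall A, dopen A -> mu A <= m A) &
    (forall A, dclosed A -> m A <= mu A)].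
Proof.
move=> Pm im; exists (wlim d m); split; last first.
- by move=> A; exact: (wlim_ge_closed hd cpt bor Pm).
- by move=> A; exact: (wlim_le_open bor Pm).
split; first exact: wlim_sprob.
have le1 g A : wlim d m (act g @^-1` A) <= wlim d m A.
  apply: (wlim_inv_le bor Pm (k := act (inv g))).
  - exact: (actVK Sy).
  - by move=> V; exact: (act_open hact).
  - by move=> V; exact: (act_open hact).
  - by move=> B mB; exact: im.
move=> g A mA; apply/eqP; rewrite eq_le le1/=.
apply: le_trans (le1 (inv g) (act g @^-1` A)); apply: eq_ler; congr (wlim d m _).
by apply/seteqP; split => x /=; rewrite (actVK Sy).
Qed.

Lemma ultra_oo : exists U : set_system nat, UltraFilter U /\ \oo `<=` U.
Proof. exact: ultraFilterLemma. Qed.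

(** Finite unions of closed balls centred in finite nets form a countable family; they approximate
    closed sets from outside, and regularity extends the agreement to all Borel sets. *)
Lemma determining : exists C : nat -> set X, (forall k, dclosed (C k)) /\
  forall p1 p2 : set X -> R, sprob p1 -> sprob p2 -> (forall k, p1 (C k) = p2 (C k)) ->
    forall A, measurable A -> p1 A = p2 A.
Proof.
have /choice [s hs] : forall n : nat, exists s : seq X, forall x, exists2 y, y \in s & d y x < n.+1%:R^-1.
  by move=> n; apply: (net hd cpt); rewrite invr_gt0.
pose cb (x : X) (r : R) := [set y | d x y <= r].
have ccb x r : dclosed (cb x r).
  move=> y /= /negP; rewrite -ltNge => xy; exists (d x y - r); first by lra.
  by move=> z; rewrite /dball /cb /= => yz; have := dT hd z x y; rewrite (dC hd z y); lra.
pose D (nm : nat * bitseq) := \big[setU/set0]_(x <- mask nm.2 (s nm.1)) cb x nm.1.+1%:R^-1.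
have cD nm : dclosed (D nm).
  rewrite /D; elim: (mask _ _) => [|x t ih]; first by rewrite big_nil; exact: dclosed0.
  by rewrite big_cons; exact: dclosedU.
exists (fun k => oapp D set0 (choice.unpickle k)); split.
  by move=> k; case: choice.unpickle => [nm|]; [exact: cD|exact: dclosed0].
move=> p1 p2 S1 S2 h12; have P1 := proj1 S1; have P2 := proj1 S2.
have hD nm : p1 (D nm) = p2 (D nm) by have := h12 (choice.pickle nm); rewrite choice.pickleK.
have memD nm x : D nm x <-> exists2 y, y \in mask nm.2 (s nm.1) & d y x <= nm.1.+1%:R^-1.
  rewrite /D; elim: (mask _ _) => [|y t ih]; first by rewrite big_nil; split=> // -[].
  rewrite big_cons; split.
    move=> [h|/ih [z zt h]]; first by exists y; rewrite ?mem_head.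
    by exists z; rewrite // in_cons zt orbT.
  by move=> [z]; rewrite in_cons => /predU1P[->|zt] h; [left|right; apply/ih; exists z].
have closed_le (q1 q2 : set X -> R) : sprob q1 -> sprob q2 -> (forall nm, q1 (D nm) = q2 (D nm)) ->
    forall A, dclosed A -> q1 A <= q2 A.
  move=> T1 T2 hq A cA; apply/ler_addgt0Pr => e e0.
  have Q1 := proj1 T1; have Q2 := proj1 T2.
  have mth r : measurable (thick d A r) by apply: mo; exact: dopen_thick.
  have [|||||n hn] := sprob_decr T2 (E := fun n => thick d A (2 * n.+1%:R^-1)) (A := A) (e := e) _ _ _ _ _ e0.
  - by [].
  - exact: mc.
  - by move=> n; apply: thick_le; rewrite ler_pM2l// lef_pV2 ?posrE// ler_nat.
  - by move=> n; apply: (sub_thick hd); rewrite mulr_gt0// invr_gt0.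
  - move=> x h; apply: (thick_cap hd cA) => n.
    apply: thick_le (h (2 * n.+1)%N); rewrite ler_pdivrMr// ler_pdivlMl// -natrM ler_nat.
    by rewrite mulnC ltnW// ltnW.
  apply: le_trans hn.
  (* The net points within [1 / (n + 1)] of [A]: their balls cover [A] and stay inside its
     thickening by twice that radius. *)
  pose msk := [seq `[<exists2 a, A a & d x a < n.+1%:R^-1>] | x <- s n].
  have memM y : y \in mask msk (s n) <-> y \in s n /\ exists2 a, A a & d y a < n.+1%:R^-1.
    rewrite /msk -filter_mask mem_filter; split; first by move=> /andP[/asboolP].
    by move=> [-> /asboolP ->].
  apply: le_trans (_ : q1 (D (n, msk)) <= _).
    apply: (pr_le Q1); [exact: mc|apply: mc; exact: cD|].
    move=> x Ax; apply/memD; have [y ys yx] := hs n x; exists y; last exact: ltW.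
    by apply/memM; split => //; exists x.
  rewrite hq; apply: (pr_le Q2) => //; first by apply: mc; exact: cD.
  move=> x /memD [y /memM [ys [a Aa ya]] yx]; exists a => //=.
  move: ya yx => /=; have := dT hd y a x; rewrite (dC hd a y).
  by move: (n.+1%:R^-1) => r; lra.
have all_le (q1 q2 : set X -> R) : sprob q1 -> sprob q2 -> (forall nm, q1 (D nm) = q2 (D nm)) ->
    forall A, measurable A -> q1 A <= q2 A.
  move=> T1 T2 hq A mA; apply/ler_addgt0Pr => e e0.
  have Q1 := proj1 T1; have Q2 := proj1 T2.
  have [C [V [cC oV CA AV h]]] := regular hd bor T1 mA e0.
  have h1 : q1 A <= q1 C + e.
    have mVC : measurable (V `\` C) by apply: measurableD; [exact: mo|exact: mc].
    apply: le_trans (_ : q1 (C `|` (V `\` C)) <= _).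
      apply: (pr_le Q1) => //; first by apply: measurableU => //; exact: mc.
      by move=> x /AV Vx; have [?|?] := pselect (C x); [left|right].
    by apply: le_trans (prU_le Q1 (mc cC) mVC) _; rewrite lerD2l.
  have h2 := closed_le _ _ T1 T2 hq C cC.
  have h3 := pr_le Q2 (mc cC) mA CA; lra.
move=> A mA; apply/eqP; rewrite eq_le all_le//= all_le// => nm.
Qed.

Variables (J : finType) (U : J -> set X) (oU : forall j, dopen (U j))
  (cU : forall x, exists j, U j x).

(** The points of [s] are separated by the cover itself, so every map subordinate to [U] has
    distinct names on [s]. [H_cover] and concavity carry the entropy [ln (size s)] from names over
    [Fs n] to names over any fixed window [K], for all these maps at once. *)
Lemma misiurewicz (b : R) :
  (forall N, exists n (s : seq X), [/\ (N <= n)%N, uniq s, s != [::],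
     b * #|` Fs n|%:R <= ln (size s)%:R &
     forall x y, x \in s -> y \in s -> x <> y -> exists2 g, g \in Fs n &
       forall j, ~ (U j (act g x) /\ U j (act g y))]) ->
  exists2 mu, isprob_inv mu & forall (T : finType) (f : X -> T), mfin f -> sub_cover U f ->
    b <= hent act mu f.
Proof.
move=> /choice [ph /choice [s hs]].
have [V [VU oV]] := ultra_oo.
have us n : uniq (s n) by case: (hs n).
have s0 n : s n != [::] by case: (hs n).
pose sg n : set X -> R := avgpr (s n) pdirac.
have Psg n : fprob (sg n) by apply: avgpr_fprob => // x _; exact: pdirac_fprob.
pose mm n := avgact act (Fs (ph n)) (sg n).
have Pmm n : fprob (mm n) by apply: (avgact_fprob Sy) => //; exact: (Fs_neq0 hF).
have Pm := ulim_fprob VU Pmm.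
have im : inv_pr act (ulim_pr V mm).
  by apply: (ulim_invariant Sy VU oV) => // n; case: (hs n).
have [mu [Imu muo muc]] := lim_meas Pm im; exists mu => // T f mf sf.
apply: (hent_usc hd cpt bor _ mact Pm Imu.1 Imu.2 muo oU cU one) => //.
  by move=> g A; exact: (act_open hact).
move=> {T f mf sf} T f K mf sf K0; apply/ler_addgt0Pr => e e0; rewrite -lerBlDr.
have Kp : 0 < #|` K|%:R :> R by rewrite ltr0n cardfs_gt0.
apply: cvg_U_ge (ent_cvg_U VU Pmm (mfin_nm mact (s := K) mf)) _.
pose n0 : R := Num.max 1 #|T|%:R.
have n01 : 1 <= n0 by rewrite le_max lexx.
have Tn0 : #|T|%:R <= n0 by rewrite le_max lexx orbT.
have ln0 : 0 <= ln n0 by exact: ln_ge0.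
have e1 : 0 < e / (#|` K|%:R * (ln n0 + 1)) by rewrite divr_gt0// mulr_gt0//; lra.
have [N _ hN] := folner_bdl hF [seq inv k | k <- K] e1.
apply: oV; exists N => // n /= Nn; have [phn _ _ hb hsep] := hs n.
have {hN} := hN (ph n) (leq_trans Nn phn); set F := Fs (ph n) in hb hsep * => hB.
have Fp : 0 < #|` F|%:R :> R by exact: (Fs_gt0R hF).
have injf : {in s n &, injective (nm act f F)}.
  move=> x y xs ys /nmP h; apply: contrapT => xy; have [g gF nU] := hsep x y xs ys xy.
  have [j hj] := sf (act g x); apply: (nU j); split; first exact: hj.
  by apply: hj; rewrite h.
have h1 := @ent_uniform R _ _ _ _ _ (s0 n) (us n) (mfin_nm mact (s := F) mf) injf.
have h2 := H_cover Sy (Psg n) K F mf n01 Tn0.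
have Fn : (F : seq G) != [::] by rewrite -size_eq0 -lt0n -(ltr0n R).
have h3 := ent_concave Fn (fun g _ => push_fprob Sy g (Psg n)) (mfin_nm mact (s := K) mf).
have h3' : \sum_(c <- F) ent (sg n) (nm act f K \o act c) <= #|` F|%:R * ent (mm n) (nm act f K) by exact: h3.
have h4 : #|` bdl mul [seq inv k | k <- K] F|%:R * (#|` K|%:R * ln n0) <= e * #|` F|%:R.
  have Kl0 : 0 <= #|` K|%:R * ln n0 by rewrite mulr_ge0// ltW.
  apply: le_trans (ler_wpM2r Kl0 hB) _.
  rewrite mulrAC; apply: ler_wpM2r; first exact: ltW.
  rewrite mulrAC ler_pdivrMr; last by rewrite mulr_gt0//; lra.
  apply: ler_wpM2l; first exact: ltW.
  by apply: ler_wpM2l; [exact: ltW|lra].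
rewrite -(ler_pM2l Fp) /=; have := ler_wpM2l (ltW Kp) (le_trans hb h1).
move: h2 h3' h4; move: (ent _ _) (ent _ _) (\sum_(_ <- _) _) => E1 E2 S1.
by move: (#|` bdl _ _ _|%:R * _) => B1; lra.
Qed.

(** Entropy relative to the cover [U]. The infimum over all subordinate maps makes it upper
    semicontinuous, which the entropy of a single partition need not be. *)
Definition hcov (pr : set X -> R) : R :=
  inf [set h | exists (T : finType) (f : X -> T), [/\ mfin f, sub_cover U f & h = hent act pr f]].

Let mU j : measurable (U j). Proof. exact: (mo (@oU j)). Qed.

Lemma hcov_has_inf pr : isprob_inv pr -> has_inf
  [set h | exists (T : finType) (f : X -> T), [/\ mfin f, sub_cover U f & h = hent act pr f]].
Proof.
move=> /isprob_iprob Ip; split.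
  by have [T [f [mf sf]]] := sub_cover_ex mU cU; exists (hent act pr f), T, f.
by exists 0 => h [T [f [mf sf hE]]]; rewrite hE; exact: (hent_ge0 Sy Ip).
Qed.

Lemma hcov_le_hent pr (T : finType) (f : X -> T) : isprob_inv pr -> mfin f -> sub_cover U f ->
  hcov pr <= hent act pr f.
Proof. by move=> Ip mf sf; apply: ge_inf; [exact: (hcov_has_inf Ip).2|exists T, f]. Qed.

Lemma hcov_ge pr b : isprob_inv pr ->
  (forall (T : finType) (f : X -> T), mfin f -> sub_cover U f -> b <= hent act pr f) ->
  b <= hcov pr.
Proof.
move=> Ip h; apply: lb_le_inf; first exact: (hcov_has_inf Ip).1.
by move=> z [T [f [mf sf zE]]]; rewrite zE; exact: h.
Qed.

Lemma hcov_near pr e : isprob_inv pr -> 0 < e -> exists (T : finType) (f : X -> T),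
  [/\ mfin f, sub_cover U f & hent act pr f <= hcov pr + e].
Proof.
move=> Ip e0; have [z [T [f [mf sf zE]]] h] := inf_adherent e0 (hcov_has_inf Ip).
by exists T, f; split=> //; rewrite -zE; exact: ltW.
Qed.

Lemma hcov_bounded : exists M, forall pr, isprob_inv pr -> 0 <= hcov pr <= M.
Proof.
have [T [f [mf sf]]] := sub_cover_ex mU cU.
exists (ln (Num.max 1 #|T|%:R)) => pr Ip; have Jp := isprob_iprob Ip; apply/andP; split.
  by apply: hcov_ge => // T' f' mf' _; exact: (hent_ge0 Sy Jp).
apply: le_trans (hcov_le_hent Ip mf sf) _; apply: le_trans (hent_le_H Sy Jp mf) _.
by apply: (H_le_ln (proj1 Jp)) => //; rewrite le_max lexx ?orbT.
Qed.

(** Nearly optimal maps on [A] and on its complement are glued. As [A] is invariant, each orbit uses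
    only one of them, and mixing the two conditional laws costs a bounded amount, negligible because
    Folner sets grow. *)
Lemma hcov_glue pr A : isprob_inv pr -> measurable A -> (forall g, act g @^-1` A = A) ->
  0 < pr A -> pr A < 1 ->
  hcov pr <= pr A * hcov (pcond pr A) + (1 - pr A) * hcov (pcond pr (~` A)).
Proof.
move=> Ip mA iA A0 A1; have [Spr ip] := Ip; have Ppr := proj1 Spr.
have mCA := measurableC mA; have prCA := prC Ppr mA.
have CA0 : 0 < pr (~` A) by rewrite prCA subr_gt0.
have iCA g : act g @^-1` (~` A) = ~` A by rewrite -preimage_setC iA.
have I1 : isprob_inv (pcond pr A) by split; [exact: pcond_sprob|exact: pcond_inv].
have I2 : isprob_inv (pcond pr (~` A)) by split; [exact: pcond_sprob|exact: pcond_inv].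
have J1 := isprob_iprob I1; have J2 := isprob_iprob I2.
apply/ler_addgt0Pr => e e0; have e3 : 0 < e / 3 by lra.
have [T1 [f1 [mf1 sf1 h1]]] := hcov_near I1 e3; have [T2 [f2 [mf2 sf2 h2]]] := hcov_near I2 e3.
pose f x : (T1 + T2)%type := if `[<A x>] then inl (f1 x) else inr (f2 x).
have mf : mfin f.
  apply: (@mfin_dpd _ _ _ _ (fun x => (`[<A x>], (f1 x, f2 x)))).
    by apply: mfin_pair; [exact: mfin_set|exact: mfin_pair].
  by move=> x y [e1 e2 e4]; rewrite /f e1 e2 e4.
have sf : sub_cover U f.
  move=> x; rewrite {2}/f; case: asboolP => Ax.
    have [j hj] := sf1 x; exists j => y; rewrite /f; case: asboolP => // Ay [fy]; exact: hj.
  have [j hj] := sf2 x; exists j => y; rewrite /f; case: asboolP => // Ay [fy]; exact: hj.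
apply: le_trans (hcov_le_hent Ip mf sf) _.
apply: (hent_limP Sy (isprob_iprob Ip)) => // e' e'0; set t := pr A in A0 A1 prCA *.
have t0 := ltW A0; have t1 := ltW A1.
pose c := phi t + phi (1 - t); pose M := Num.bound (c / (e / 3)).
have cM : c <= e / 3 * M.+1%:R.
  rewrite mulrC -ler_pdivrMr//; apply: le_trans (_ : M%:R <= _); last by rewrite ler_nat.
  apply/ltW/archi_boundP; rewrite divr_ge0 ?(ltW e3)// addr_ge0//; first exact: phi_ge0.
  by apply: phi_ge0; lra.
have n1 := hent_near Sy J1 mf1 e3; have n2 := hent_near Sy J2 mf2 e3; have n3 := Fs_large M.+1.
near=> n; have Fp : 0 < #|` Fs n|%:R :> R by exact: (Fs_gt0R hF).
have k1 : ent (pcond pr A) (nm act f1 (Fs n)) <= (hent act (pcond pr A) f1 + e / 3) * #|` Fs n|%:R.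
  by near: n.
have k2 : ent (pcond pr (~` A)) (nm act f2 (Fs n)) <=
    (hent act (pcond pr (~` A)) f2 + e / 3) * #|` Fs n|%:R by near: n.
have k3 : (M.+1 <= #|` Fs n|)%N by near: n.
have mix : ent pr (nm act f (Fs n)) <= t * ent (pcond pr A) (nm act f (Fs n)) +
    (1 - t) * ent (pcond pr (~` A)) (nm act f (Fs n)) + c.
  apply: (ent_mix (proj1 J1) (proj1 J2)) => //; first exact: mfin_nm.
  move=> B mB; rewrite /pcond -/t prCA mulrC divfK ?gt_eqF//.
  rewrite mulrC divfK ?gt_eqF ?subr_gt0//.
  rewrite -(prU Ppr); [|exact: measurableI|exact: measurableI|].
    by rewrite -setIUl setUv setTI.
  by rewrite setIACA setICr set0I.
have actA g x : A (act g x) <-> A x by rewrite -[in X in _ <-> X](iA g).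
have l1 : ent (pcond pr A) (nm act f (Fs n)) <= ent (pcond pr A) (nm act f1 (Fs n)).
  apply: (@H_ae _ _ _ _ A) => //; [exact: (proj1 J1)| |exact: mfin_nm|exact: mfin_nm|].
    by rewrite /pcond setIid divff// gt_eqF.
  move=> x y Ax Ay /nmP h; apply/nmP => g gF; rewrite /f.
  case: asboolP => [_|/actA//]; case: asboolP => [_|/actA//]; congr inl; exact: h.
have l2 : ent (pcond pr (~` A)) (nm act f (Fs n)) <= ent (pcond pr (~` A)) (nm act f2 (Fs n)).
  apply: (@H_ae _ _ _ _ (~` A)) => //; [exact: (proj1 J2)| |exact: mfin_nm|exact: mfin_nm|].
    by rewrite /pcond setIid divff// gt_eqF.
  move=> x y Ax Ay /nmP h; apply/nmP => g gF; rewrite /f.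
  case: asboolP => [/actA//|_]; case: asboolP => [/actA//|_]; congr inr; exact: h.
have cF : c <= e / 3 * #|` Fs n|%:R.
  by apply: le_trans cM _; rewrite ler_pM2l// ler_nat.
have t1' : 0 <= 1 - t by rewrite subr_ge0.
apply: le_trans mix _.
have m1 := ler_wpM2l t0 (le_trans l1 k1); have m2 := ler_wpM2l t1' (le_trans l2 k2).
have w1 : hent act (pcond pr A) f1 + e / 3 <= hcov (pcond pr A) + e * 2 / 3 by lra.
have w2 : hent act (pcond pr (~` A)) f2 + e / 3 <= hcov (pcond pr (~` A)) + e * 2 / 3 by lra.
have w1' := ler_wpM2l t0 (ler_wpM2r (ltW Fp) w1).
have w2' := ler_wpM2l t1' (ler_wpM2r (ltW Fp) w2).
have e'F : 0 <= e' * #|` Fs n|%:R by rewrite mulr_ge0// ltW.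
exact: (glue_arith m1 m2 w1' w2' cF e'F).
Unshelve. all: by end_near. Qed.

(* A bounded strictly convex upper semicontinuous functional: adding it to [hcov] forces
   the maximizers to be ergodic. *)

Section Psi.
Variable C : nat -> set X.
Hypothesis cC : forall k, dclosed (C k).

Definition psiN (N : nat) (pr : set X -> R) : R := \sum_(k < N) pr (C k) ^+ 2 / 2 ^+ k.+1.
Definition psi (pr : set X -> R) : R := sup [set psiN N pr | N in [set: nat]].

Lemma psiN_tail pr N M : fprob pr -> psiN (N + M) pr <= psiN N pr + (1 - (2 ^+ M)^-1) / 2 ^+ N.
Proof.
move=> Ppr; elim: M => [|M ih]; first by rewrite addn0 expr0 invr1 subrr mul0r addr0.
rewrite addnS {1}/psiN big_ord_recr/= -/(psiN _ _).
have h : pr (C (N + M)) ^+ 2 / 2 ^+ (N + M).+1 <= 1 / 2 ^+ (N + M).+1.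
  rewrite ler_pM2r ?invr_gt0 ?exprn_gt0// expr_le1//; last exact: (pr_ge0 Ppr (mc (@cC _))).
  exact: (pr_le1 Ppr (mc (@cC _))).
apply: le_trans (lerD ih h) _; apply: eq_ler.
by rewrite !exprS exprD; field; rewrite !expf_neq0.
Qed.

Lemma psiN_mono pr N M : psiN N pr <= psiN (N + M) pr.
Proof.
elim: M => [|M ih]; first by rewrite addn0.
rewrite addnS /psiN big_ord_recr/= -/(psiN _ _); apply: le_trans ih _.
by rewrite lerDl mulr_ge0 ?sqr_ge0// invr_ge0 exprn_ge0.
Qed.

Lemma psiN_le1 pr N : fprob pr -> psiN N pr <= 1.
Proof.
move=> Ppr; have := psiN_tail 0 N Ppr; rewrite add0n /psiN big_ord0 add0r expr0 divr1.
by move/le_trans; apply; rewrite lerBlDr lerDl invr_ge0 exprn_ge0.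
Qed.

Let psi_has_sup pr : fprob pr -> has_sup [set psiN N pr | N in [set: nat]].
Proof.
move=> Ppr; split; first by exists (psiN 0 pr), 0%N.
by exists 1 => _ [N _ <-]; exact: psiN_le1.
Qed.

Lemma psi_ge pr N : fprob pr -> psiN N pr <= psi pr.
Proof. by move=> Ppr; apply: ub_le_sup; [exact: (psi_has_sup Ppr).2|exists N]. Qed.

Lemma psi_le pr N : fprob pr -> psi pr <= psiN N pr + (2 ^+ N)^-1.
Proof.
move=> Ppr; apply: ge_sup; first exact: (psi_has_sup Ppr).1.
move=> _ [M _ <-]; have [MN|NM] := leqP M N.
  apply: le_trans (_ : psiN N pr <= _); last by rewrite lerDl invr_ge0 exprn_ge0.
  by rewrite -(subnKC MN); exact: psiN_mono.
rewrite -(subnKC (ltnW NM)); apply: le_trans (psiN_tail _ _ Ppr) _; rewrite lerD2l.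
rewrite ler_piMl ?invr_ge0 ?exprn_ge0// lerBlDr lerDl invr_ge0 exprn_ge0//.
Qed.

Lemma psi_bound pr : fprob pr -> 0 <= psi pr <= 1.
Proof.
move=> Ppr; apply/andP; split; first by have := psi_ge 0 Ppr; rewrite /psiN big_ord0.
apply: ge_sup; first exact: (psi_has_sup Ppr).1.
by move=> _ [M _ <-]; exact: psiN_le1.
Qed.

Lemma inv_exp2_small (e : R) : 0 < e -> exists N, (2 ^+ N)^-1 <= e.
Proof.
move=> e0; have [N hN] := natSinv_lt e0; exists N; apply: le_trans (ltW hN).
rewrite lef_pV2 ?posrE ?exprn_gt0//; elim: N {hN} => [|N ih]; first by rewrite expr0.
have h : 1 <= 2 ^+ N :> R by apply: exprn_ege1; rewrite ler1n.
by rewrite exprS -[N.+2%:R]natr1; lra.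
Qed.

(** Limits of masses of closed sets are at most their masses under [mu], and the tail of the series
    is uniformly small. *)
Lemma psi_usc (V : set_system nat) (VU : UltraFilter V) (p : nat -> set X -> R) (mu : set X -> R) b :
  (forall n, fprob (p n)) -> fprob mu ->
  (forall A, dclosed A -> ulim_pr V p A <= mu A) ->
  V [set n | b <= psi (p n)] -> b <= psi mu.
Proof.
move=> Pp Pmu hC hb; apply/ler_addgt0Pr => e e0; have [N hN] := inv_exp2_small e0.
apply: le_trans (_ : psiN N mu + e <= _); last by rewrite lerD2r psi_ge.
have cv : psiN N (p n) @[n --> V] --> psiN N (ulim_pr V p).
  rewrite /psiN; elim: N {hN} => [|N ih].
    by rewrite big_ord0; under eq_cvg => n do rewrite big_ord0; exact: cvg_cst.
  rewrite big_ord_recr/=; under eq_cvg => n do rewrite big_ord_recr/=.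
  apply: cvgD => //; apply: cvgMl; rewrite expr2; under eq_cvg => n do rewrite expr2.
  by apply: cvgM; apply: (ulim_pr_cvg VU Pp); exact: (mc (@cC _)).
have : b - e <= psiN N (ulim_pr V p).
  apply: (cvg_U_ge VU cv); apply: filterS hb => n /= h.
  by have := psi_le N (Pp n); lra.
suff : psiN N (ulim_pr V p) <= psiN N mu by lra.
apply: ler_sum => k _; rewrite ler_pM2r ?invr_gt0 ?exprn_gt0// lerXn2r ?nnegrE//.
- exact: (pr_ge0 (ulim_fprob VU Pp) (mc (@cC _))).
- exact: (pr_ge0 Pmu (mc (@cC _))).
- exact: hC.
Qed.

(** The square is strictly convex with defect [t (1 - t) (x - y)^2]; the term of index [k] alone
    gives the gap [del]. *)
Lemma psi_convex (p p1 p2 : set X -> R) t k : fprob p -> fprob p1 -> fprob p2 ->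
  0 < t -> t < 1 ->
  (forall B, measurable B -> p B = t * p1 B + (1 - t) * p2 B) -> p1 (C k) <> p2 (C k) ->
  psi p < t * psi p1 + (1 - t) * psi p2.
Proof.
move=> P P1 P2 t0 t1 hp ne.
pose del := t * (1 - t) * (p1 (C k) - p2 (C k)) ^+ 2 / 2 ^+ k.+1.
have t1' : 0 < 1 - t by rewrite subr_gt0.
have d0 : 0 < del.
  rewrite divr_gt0 ?exprn_gt0// mulr_gt0//; first exact: mulr_gt0.
  by rewrite exprn_even_gt0//= subr_eq0; apply/eqP.
suff h N : (k < N)%N -> psiN N p <= t * psiN N p1 + (1 - t) * psiN N p2 - del.
  have [N0 hN0] := inv_exp2_small (divr_gt0 d0 (ltr0n R 2)).
  pose N := (N0 + k.+1)%N.
  have hN : (2 ^+ N)^-1 <= del / 2.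
    apply: le_trans hN0; rewrite lef_pV2 ?posrE ?exprn_gt0// ler_weXn2l//; last exact: leq_addr.
    by rewrite ler1n.
  have kN : (k < N)%N by rewrite /N leq_addl.
  have h1 := h N kN; have h2 := psi_le N P.
  have h3 := ler_wpM2l (ltW t0) (psi_ge N P1); have h4 := ler_wpM2l (ltW t1') (psi_ge N P2).
  lra.
move=> kN; rewrite lerBrDr /psiN.
have hk : p (C k) ^+ 2 / 2 ^+ k.+1 + del = t * (p1 (C k) ^+ 2 / 2 ^+ k.+1) + (1 - t) * (p2 (C k) ^+ 2 / 2 ^+ k.+1).
  rewrite hp; last exact: (mc (@cC _)).
  by rewrite /del; move: (p1 _) (p2 _) ((2 ^+ k.+1)^-1) => x y z; ring.
have hs : \sum_(i < N | i != Ordinal kN) p (C i) ^+ 2 / 2 ^+ i.+1 <=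
    t * \sum_(i < N | i != Ordinal kN) p1 (C i) ^+ 2 / 2 ^+ i.+1 +
    (1 - t) * \sum_(i < N | i != Ordinal kN) p2 (C i) ^+ 2 / 2 ^+ i.+1.
  rewrite !mulr_sumr -big_split/=; apply: ler_sum => i _.
  rewrite !mulrA -mulrDl ler_pM2r ?invr_gt0 ?exprn_gt0// hp; last exact: (mc (@cC _)).
  move: (p1 _) (p2 _) => x y; rewrite -subr_ge0.
  have -> : t * x * x + (1 - t) * y * y - (t * x + (1 - t) * y) ^+ 2 = t * (1 - t) * (x - y) ^+ 2.
    by ring.
  by rewrite mulr_ge0 ?sqr_ge0// mulr_ge0// ltW.
rewrite (bigD1 (Ordinal kN))//= [X in t * X](bigD1 (Ordinal kN))//=.
rewrite [X in _ <= _ + (1 - t) * X](bigD1 (Ordinal kN))//= addrAC hk !mulrDr.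
move: hs; move: (\sum_(_ < _ | _) _) (\sum_(_ < _ | _) _) (\sum_(_ < _ | _) _) => x y z.
move: (t * (_ / _)) ((1 - t) * (_ / _)) => u v; lra.
Qed.

End Psi.

(** An invariant set of intermediate mass would split a maximiser into two conditional measures, one
    of which does strictly better, by [hcov_glue] and [psi_convex]. The loss 1 is the range of
    [psi]. *)
Lemma max_principle q0 : isprob_inv q0 -> exists2 nu, perg nu & hcov q0 - 1 <= hcov nu.
Proof.
move=> I0; have [C [cC detC]] := determining.
pose W pr := hcov pr + psi C pr.
have [M hM] := hcov_bounded.
have Wb pr : isprob_inv pr -> 0 <= W pr <= M + 1.
  move=> Ip; have /andP[h1 h2] := hM _ Ip; have /andP[h3 h4] := psi_bound cC (proj1 (proj1 Ip)).
  by rewrite /W; apply/andP; split; lra.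
pose S := [set W pr | pr in isprob_inv].
have supS : has_sup S.
  split; first by exists (W q0), q0.
  by exists (M + 1) => _ [pr Ip <-]; have /andP[] := Wb _ Ip.
have /choice [p hp] : forall n : nat, exists pr, isprob_inv pr /\ sup S - n.+1%:R^-1 <= W pr.
  move=> n; have n0 : 0 < (n.+1%:R : R)^-1 by rewrite invr_gt0.
  by have [_ [pr Ip <-] h] := sup_adherent n0 supS; exists pr; split => //; exact: ltW.
have Ip n : isprob_inv (p n) by case: (hp n).
have Pp n : fprob (p n) by case: (Ip n) => -[].
have [V [VU oV]] := ultra_oo.
have Pm := ulim_fprob VU Pp.
have im : inv_pr act (ulim_pr V p).
  by move=> g A mA; rewrite /ulim_pr; congr (ulim V _); apply/funext => n; case: (Ip n) => _; apply.
have [mu [Imu muo muc]] := lim_meas Pm im.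
have bh n : `|hcov (p n)| <= M by have /andP[h1 h2] := hM _ (Ip n); rewrite ger0_norm.
have bp n : `|psi C (p n)| <= 1.
  by have /andP[h1 h2] := psi_bound cC (Pp n); rewrite ger0_norm.
have ch := ulim_cvg VU bh; have cp := ulim_cvg VU bp.
set hl := ulim _ _ in ch; set pl := ulim _ _ in cp.
have hhl : hl <= hcov mu.
  apply: hcov_ge => // T f mf sf; apply/ler_addgt0Pr => e e0; rewrite -lerBlDr.
  apply: (hent_usc hd cpt bor _ mact Pm Imu.1 Imu.2 muo oU cU one) mf sf => //.
    by move=> g A; exact: (act_open hact).
  move=> {}T {}f K mf sf K0; apply: (cvg_U_ge VU (ent_cvg_U VU Pp (mfin_nm mact (s := K) mf))).
  have : V [set n | hl - e <= hcov (p n)] by apply: (cvgr_ge _ ch); lra.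
  apply: filterS => n /= h; apply: le_trans (hent_le Sy (isprob_iprob (Ip n)) mf K0).
  by apply: ler_wpM2r => //; apply: le_trans h _; exact: hcov_le_hent.
have hpl : pl <= psi C mu.
  apply/ler_addgt0Pr => e e0; rewrite -lerBlDr.
  apply: (psi_usc cC VU Pp (proj1 (proj1 Imu)) muc).
  by apply: (cvgr_ge _ cp); lra.
have hW : sup S <= W mu.
  apply: le_trans (_ : hl + pl <= _); last exact: lerD.
  apply/ler_addgt0Pr => e e0; have [n0 hn0] := natSinv_lt e0.
  rewrite -lerBlDr; apply: (cvg_U_ge VU (cvgD ch cp)); apply: oV; exists n0 => // n /= n0n.
  have [_ h] := hp n; apply: le_trans h; rewrite lerD2l lerN2; apply: le_trans (ltW hn0).
  by rewrite lef_pV2 ?posrE// ler_nat.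
have Wmax pr : isprob_inv pr -> W pr <= W mu.
  by move=> I; apply: le_trans hW; apply: ub_le_sup; [exact: supS.2|exists pr].
exists mu; last first.
  have := Wmax _ I0; rewrite /W; have /andP[h3 h4] := psi_bound cC (proj1 (proj1 Imu)).
  by have /andP[h5 h6] := psi_bound cC (proj1 (proj1 I0)); lra.
split => // A mA iA; apply: contrapT => nA.
have Pmu := proj1 (proj1 Imu).
have A0 : 0 < mu A.
  rewrite lt_neqAle (pr_ge0 Pmu mA) andbT eq_sym; apply/eqP => h; apply: nA; by left.
have A1 : mu A < 1.
  rewrite lt_neqAle (pr_le1 Pmu mA) andbT; apply/eqP => h; apply: nA; by right.
have mCA := measurableC mA; have prCA := prC Pmu mA.
have CA0 : 0 < mu (~` A) by rewrite prCA subr_gt0.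
have iCA g : act g @^-1` (~` A) = ~` A by rewrite -preimage_setC iA.
have [Smu imu] := Imu.
have I1 : isprob_inv (pcond mu A) by split; [exact: pcond_sprob|exact: pcond_inv].
have I2 : isprob_inv (pcond mu (~` A)) by split; [exact: pcond_sprob|exact: pcond_inv].
(* The conditional measures differ on [A], hence on some member of the determining family. *)
have [k hk] : exists k, pcond mu A (C k) <> pcond mu (~` A) (C k).
  apply: contrapT => h; have : pcond mu A A = pcond mu (~` A) A.
    apply: detC => //; [by case: I1|by case: I2|].
    by move=> k; apply: contrapT => hk; apply: h; exists k.
  rewrite /pcond setIid setICl (pr0 Pmu) mul0r divff ?gt_eqF// => /eqP.
  by rewrite oner_eq0.
have hconv : psi C mu < mu A * psi C (pcond mu A) + (1 - mu A) * psi C (pcond mu (~` A)).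
  apply: (psi_convex cC Pmu (proj1 (proj1 I1)) (proj1 (proj1 I2)) A0 A1 _ hk).
  move=> B mB; rewrite /pcond prCA mulrC divfK ?gt_eqF//.
  rewrite mulrC divfK ?gt_eqF ?subr_gt0//.
  rewrite -(prU Pmu); [|exact: measurableI|exact: measurableI|].
    by rewrite -setIUl setUv setTI.
  by rewrite setIACA setICr set0I.
have hglue := hcov_glue Imu mA iA A0 A1.
have A1' : 0 <= 1 - mu A by rewrite subr_ge0 ltW.
have w1 := ler_wpM2l (ltW A0) (Wmax _ I1); have w2 := ler_wpM2l A1' (Wmax _ I2).
move: w1 w2 hconv hglue; rewrite /W; lra.
Qed.

End MaxPrinciple.

(** * The mean ergodic theorem *)

Section SumPr.
Context {R : realType} {dX : measure_display} {X : measurableType dX}.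
Variables (pr : set X -> R) (Ppr : fprob pr).

(** Integrates a finite sum of indicators through one finite-valued map, which makes sense for
    finitely additive [pr]. *)
Lemma sum_pr_law (I : Type) (s : seq I) (E : I -> set X) (Y : set X) :
  (forall i, measurable (E i)) -> measurable Y ->
  exists (T : finType) (q : X -> T) (u : T -> bool) (v : T -> R), [/\ mfin q,
    forall x, u (q x) = `[<Y x>], forall x, v (q x) = \sum_(i <- s) (`[<E i x>])%:R,
    pr Y = \sum_t plaw pr q t * (u t)%:R &
    \sum_(i <- s) pr (Y `&` E i) = \sum_t plaw pr q t * ((u t)%:R * v t)].
Proof.
move=> mE mY; elim: s => [|i s [T [q [u [v [mq hu hv hY hS]]]]]].
  exists bool, (fun x => `[<Y x>]), id, (fun _ => 0); split => //.
  - exact: mfin_set.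
  - by move=> x; rewrite big_nil.
  - rewrite -(pr_lawE Ppr (f := fun x => `[<Y x>]) id) ?mfin_set//; last exact: mfin_set.
    by congr pr; apply/seteqP; split => x /= /asboolP.
  - by rewrite big_nil big1// => t _; rewrite !mulr0.
pose q' x := (q x, `[<E i x>]); have mq' : mfin q' by apply: mfin_pair => //; exact: mfin_set.
exists (T * bool)%type, q', (fun t => u t.1), (fun t : T * bool => (t.2 : bool)%:R + v t.1); split => //.
- by move=> x; rewrite big_cons /= hv.
- rewrite -(pr_lawE Ppr (f := q') (fun t => u t.1))//.
  by congr pr; apply/seteqP; split => x /=; rewrite hu => /asboolP.
rewrite big_cons hS.
have -> : pr (Y `&` E i) = \sum_t plaw pr q' t * (u t.1 && t.2)%:R.
  rewrite -(pr_lawE Ppr (f := q') (fun t => u t.1 && t.2))//.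
  congr pr; apply/seteqP; split => x /=; rewrite hu.
    by move=> [/asboolP -> /asboolP ->].
  by move=> /andP[/asboolP ? /asboolP].
have -> : \sum_t plaw pr q t * ((u t)%:R * v t) = \sum_t plaw pr q' t * ((u t.1)%:R * v t.1).
  rewrite [RHS](partition_big fst xpredT)//=; apply: eq_bigr => t _.
  rewrite (law_comp Ppr (f := q') fst t mq') mulr_suml.
  by apply: eq_bigr => t' /eqP ->.
by rewrite -big_split/=; apply: eq_bigr => t _; case: (u t.1); case: (t.2) => /=; lra.
Qed.

Lemma sum_pr_ge (I : Type) (s : seq I) (E : I -> set X) (Y : set X) c :
  (forall i, measurable (E i)) -> measurable Y ->
  (forall x, Y x -> c <= \sum_(i <- s) (`[<E i x>])%:R) ->
  c * pr Y <= \sum_(i <- s) pr (Y `&` E i).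
Proof.
move=> mE mY h; have [T [q [u [v [mq hu hv -> ->]]]]] := sum_pr_law s mE mY.
rewrite mulr_sumr; under eq_bigr => t _ do rewrite mulrCA.
apply: (sum_law_le Ppr mq (b := fun t => c * (u t)%:R)) => x; rewrite hu hv.
by case: asboolP => Yx; rewrite ?mulr1 ?mul1r ?mulr0 ?mul0r//; exact: h.
Qed.

Lemma sum_pr_le (I : Type) (s : seq I) (E : I -> set X) (Y : set X) c :
  (forall i, measurable (E i)) -> measurable Y ->
  (forall x, Y x -> \sum_(i <- s) (`[<E i x>])%:R <= c) ->
  \sum_(i <- s) pr (Y `&` E i) <= c * pr Y.
Proof.
move=> mE mY h; have [T [q [u [v [mq hu hv -> ->]]]]] := sum_pr_law s mE mY.
rewrite mulr_sumr; under [leRHS]eq_bigr => t _ do rewrite mulrCA.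
apply: (sum_law_le Ppr mq (c := fun t => c * (u t)%:R)) => x; rewrite hu hv.
by case: asboolP => Yx; rewrite ?mulr1 ?mul1r ?mulr0 ?mul0r//; exact: h.
Qed.

End SumPr.

(** * Invariant measures dominated by an ergodic one *)

Section AbsCont.
Context {R : realType} {G : countType} {dX : measure_display} {X : measurableType dX}
  (mul : G -> G -> G) (one : G) (act : G -> X -> X).
Hypotheses (aM : forall g h x, act (mul g h) x = act g (act h x)) (a1 : forall x, act one x = x)
  (sur : forall h k, exists g, mul g h = k)
  (mact : forall g A, measurable A -> measurable (act g @^-1` A)).
Variables (m mu : set X -> R) (Im : isprob_inv act m) (Emu : perg act mu) (K : R).
Hypothesis mK : forall A, measurable A -> m A <= K * mu A.
Let Sm := proj1 Im. Let Pm := proj1 Sm. Let im := proj2 Im.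
Let Imu := proj1 Emu. Let Smu := proj1 Imu. Let Pmu := proj1 Smu. Let imu := proj2 Imu.

Let v (A : set X) : R := m A - mu A.
Let S := [set v A | A in measurable].

Lemma ac_has_sup : has_sup S.
Proof.
split; first by exists (v set0), set0.
exists 1 => _ [A mA <-]; rewrite /v; have := pr_le1 Pm mA; have := pr_ge0 Pmu mA; lra.
Qed.

Let s := sup S.

Lemma ac_v_le A : measurable A -> v A <= s.
Proof. by move=> mA; apply: ub_le_sup; [exact: ac_has_sup.2|exists A]. Qed.

(** [v] is modular and its value on the union is at most [s], so defects from the supremum add up
    under intersection. *)
Lemma ac_v_cap A B a b : measurable A -> measurable B -> s - a <= v A -> s - b <= v B ->
  s - (a + b) <= v (A `&` B).
Proof.
move=> mA mB hA hB; have hU := ac_v_le (measurableU _ _ mA mB).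
have modular (p : set X -> R) : fprob p -> p (A `|` B) = p A + p B - p (A `&` B).
  move=> P; have -> : A `|` B = A `|` (B `\` A).
    apply/seteqP; split => x; last by move=> [|[? _]]; [left|right].
    by move=> [?|?]; [left|have [?|?] := pselect (A x); [left|right]].
  rewrite (prU P) ?(prD P mB mA)//; [|exact: measurableD|].
    by rewrite setIC; lra.
  by apply/seteqP; split => // x [Ax [_]].
by move: hU hA hB; rewrite /v !modular//; lra.
Qed.

Lemma ac_v_bigcap (B : nat -> set X) (a : nat -> R) c : (forall n, measurable (B n)) ->
  (forall n, s - a n <= v (B n)) -> (forall n, \sum_(i < n) a i <= c) ->
  s - c <= v (\bigcap_n B n).
Proof.
move=> mB hB hc; pose E n := [set x | forall i, (i <= n)%N -> B i x].
have ES n : E n.+1 = E n `&` B n.+1.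
  apply/seteqP; split => x /=.
    by move=> h; split => [i il|]; apply: h => //; exact: leqW.
  by move=> [h1 h2] i; rewrite leq_eqVlt => /predU1P[->//|]; rewrite ltnS => /h1.
have E0 : E 0%N = B 0%N.
  apply/seteqP; split => x /=; first by apply.
  by move=> h i; rewrite leqn0 => /eqP->.
have mE n : measurable (E n) by elim: n => [|n ih]; rewrite ?E0// ES; exact: measurableI.
have hE n : s - \sum_(i < n.+1) a i <= v (E n).
  elim: n => [|n ih]; first by rewrite big_ord1 E0.
  by rewrite big_ord_recr/= ES; apply: ac_v_cap.
have mC : measurable (\bigcap_n B n) by exact: bigcapT_measurable.
have CE n : \bigcap_n B n `<=` E n by move=> x h i _; exact: h.
apply/ler_addgt0Pr => e e0.
have [||n hn] := sprob_decr Smu (E := E) (A := \bigcap_n B n) (e := e) mE mC _ CE _ e0.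
- by move=> n; rewrite ES; exact: subIsetl.
- by move=> x h i _; exact: (h i).
have [||n' hn'] := sprob_decr Sm (E := E) (A := \bigcap_n B n) (e := e) mE mC _ CE _ e0.
- by move=> k; rewrite ES; exact: subIsetl.
- by move=> x h i _; exact: (h i).
have h1 := hE n'; have h2 := hc n'.+1; have h3 := pr_le Pmu mC (mE n') (CE n').
by move: h1 h2 h3 hn'; rewrite /v; lra.
Qed.

(* Nearly maximising sets of [m - mu] combine into a maximising one, whose largest
   invariant subset is still maximising and has measure 0 or 1 by ergodicity. *)
Lemma ac_le A : measurable A -> m A <= mu A.
Proof.
move=> mA; rewrite leNgt; apply/negP => lt.
have s0 : 0 < s by apply: lt_le_trans (ac_v_le mA); rewrite subr_gt0.
have /choice [B hB] : forall n : nat, exists B, measurable B /\ s - 1 / 2 ^+ n.+1 <= v B.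
  move=> n; have n0 : 0 < 1 / 2 ^+ n.+1 :> R by rewrite divr_gt0// exprn_gt0.
  by have [_ [B mB <-] h] := sup_adherent n0 ac_has_sup; exists B; split => //; exact: ltW.
have mB n : measurable (B n) by case: (hB n).
(* Intersections of tails, whose defects are summable; their union [Q] attains the supremum. *)
pose P N := \bigcap_n B (N + n)%N.
have mP N : measurable (P N) by exact: bigcapT_measurable.
have hP N : s - (2 ^+ N)^-1 <= v (P N).
  apply: (ac_v_bigcap (a := fun i => (2 ^+ N)^-1 / 2 ^+ i.+1)) => // n.
    have [_] := hB (N + n)%N; apply: le_trans; rewrite lerD2l lerN2.
    by apply: eq_ler; rewrite -addnS exprD invfM mul1r.
  by apply: geo_sum_le; rewrite invr_ge0 exprn_ge0.
have iP N : P N `<=` P N.+1 by move=> x h n _; rewrite addSnnS; exact: h.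
have iP' N N' : (N <= N')%N -> P N `<=` P N'.
  by move=> NN x h n _; rewrite -(subnKC NN) -addnA; exact: h.
pose Q := \bigcup_N P N; have mQ : measurable Q by exact: bigcupT_measurable.
have PQ N : P N `<=` Q by move=> x ?; exists N.
have hQ : s <= v Q.
  apply/ler_addgt0Pr => e e0; have e2 : 0 < e / 2 by lra.
  have [|N hN] := sprob_incr Smu (E := P) (A := Q) (e := e / 2) mP mQ iP PQ _ e2.
  - by move=> x [N _ ?]; exists N.
  have [N0 hN0] := inv_exp2_small e2; set N1 := maxn N N0.
  have h1 := hP N1; have h2 := pr_le Pmu (mP N) (mP N1) (iP' _ _ (leq_maxl N N0)).
  have h3 := pr_le Pm (mP N1) mQ (PQ N1).
  have h4 : (2 ^+ N1)^-1 <= (2 ^+ N0)^-1 :> R.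
    by rewrite lef_pV2 ?posrE ?exprn_gt0// ler_weXn2l ?ler1n// leq_maxr.
  by move: h1; rewrite /v; lra.
(* The translates of [Q], enumerated by code with [Q] as default value; each attains the supremum
   because [m] and [mu] are invariant. *)
pose D k := if choice.unpickle k is Some g then act g @^-1` Q else Q.
have mD k : measurable (D k) by rewrite /D; case: choice.unpickle => [g|//]; exact: mact.
have vD k : s - 0 <= v (D k).
  by rewrite subr0 /D /v; case: choice.unpickle => [g|//]; rewrite im// imu.
have hI : s <= v (\bigcap_k D k).
  have := ac_v_bigcap mD vD (c := 0); rewrite subr0; apply => n.
  by rewrite big1.
pose I0 := [set x | forall g, Q (act g x)].
have IE : I0 = \bigcap_k D k.
  apply/seteqP; split => x h.
    by move=> k _; rewrite /D; case: choice.unpickle => [g|]; [exact: h|rewrite -(a1 x); exact: h].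
  by move=> g; have := h (choice.pickle g) I; rewrite /D choice.pickleK.
rewrite -IE in hI; have mI : measurable I0 by rewrite IE; exact: bigcapT_measurable.
have [|h0|h0] := proj2 Emu I0 mI.
- move=> g; apply/seteqP; split => x h k; last by rewrite /= -aM; exact: h.
  by have [k' <-] := sur g k; rewrite aM; exact: h.
- have := mK mI; rewrite h0 mulr0 => h1; move: hI; rewrite /v h0; lra.
- have := pr_le1 Pm mI; move: hI; rewrite /v h0; lra.
Qed.

Lemma ac_eq A : measurable A -> m A = mu A.
Proof.
move=> mA; apply/eqP; rewrite eq_le ac_le//=.
have := ac_le (measurableC mA); rewrite (prC Pm mA) (prC Pmu mA); lra.
Qed.

End AbsCont.

Section MeanErgodic.
Context {R : realType} {G : countType} (mul : G -> G -> G) (one : G) (inv : G -> G)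
  (Fs : nat -> {fset G}) {dX : measure_display} {X : measurableType dX} (act : G -> X -> X).
Hypothesis Sy : sys (R := R) mul one inv Fs act.
Let hG := sysG Sy. Let hF := sysF Sy. Let mact := sys_mact Sy. Let actM := sysM Sy.

Definition visits (F : {fset G}) (A : set X) (x : X) : R := \sum_(k <- F) (`[<A (act k x)>])%:R.

Lemma visitsE F A x : visits F A x = \sum_(i < size F) (nm act (fun y => `[<A y>]) F x i)%:R.
Proof. by rewrite /visits (big_tnth _ _ F) /=; apply: eq_bigr => i _; rewrite ffunE. Qed.

Lemma measurable_visits F A (Q : R -> Prop) : measurable A -> measurable [set x | Q (visits F A x)].
Proof.
move=> mA; rewrite (_ : mkset _ = [set x | (fun t : {ffun 'I_(size F) -> bool} =>
    Q (\sum_(i < size F) (t i)%:R)) (nm act (fun y => `[<A y>]) F x)]).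
  exact: (mfin_pred (fun t : {ffun 'I_(size F) -> bool} => Q (\sum_(i < size F) (t i)%:R))
    (mfin_nm mact (s := F) (mfin_set mA))).
by apply/seteqP; split => x /=; rewrite visitsE.
Qed.

Lemma visitsC F A x : visits F (~` A) x = #|` F|%:R - visits F A x.
Proof.
apply/eqP; rewrite eq_sym subr_eq /visits -big_split/=; apply/eqP.
rewrite (eq_bigr (fun _ => 1 : R)); first by rewrite sum_const_seq mulr1.
by move=> i _; rewrite asbool_neg; case: asboolP; rewrite ?addr0 ?add0r.
Qed.

(** If exceptional sets of mass above [del] recurred, [mu] conditioned on them and averaged along
    [Fs] would have an invariant limit dominated by [del^-1 * mu]. Domination makes the limit
    countably additive and [ac_eq] identifies it with [mu], yet it gives [A] mass at least
    [mu A + eta]. *)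
Lemma mean_ergodic_up (mu : set X -> R) A eta del : perg act mu -> measurable A -> 0 < eta -> 0 < del ->
  \forall n \near \oo, mu [set x | (mu A + eta) * #|` Fs n|%:R <= visits (Fs n) A x] <= del.
Proof.
move=> Emu mA eta0 del0; apply: contrapT => nh.
have [Imu _] := Emu; have [Smu imu] := Imu; have Pmu := proj1 Smu.
pose Y n := [set x | (mu A + eta) * #|` Fs n|%:R <= visits (Fs n) A x].
have mY n : measurable (Y n) by exact: (measurable_visits (Fs n) (fun c => (mu A + eta) * #|` Fs n|%:R <= c) mA).
have /choice [ph hph] : forall N, exists n, (N <= n)%N /\ del < mu (Y n).
  move=> N; apply: contrapT => h; apply: nh; exists N => // n /= Nn.
  by rewrite leNgt; apply/negP => lt; apply: h; exists n.
have Y0 n : 0 < mu (Y (ph n)) by case: (hph n) => _; exact: lt_trans.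
have Pc n : fprob (pcond mu (Y (ph n))) by exact: pcond_fprob.
pose mm n := avgact act (Fs (ph n)) (pcond mu (Y (ph n))).
have Pmm n : fprob (mm n) by apply: (avgact_fprob Sy) => //; exact: (Fs_neq0 hF).
have [V [VU oV]] : exists U : set_system nat, UltraFilter U /\ \oo `<=` U by exact: ultraFilterLemma.
have Pm := ulim_fprob VU Pmm.
have im : inv_pr act (ulim_pr V mm) by apply: (ulim_invariant Sy VU oV) => // n; case: (hph n).
have dom B : measurable B -> ulim_pr V mm B <= del^-1 * mu B.
  move=> mB; apply: (cvg_U_le VU (ulim_pr_cvg VU Pmm mB)); apply: filterE => n /=.
  have F0 : (Fs (ph n) : seq G) != [::] by rewrite -size_eq0; have := Fs_neq0 hF (ph n); rewrite -cardfs_eq0.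
  apply: (avgpr_le F0) => k _; rewrite /pcond ler_pdivrMr// mulrAC.
  have mkB := mact k mB; apply: le_trans (_ : mu (act k @^-1` B) <= _).
    by apply: (pr_le Pmu) => //; exact: measurableI.
  rewrite imu// ler_peMl//; first exact: (pr_ge0 Pmu).
  by rewrite mulrC ler_pdivlMr// mul1r ltW//; case: (hph n).
have Sm : sprob (ulim_pr V mm).
  split => // D mD dD eD e e0.
  have [n hn] := proj2 Smu D mD dD eD (e * del) (mulr_gt0 e0 del0).
  by exists n; apply: le_trans (dom _ (mD n)) _; rewrite mulrC ler_pdivrMr.
have [gA _ g1 gV _] := hG.
have sur h k : exists g, mul g h = k by exists (mul k (inv h)); rewrite -gA gV g1.
have := ac_eq actM (sys1 Sy) sur mact (conj Sm im) Emu dom mA.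
suff : mu A + eta <= ulim_pr V mm A by lra.
apply: (cvg_U_ge VU (ulim_pr_cvg VU Pmm mA)); apply: filterE => n /=.
have Fp : 0 < #|` Fs (ph n)|%:R :> R := Fs_gt0R hF (ph n).
rewrite /mm /avgact /avgpr mulrC ler_pdivlMr//.
rewrite /pcond -mulr_suml ler_pdivlMr//.
apply: (sum_pr_ge Pmu (E := fun k => act k @^-1` A)) => //.
by move=> k; exact: mact.
Qed.

(** A lower deviation for [A] is an upper deviation for its complement. *)
Lemma mean_ergodic (mu : set X -> R) A eta del : perg act mu -> measurable A -> 0 < eta -> 0 < del ->
  \forall n \near \oo,
    mu [set x | eta * #|` Fs n|%:R <= `|visits (Fs n) A x - mu A * #|` Fs n|%:R| ] <= del.
Proof.
move=> Emu mA eta0 del0; have d2 : 0 < del / 2 by lra.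
have [Imu _] := Emu; have [Smu imu] := Imu; have Pmu := proj1 Smu.
have h1 := mean_ergodic_up Emu mA eta0 d2; have h2 := mean_ergodic_up Emu (measurableC mA) eta0 d2.
near=> n; have k1 : mu [set x | (mu A + eta) * #|` Fs n|%:R <= visits (Fs n) A x] <= del / 2 by near: n.
have k2 : mu [set x | (mu (~` A) + eta) * #|` Fs n|%:R <= visits (Fs n) (~` A) x] <= del / 2 by near: n.
have m1 := measurable_visits (Fs n) (fun c => (mu A + eta) * #|` Fs n|%:R <= c) mA.
have m2 := measurable_visits (Fs n) (fun c => (mu (~` A) + eta) * #|` Fs n|%:R <= c) (measurableC mA).
have m3 := measurable_visits (Fs n) (fun c => eta * #|` Fs n|%:R <= `|c - mu A * #|` Fs n|%:R|) mA.
apply: le_trans (pr_le Pmu m3 (measurableU _ _ m1 m2) _) _.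
  move=> x /=; rewrite visitsC (prC Pmu mA) ler_normr => /orP[h|h]; [left|right]; lra.
apply: le_trans (prU_le Pmu m1 m2) _; lra.
Unshelve. all: by end_near. Qed.

End MeanErgodic.

(** * Upper and lower limits *)

Section Limf.
Context {T : choiceType} {Y : filteredType T} {R : realType} (F : set_system Y) {FF : ProperFilter F}.
Implicit Types (f g : Y -> \bar R) (b : \bar R).
Local Open Scope ereal_scope.

Lemma esup_lt f b : limf_esup f F < b -> \forall x \near F, f x < b.
Proof.
move=> /ereal_inf_lt [_ [V FV <-] h]; apply: filterS FV => x Vx.
by apply: le_lt_trans h; apply: ereal_sup_ubound; exists x.
Qed.

Lemma esup_le f b : (\forall x \near F, f x <= b) -> limf_esup f F <= b.
Proof.
move=> h; apply: (@le_trans _ _ (ereal_sup (f @` [set x | f x <= b]))).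
  by apply: ereal_inf_lbound; exists [set x | f x <= b].
by apply: ge_ereal_sup => _ [x /= hx <-].
Qed.

Lemma esup_mono f g : (\forall x \near F, f x <= g x) -> limf_esup f F <= limf_esup g F.
Proof.
move=> h; apply: le_ereal_inf_tmp => _ [V FV <-].
apply: (@le_trans _ _ (ereal_sup (f @` (V `&` [set x | f x <= g x])))).
  by apply: ereal_inf_lbound; exists (V `&` [set x | f x <= g x]) => //; exact: filterI.
apply: ge_ereal_sup => _ [x [Vx /= hx] <-]; apply: le_trans hx _.
by apply: ereal_sup_ubound; exists x.
Qed.

Lemma esup_ge_freq f b : (forall V, F V -> exists2 x, V x & b <= f x) -> b <= limf_esup f F.
Proof.
move=> h; apply: le_ereal_inf_tmp => _ [V FV <-]; have [x Vx bx] := h V FV.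
by apply: le_trans bx _; apply: ereal_sup_ubound; exists x.
Qed.

Lemma esup_gt_freq f b : b < limf_esup f F -> forall V, F V -> exists2 x, V x & b < f x.
Proof.
move=> h V FV; have : b < ereal_sup (f @` V).
  by apply: lt_le_trans h _; apply: ereal_inf_lbound; exists V.
by move=> /ereal_sup_gt [_ [x Vx <-] bx]; exists x.
Qed.

Lemma einf_mono f g : (\forall x \near F, f x <= g x) -> limf_einf f F <= limf_einf g F.
Proof.
move=> h; rewrite /limf_einf leeN2; apply: esup_mono; apply: filterS h => x.
by rewrite leeN2.
Qed.

Lemma einf_lt_freq f b : limf_einf f F < b -> forall V, F V -> exists2 x, V x & f x < b.
Proof.
rewrite /limf_einf lteNl => h V FV; have [x Vx hx] := esup_gt_freq h FV.
by exists x => //; rewrite -lteN2.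
Qed.

Lemma einf_le_freq f b : (forall V, F V -> exists2 x, V x & f x <= b) -> limf_einf f F <= b.
Proof.
move=> h; rewrite /limf_einf leeNl; apply: esup_ge_freq => V FV.
by have [x Vx hx] := h V FV; exists x => //; rewrite leeN2.
Qed.

Lemma einf_le_esup f : limf_einf f F <= limf_esup f F.
Proof.
apply: le_ereal_inf_tmp => _ [V FV <-]; apply: einf_le_freq => W FW.
have [x [Wx Vx]] := filter_ex (filterI FW FV); exists x => //.
by apply: ereal_sup_ubound; exists x.
Qed.

Lemma ereal_between (x y : \bar R) : x < y -> exists r : R, x < r%:E /\ r%:E < y.
Proof.
case: x => [x| |]; case: y => [y| |] //.
- by rewrite lte_fin => xy; exists ((x + y) / 2)%R; rewrite !lte_fin; split; lra.
- by move=> _; exists (x + 1)%R; rewrite lte_fin ltry; split => //; lra.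
- by move=> _; exists (y - 1)%R; rewrite lte_fin ltNyr; split => //; lra.
- by move=> _; exists 0%R; rewrite ltry ltNyr.
Qed.

End Limf.

Section Scaling.
Context {R : realType}.
Implicit Types (f g : R -> \bar R).
Local Open Scope ereal_scope.

Lemma near0_lt (c : R) : (0 < c)%R -> \forall e \near (0 : R)^'+, (0 < e < c)%R.
Proof.
move=> c0; near=> e; apply/andP; split; first by near: e; exact: nbhs_right_gt.
by near: e; exact: nbhs_right_lt.
Unshelve. all: by end_near. Qed.

Lemma near0_scale (c : R) (P : R -> Prop) : (0 < c)%R ->
  (\forall e \near (0 : R)^'+, P e) -> \forall e \near (0 : R)^'+, P (c * e)%R.
Proof.
move=> c0 [r /= r0 hr]; have rc : (0 < r / c)%R by rewrite divr_gt0.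
have := near0_lt rc; apply: filterS => e /andP[e0 er]; apply: hr => /=; last exact: mulr_gt0.
by rewrite sub0r normrN gtr0_norm ?mulr_gt0// mulrC -ltr_pdivlMr.
Qed.

Lemma ln_inv_large (M : R) : \forall e \near (0 : R)^'+, (M < ln e^-1)%R.
Proof.
have := near0_lt (expR_gt0 (- M)); apply: filterS => e /andP[e0 eM].
by rewrite -ltr_expR lnK ?posrE ?invr_gt0// -ltf_pV2 ?posrE ?invr_gt0 ?expR_gt0// invrK -expRN.
Qed.

(* The rescaling [e -> c e] and an additive constant are invisible after division by [ln (1/e)]. *)
Lemma quot_lt (c C b b' : R) f g : (0 < c)%R -> (b < b')%R ->
  \forall e \near (0 : R)^'+, f e <= g (c * e)%R + C%:E ->
     ((ln (c * e)^-1)^-1)%:E * g (c * e)%R < b%:E -> ((ln e^-1)^-1)%:E * f e < b'%:E.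
Proof.
move=> c0 bb'.
(* For [ln (1/e)] above [M], the constants [b ln c] and [C] fit in the gap [(b' - b) ln (1/e)], and
   [ln (1/(c e))] is positive. *)
pose M := ((`|b * ln c| + `|C|) / (b' - b) + 1 + `|ln c|)%R.
have h1 := ln_inv_large M; have h2 := near0_lt (@ltr01 R).
near=> e; have /andP[e0 e1] : (0 < e < 1)%R by near: e.
have Me : (M < ln e^-1)%R by near: e.
move=> hf hg; set L := ln e^-1 in Me *.
have lce : ln (c * e)^-1 = (L - ln c)%R.
  by rewrite /L invfM lnM ?posrE ?invr_gt0// !lnV ?posrE//; lra.
have b0 : (0 < b' - b)%R by lra.
have q0 : (0 <= (`|b * ln c| + `|C|) / (b' - b))%R by apply: divr_ge0; [exact: addr_ge0|exact: ltW].
have lc := ler_norm (ln c).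
have L0 : (0 < L)%R by apply: lt_trans Me; rewrite /M; have := normr_ge0 (ln c); lra.
have Lc0 : (0 < L - ln c)%R by move: Me; rewrite /M; lra.
rewrite lce in hg.
have hb : ((L - ln c) * b + C < L * b')%R.
  have h3 : ((`|b * ln c| + `|C|) < L * (b' - b))%R.
    by rewrite -ltr_pdivrMr//; move: Me; rewrite /M; have := normr_ge0 (ln c); lra.
  have := ler_norm (- (b * ln c))%R; rewrite normrN; have := ler_norm C; lra.
have gb : g (c * e)%R <= ((L - ln c) * b)%:E.
  move: hg; case: (g _) => [r| |].
  - by rewrite -EFinM lte_fin mulrC ltr_pdivrMr// lee_fin mulrC => /ltW.
  - by rewrite gt0_muley ?lte_fin ?invr_gt0// ltNge leey.
  - by rewrite leNye.
have fb : f e < (L * b')%:E.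
  apply: le_lt_trans (le_trans hf (leeD2r C%:E gb)) _.
  by rewrite -EFinD lte_fin.
move: fb; case: (f e) => [r| |].
- by rewrite -EFinM !lte_fin => h; rewrite mulrC ltr_pdivrMr// mulrC.
- by rewrite ltNge leey.
- by move=> _; rewrite gt0_muleNy ?lte_fin ?invr_gt0// ltNyr.
Unshelve. all: by end_near. Qed.

Lemma LS_le (c C : R) f g : (0 < c)%R ->
  (\forall e \near (0 : R)^'+, f e <= g (c * e)%R + C%:E) -> LS f <= LS g.
Proof.
move=> c0 h; rewrite leNgt; apply/negP => /ereal_between [b' [hb' fb']].
have [b [hb]] := ereal_between hb'; rewrite lte_fin => bb.
suff : LS f <= b'%:E by rewrite leNgt fb'.
apply: esup_le; apply: filterS (filterI (filterI h (quot_lt C f g c0 bb))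
  (near0_scale c0 (esup_lt hb))) => e [[h1 h2] h3].
by apply/ltW/h2.
Qed.

(** A lower limit is tested on scales that occur arbitrarily close to 0; a scale good for [g] is
    divided by [c]. *)
Lemma LI_le (c C : R) f g : (0 < c)%R ->
  (\forall e \near (0 : R)^'+, f e <= g (c * e)%R + C%:E) -> LI f <= LI g.
Proof.
move=> c0 h; rewrite leNgt; apply/negP => /ereal_between [b' [hb' fb']].
have [b [hb]] := ereal_between hb'; rewrite lte_fin => bb.
suff : LI f <= b'%:E by rewrite leNgt fb'.
apply: einf_le_freq => V FV.
have ci : (0 < c^-1)%R by rewrite invr_gt0.
have [e [h1 [h2 h3]] he] :=
  einf_lt_freq hb (near0_scale ci (filterI FV (filterI h (quot_lt C f g c0 bb)))).
exists (c^-1 * e)%R => //; apply/ltW/h3 => //.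
by rewrite mulrA divff ?gt_eqF// mul1r.
Qed.

End Scaling.

(** * Integrals of functions close to finite-valued ones *)

Section Integral.
Context {R : realType} {dX : measure_display} {X : measurableType dX}.

Lemma int_simple (nu : {measure set X -> \bar R}) (T : finType) (q : X -> T) (c : T -> R) :
  isprob nu -> mfin q ->
  nu.-integrable setT (EFin \o (c \o q)) /\
  (\int[nu]_x (c (q x))%:E = (\sum_t c t * fine (nu [set x | q x = t]))%:E)%E.
Proof.
move=> nu1 mq.
have E x : c (q x) = \sum_(t : T) c t * \1_[set x | q x = t] x.
  rewrite (bigD1 (q x))//= indicE mem_set// mulr1 big1 ?addr0// => t tq.
  by rewrite indicE memNset ?mulr0// => /= h; rewrite h eqxx in tq.
have -> : EFin \o (c \o q) = EFin \o (fun x => \sum_(t : T) c t * \1_[set x | q x = t] x).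
  by apply/funext => x /=; rewrite E.
have -> : (\int[nu]_x (c (q x))%:E = \int[nu]_x (\sum_(t : T) c t * \1_[set x | q x = t] x)%:E)%E.
  by apply: eq_integral => x _; rewrite E.
have ind t : nu.-integrable setT (fun x => (\1_[set y | q y = t] x)%:E : \bar R).
  apply: (measurable_bounded_integrable (f := \1_[set y | q y = t])) => //.
  - by rewrite nu1 ltry.
  - exists 1; split; first exact: num_real.
    by move=> M hM x _; apply: le_trans (ltW hM); rewrite /= indicE; case: (_ \in _); rewrite ?normr1 ?normr0.
elim: (index_enum T) => [|t s [ih1 ih2]].
  rewrite big_nil; split.
    by under eq_fun do rewrite big_nil; exact: integrable0.
  by under eq_integral do rewrite big_nil; rewrite integral0.
have it : nu.-integrable setT (EFin \o (fun x => c t * \1_[set x | q x = t] x)).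
  have := integrableZl measurableT (c t) (ind t).
  by apply: eq_integrable.
rewrite big_cons; split.
  have := integrableD measurableT it ih1; apply: eq_integrable => // x _.
  by rewrite /= big_cons.
under eq_integral do rewrite big_cons EFinD.
rewrite (integralD_EFin measurableT it ih1) EFinD -ih2; congr (_ + _)%E.
transitivity (\int[nu]_x ((c t)%:E * (\1_[set y | q y = t] x)%:E))%E.
  by apply: eq_integral => x _; rewrite /= EFinM.
rewrite integralZl//.
by rewrite integral_indic// setIT EFinM fineK//; exact: meas_fin.
Qed.

Lemma int_approx (nu : {measure set X -> \bar R}) (f : X -> R) (T : finType) (q : X -> T)
    (c : T -> R) (e : R) : isprob nu -> mfin q -> measurable_fun setT f -> 0 <= e ->
  (forall x, `|f x - c (q x)| <= e) -> exists2 r : R,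
  (\int[nu]_x (f x)%:E = r%:E)%E & `|r - \sum_t c t * fine (nu [set x | q x = t])| <= e.
Proof.
move=> nu1 mq mf e0 h; have [ic hc] := int_simple c nu1 mq.
set sc := \sum_t _ in hc *.
have nufin : (nu setT < +oo)%E by rewrite nu1 ltry.
have ifn : nu.-integrable setT (EFin \o f).
  apply: measurable_bounded_integrable => //.
  exists (e + \sum_t `|c t|); split; first exact: num_real.
  move=> M hM x _; apply: le_trans (ltW hM).
  have -> : f x = (f x - c (q x)) + c (q x) by rewrite subrK.
  apply: le_trans (ler_normD _ _) _; apply: lerD => //.
  by rewrite (bigD1 (q x))//= lerDl sumr_ge0.
have hB := integralB_EFin measurableT ifn ic.
have hle : (`| \int[nu]_x ((f x)%:E - (c (q x))%:E) | <= e%:E)%E.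
  have mfc := measurable_int nu (integrableB measurableT ifn ic).
  apply: le_trans (le_abse_integral nu measurableT mfc) _.
  apply: le_trans (_ : \int[nu]_x (cst e%:E) x <= _)%E.
    apply: ge0_le_integral => //.
    - exact: (measurable_int nu (integrable_abse (integrableB measurableT ifn ic))).
    - by move=> x _; rewrite -EFinB abse_EFin lee_fin; exact: h.
  by rewrite integral_cst// nu1 mule1.
have fi := integrable_fin_num measurableT ifn.
exists (fine (\int[nu]_x (f x)%:E)%E); first by rewrite fineK.
move: hle; rewrite hB.
have -> : (\int[nu]_x (EFin \o (c \o q)) x = sc%:E)%E by [].
have {fi} : (\int[nu]_x (f x)%:E)%E \is a fin_num by [].
by case: (\int[nu]_x (f x)%:E)%E => // r _; rewrite -EFinB abse_EFin lee_fin.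
Qed.

End Integral.

(** * Pfister-Sullivan entropy *)

Section PfisterSullivan.
Context {R : realType} {G : countType} (mul : G -> G -> G) (one : G) (inv : G -> G)
  (Fs : nat -> {fset G}) {dX : measure_display} {X : measurableType dX}
  (d : X -> X -> R) (act : G -> X -> X).
Hypotheses (hG : is_group mul one inv) (hF : folner (R := R) mul Fs)
  (hd : is_metric d) (cpt : dcompact d) (bor : borel_space d) (hact : is_action one d act mul).
Local Notation dF := (dF d act).
Let Sy := dsys hG hF hd bor hact.
Local Notation mpr mu := (fun A => fine (mu A)).

Lemma emp_visits (F : {fset G}) x A : F != fset0 -> measurable A ->
  emp (R := R) one act F x A = (#|` F|%:R^-1 * visits act F A x)%:E.
Proof.
move=> F0 mA; rewrite /emp /mscale /= /msum /= EFinM; congr (_ * _)%E.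
rewrite /visits (big_nth one) big_mkord -sumEFin; apply: eq_bigr => i _.
by rewrite /= /dirac indicE; congr (_%:R%:E).
Qed.

Lemma emp_isprob (F : {fset G}) x : F != fset0 -> isprob (emp (R := R) one act F x).
Proof.
move=> F0; rewrite /isprob emp_visits// /visits.
rewrite (eq_bigr (fun _ => 1 : R)); last by move=> i _; rewrite asboolT.
by rewrite sum_const_seq mulr1 mulVf// pnatr_eq0 cardfs_eq0.
Qed.

Lemma dcontR_measurable (f : X -> R) : dcontinuousR d f -> measurable_fun setT f.
Proof.
move=> cf; apply: (measurability _ (measurable_realfun.RGenOInfty.measurableE R)) => //.
move=> _ [_ [a ->] <-]; rewrite setTI; apply: (mopen bor) => x /=.
rewrite in_itv/= andbT => ax; have e0 : 0 < f x - a by rewrite subr_gt0.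
have [r r0 hr] := cf x _ e0; exists r => // y /hr; rewrite /= in_itv/= andbT.
by rewrite ltr_norml => /andP[_]; lra.
Qed.

Lemma unif_cont (f : X -> R) (h : R) : dcontinuousR d f -> 0 < h ->
  exists2 r, 0 < r & forall x y, d x y < r -> `|f x - f y| < h.
Proof.
move=> cf h0; have h2 : 0 < h / 2 by lra.
have [||r r0 hr] := lebesgue_number hd cpt (C := [set V | exists x, V = [set y | `|f x - f y| < h / 2]]).
- move=> V [x ->] y /= xy; have e0 : 0 < h / 2 - `|f x - f y| by rewrite subr_gt0.
  have [r r0 hr] := cf y _ e0; exists r => // z /hr yz /=.
  have -> : f x - f z = (f x - f y) + (f y - f z) by ring.
  by apply: le_lt_trans (ler_normD _ _) _; lra.
- apply/seteqP; split => // x _; exists [set y | `|f x - f y| < h / 2]; first by exists x.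
  by rewrite /= subrr normr0.
exists r => // x y xy; have [_ [z ->] hz] := hr x.
have hx := hz x (dball_center hd x r0); have hy := hz y xy.
have -> : f x - f y = (f z - f y) - (f z - f x) by ring.
by apply: le_lt_trans (ler_normB _ _) _; move: hx hy => /=; lra.
Qed.

(** The finitely many test functions are uniformly close to functions of one finite map [q] with
    small fibres, so it is enough that orbits visit each fibre with nearly the right frequency;
    [mean_ergodic] provides this off a small set. *)
Lemma emp_good (mu : {measure set X -> \bar R}) (O : set {measure set X -> \bar R}) del :
  isprob mu -> perg act (mpr mu) -> wnbhs d mu O -> 0 < del ->
  \forall n \near \oo, exists Y, [/\ measurable Y, fine (mu (~` Y)) <= del & Y `<=` XFO one act (Fs n) O].
Proof.
move=> mu1 Emu [_ [k [f [eta [eta0 cf hO]]]]] del0.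
have Pmu := proj1 (sprob_meas mu1).
have e8 : 0 < eta / 8 by lra.
have [||r r0 hr] := @fin_small R 'I_k (fun i r => forall x y, d x y < r -> `|f i x - f i y| < eta / 8).
- by move=> i r r' rr h x y xy; apply: h; exact: lt_le_trans rr.
- by move=> i; exact: unif_cont.
have [T [q [mq hq]]] := fine_map hd cpt bor r0.
have [x0] := fprob_inh Pmu.
have /choice [rep hrep] : forall t, exists y, forall x, q x = t -> q y = t.
  move=> t; have [[y qy]|ne] := pselect (exists y, q y = t); first by exists y.
  by exists x0 => x qx; case: ne; exists x.
pose c i t := f i (rep t).
have hc i x : `|f i x - c i (q x)| <= eta / 8.
  by apply/ltW/hr/hq; rewrite (hrep (q x) x).
pose M := \sum_i \sum_t `|c i t|.
have M0 : 0 <= M by apply: sumr_ge0 => i _; exact: sumr_ge0.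
(* The two approximations by [c i] cost [eta / 8] each and the frequencies at most [eta / 4]. *)
pose eta' := eta / (4 * (M + 1)).
have M1 : 0 < 4 * (M + 1) by lra.
have eta'0 : 0 < eta' by rewrite divr_gt0.
pose N : R := #|T|%:R + 1; have N0 : 0 < N by rewrite /N; have := ler0n R #|T|; lra.
have dN0 : 0 < del / N by rewrite divr_gt0.
pose bad n t := [set x | eta' * #|` Fs n|%:R <= `|visits act (Fs n) [set y | q y = t] x
    - fine (mu [set y | q y = t]) * #|` Fs n|%:R| ].
have hbad : \forall n \near \oo, forall t, fine (mu (bad n t)) <= del / N.
  suff h : \forall n \near \oo, forall t, t \in enum T -> fine (mu (bad n t)) <= del / N.
    by apply: filterS h => n h t; apply: h; rewrite mem_enum.
  elim: (enum T) => [|t s ih]; first by apply: nearW.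
  have := mean_ergodic Sy Emu (mq t) eta'0 dN0.
  move=> h; apply: filterS (filterI h ih) => n [h1 h2] t'.
  by rewrite in_cons => /predU1P[->|/h2].
apply: filterS hbad => n hn; have F0 := Fs_neq0 hF n.
have Fp : 0 < #|` Fs n|%:R :> R := Fs_gt0R hF n.
have mbad t : measurable (bad n t).
  exact: (measurable_visits Sy (Fs n) (fun v => eta' * #|` Fs n|%:R <= `|v
    - fine (mu [set y | q y = t]) * #|` Fs n|%:R|) (mq t)).
pose B := \big[setU/set0]_(t <- enum T) bad n t.
have [mB hB] : measurable B /\ fine (mu B) <= (size (enum T))%:R * (del / N).
  rewrite /B; elim: (enum T) => [|t s [ih1 ih2]].
    by rewrite big_nil measure0 mul0r.
  rewrite big_cons; split; first exact: measurableU.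
  apply: le_trans (prU_le Pmu (mbad t) ih1) _; rewrite /= -[(size s).+1%:R]natr1 mulrDl mul1r addrC.
  by apply: lerD.
exists (~` B); split.
- exact: measurableC.
- rewrite setCK; apply: le_trans hB _; rewrite -cardE mulrA ler_pdivrMr// mulrC ler_pM2l//.
  by rewrite /N lerDl.
move=> x nB; rewrite /XFO /=; apply: hO; first exact: emp_isprob.
move=> i; have mf := dcontR_measurable (cf i).
have [a ha ha'] := int_approx (c := c i) (emp_isprob x F0) mq mf (ltW e8) (hc i).
have [b hb hb'] := int_approx (c := c i) mu1 mq mf (ltW e8) (hc i).
rewrite ha hb -EFinB abse_EFin lte_fin.
have key : `|\sum_t c i t * fine (emp one act (Fs n) x [set y | q y = t]) -
     \sum_t c i t * fine (mu [set y | q y = t])| <= M * eta'.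
  rewrite -sumrB; apply: le_trans (ler_norm_sum _ _ _) _.
  apply: le_trans (_ : (\sum_t `|c i t|) * eta' <= _); last first.
    apply: ler_wpM2r; first exact: ltW.
    by rewrite /M (bigD1 i)//= lerDl sumr_ge0// => j _; exact: sumr_ge0.
  rewrite mulr_suml; apply: ler_sum => t _; rewrite -mulrBr normrM.
  apply: ler_wpM2l => //; rewrite emp_visits//=.
  have nb : ~ bad n t x.
    move=> bx; apply: nB; rewrite /B; have : t \in enum T by rewrite mem_enum.
    elim: (enum T) => // t' s ih; rewrite in_cons big_cons => /predU1P[<-|/ih]; by [left|right].
  have {nb} : `|visits act (Fs n) [set y | q y = t] x
      - fine (mu [set y | q y = t]) * #|` Fs n|%:R| < eta' * #|` Fs n|%:R.
    by rewrite ltNge; apply/negP.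
  move: (visits _ _ _ _) (fine _) => v w /ltW.
  rewrite -ler_pdivrMr// -[X in _ / X](gtr0_norm Fp) -normf_div mulrBl mulfK ?gt_eqF//.
  by rewrite mulrC.
have Mh : M * eta' <= eta / 4.
  rewrite /eta' mulrA ler_pdivrMr//.
  have -> : eta / 4 * (4 * (M + 1)) = eta * (M + 1) by field.
  by rewrite mulrC ler_pM2l// lerDl.
move: ha' hb' key; set s1 := \sum_t _; set s2 := \sum_t _ => ha' hb' key.
have -> : a - b = (a - s1) + (s1 - s2) - (b - s2) by ring.
apply: le_lt_trans (ler_normB _ _) _; have := ler_normD (a - s1) (s1 - s2); lra.
Qed.

Lemma dF_tri (F : {fset G}) y x z : dF F x z <= dF F x y + dF F y z.
Proof.
apply: dF_le; first by rewrite addr_ge0// dF_ge0.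
by move=> g gF; apply: le_trans (dT hd (act g y) _ _) _; apply: lerD; exact: dF_ge.
Qed.

(** A finite subcover by balls of radius [e / 2] bounds the size of separated sets, so a largest one
    exists, and by maximality it spans. *)
Lemma sep_spanning (Z : set X) (F : {fset G}) e : 0 < e -> exists s : seq X,
  [/\ forall x, x \in s -> Z x, pairwise (fun x y => e < dF F x y) s,
      sep d act Z F e = (size s)%:R%:E & forall z, Z z -> exists2 x, x \in s & dF F x z <= e].
Proof.
move=> e0; have e2 : 0 < e / 2 by lra.
have dFxx x : dF F x x = 0.
  apply/eqP; rewrite eq_le dF_ge0 andbT; apply: dF_le => // g _; by rewrite (dxx hd).
have [||c cC cT] := cpt (C := [set V | exists x, V = ballF d act F x (e / 2)]).
- by move=> V [x ->]; apply: (open_ballF hd hact).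
- by apply/seteqP; split => // x _; exists (ballF d act F x (e / 2)); [exists x|rewrite /ballF /= dFxx].
have /choice [h hh] : forall x, exists V, V \in c /\ V x.
  by move=> x; have : [set: X] x by []; rewrite -cT => -[V Vc Vx]; exists V.
have bnd s : pairwise (fun x y => e < dF F x y) s -> (size s <= size c)%N.
  move=> ps; rewrite -(size_map h); apply: uniq_leq_size; last first.
    by move=> V /mapP[x _ ->]; case: (hh x).
  elim: s ps => //= x s ih /andP[px /ih ->]; rewrite andbT.
  apply/negP => /mapP[y ys hxy].
  have := allP px y ys; rewrite ltNge => /negP; apply.
  have [hc hx] := hh x; have [_ hy] := hh y; rewrite -hxy in hy.
  have [z zE] := cC _ hc; rewrite zE in hx hy.
  by move: hx hy; rewrite /ballF /=; have := dF_tri F z x y; rewrite (dFC _ hd F x z); lra.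
pose P (n : nat) := `[<exists s : seq X, [/\ forall x, x \in s -> Z x,
   pairwise (fun x y => e < dF F x y) s & size s = n]>].
have exP : exists n, P n by exists 0%N; apply/asboolP; exists [::].
have ubP n : P n -> (n <= size c)%N by move=> /asboolP [s [_ ps <-]]; exact: bnd.
case: (ex_maxnP exP ubP) => n /asboolP [s [sZ ps ns]] maxn.
exists s; split => //.
  apply/eqP; rewrite eq_le; apply/andP; split.
    apply: ge_ereal_sup => _ [s' [s'Z ps'] <-]; rewrite lee_fin ler_nat ns.
    by apply: maxn; apply/asboolP; exists s'.
  by apply: ereal_sup_ubound; exists s.
move=> z Zz; apply: contrapT => nz; suff : (n.+1 <= n)%N by rewrite ltnn.
apply: maxn; apply/asboolP; exists (z :: s); split.
- by move=> x; rewrite in_cons => /predU1P[->|/sZ].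
- rewrite /= ps andbT; apply/allP => x xs; rewrite ltNge; apply/negP => h1.
  by apply: nz; exists x => //; rewrite (dFC _ hd).
- by rewrite /= ns.
Qed.

End PfisterSullivan.

(** * Coding of ergodic measures *)

Section Cases.
Context {R : realType} {G : countType} (mul : G -> G -> G) (one : G) (inv : G -> G)
  (Fs : nat -> {fset G}) {dX : measure_display} {X : measurableType dX}
  (d : X -> X -> R) (act : G -> X -> X).
Hypotheses (hG : is_group mul one inv) (iG : infinite_group (G := G))
  (hF : folner (R := R) mul Fs)
  (hd : is_metric d) (cpt : dcompact d) (bor : borel_space d) (hact : is_action one d act mul).
Let Sy := dsys hG hF hd bor hact.
Let mact := sys_mact Sy.
Let actM := sysM Sy.
Let act1 := sys1 Sy.

Lemma measurable_ex (I : countType) (A : I -> set X) : (forall i, measurable (A i)) ->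
  measurable [set x | exists i, A i x].
Proof.
move=> mA; rewrite (_ : mkset _ = \bigcup_k oapp A set0 (choice.unpickle k)).
  by apply: bigcupT_measurable => k; case: choice.unpickle => [i|] /=; [exact: mA|exact: measurable0].
apply/seteqP; split => x; first by move=> [i Ai]; exists (choice.pickle i) => //; rewrite choice.pickleK.
by move=> [k _]; case: choice.unpickle => //= i Ai; exists i.
Qed.

Lemma exhaust (pr : set X -> R) (I : countType) (A : I -> set X) (e : R) : sprob pr ->
  (forall i, measurable (A i)) -> pr [set x | exists i, A i x] = 1 -> 0 < e ->
  exists (l : seq I) (Bad : set X), [/\ measurable Bad, pr Bad <= e &
    forall x, ~ Bad x -> exists2 i, i \in l & A i x].
Proof.
move=> Spr mA A1 e0; have Ppr := proj1 Spr; have mEx := measurable_ex mA.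
pose E N := \big[setU/set0]_(k < N) oapp A set0 (choice.unpickle k).
have mE N : measurable (E N).
  by apply: bigsetU_measurable => k _; case: choice.unpickle => [i|] /=; [exact: mA|exact: measurable0].
have EP N x : E N x <-> exists k, (k < N)%N /\ oapp A set0 (choice.unpickle k) x.
  rewrite /E -(bigcup_mkord N (fun k => oapp A set0 (choice.unpickle k))).
  by split; [move=> [k /= kN h]; exists k|move=> [k [kN h]]; exists k].
have [|||N hN] := sprob_incr Spr (E := E) (e := e) mE mEx _ _ _ e0.
- by move=> N x /EP [k [kN h]]; apply/EP; exists k; split => //; exact: ltnW.
- by move=> N x /EP [k [_]]; case: choice.unpickle => //= i Ai; exists i.
- by move=> x [i Ai]; exists (choice.pickle i).+1; apply/EP; exists (choice.pickle i); rewrite choice.pickleK.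
exists (pmap choice.unpickle (iota 0 N)), (~` E N); split.
- exact: measurableC.
- by rewrite (prC Ppr)//; lra.
move=> x /contrapT /EP [k [kN]]; case Ek : (choice.unpickle k) => [i|//] /= Ai; exists i => //.
by rewrite mem_pmap -Ek map_f// mem_iota.
Qed.

(** The witness is a list of group elements, which makes the set a countable union of measurable
    ones. *)
Definition orbit_ge (n : nat) : set X := [set x | exists t : seq G,
  [/\ uniq t, size t = n & {in t &, injective (act^~ x)}]].
Definition stab_ge (n : nat) : set X := [set x | exists t : seq G,
  [/\ uniq t, size t = n & forall g, g \in t -> act g x = x]].

Lemma measurable_and (P : Prop) (A : set X) : measurable A -> measurable [set x | P /\ A x].
Proof.
move=> mA; have [p|np] := pselect P.
  by rewrite (_ : mkset _ = A)//; apply/seteqP; split => x // [].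
by rewrite (_ : mkset _ = set0)//; apply/seteqP; split => x // [].
Qed.

Let orbit_t (n : nat) (t : seq G) : set X :=
  [set x | (uniq t /\ size t = n) /\ {in t &, injective (act^~ x)}].
Let stab_t (n : nat) (t : seq G) : set X :=
  [set x | (uniq t /\ size t = n) /\ forall g, g \in t -> act g x = x].

Lemma measurable_all (t : seq G) (A : G -> set X) : (forall g, g \in t -> measurable (A g)) ->
  measurable [set x | forall g, g \in t -> A g x].
Proof.
move=> mA; rewrite (_ : mkset _ = ~` [set x | exists2 g, g \in t & (~` A g) x]).
  by apply: measurableC; apply: measurable_seq_ex => g gt; apply: measurableC; exact: mA.
apply/seteqP; split => x h; first by move=> [g gt]; apply; exact: h.
by move=> g gt; apply: contrapT => nA; apply: h; exists g.
Qed.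

Lemma measurable_orbit_t n t : measurable (orbit_t n t).
Proof.
have hg g h : dclosed d [set x | act g x = act h x] by exact: dclosed_eq hd hact _ _.
have m g h : measurable [set x | act g x = act h x -> g = h].
  have [->|gh] := pselect (g = h).
    by rewrite (_ : mkset _ = setT)//; apply/seteqP; split.
  rewrite (_ : mkset _ = ~` [set x | act g x = act h x]).
    by apply: measurableC; exact: (mclosed bor (hg g h)).
  by apply/seteqP; split => x /= h1 h2; [apply: gh; exact: h1|case: h1].
apply: measurable_and.
rewrite (_ : (fun x : X => {in t &, injective (act^~ x)}) =
    [set x | forall g, g \in t -> [set x | forall h, h \in t ->
    [set x | act g x = act h x -> g = h] x] x]).
  by apply: measurable_all => g _; apply: measurable_all => h _; exact: m.
by apply/seteqP; split => x h1 g; [move=> gt h ht; exact: h1|move=> h gt ht; exact: h1].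
Qed.

Lemma measurable_stab_t n t : measurable (stab_t n t).
Proof. by apply: measurable_and; apply: measurable_all => g _; exact: (sys_fix Sy). Qed.

Lemma orbit_geE n : orbit_ge n = [set x | exists t, orbit_t n t x].
Proof. by apply/seteqP; split => x [t]; [move=> [h1 h2 h3]|move=> [[h1 h2] h3]]; exists t. Qed.
Lemma stab_geE n : stab_ge n = [set x | exists t, stab_t n t x].
Proof. by apply/seteqP; split => x [t]; [move=> [h1 h2 h3]|move=> [[h1 h2] h3]]; exists t. Qed.

Lemma measurable_orbit_ge n : measurable (orbit_ge n).
Proof. by rewrite orbit_geE; apply: measurable_ex => t; exact: measurable_orbit_t. Qed.
Lemma measurable_stab_ge n : measurable (stab_ge n).
Proof. by rewrite stab_geE; apply: measurable_ex => t; exact: measurable_stab_t. Qed.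

Lemma inv_of_le (A : set X) : (forall g, act g @^-1` A `<=` A) -> forall g, act g @^-1` A = A.
Proof.
move=> h g; apply/seteqP; split => [|x Ax]; first exact: h.
by apply: (h (inv g)); rewrite /preimage/= (actK Sy).
Qed.

Lemma orbit_ge_inv n g : act g @^-1` orbit_ge n = orbit_ge n.
Proof.
move: g; apply: inv_of_le => g x [t [ut st it]]; exists [seq mul h g | h <- t]; split.
- by rewrite map_inj_uniq//; exact: mul_injr hG g.
- by rewrite size_map.
- move=> _ _ /mapP[h ht ->] /mapP[k kt ->] /=; rewrite !actM => e.
  by rewrite (it h k).
Qed.

Lemma stab_ge_inv n g : act g @^-1` stab_ge n = stab_ge n.
Proof.
have [gA _ _ gV gV'] := hG.
move: g; apply: inv_of_le => g x [t [ut st it]]; exists [seq mul (inv g) (mul h g) | h <- t]; split.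
- rewrite map_inj_uniq// => h k e; apply: (mul_injr hG (g := g)); exact: (mul_injl hG e).
- by rewrite size_map.
- by move=> _ /mapP[h ht ->]; rewrite !actM it// (actK Sy).
Qed.

Section Ergodic.
Variables (pr : set X -> R) (E : perg act pr).
Let Ipr := proj1 E. Let Spr := proj1 Ipr. Let Ppr := proj1 Spr. Let ip := proj2 Ipr.
Let Jp := isprob_iprob Ipr.

(** By ergodicity the translates of [A] fill the space. Made disjoint and pulled back into [A], they
    overlap at most [n] times, since pieces meeting at a point come from distinct points of its
    orbit. *)
Lemma finite_orbit_atoms n A : pr (orbit_ge n) = 0 -> measurable A -> 0 < pr A -> 1 <= n%:R * pr A.
Proof.
move=> Zn mA A0; have mZ := measurable_orbit_ge n.
pose D k := oapp (fun g => act g @^-1` A) set0 (choice.unpickle k).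
have mD k : measurable (D k) by rewrite /D; case: choice.unpickle => //= g; exact: mact.
pose B k := D k `\` \big[setU/set0]_(i < k) D i.
have mB k : measurable (B k) by apply: measurableD => //; exact: bigsetU_measurable.
have Bdis i j x : B i x -> B j x -> i = j.
  have key a b : (a < b)%N -> B a x -> B b x -> False.
    move=> ab [Da _] [_]; rewrite -bigcup_mkord; apply; by exists a.
  by move=> Bi Bj; case: (ltngtP i j) => // h; [case: (key i j)|case: (key j i)].
have DB x k : D k x -> exists i, B i x.
  move=> Dk; have exD : exists k, `[<D k x>] by exists k; apply/asboolP.
  case: (ex_minnP exD) => i /asboolP Di mini; exists i; split => //.
  rewrite -bigcup_mkord => -[j /= ji /asboolP Dj].
  by have := mini j Dj; rewrite leqNgt ji.
pose GA := [set x | exists g, A (act g x)].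
have mGA : measurable GA by apply: measurable_ex => g; exact: mact.
have GA1 : pr GA = 1.
  have [|h|//] := proj2 E GA mGA.
    apply: inv_of_le => g x [h hA]; exists (mul h g); by rewrite actM.
  have : pr A <= pr GA by apply: (pr_le Ppr) => // x Ax; exists one; rewrite act1.
  by rewrite h; lra.
have GAB : GA = \bigcup_k B k.
  apply/seteqP; split => x.
    move=> [g Ag]; have [|i Bi] := DB x (choice.pickle g); last by exists i.
    by rewrite /D choice.pickleK.
  by move=> [k _ [Dk _]]; move: Dk; rewrite /D; case: choice.unpickle => //= g Ag; exists g.
rewrite -[X in X <= _]GA1 GAB; apply: (sprob_bigcup Spr) => // N.
pose gk k : G := odflt one (choice.unpickle k).
pose Ek k := act (inv (gk k)) @^-1` B k.
have mEk k : measurable (Ek k) by exact: mact.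
have EA k : Ek k `<=` A.
  move=> y [Dk _]; move: Dk; rewrite /D /gk; case: choice.unpickle => //= g.
  by rewrite /preimage/= (actVK Sy).
pose Y := A `\` orbit_ge n; have mY : measurable Y by exact: measurableD.
have prY : pr Y = pr A.
  rewrite /Y (prD Ppr)//; suff -> : pr (A `&` orbit_ge n) = 0 by rewrite subr0.
  apply/eqP; rewrite eq_le (pr_ge0 Ppr (measurableI _ _ mA mZ)) andbT -Zn.
  by apply: (pr_le Ppr) => //; exact: measurableI.
have -> : \sum_(i < N) pr (B i) = \sum_(i <- iota 0 N) pr (Y `&` Ek i).
  have -> : iota 0 N = index_iota 0 N by rewrite /index_iota subn0.
  rewrite big_mkord; apply: eq_bigr => i _.
  rewrite -(ip (inv (gk i)) (mB i)) -/(Ek i) -[LHS](subrK (pr (Ek i `&` orbit_ge n))).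
  have -> : pr (Ek i `&` orbit_ge n) = 0.
    apply/eqP; rewrite eq_le (pr_ge0 Ppr (measurableI _ _ (mEk i) mZ)) andbT -Zn.
    by apply: (pr_le Ppr) => //; exact: measurableI.
  rewrite addr0 subr0; apply/eqP; rewrite eq_le; apply/andP; split.
    apply: le_trans (_ : pr ((Y `&` Ek i) `|` orbit_ge n) <= _).
      apply: (pr_le Ppr) => //; first by apply: measurableU => //; exact: measurableI.
      move=> x Ex; have [?|nz] := pselect (orbit_ge n x); [by right|left].
      by split => //; split => //; exact: EA Ex.
    by apply: le_trans (prU_le Ppr (measurableI _ _ mY (mEk i)) mZ) _; rewrite Zn addr0.
  by apply: (pr_le Ppr) => //; exact: measurableI.
rewrite -prY; apply: (sum_pr_le Ppr mEk mY) => y [Ay nZ].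
rewrite -natr_sum ler_nat -big_mkcond/= sum1_count -size_filter leqNgt; apply/negP => big.
apply: nZ; exists (take n [seq inv (gk i) | i <- [seq i <- iota 0 N | `[<Ek i y>]]]).
have inj i j : i \in [seq i <- iota 0 N | `[<Ek i y>]] -> j \in [seq i <- iota 0 N | `[<Ek i y>]] ->
    act (inv (gk i)) y = act (inv (gk j)) y -> i = j.
  rewrite !mem_filter => /andP[/asboolP Ei _] /andP[/asboolP Ej _] e.
  by apply: (Bdis i j (act (inv (gk i)) y)) => //; rewrite e.
split.
- rewrite take_uniq// map_inj_in_uniq ?filter_uniq ?iota_uniq// => i j ii jj e.
  by apply: inj => //; rewrite e.
- by rewrite size_takel// size_map ltnW.
- move=> _ _ /mem_take /mapP[i ii ->] /mem_take /mapP[j jj ->] /= e.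
  by rewrite (inj i j).
Qed.

(** Every name of positive mass has mass at least [1 / n], so names have entropy at most [ln n],
    however long they are. *)
Lemma finite_orbit_hent n (T : finType) (f : X -> T) : pr (orbit_ge n) = 0 -> mfin f ->
  hent act pr f <= 1.
Proof.
move=> Zn mf; have [x0] := fprob_inh Ppr.
have n0 : 1 <= n%:R :> R.
  by have := finite_orbit_atoms Zn measurableT; rewrite (prT Ppr) mulr1; apply.
have ln0 : 0 <= ln (n%:R : R) by exact: ln_ge0.
have Hb (K : seq G) : ent pr (nm act f K) <= ln n%:R.
  have mnf := mfin_nm mact (s := K) mf.
  rewrite -[leRHS]mul1r -[X in X * _](sum_law Ppr mnf) mulr_suml; apply: ler_sum => t _.
  have := law_ge0 Ppr t mnf; rewrite le_eqVlt => /predU1P[<-|l0]; first by rewrite phi0 mul0r.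
  rewrite /phi -mulrN; apply: ler_wpM2l; first exact: ltW.
  have h := finite_orbit_atoms Zn (mnf t) l0.
  rewrite -lnV ?posrE//; rewrite ler_ln ?posrE ?invr_gt0//; last exact: lt_le_trans n0.
  by rewrite -[leLHS]mul1r ler_pdivrMr.
have [N _ hN] := Fs_large hG iG hF (Num.bound (ln (n%:R : R))).
apply: (hent_leP Sy Jp mf (Fs_neq0 hF N)); apply: le_trans (Hb _) _.
rewrite mul1r; apply: le_trans (ltW (archi_boundP ln0)) _; rewrite ler_nat.
exact: (hN N (leqnn N)).
Qed.

End Ergodic.
End Cases.

Section ErgodicCoding.
Context {R : realType} {G : countType} (mul : G -> G -> G) (one : G) (inv : G -> G)
  (Fs : nat -> {fset G}) {dX : measure_display} {X : measurableType dX}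
  (d : X -> X -> R) (act : G -> X -> X).
Hypotheses (hG : is_group mul one inv) (iG : infinite_group (G := G))
  (hF : folner (R := R) mul Fs)
  (hd : is_metric d) (cpt : dcompact d) (bor : borel_space d) (hact : is_action one d act mul).
Local Notation orbit_ge := (orbit_ge act).
Local Notation stab_ge := (stab_ge act).
Let Sy := dsys hG hF hd bor hact.
Let actM := sysM Sy.

Section Pr.
Variables (pr : set X -> R) (E : perg act pr).
Let Ipr := proj1 E. Let Spr := proj1 Ipr. Let Ppr := proj1 Spr.
Let Jp := isprob_iprob Ipr.

Lemma orbit_ge_infinite : (forall n, pr (orbit_ge n) = 1) -> infinite_orbits act pr.
Proof.
move=> h1 n e e0; have := h1 n; rewrite orbit_geE => h.
have [|l [Bad [mB pB hB]]] := exhaust Spr _ h e0.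
  by move=> t; exact: measurable_orbit_t hd bor hact n t.
exists (flatten l), Bad; split => // x /hB [t tl [[ut st] it]].
by exists t; split => // g gt; apply/flattenP; exists t.
Qed.

Lemma card_stab (S : seq G) (x : X) :
  #|[set i | stab act S x i]%SET| = count (fun g => `[< act g x = x >]) S.
Proof.
rewrite cardsE -sum1_card -sum1_count [RHS]big_tnth.
by apply: eq_bigl => i; rewrite /in_mem /= ffunE.
Qed.

Lemma stab_ge_full n : pr (stab_ge n) = 1 ->
  forall de : R, 0 < de -> exists (S : seq G) (Bad : set X),
    [/\ uniq S, one \in S, measurable Bad, pr Bad <= de &
        forall x, ~ Bad x -> (n <= #|[set i | stab act S x i]%SET|)%N].
Proof.
rewrite stab_geE => h e e0; have [|l [Bad [mB pB hB]]] := exhaust Spr _ h e0.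
  by move=> t; exact: measurable_stab_t hG hF hd bor hact n t.
exists (undup (one :: flatten l)), Bad; split => //; first exact: undup_uniq.
  by rewrite mem_undup mem_head.
move=> x /hB [t tl [[ut <-] it]]; rewrite card_stab -size_filter uniq_leq_size// => g gt.
rewrite mem_filter mem_undup in_cons; apply/andP; split; first by apply/asboolP; exact: it.
by apply/orP; right; apply/flattenP; exists t.
Qed.

(** If [f^-1 x] and [f0^-1 x] coincide, then [f f0^-1] fixes [x]. *)
Lemma stab_ge_mult A x : ~ stab_ge A.+1 x -> forall (F : seq G), uniq F -> forall z,
  (count (fun f => `[< act (inv f) x = z >]) F <= A)%N.
Proof.
move=> nS F uF z; rewrite leqNgt -size_filter; apply/negP => big; apply: nS.
case EL : [seq _ <- F | _] big => [//|f0 L] big.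
have hL f : f \in f0 :: L -> act (inv f) x = z.
  by rewrite -EL mem_filter => /andP[/asboolP].
exists (take A.+1 [seq mul f (inv f0) | f <- f0 :: L]); split.
- by rewrite take_uniq// map_inj_uniq -?EL ?filter_uniq//; exact: mul_injr hG _.
- by rewrite size_takel// size_map.
- move=> _ /mem_take /mapP[f fL ->]; rewrite actM (hL f0 (mem_head _ _)) -(hL f fL).
  exact: (actVK Sy).
Qed.

(** By ergodicity the orbit size and the stabiliser order are almost surely constant. Finite orbits
    and infinite stabilisers are settled by the crude partition [rho]; otherwise [coding] applies
    with [A] the order of the stabilisers. *)
Lemma ergodic_coding (e a : R) : 0 < e -> 0 <= a ->
  shapes mul act pr (fun x y => d x y <= e) a ->
  exists (U : finType) (al : X -> U), [/\ mfin al, near_le d e al & hent act pr al <= a + 1].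
Proof.
move=> e0 a0 Sh; have [TR [rho [mrho hrho]]] := fine_map hd cpt bor e0.
have nrho : near_le d e rho by move=> x y /hrho /ltW.
have sepH := dseparating hd cpt bor hact Spr.
have zo := proj2 E.
have [[n on]|ninf] := pselect (exists n, pr (orbit_ge n) = 0).
  exists TR, rho; split => //; apply: le_trans (_ : 1 <= _); last by lra.
  exact: (finite_orbit_hent hG iG hF hd bor hact E on mrho).
have inf : infinite_orbits act pr.
  apply: orbit_ge_infinite => n.
  have [//|h|//] := zo (orbit_ge n) (measurable_orbit_ge hd bor hact n).
    by move=> g; exact: orbit_ge_inv hG hF hd bor hact n g.
  by case: ninf; exists n.
have zs n : pr (stab_ge n) = 0 \/ pr (stab_ge n) = 1.
  apply: zo; first exact: measurable_stab_ge hG hF hd bor hact n.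
  by move=> g; exact: stab_ge_inv hG hF hd bor hact n g.
have [exn|nex] := pselect (exists n, `[< pr (stab_ge n) = 0 >]); last first.
  exists TR, rho; split => //; apply: le_trans (_ : 1 <= _); last by lra.
  apply: (hent_inf_stab Sy Jp mrho sepH inf) => n de; apply: stab_ge_full.
  by have [h|//] := zs n; case: nex; exists n; apply/asboolP.
(* [n] is the least size that stabilisers almost surely fail to reach, so almost all of them have
   [n - 1] elements; [n] exceeds 1 because the identity always belongs to them. *)
case: (ex_minnP exn) => n /asboolP n0 minn.
have n2 : (1 < n)%N.
  rewrite ltnNge; apply/negP => n1; move: n0; suff -> : stab_ge n = setT by rewrite (prT Ppr); lra.
  apply/seteqP; split => // x _; case: n n1 {minn} => [|[|//]] _; first by exists [::].
  by exists [:: one]; split => // g; rewrite inE => /eqP ->; exact: (sys1 Sy).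
have sA : pr (stab_ge n.-1) = 1.
  by have [/asboolP /minn|//] := zs n.-1; lia.
have nE : n = n.-1.+1 by lia.
apply: (coding Sy Jp (A := n.-1) _ sepH (N0 := stab_ge n) _ n0 _ mrho nrho Sh a0 inf) => //.
- by lia.
- exact: measurable_stab_ge hG hF hd bor hact n.
- by move=> x; rewrite [X in stab_ge X]nE; exact: stab_ge_mult.
- exact: stab_ge_full.
Qed.
End Pr.

(** Good [n] occur beyond any bound, hence with [Fs n] as large and as invariant as required. Two
    points of the same ball are at distance at most [2 * e] through its centre. *)
Lemma katok_shapes (mu : {measure set X -> \bar R}) (e a : R) : isprob mu ->
  (forall (del : R) (N : nat), 0 < del -> del < 1 -> exists n (s : seq X), [/\ (N <= n)%N,
     ((1 - del)%:E <= mu (\bigcup_(x in [set` s]) ballF d act (Fs n) x e))%E &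
     ln (size s)%:R <= a * #|` Fs n|%:R]) ->
  shapes mul act (fun A => fine (mu A)) (fun x y => d x y <= 2 * e) a.
Proof.
move=> Pmu hK T ka de m ka0 de0; have Ppr := proj1 (sprob_meas Pmu).
have [N1 _ h1] := Fs_large hG iG hF m.
have [N2 _ h2] := folner_bdl hF T ka0.
(* Kept at most [2^-1] so that the family of balls cannot be empty. *)
pose del := Num.min de 2^-1.
have del0 : 0 < del by rewrite lt_min de0/=; lra.
have del1 : del < 1 by rewrite gt_min; apply/orP; right; lra.
have dele : del <= de by rewrite ge_min lexx.
have [n [s [Nn cov sz]]] := hK del (maxn N1 N2) del0 del1.
pose Y := \bigcup_(x in [set` s]) ballF d act (Fs n) x e.
have oY : dopen d Y by apply: dopen_bigcup => x _; exact: open_ballF hd hact _ _ _.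
have mY := mopen bor oY.
have s0 : (0 < size s)%N.
  rewrite lt0n; apply/negP => /nilP E; move: cov; rewrite E.
  have -> : [set` [::]] = set0 :> set X by apply/seteqP; split.
  by rewrite bigcup_set0 measure0 lee_fin; lra.
case: s s0 cov sz @Y oY mY => [//|x0 s] _ cov sz Y oY mY.
pose b (x : X) : {ffun 'I_(size s).+1 -> bool} :=
  [ffun i : 'I_(size s).+1 => `[< ballF d act (Fs n) (nth x0 (x0 :: s) i) e x >]].
have mb : mfin b.
  apply: mfin_ffun => i; apply: mfin_set; apply: (mopen bor); exact: open_ballF hd hact _ _ _.
(* Selects a ball containing the point; [ord0] is a default that matters only off [Y]. *)
pose h (w : {ffun 'I_(size s).+1 -> bool}) := odflt ord0 [pick i | w i].
have hY x : Y x -> ballF d act (Fs n) (nth x0 (x0 :: s) (h (b x))) e x.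
  move=> [y /= ys Bx]; rewrite /h; case: pickP => [i|]; first by rewrite ffunE => /asboolP.
  move=> /(_ (inord (index y (x0 :: s)))); rewrite ffunE => /asboolPn; case.
  by rewrite inordK ?index_mem// nth_index.
exists (Fs n), Y, (size s).+1, (h \o b); split.
- split; first by apply: h1; apply: leq_trans Nn; exact: leq_maxl.
  by apply: h2; apply: leq_trans Nn; exact: leq_maxr.
- by split => //; exact: mfin_comp.
- rewrite (prC Ppr)//; apply: le_trans dele.
  by move: cov; rewrite -[X in (_ <= X)%E](fineK (meas_fin Pmu mY)) lee_fin -/Y; lra.
- by [].
- move=> x y Yx Yy; rewrite /= => e1 f fF.
  have := hY x Yx; have := hY y Yy; rewrite e1 /ballF/= => hy hx.
  set z := nth _ _ _ in hx hy.
  apply: le_trans (dT hd (act f z) _ _) _; rewrite (dC hd).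
  have := dF_ge d act z x fF; have := dF_ge d act z y fF; lra.
Qed.
End ErgodicCoding.

(** * Comparison of the entropies *)

Section ExtLog.
Context {R : realType}.
Local Open Scope ereal_scope.

Lemma elog_mono (x y : \bar R) : x <= y -> elog x <= elog y.
Proof.
case: x => [x||]; case: y => [y||] //=; rewrite ?leey ?leNye//.
rewrite lee_fin => xy; case: ifP => x0; last by rewrite leNye.
have y0 := lt_le_trans x0 xy.
by rewrite y0 lee_fin ler_ln ?posrE.
Qed.

Lemma elog_lt (x : \bar R) (c : R) : elog x < c%:E -> x < (expR c)%:E.
Proof.
case: x => [x||] //=; last by rewrite !ltNyr.
case: ifPn => x0 h; rewrite lte_fin; last by rewrite (le_lt_trans _ (expR_gt0 c))// leNgt.
by rewrite -(lnK x0) ltr_expR -lte_fin.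
Qed.

Lemma elog_ge0 (x : \bar R) : 1 <= x -> 0 <= elog x.
Proof. by move=> /elog_mono; apply: le_trans; rewrite /= ltr01 ln1. Qed.

(** By monotonicity the limit at 0 is a supremum. *)
Lemma lim0_ge (f : R -> \bar R) (del : R) : (0 < del)%R ->
  (forall a b : R, (0 < a)%R -> (a <= b)%R -> f b <= f a) -> f del <= lim (f x @[x --> 0%R^'+]).
Proof.
move=> del0 h; have -> : lim (f x @[x --> 0%R^'+]) =
    ereal_sup [set f x | x in [set` Interval (BRight (0%R : R)) (BRight del)]].
  apply: cvg_lim => //; apply: nonincreasing_at_right_cvge => // a b.
  by rewrite !in_itv/= => /andP[a0 _] _ /h; apply.
by apply: ereal_sup_ubound; exists del => //=; rewrite in_itv/= del0/=.
Qed.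

Lemma lim0_le (f : R -> \bar R) (M : \bar R) :
  (forall a b : R, (0 < a)%R -> (a <= b)%R -> f b <= f a) ->
  (forall a : R, (0 < a)%R -> f a <= M) -> lim (f x @[x --> 0%R^'+]) <= M.
Proof.
move=> h hM; have -> : lim (f x @[x --> 0%R^'+]) =
    ereal_sup [set f x | x in [set` Interval (BRight (0%R : R)) (BRight (1%R : R))]].
  apply: cvg_lim => //; apply: nonincreasing_at_right_cvge => //.
    by rewrite bnd_simp.
  by move=> a b; rewrite !in_itv/= => /andP[a0 _] _ /h; apply.
by apply: ge_ereal_sup => _ [x + <-]; rewrite /= in_itv/= => /andP[x0 _]; exact: hM.
Qed.
End ExtLog.

Lemma eq_hent {R : realType} {G : countType} {dX : measure_display} {X : measurableType dX}
  (act : G -> X -> X) (p q : set X -> R) (T : finType) (f : X -> T) :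
  (forall g A, measurable A -> measurable (act g @^-1` A)) ->
  (forall A, measurable A -> p A = q A) -> mfin f -> hent act p f = hent act q f.
Proof.
move=> mact pq mf; rewrite /hent; congr inf; apply: eq_imagel => K _; congr (_ / _).
apply: eq_bigr => t _; congr phi; rewrite /plaw; apply: pq.
exact: (mfin_nm mact (s := K) mf).
Qed.

Section Final.
Context {R : realType} {G : countType} (mul : G -> G -> G) (one : G) (inv : G -> G)
  (Fs : nat -> {fset G}) {dX : measure_display} {X : measurableType dX}
  (d : X -> X -> R) (act : G -> X -> X).
Hypotheses (hG : is_group mul one inv) (iG : infinite_group (G := G))
  (hF : folner (R := R) mul Fs)
  (hd : is_metric d) (cpt : dcompact d) (bor : borel_space d) (hact : is_action one d act mul).
Let Sy := dsys hG hF hd bor hact.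
Let mact := sys_mact Sy.
Local Notation meas := {measure set X -> \bar R}.
Local Notation mpr mu := (fun A => fine (mu A)).
Local Notation dF := (dF d act).
Local Notation ballF := (ballF d act).
Local Notation sep := (sep d act).
Local Notation Rmu := (Rmu d act).
Local Open Scope ereal_scope.

Definition sep_growth (e : R) : \bar R :=
  limn_esup (fun n => avg (Fs n) (elog (sep setT (Fs n) e))).
Local Notation hS := sep_growth.

Let Fgt n : (0 < #|` Fs n|%:R :> R)%R := Fs_gt0R hF n.

Lemma avg_mono n (x y : \bar R) : x <= y -> avg (Fs n) x <= avg (Fs n) y.
Proof. by move=> xy; apply: lee_wpmul2l => //; rewrite lee_fin invr_ge0 ltW. Qed.

Lemma Rmu_mono (mu : meas) F e (a b : R) : (a <= b)%R -> Rmu mu F e b <= Rmu mu F e a.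
Proof.
move=> ab; apply: le_ereal_inf => _ [s /= hs <-]; exists s => //=.
by apply: le_trans hs; rewrite lee_fin lerD2l lerN2.
Qed.

Lemma Rmu_le_cover (mu : meas) n e (del : R) (Y : set X) (s : seq X) : isprob mu -> measurable Y ->
  (fine (mu (~` Y)) <= del)%R -> (forall y, Y y -> exists2 x, x \in s & (dF (Fs n) x y < e)%R) ->
  Rmu mu (Fs n) e del <= (size s)%:R%:E.
Proof.
move=> Pmu mY hY hs; apply: ereal_inf_lbound; exists s => //=.
have Ppr := proj1 (sprob_meas Pmu).
apply: (@le_trans _ _ (mu Y)).
  rewrite -(fineK (meas_fin Pmu mY)) lee_fin.
  by move: hY; rewrite (prC Ppr mY) => h; rewrite lerBlDr addrC -lerBlDr.
apply: le_measure; rewrite ?inE//.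
by apply: (mopen bor); apply: dopen_bigcup => x _; exact: open_ballF hd hact _ _ _.
Qed.

Lemma Rmu_ge1 (mu : meas) F e (del : R) : (del < 1)%R -> 1 <= Rmu mu F e del.
Proof.
move=> del1; apply: le_ereal_inf_tmp => _ [s /= hs <-]; rewrite lee_fin ler1n lt0n.
apply/negP => /nilP E; move: hs; rewrite E.
have -> : [set` [::]] = set0 :> set X by apply/seteqP; split.
by rewrite bigcup_set0 measure0 lee_fin leNgt subr_gt0 del1.
Qed.

Let kup (mu : meas) e del := limn_esup (fun n => avg (Fs n) (elog (Rmu mu (Fs n) e del))).
Let klo (mu : meas) e del := limn_einf (fun n => avg (Fs n) (elog (Rmu mu (Fs n) e del))).

Lemma kup_mono mu e (a b : R) : (0 < a)%R -> (a <= b)%R -> kup mu e b <= kup mu e a.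
Proof.
move=> _ ab; apply: esup_mono; apply: nearW => n; apply: avg_mono; apply: elog_mono.
exact: Rmu_mono.
Qed.
Lemma klo_mono mu e (a b : R) : (0 < a)%R -> (a <= b)%R -> klo mu e b <= klo mu e a.
Proof.
move=> _ ab; apply: (@einf_mono _ _ _ \oo); apply: nearW => n; apply: avg_mono; apply: elog_mono.
exact: Rmu_mono.
Qed.

Lemma katok_lo_le_up mu e : katok_lo d act Fs mu e <= katok_up d act Fs mu e.
Proof.
apply: lim0_le; first exact: klo_mono.
move=> a a0; apply: le_trans (lim0_ge a0 (@kup_mono mu e)); exact: (@einf_le_esup _ _ _ \oo).
Qed.

Lemma katok_lo_ge0 mu e : 0 <= katok_lo d act Fs mu e.
Proof.
have h0 : (0 < 2^-1 :> R)%R by rewrite invr_gt0.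
apply: le_trans (lim0_ge h0 (@klo_mono mu e)).
rewrite /klo /limn_einf leeNr oppe0; apply: (@esup_le _ _ _ \oo); apply: nearW => n /=.
rewrite leeNl oppe0; apply: mule_ge0; first by rewrite lee_fin invr_ge0 ltW.
by apply: elog_ge0; apply: Rmu_ge1; rewrite invf_lt1// ltr1n.
Qed.

(** A largest [e]-separated set spans with a weak inequality; doubling [e] gives the strict one of
    [ballF]. *)
Lemma katok_up_le_sep mu e : isprob mu -> (0 < e)%R ->
  katok_up d act Fs mu (2 * e) <= hS e.
Proof.
move=> Pmu e0; apply: lim0_le; first exact: kup_mono.
move=> a a0; apply: esup_mono; apply: nearW => n; apply: avg_mono; apply: elog_mono.
have [s [_ _ -> hs]] := sep_spanning hd cpt hact setT (Fs n) e0.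
apply: (Rmu_le_cover Pmu measurableT); first by rewrite setCT measure0 ltW.
move=> y _; have [x xs h] := hs y I; exists x => //; apply: le_lt_trans h _.
by rewrite mulr_natl mulr2n ltrDl.
Qed.

(** The set of all probabilities is a neighbourhood of [mu], with an empty family of test
    functions. *)
Lemma PS_le_sep mu e : isprob mu -> PS one d act Fs mu e <= hS e.
Proof.
move=> Pmu; apply: (@le_trans _ _
    (limn_esup (fun n => avg (Fs n) (elog (sep (XFO one act (Fs n) (@isprob R dX X)) (Fs n) e))))).
  apply: ereal_inf_lbound; exists (@isprob R dX X) => //; split => //.
  by exists 0%N, (fun _ _ => 0%R), 1%R; split => // -[].
apply: esup_mono; apply: nearW => n; apply: avg_mono; apply: elog_mono.
by apply: le_ereal_sup => _ [s [_ hs] <-]; exists s.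
Qed.

Lemma ergodic_perg (mu : meas) : ergodic act mu -> perg act (mpr mu).
Proof.
move=> [[Pmu imu] emu]; split; first split.
- exact: sprob_meas.
- by move=> g A mA /=; rewrite imu.
- by move=> A mA iA; have [->|->] := emu A mA iA; [left|right].
Qed.

(** By [emp_good] most points have empirical measures in the neighbourhood, so balls around a set
    spanning [XFO] already carry the required mass. *)
Lemma katok_lo_le_PS mu e : ergodic act mu -> (0 < e)%R ->
  katok_lo d act Fs mu (2 * e) <= PS one d act Fs mu e.
Proof.
move=> Emu e0; have Pmu := proj1 (proj1 Emu).
apply: le_ereal_inf_tmp => _ [Op nO <-]; apply: lim0_le; first exact: klo_mono.
move=> a a0; apply: le_trans (@einf_le_esup _ _ _ \oo _ _).
apply: (@einf_mono _ _ _ \oo).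
have := emp_good hG hF hd cpt bor hact Pmu (ergodic_perg Emu) nO a0.
apply: filterS => n [Y [mY hY YO]]; apply: avg_mono; apply: elog_mono.
have [s [_ _ -> hs]] := sep_spanning hd cpt hact (XFO one act (Fs n) Op) (Fs n) e0.
apply: (Rmu_le_cover Pmu mY hY) => y /YO /hs [x xs h]; exists x => //; apply: le_lt_trans h _.
by rewrite mulr_natl mulr2n ltrDl.
Qed.

(** The lower limit supplies ball families for arbitrarily late [n], as [katok_shapes] asks; the
    term 1 is the loss in [ergodic_coding]. *)
Lemma E1a_le_katok mu e : ergodic act mu -> (0 < e)%R ->
  hE1a d act Fs mu (2 * e) <= katok_lo d act Fs mu e + 1%:E.
Proof.
move=> Emu e0; have Imu := proj1 Emu; have Pmu := proj1 Imu.
have := katok_lo_ge0 mu e; case Ek : (katok_lo d act Fs mu e) => [k||] //=; rewrite ?leey//.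
rewrite lee_fin => k0; apply/lee_addgt0Pr => eta eta0.
have ka a : (0 < a)%R -> klo mu e a < (k + eta)%:E.
  by move=> a0; apply: le_lt_trans (lim0_ge a0 (@klo_mono mu e)) _; rewrite -/(katok_lo _ _ _ _ _) Ek lte_fin ltrDl.
have hK (del : R) (N : nat) : (0 < del)%R -> (del < 1)%R -> exists n (s : seq X), [/\ (N <= n)%N,
     (1 - del)%:E <= mu (\bigcup_(x in [set` s]) ballF (Fs n) x e) &
     (ln (size s)%:R <= (k + eta) * #|` Fs n|%:R)%R].
  move=> d0 _; have VN : \forall n \near \oo, (N <= n)%N by exists N.
  have [n /= Nn hn] := @einf_lt_freq _ _ _ \oo _ _ (ka del d0) _ VN.
  move: hn; rewrite /avg lte_pdivrMl// => /elog_lt /ereal_inf_lt [_ [s /= hs <-]].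
  rewrite lte_fin => hsz; exists n, s; split => //.
  (* An empty family is harmless here because [ln 0] is 0 by convention. *)
  have [->|sN0] := posnP (size s); first by rewrite ln0// mulr_ge0// addr_ge0// ltW.
  by rewrite -(expRK ((k + eta) * _)%R) mulrC ler_ln ?posrE ?ltr0n ?expR_gt0// ltW.
have ke0 : (0 <= k + eta)%R by rewrite addr_ge0// ltW.
have Sh := katok_shapes hG iG hF hd bor hact Pmu hK.
have e20 : (0 < 2 * e)%R by rewrite mulr_gt0.
have [T [al [mal nal hal]]] := ergodic_coding hG iG hF hd cpt bor hact (ergodic_perg Emu) e20 ke0 Sh.
apply: le_trans (hE1a_le hG hF hd bor hact Imu mal nal) _.
by rewrite -!EFinD lee_fin addrAC.
Qed.

Lemma pairwise_sym (T : eqType) (r : rel T) (s : seq T) : symmetric r -> pairwise r s ->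
  forall x y, x \in s -> y \in s -> x <> y -> r x y.
Proof.
move=> rC; elim: s => [//|z s IH] /= /andP[/allP zs ps] x y; rewrite !inE.
move=> /predU1P[->|xs] /predU1P[->|ys] // xy; [exact: zs|by rewrite rC; exact: zs|exact: IH].
Qed.

Lemma ball_cover_open e U : is_ocover d U ->
  (forall x, exists2 B, B \in U & dball d x (e / 4) `<=` B) ->
  (forall j, dopen d (idx_cover (U := U) j)) /\
  (forall x, exists j, forall y, (d x y < e / 4)%R -> idx_cover (U := U) j y).
Proof.
move=> [oU _] hU; split => [j|x]; first by apply: oU; exact: mem_nth.
have [B BU hB] := hU x; have iB : (index B U < size U)%N by rewrite index_mem.
by exists (Ordinal iB) => y xy; rewrite /idx_cover /= nth_index//; exact: hB.
Qed.

(* The Lebesgue number of [U] is what lets an arbitrary fine partition of the ergodic measure refine [U]. *)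
Lemma supE_E1a_ge e U (q0 : set X -> R) b : (0 < e)%R -> is_ocover d U ->
  (forall x, exists2 B, B \in U & dball d x (e / 4) `<=` B) ->
  isprob_inv act q0 -> (b <= hcov act (idx_cover (U := U)) q0)%R ->
  (b - 1)%:E <= supE act (hE1a d act Fs) (e / 8).
Proof.
move=> e0 cU hU Iq bq; have [oU lU] := ball_cover_open cU hU.
have e4 : (0 < e / 4)%R by rewrite divr_gt0.
have cU' x : exists j, idx_cover (U := U) j x.
  by have [j hj] := lU x; exists j; apply: hj; rewrite (dxx hd).
have [nu Enu hnu] := max_principle hG iG hF hd cpt bor hact oU cU' Iq.
have [[Snu inu] enu] := Enu.
have [mu hmu] := meas_sprob Snu.
have Imu : Defs.invariant act mu.
  split; first by rewrite /isprob hmu// (prT (proj1 Snu)).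
  by move=> g A mA; rewrite !hmu//; [rewrite inu|exact: mact].
have Emu : ergodic act mu.
  by split => // A mA iA; rewrite hmu//; have [->|->] := enu A mA iA; [left|right].
apply: (@le_trans _ _ (hE1a d act Fs mu (e / 8))); last by apply: ereal_sup_ubound; exists mu.
apply: (hE1a_ge hG hF hd bor hact Imu) => T f mf nf.
have -> : hent act (mpr mu) f = hent act nu f by apply: eq_hent => // A mA; rewrite hmu.
apply: le_trans (hcov_le_hent hG hF hd bor hact oU cU' (proj1 Enu) mf _).
  by apply: le_trans hnu; rewrite lerD2r.
move=> x; have [j hj] := lU x; exists j => y fxy; apply: hj; apply: le_lt_trans (nf x y (esym fxy)) _.
by rewrite ltr_pM2l// ltf_pV2 ?posrE// ltr_nat.
Qed.

(** Elements of a cover of diameter at most [e] cannot contain two points more than [e] apart, so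
    [misiurewicz] applies to largest separated sets. The 1 is lost in [max_principle]. *)
Lemma sep_le_E1a e : (0 < e)%R -> hS e <= supE act (hE1a d act Fs) (e / 8) + 1%:E.
Proof.
move=> e0; rewrite leNgt; apply/negP => /ereal_between [b [hb1 hb2]].
have [U [cU dU hU]] := ball_cover hd cpt e0.
have [oU lU] := ball_cover_open cU hU.
have e4 : (0 < e / 4)%R by rewrite divr_gt0.
have cU' x : exists j, idx_cover (U := U) j x.
  by have [j hj] := lU x; exists j; apply: hj; rewrite (dxx hd).
have [|mu Imu hmu] := misiurewicz hG hF hd cpt bor hact oU cU' (b := b).
  move=> N; have VN : \forall n \near \oo, (N <= n)%N by exists N.
  have [n /= Nn hn] := @esup_gt_freq _ _ _ \oo _ _ hb2 _ VN.
  have [s [_ ps es _]] := sep_spanning hd cpt hact setT (Fs n) e0.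
  move: hn; rewrite es /avg lte_pdivlMl//=.
  case: ifPn => [s0|_]; last by rewrite ltNge leNye.
  rewrite -EFinM lte_fin mulrC => hn.
  have sC : symmetric (fun x y => e < dF (Fs n) x y)%R by move=> x y; rewrite (dFC _ hd).
  exists n, s; split => //.
  - apply: pairwise_uniq ps => x; apply/negbTE; rewrite -leNgt; apply: dF_le; first exact: ltW.
    by move=> g _; rewrite (dxx hd) ltW.
  - by move: s0; rewrite ltr0n; case: s {ps es hn}.
  - exact: ltW.
  - move=> x y xs ys xy; have exy := pairwise_sym sC ps xs ys xy.
    apply: contrapT => nex; move: exy; rewrite ltNge => /negP; apply.
    apply: dF_le; first exact: ltW.
    move=> g gF; rewrite leNgt; apply/negP => eg; apply: nex; exists g => // j [Ux Uy].
    move: eg; rewrite ltNge => /negP; apply.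
    have := dU (idx_cover j) (mem_nth _ (ltn_ord j)); rewrite diam_leP; exact.
have bq := hcov_ge hG hF hd bor hact oU cU' Imu hmu.
have := supE_E1a_ge e0 cU hU Imu bq; move: hb1; rewrite ltNge => /negP h1 h2; apply: h1.
by rewrite -(subrK 1%R b) EFinD; apply: leeD2r.
Qed.

(** Maps subordinate to a cover of diameter at most [e] compete in [hE1a], so [hcov] bounds it;
    [max_principle] then passes to an ergodic measure. *)
Lemma supI_le_supE_E1a e : (0 < e)%R ->
  supI act (hE1a d act Fs) e <= supE act (hE1a d act Fs) (e / 8) + 1%:E.
Proof.
move=> e0; apply: ge_ereal_sup => _ [mu Imu <-].
have [U [cU dU hU]] := ball_cover hd cpt e0.
have [oU lU] := ball_cover_open cU hU.
have e4 : (0 < e / 4)%R by rewrite divr_gt0.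
have cU' x : exists j, idx_cover (U := U) j x.
  by have [j hj] := lU x; exists j; apply: hj; rewrite (dxx hd).
have Iq : isprob_inv act (mpr mu).
  by split; [apply: sprob_meas; exact: (proj1 Imu)|move=> g A mA /=; rewrite (proj2 Imu)].
have := supE_E1a_ge e0 cU hU Iq (lexx _); set c := hcov _ _ _ => hc.
apply: (@le_trans _ _ c%:E); last first.
  by rewrite -(subrK 1%R c) EFinD; apply: leeD2r.
apply/lee_addgt0Pr => eta eta0.
have [T [f [mf sf hf]]] := hcov_near hG hF hd bor hact oU cU' Iq eta0.
apply: le_trans (hE1a_le hG hF hd bor hact Imu mf _) _; last by rewrite -EFinD lee_fin.
move=> x y fxy; have [j hj] := sf x.
have := dU (idx_cover j) (mem_nth _ (ltn_ord j)); rewrite diam_leP; apply; exact: hj.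
Qed.

Lemma supE_E1a_le e : (0 < e)%R -> supE act (hE1a d act Fs) e <= hS (e / 4) + 1%:E.
Proof.
move=> e0; apply: ge_ereal_sup => _ [mu Emu <-].
have e2 : (0 < e / 2)%R by rewrite divr_gt0.
have e4 : (0 < e / 4)%R by rewrite divr_gt0.
have Ee : (e = 2 * (e / 2))%R by field.
have Ee2 : (e / 2 = 2 * (e / 4))%R by field.
rewrite {1}Ee; apply: le_trans (E1a_le_katok Emu e2) _; apply: leeD2r.
rewrite Ee2; apply: le_trans (katok_lo_le_up mu _) _.
exact: katok_up_le_sep (proj1 (proj1 Emu)) e4.
Qed.

Lemma supE_le_supI h (e : R) : supE act h e <= supI act h e.
Proof. by apply: le_ereal_sup => _ [mu [Imu _] <-]; exists mu. Qed.
Lemma supI_le_supM h (e : R) : supI act h e <= supM h e.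
Proof. by apply: le_ereal_sup => _ [mu [Pmu _] <-]; exists mu. Qed.

(** The cycle [hS <= supE <= supI <= hS], up to rescalings and constants, makes all the limits
    equal. *)
Lemma conclE1_of h (c c' C C' : R) : (0 < c)%R -> (0 < c')%R ->
  (forall e : R, (0 < e)%R -> hS e <= supE act h (c * e) + C%:E) ->
  (forall e : R, (0 < e)%R -> supI act h e <= hS (c' * e) + C'%:E) ->
  conclE1 d act Fs h.
Proof.
move=> c0 c0' h1 h2.
have N1 : \forall e \near (0 : R)^'+, hS e <= supE act h (c * e)%R + C%:E.
  by have := @near0_lt R 1%R ltr01; apply: filterS => e /andP[e0 _]; exact: h1.
have N2 : \forall e \near (0 : R)^'+, supE act h e <= supI act h (1 * e)%R + 0%:E.
  by apply: nearW => e; rewrite mul1r adde0; exact: supE_le_supI.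
have N3 : \forall e \near (0 : R)^'+, supI act h e <= hS (c' * e)%R + C'%:E.
  by have := @near0_lt R 1%R ltr01; apply: filterS => e /andP[e0 _]; exact: h2.
have o := @ltr01 R.
have S1 := LS_le c0 N1; have S2 := LS_le o N2; have S3 := LS_le c0' N3.
have I1 := LI_le c0 N1; have I2 := LI_le o N2; have I3 := LI_le c0' N3.
split; apply/eqP; rewrite eq_le; apply/andP; split => //.
- exact: le_trans S2 S3.
- exact: le_trans S1 S2.
- exact: le_trans I2 I3.
- exact: le_trans I1 I2.
Qed.

Lemma conclE2_of h (c c' C C' : R) : (0 < c)%R -> (0 < c')%R ->
  (forall e : R, (0 < e)%R -> hS e <= supE act h (c * e) + C%:E) ->
  (forall e : R, (0 < e)%R -> supM h e <= hS (c' * e) + C'%:E) ->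
  conclE2 d act Fs h.
Proof.
move=> c0 c0' h1 h2.
have h3 e : (0 < e)%R -> supI act h e <= hS (c' * e)%R + C'%:E.
  by move=> e0; apply: le_trans (supI_le_supM h e) _; exact: h2.
have c1 := conclE1_of c0 c0' h1 h3.
have N2 : \forall e \near (0 : R)^'+, supI act h e <= supM h (1 * e)%R + 0%:E.
  by apply: nearW => e; rewrite mul1r adde0; exact: supI_le_supM.
have N3 : \forall e \near (0 : R)^'+, supM h e <= hS (c' * e)%R + C'%:E.
  by have := @near0_lt R 1%R ltr01; apply: filterS => e /andP[e0 _]; exact: h2.
have o := @ltr01 R; have [_ uI _ lI] := c1.
split => //; apply/eqP; rewrite eq_le; apply/andP; split.
- by rewrite uI; exact: LS_le o N2.
- exact: LS_le c0' N3.
- by rewrite lI; exact: LI_le o N2.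
- exact: LI_le c0' N3.
Qed.

Lemma conclE1_E1a_equiv h (c c' : R) : (0 < c)%R -> (0 < c')%R ->
  (forall mu e, Defs.invariant act mu -> (0 < e)%R -> hE1a d act Fs mu e <= h mu (c * e)%R) ->
  (forall mu e, Defs.invariant act mu -> (0 < e)%R -> h mu e <= hE1a d act Fs mu (c' * e)%R) ->
  conclE1 d act Fs h.
Proof.
move=> c0 c0' h1 h2.
(* The 8 comes from [sep_le_E1a]; 32 is the 8 of [supI_le_supE_E1a] times the 4 of [supE_E1a_le]. *)
apply: (@conclE1_of _ (c / 8) (c' / 32) 1 2) => [||e e0|e e0]; rewrite ?divr_gt0//.
  apply: le_trans (sep_le_E1a e0) _; apply: leeD2r; apply: ge_ereal_sup => _ [mu Emu <-].
  apply: le_trans (h1 mu _ (proj1 Emu) _) _; first by rewrite divr_gt0.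
  by apply: ereal_sup_ubound; exists mu => //; congr h; field.
have ce0 : (0 < c' * e)%R by rewrite mulr_gt0.
apply: (@le_trans _ _ (supI act (hE1a d act Fs) (c' * e)%R)).
  apply: ge_ereal_sup => _ [mu Imu <-]; apply: le_trans (h2 mu e Imu e0) _.
  by apply: ereal_sup_ubound; exists mu.
apply: le_trans (supI_le_supE_E1a ce0) _.
have -> : (2 = 1 + 1 :> R)%R by [].
rewrite EFinD addeA; apply: leeD2r; apply: le_trans (supE_E1a_le _) _; first by rewrite divr_gt0.
by rewrite (_ : c' * e / 8 / 4 = c' / 32 * e)%R//; field.
Qed.

(** Over all probabilities only the bound by [hS] enters; the lower bound comes from ergodic
    measures alone. *)
Lemma conclE2_katok_equiv h (c c' : R) : (0 < c)%R -> (0 < c')%R ->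
  (forall mu e, ergodic act mu -> (0 < e)%R -> katok_lo d act Fs mu e <= h mu (c * e)%R) ->
  (forall mu e, isprob mu -> (0 < e)%R -> h mu e <= hS (c' * e)%R) ->
  conclE2 d act Fs h.
Proof.
move=> c0 c0' h1 h2.
(* 16 is the 8 of [sep_le_E1a] times the 2 of [E1a_le_katok]. *)
apply: (@conclE2_of _ (c / 16) c' 2 0) => [||e e0|e e0]; rewrite ?divr_gt0//; last first.
  by rewrite adde0; apply: ge_ereal_sup => _ [mu Pmu <-]; exact: h2.
apply: le_trans (sep_le_E1a e0) _.
have -> : (2 = 1 + 1 :> R)%R by [].
rewrite EFinD addeA; apply: leeD2r; apply: ge_ereal_sup => _ [mu Emu <-].
have e16 : (0 < e / 16)%R by rewrite divr_gt0.
rewrite (_ : e / 8 = 2 * (e / 16))%R; last by field.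
apply: le_trans (E1a_le_katok Emu e16) _; apply: leeD2r.
apply: le_trans (h1 mu _ Emu e16) _.
by apply: ereal_sup_ubound; exists mu => //; congr h; field.
Qed.

End Final.

Theorem theorem3p33 (R : realType)
    (G : countType) (mul : G -> G -> G) (one : G) (inv : G -> G)
    (dX : measure_display) (X : measurableType dX) (d : X -> X -> R)
    (act : G -> X -> X) (Fs : nat -> {fset G}) :
  is_group mul one inv -> infinite_group (G := G) ->
  is_metric d -> dcompact d -> borel_space d ->
  is_action one d act mul ->
  folner (R := R) mul Fs -> tempered (R := R) mul inv Fs ->
  [/\ conclE1 d act Fs (hE1a d act Fs),
      conclE1 d act Fs (hE1b d act Fs),
      conclE1 d act Fs (hE1c d act Fs)
    & conclE1 d act Fs (hE1d d act Fs)] /\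
  [/\ conclE2 d act Fs (PS one d act Fs),
      conclE2 d act Fs (katok_lo d act Fs)
    & conclE2 d act Fs (katok_up d act Fs)].
Proof.
move=> hG iG hd cpt bor hact hF _.
have equiv1 h c c' := conclE1_E1a_equiv hG iG hF hd cpt bor hact (h := h) (c := c) (c' := c').
have equiv2 h c c' := conclE2_katok_equiv hG iG hF hd cpt bor hact (h := h) (c := c) (c' := c').
have ab mu e : Defs.invariant act mu -> 0 < e -> (hE1a d act Fs mu e <= hE1b d act Fs mu e)%E.
  by move=> Imu e0; exact: E1a_le_E1b.
have bc mu e : 0 < e -> (hE1b d act Fs mu e <= hE1c d act Fs mu e)%E.
  exact: E1b_le_E1c hd cpt _ _.
have cd mu e : (hE1c d act Fs mu e <= hE1d d act Fs mu (e / 4))%E by exact: E1c_le_E1d.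
have da mu e : Defs.invariant act mu -> 0 < e -> (hE1d d act Fs mu e <= hE1a d act Fs mu (e / 2))%E.
  by move=> Imu e0; exact: E1d_le_E1a.
(* The factor 8 combines the Lebesgue number [e / 4] with the halving in [E1d_le_E1a]. *)
have ca mu e : Defs.invariant act mu -> 0 < e ->
    (hE1c d act Fs mu e <= hE1a d act Fs mu (8^-1 * e))%E.
  move=> Imu e0; apply: le_trans (cd mu e) _; rewrite (_ : 8^-1 * e = e / 4 / 2); last by field.
  by apply: da => //; rewrite divr_gt0.
have i2 : 0 < 2^-1 :> R by rewrite invr_gt0.
have i4 : 0 < 4^-1 :> R by rewrite invr_gt0.
have i8 : 0 < 8^-1 :> R by rewrite invr_gt0.
have half (e : R) : 2 * (2^-1 * e) = e by field.
have up_sep mu (e : R) : isprob mu -> 0 < e -> (katok_up d act Fs mu e <= sep_growth Fs d act (2^-1 * e))%E.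
  move=> Pmu e0; have h := katok_up_le_sep Fs hd cpt bor hact Pmu (mulr_gt0 i2 e0).
  by rewrite half in h.
have lo_up mu (e : R) : (katok_lo d act Fs mu e <= katok_up d act Fs mu e)%E.
  by apply: katok_lo_le_up.
have o1 := @ltr01 R.
split; split.
- by apply: (equiv1 _ 1 1 o1 o1) => mu e _ _; rewrite mul1r.
- apply: (equiv1 _ 1 8^-1 o1 i8) => mu e Imu e0; first by rewrite mul1r; exact: ab.
  by apply: le_trans (bc mu e e0) _; exact: ca.
- apply: (equiv1 _ 1 8^-1 o1 i8) => mu e Imu e0; last exact: ca.
  by rewrite mul1r; apply: le_trans (ab mu e Imu e0) _; exact: bc.
- apply: (equiv1 _ 4^-1 2^-1 i4 i2) => mu e Imu e0; rewrite mulrC; last exact: da.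
  by apply: le_trans (cd mu e); apply: le_trans (ab mu e Imu e0) _; exact: bc.
- apply: (equiv2 _ 2^-1 1 i2 o1) => mu e Hmu e0; last by rewrite mul1r; exact: PS_le_sep.
  have h := katok_lo_le_PS hG hF hd cpt bor hact Hmu (mulr_gt0 i2 e0).
  by rewrite half in h.
- apply: (equiv2 _ 1 2^-1 o1 i2) => mu e Hmu e0; first by rewrite mul1r.
  by apply: le_trans (lo_up mu e) _; exact: up_sep.
- apply: (equiv2 _ 1 2^-1 o1 i2) => mu e Hmu e0; last exact: up_sep.
  by rewrite mul1r; exact: lo_up.
Qed.
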